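(* Let $r_*$ satisfy $\frac3{5-a}<r_*<1$, $r_*\ge\frac1{2-a}$; set $\lambda_0=\frac{r_*(5-a)-3}{3r_*}$; fix $\tilde\kappa\in(1,\sqrt{1+\lambda_0})$ and $p_i,q_i$ ($i=1,\dots,4$) with $\tilde\kappa>p_1,p_2,p_3,p_4>1$ and $1/p_i+1/q_i=1$. Let $\alpha_0$ satisfy $$\alpha_0\ge\max\Big\{\frac{2p_3(1-a)}{\tilde\kappa-p_3},\frac{4(1-a)}{\tilde\kappa-1},\frac{a}{1+\lambda_0-\tilde\kappa^2}\Big\},\qquad\alpha_0>\max\Big\{2,\frac a{\lambda_0}\Big\}.$$ Define $\beta_j=\tilde\kappa^j\alpha_0$, $\tilde r_j=\beta_j-2$, $\tilde s_j=(\beta_j+4(1-a))\big(1+\frac a{\beta_j-a}\big)$ ($j\ge0$), $\tilde\mu=\prod_{j\ge0}\tilde r_j/\beta_j$, $\tilde\nu=\prod_{j\ge0}\tilde s_j/\beta_j$ (these are positive and $\tilde\mu<\tilde\nu$), and $\omega=\frac{\tilde\nu\beta_0}{\tilde s_0}\cdot\frac{\tilde\kappa^2}{\alpha_0(\tilde\kappa-1)^2}$. Let $u\ge0$ be a sufficiently regular solution of the problem below and $\bar u=u-\Psi$. Then for all $T>0$ and $\sigma\in(0,1)$, $$\|\bar u\|_{L^\infty(U\times(\sigma T,T))}\le\Big[\bar c_2\alpha_0^{\mu_3}\chi_*^{1/\hat\kappa}\Big(1+\frac1{\sigma T}\Big)^{\mu_2}(1+|Q_T|)^{\mu_3}\mathcal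 M_1^{\mu_2}E_*^{1/\hat\kappa}\Big]^\omega\max\Big\{\|\bar u\|_{L^{\tilde\kappa\alpha_0}(U\times(0,T))}^{\tilde\mu},\|\bar u\|_{L^{\tilde\kappa\alpha_0}(U\times(0,T))}^{\tilde\nu}\Big\},$$ where $\mu_2=1+\frac a{1+\lambda_0}$, $\mu_3=2+\frac a{1+\lambda_0}$, $\hat\kappa=1+\lambda_0-\frac a2$, $\bar c_2=(2\tilde\kappa)^{\mu_3}\bar A$, $\bar A=2^{4+\frac1{r_*}}\bar c_1c_{16}^2$, $\bar c_1=\max\{1,\frac1{c_{10}}(\frac{\bar c}{2-a})^{2-a}\}$, $\mathcal M_1=\mathcal M_{0,T}(q_1,q_2,q_3,q_4)$ and $$E_*=\max\Big\{1,\operatorname*{ess\,sup}_{t\in(\sigma T/2,T)}\|1+|\Psi(\cdot,t)|\|_{L^{\frac{2r_*}{1-r_*}}}^2+\operatorname*{ess\,sup}_{t\in(\sigma T/2,T)}\|\bar u(\cdot,t)\|_{L^{\frac{2r_*}{1-r_*}}}^2\Big\}.$$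
   Context: Let $N\ge1$, $0=\bar\alpha_0<\dots<\bar\alpha_N$, $a_0,\dots,a_N>0$, $g(s)=\sum_ia_is^{\bar\alpha_i}$ ($0^0=1$), $a=\bar\alpha_N/(1+\bar\alpha_N)$, $\chi_0=\sum_ia_i$. $\vec k$ unit vector in $\mathbb R^3$, $\mathbf Jx=\vec k\times x$, $F_z(v)=g(|v|)v+z\mathbf Jv$ (a bijection of $\mathbb R^3$), fix $R_*\ge0$, $X(z,y)=F_{R_*z}^{-1}(y)$. $\mathcal G>0$, $\Omega\ge0$, $e_0\in C^\infty(\mathbb R,\mathbb R^3)$ with $|e_0|=1$, $\mathcal Z(x,t)=-\mathcal Ge_0(t)+\Omega^2\mathbf J^2x$. $U\subset\mathbb R^3$ open bounded with $C^1$ boundary $\Gamma$, $r_U=\max_{\bar U}|x|$, $\chi_*=\max\{1,R_*^2,\chi_0^2,\mathcal G+\Omega^2r_U\}$. Problem: $u_t=\nabla\cdot X(u,\nabla u+u^2\mathcal Z)$ in $U\times(0,\infty)$, $u(\cdot,0)=u_0$, $u=\psi$ on $\Gamma\times(0,\infty)$; $\Psi$ an extension of $\psi$ to $\bar U\times[0,\infty)$. $Q_T=U\times(0,T)$. With $\tilde q=2\max\{2-a,3-2a\}$, $\mathcal M_{T',T}(q_1,q_2,q_3,q_4)=1+\chi_*^{1-a}\big(\int_{T'}^T\!\int_U(1+|\nabla\Psi|)^{(2-a)q_1}\big)^{1/q_1}+\chi_*^{1-a}\big(\int_{T'}^T\!\int_U(1+|\Psi|)^{2(1-a)q_2}(1+|\nabla\Psi|)^{(2-a)q_2}\big)^{1/q_2}+\chi_*^{3-a}\big(\int_{T'}^T\!\int_U(1+|\Psi|)^{\tilde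 qq_3}\big)^{1/q_3}+\big(\int_{T'}^T\!\int_U|\Psi_t|^{q_4}\big)^{1/q_4}$. Constants: $c_3=a_N^{a-1}$, $c_4=(\min\{1,a_0,a_N\}/2^{\bar\alpha_N})^{1+a}$, $c_5=2^{-a}c_4$, $c_9=c_5\chi_0^{-2}$, $c_{10}=c_4/4$, $c_{11}=4^{1-a}c_5+c_9+2c_3(32c_3/c_4)^{1-a}+c_{10}$, $c_{12}=2\cdot4^{1-a}c_3[1+(32c_3/c_4)^{1-a}]$, $c_{16}=9(1+c_{11}+c_{12})$; $\bar c>0$ depends on $U$ and $q=r_*(2-a)$ with $\|f\|_{L^{3q/(3-q)}(U)}\le\bar c\|\nabla f\|_{L^q(U)}$ for all $f\in W_0^{1,q}(U)$. *)

(* Defs.v *)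
From HB Require Import structures.
From mathcomp Require Import all_boot all_order all_algebra.
From mathcomp Require Import all_classical all_reals all_analysis ess_sup_inf.
Set Implicit Arguments.
Unset Strict Implicit.
Unset Printing Implicit Defensive.
Import Order.TTheory GRing.Theory Num.Theory numFieldNormedType.Exports.
Local Open Scope classical_set_scope.
Local Open Scope ring_scope.

Section Defs.
Variable R : realType.
Local Notation vec := 'rV[R]_3.

Definition ev (i : 'I_3) : vec := delta_mx 0 i.
Definition vnorm (v : vec) : R := Num.sqrt (\sum_(i < 3) v 0 i ^+ 2).
Definition cross (k x : vec) : vec :=
  \row_(j < 3) (k 0 (inord ((j + 1) %% 3)) * x 0 (inord ((j + 2) %% 3))
              - k 0 (inord ((j + 2) %% 3)) * x 0 (inord ((j + 1) %% 3))).

(** g(s) = sum_i a_i s^{alpha_i}   (powR 0 0 = 1, i.e. 0^0 = 1). *)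
Definition gfun (N : nat) (al aa : 'I_N.+1 -> R) (s : R) : R :=
  \sum_(i < N.+1) aa i * powR s (al i).
Definition Fmap (N : nat) (al aa : 'I_N.+1 -> R) (k : vec) (z : R) (v : vec) : vec :=
  gfun al aa (vnorm v) *: v + z *: cross k v.
Definition aexp (N : nat) (al : 'I_N.+1 -> R) : R := al ord_max / (1 + al ord_max).
Definition chi0 (N : nat) (aa : 'I_N.+1 -> R) : R := \sum_(i < N.+1) aa i.
Definition Zfield (k : vec) (G Om : R) (e0 : R -> vec) (x : vec) (t : R) : vec :=
  - (G *: e0 t) + (Om ^+ 2) *: cross k (cross k x).

Definition smooth_curve (e : R -> vec) : Prop :=
  forall (n : nat) (t : R), derivable (iter n (fun f : R -> vec => derive1 f) e) t 1.

Definition C1_R2 (h : 'rV[R]_2 -> R) : Prop :=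
  forall i : 'I_2, (forall z, derivable h z (delta_mx 0 i)) /\
                   continuous (fun z => 'D_(delta_mx 0 i) h z).

Definition bdry (U : set vec) : set vec := closure U `\` U.

Definition C1_boundary (U : set vec) : Prop :=
  forall x0, bdry U x0 ->
  exists (r : R) (Q : 'M[R]_3) (h : 'rV[R]_2 -> R),
    0 < r /\ Q *m Q^T = 1%:M /\ C1_R2 h /\
    forall x, vnorm (x - x0) < r ->
      (U x <-> let y := (x - x0) *m Q in
               y 0 (inord 2) < h (\row_(j < 2) y 0 (inord j))).

Definition rU (U : set vec) : R := sup [set vnorm x | x in closure U].

Definition chistar (N : nat) (aa : 'I_N.+1 -> R) (Rs G Om : R) (U : set vec) : R :=
  Num.max 1 (Num.max (Rs ^+ 2) (Num.max (chi0 aa ^+ 2) (G + Om ^+ 2 * rU U))).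

Definition leb3 := ((@lebesgue_measure R \x @lebesgue_measure R) \x @lebesgue_measure R)%E.
Definition leb4 := (leb3 \x @lebesgue_measure R)%E.
Definition mk3 (p : (R * R) * R) : vec :=
  \row_(i < 3) (if (i == 0 :> nat) then p.1.1 else if (i == 1 :> nat) then p.1.2 else p.2).
Definition mk4 (z : ((R * R) * R) * R) : vec * R := (mk3 z.1, z.2).

Definition volU (U : set vec) : R := fine (leb3 (mk3 @^-1` U)).
Definition LpU (q : R) (U : set vec) (f : vec -> R) : R :=
  powR (fine (\int[leb3]_(p in mk3 @^-1` U) (powR `|f (mk3 p)| q)%:E)%E) q^-1.

Definition intST (S : set (vec * R)) (h : vec -> R -> R) : R :=
  fine (\int[leb4]_(z in mk4 @^-1` S) (h (mk4 z).1 (mk4 z).2)%:E)%E.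
Definition LpST (q : R) (S : set (vec * R)) (h : vec -> R -> R) : R :=
  powR (intST S (fun x t => powR `|h x t| q)) q^-1.
Definition LinfST (S : set (vec * R)) (h : vec -> R -> R) : R :=
  fine (ess_sup leb4 (fun z => if `[< S (mk4 z) >] then (`|h (mk4 z).1 (mk4 z).2|)%:E
                               else -oo%E)).
Definition esssupT (t1 t2 : R) (phi : R -> R) : R :=
  fine (ess_sup (@lebesgue_measure R)
          (fun t => if `[< t1 < t < t2 >] then (phi t)%:E else -oo%E)).

Definition gradx (h : vec -> R -> R) (x : vec) (t : R) : vec :=
  \row_(i < 3) 'D_(ev i) (fun y => h y t) x.
Definition dt (h : vec -> R -> R) (x : vec) (t : R) : R := derive1 (h x) t.
Definition gradnorm (f : vec -> R) (x : vec) : R := vnorm (\row_(i < 3) 'D_(ev i) f x).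

Definition uncurry (h : vec -> R -> R) : vec * R -> R := fun p => h p.1 p.2.

Definition C1_on (W : set (vec * R)) (h : vec -> R -> R) : Prop :=
  open W /\
  (forall p, W p -> derivable (h p.1) p.2 1 /\
                     forall i, derivable (fun y => h y p.2) p.1 (ev i)) /\
  (forall p, W p -> {for p, continuous (uncurry h)} /\
                     {for p, continuous (uncurry (dt h))} /\
                     forall i, {for p, continuous (fun q => 'D_(ev i) (fun y => h y q.2) q.1)}).

Definition C21_on (W : set (vec * R)) (h : vec -> R -> R) : Prop :=
  C1_on W h /\
  forall i j, (forall p, W p ->
      derivable (fun y => 'D_(ev i) (fun y' => h y' p.2) y) p.1 (ev j)) /\
    (forall p, W p -> {for p, continuous (fun q =>
      'D_(ev j) (fun y => 'D_(ev i) (fun y' => h y' q.2) y) q.1)}).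

Definition regular_solution (X : R -> vec -> vec) (Zf : vec -> R -> vec)
    (U : set vec) (u0 : vec -> R) (psi u : vec -> R -> R) : Prop :=
  (exists W, C21_on W u /\ (closure U `*` `]0, +oo[%classic) `<=` W) /\
  {within closure U `*` `[0, +oo[%classic, continuous (uncurry u)} /\
  (forall x t, U x -> 0 < t ->
     let V := fun y => X (u y t) (gradx u y t + (u y t) ^+ 2 *: Zf y t) in
     (forall i, derivable (fun y => V y 0 i) x (ev i)) /\
     dt u x t = \sum_(i < 3) 'D_(ev i) (fun y => V y 0 i) x) /\
  (forall x, U x -> u x 0 = u0 x) /\
  (forall x t, bdry U x -> 0 < t -> u x t = psi x t).

(** compactly supported C^1 functions in U (dense in W_0^{1,q}(U)) *)
Definition Cc1 (U : set vec) (f : vec -> R) : Prop :=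
  (exists K, compact K /\ K `<=` U /\ forall x, ~ K x -> f x = 0) /\
  (forall i x, derivable f x (ev i)) /\ (forall i, continuous (fun x => 'D_(ev i) f x)).

Definition sobolev_const (U : set vec) (q cbar : R) : Prop :=
  0 < cbar /\
  forall f, Cc1 U f -> LpU (3 * q / (3 - q)) U f <= cbar * LpU q U (gradnorm f).

Definition Mfun (a chis : R) (U : set vec) (Psi : vec -> R -> R) (T' T : R)
    (q : 'I_4 -> R) : R :=
  let S := U `*` `]T', T[%classic in
  let qt := 2 * Num.max (2 - a) (3 - 2 * a) in
  let gP := fun x t => 1 + vnorm (gradx Psi x t) in
  1 + powR chis (1 - a) * powR (intST S (fun x t => powR (gP x t) ((2 - a) * q 0)))
                                (q 0)^-1
    + powR chis (1 - a) * powR (intST S (fun x t =>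
            powR (1 + `|Psi x t|) (2 * (1 - a) * q 1) * powR (gP x t) ((2 - a) * q 1)))
                                (q 1)^-1
    + powR chis (3 - a) * powR (intST S (fun x t => powR (1 + `|Psi x t|) (qt * q 2)))
                                (q 2)^-1
    + powR (intST S (fun x t => powR `|dt Psi x t| (q 3))) (q 3)^-1.

Definition c4 (N : nat) (al aa : 'I_N.+1 -> R) : R :=
  powR (Num.min 1 (Num.min (aa 0) (aa ord_max)) / powR 2 (al ord_max)) (1 + aexp al).
Definition c16 (N : nat) (al aa : 'I_N.+1 -> R) : R :=
  let a := aexp al in
  let c3 := powR (aa ord_max) (a - 1) in
  let c4 := c4 al aa in
  let c5 := powR 2 (- a) * c4 in
  let c9 := c5 / chi0 aa ^+ 2 in
  let c10 := c4 / 4 in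
  let c11 := powR 4 (1 - a) * c5 + c9 + 2 * c3 * powR (32 * c3 / c4) (1 - a) + c10 in
  let c12 := 2 * powR 4 (1 - a) * c3 * (1 + powR (32 * c3 / c4) (1 - a)) in
  9 * (1 + c11 + c12).

Definition infprod (f : nat -> R) : R := limn (fun n => \prod_(j < n) f j).

End Defs.

(* Main.v *)
Require Import Defs.
From HB Require Import structures.
From mathcomp Require Import all_boot all_order all_algebra.
From mathcomp Require Import all_classical all_reals all_analysis ess_sup_inf.
From mathcomp Require Import measurable_realfun ring lra.
Import Order.TTheory GRing.Theory Num.Theory numFieldNormedType.Exports.
Local Open Scope classical_set_scope.
Local Open Scope ring_scope.

Set Implicit Arguments.
Unset Strict Implicit.
Unset Printing Implicit Defensive.

(** The proof is a Moser iteration for [ubar] = u - Psi, which vanishes on the lateral boundary.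

    Structure of the flux. If y = F_z(v), then v . y = g(|v|)|v|^2 because the rotation term is
    orthogonal to v. Comparing powers of |v| and |y| gives coercivity, with a constant that degrades
    like 1/(chi0 + z)^2, and the growth bound |v| <= c3 |y|^(1-a) ([Fmap_coercive_power],
    [Fmap_growth]). With z = Rs u the degradation becomes the weight (1+u)^(-2)/chi. Strong
    monotonicity of F makes v a Lipschitz function of (z,y) ([Fmap_lipschitz]), so the flux is
    continuous up to the boundary and its partial derivatives are bounded.

    Energy. The equation is tested with sign(ubar)(|ubar|-e)_+^(m-1). For e > 0 this function has
    compact support in U, since ubar = 0 on the boundary; integration by parts therefore reduces to
    the fundamental theorem of calculus on lines, applied to a function extended by zero
    ([int_div_test_i], [flux_ibp]). The result is [energy]. Averaging it over the starting time in
    (T1,T2) replaces a time cutoff ([energy_average]) and bounds, by one quantity D, both the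
    integral of |ubar|^m at each time in (T2,T) and, up to an explicit factor, the space-time
    integral of (1+u)^(-2) |grad ubar|^(2-a) |ubar|^(m-2).

    Gain. Sobolev and Hoelder at fixed time turn these into a bound for the integral of
    |ubar|^(m(1+lam0)-a) by m^(-a) D^(1+lam0); the weight (1+u)^(-2) is paid for by [Estar]
    ([gn_interpolation], [gain_cut], [ae_slice_norm]). The parameter e is then sent to 0
    ([int_cut_limit]).

    Closing the step. Hoelder with the exponents p_i, q_i bounds D by m^2 times the data times
    max(y^(m-2), y^(m+4(1-a))), where y is the norm of ubar in L^(kap m) on the larger cylinder
    ([data_bound]). As kap^2 m <= m(1+lam0) - a, this bounds the L^(kap^2 m) norm on the smaller
    cylinder ([one_step]). A power of chi that the data cannot absorb completely survives, with an
    exponent decaying like kap^(-j) ([share_power]).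

    Iteration. With m = beta_j and T_j increasing to sigma T the norms satisfy Y_(j+1)^(beta_j) <= A
    P^j X^(K/kap^j) max(Y_j^(r_j), Y_j^(s_j)). The exponents telescope into the infinite products,
    and the sums of the logarithms of the constants produce omega ([moser_iteration]). Letting the
    exponents tend to infinity gives the supremum bound ([LinfST_le]).

    All integrands are bounded and measurable on sets of finite measure; [bmeas] records this, so
    that integrals are finite reals and integrability never has to be argued separately. *)

Definition bmeas d (T : measurableType d) (R : realType) (D : set T) (f : T -> R) :=
  measurable_fun D f /\ exists M, forall x, D x -> `|f x| <= M.

(** * Integrals of bounded measurable functions on sets of finite measure *)

Section BoundedMeasurable.
Context d (T : measurableType d) (R : realType) (D : set T).
Implicit Types f g : T -> R.

Lemma bmeas_cst (c : R) : bmeas D (fun=> c).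
Proof. by split; [exact: measurable_cst | exists `|c|]. Qed.

Lemma bmeasD f g : bmeas D f -> bmeas D g -> bmeas D (fun x => f x + g x).
Proof.
move=> [mf [M hM]] [mg [N hN]]; split; first exact: measurable_funD.
exists (M + N) => x Dx; apply: (le_trans (ler_normD _ _)).
by apply: lerD; [exact: hM | exact: hN].
Qed.

Lemma bmeasN f : bmeas D f -> bmeas D (fun x => - f x).
Proof.
move=> [mf [M hM]]; split; first exact: (measurable_funN mf).
by exists M => x Dx; rewrite normrN; exact: hM.
Qed.

Lemma bmeasB f g : bmeas D f -> bmeas D g -> bmeas D (fun x => f x - g x).
Proof. by move=> bf bg; apply: bmeasD => //; exact: bmeasN. Qed.

Lemma bmeasM f g : bmeas D f -> bmeas D g -> bmeas D (fun x => f x * g x).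
Proof.
move=> [mf [M hM]] [mg [N hN]]; split; first exact: measurable_funM.
exists (M * N) => x Dx; rewrite normrM.
by apply: ler_pM => //; [exact: hM | exact: hN].
Qed.

Lemma bmeas_norm f : bmeas D f -> bmeas D (fun x => `|f x|).
Proof.
move=> [mf [M hM]]; split; first exact: measurableT_comp.
by exists M => x Dx; rewrite normr_id; exact: hM.
Qed.

Lemma bmeas_max f g : bmeas D f -> bmeas D g ->
  bmeas D (fun x => Num.max (f x) (g x)).
Proof.
move=> [mf [M hM]] [mg [N hN]]; split; first exact: measurable_maxr.
exists (Num.max M N) => x Dx; have hm := hM x Dx; have hn := hN x Dx.
by rewrite le_max; case: (leP (f x) (g x)) => _; rewrite ?hm ?hn ?orbT.
Qed.

Lemma bmeas_powR f p : 0 <= p -> bmeas D f -> bmeas D (fun x => powR (f x) p).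
Proof.
move=> p0 [mf [M hM]]; split; first exact: (measurableT_comp (measurable_powR p)).
exists (powR (Num.max 1 M) p) => x Dx; rewrite ger0_norm ?powR_ge0//.
have [fx|fx] := leP 0 (f x); last first.
  rewrite lt0_powR1//; apply: (@le_trans _ _ (powR 1 p)); first by rewrite powR1.
  by rewrite ge0_ler_powR ?nnegrE ?le_max ?ler01 ?lexx.
rewrite ge0_ler_powR// ?nnegrE// ?le_max ?ler01//.
by have := hM x Dx; rewrite ger0_norm// => ->; rewrite orbT.
Qed.

Lemma bmeas_exprn f n : bmeas D f -> bmeas D (fun x => f x ^+ n).
Proof.
move=> bf; elim: n => [|n ih]; first exact: (bmeas_cst 1).
by under [X in bmeas _ X]funext do rewrite exprS; exact: bmeasM.
Qed.

Lemma bmeas_inv f (c : R) : 0 < c -> (forall x, D x -> c <= f x) ->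
  bmeas D f -> bmeas D (fun x => (f x)^-1).
Proof.
move=> c0 fc [mf _]; split.
  have h := measurableT_comp (measurable_powR (-1 : R)) mf.
  apply: eq_measurable_fun h => x /set_mem Dx /=; rewrite powR_inv1//.
  exact: le_trans (ltW c0) (fc x Dx).
exists c^-1 => x Dx; have fx := lt_le_trans c0 (fc x Dx).
by rewrite gtr0_norm ?invr_gt0// lef_pV2 ?posrE ?fc.
Qed.

Lemma bmeas_sum (I : finType) (F : I -> T -> R) :
  (forall i, bmeas D (F i)) -> bmeas D (fun x => \sum_i F i x).
Proof.
move=> bF; rewrite unlock; elim: (index_enum I) => [|i s ih] /=; first exact: bmeas_cst.
by apply: bmeasD.
Qed.

Lemma bmeas_eq f g : {in D, f =1 g} -> bmeas D f -> bmeas D g.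
Proof.
move=> fg [mf [M hM]]; split; first by apply: eq_measurable_fun mf.
by exists M => x Dx; rewrite -fg ?inE//; exact: hM.
Qed.

Lemma bmeas_sub (E : set T) f : measurable D -> measurable E -> E `<=` D ->
  bmeas D f -> bmeas E f.
Proof.
move=> mD mE ED [mf [M hM]]; split; first exact: measurable_funS mf.
by exists M => x /ED /hM.
Qed.

Context (mu : {measure set T -> \bar R}) (mD : measurable D) (fD : (mu D < +oo)%E).

Lemma bmeas_integrable f : bmeas D f -> mu.-integrable D (EFin \o f).
Proof.
move=> [mf [M hM]]; apply: measurable_bounded_integrable => //.
exists M; split; first exact: num_real.
by move=> y My x Dx /=; exact: (le_trans (hM x Dx) (ltW My)).
Qed.

Lemma bmeas_EFin f : bmeas D f ->
  (\int[mu]_(x in D) (f x)%:E = (\int[mu]_(x in D) f x)%:E)%E.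
Proof. by move=> bf; rewrite /Rintegral fineK//; apply: integrable_fin_num => //; exact: bmeas_integrable. Qed.

Lemma bmeas_le f g : bmeas D f -> bmeas D g ->
  (forall x, D x -> f x <= g x) ->
  \int[mu]_(x in D) f x <= \int[mu]_(x in D) g x.
Proof. by move=> bf bg fg; apply: le_Rintegral => //; exact: bmeas_integrable. Qed.

Lemma bmeas_intD f g : bmeas D f -> bmeas D g ->
  \int[mu]_(x in D) (f x + g x) = \int[mu]_(x in D) f x + \int[mu]_(x in D) g x.
Proof. by move=> bf bg; rewrite RintegralD//; exact: bmeas_integrable. Qed.

Lemma bmeas_intB f g : bmeas D f -> bmeas D g ->
  \int[mu]_(x in D) (f x - g x) = \int[mu]_(x in D) f x - \int[mu]_(x in D) g x.
Proof. by move=> bf bg; rewrite RintegralB//; exact: bmeas_integrable. Qed.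

Lemma bmeas_intZ (c : R) f : bmeas D f ->
  \int[mu]_(x in D) (c * f x) = c * \int[mu]_(x in D) f x.
Proof. by move=> bf; rewrite RintegralZl//; exact: bmeas_integrable. Qed.

Lemma Lnorm_restrict f p : 0 < p -> bmeas D f -> (forall x, D x -> 0 <= f x) ->
  ('N[mu]_p%:E[EFin \o (f \_ D)] = (powR (\int[mu]_(x in D) powR (f x) p) p^-1)%:E)%E.
Proof.
move=> p0 bf f0.
have E x : (`|((f \_ D) x)%:E| `^ p = (((fun x => (powR (f x) p)%:E) \_ D) x))%E.
  rewrite /patch; case: ifPn => [/set_mem Dx|_].
    by rewrite gee0_abs ?lee_fin ?f0// poweR_EFin.
  by rewrite abse0 poweR0r// gt_eqF.
rewrite unlock /= (eq_integral _ _ (fun x _ => E x)) -integral_mkcond.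
by rewrite bmeas_EFin ?poweR_EFin//; apply: bmeas_powR => //; exact: ltW.
Qed.

Lemma bmeas_restrict f : bmeas D f -> measurable_fun setT (f \_ D).
Proof. by move=> [mf _]; apply/(measurable_restrictT f mD). Qed.

Lemma bmeas_hoelder f g p q : 0 < p -> 0 < q -> p^-1 + q^-1 = 1 ->
  bmeas D f -> bmeas D g ->
  (forall x, D x -> 0 <= f x) -> (forall x, D x -> 0 <= g x) ->
  \int[mu]_(x in D) (f x * g x) <=
    powR (\int[mu]_(x in D) powR (f x) p) p^-1 * powR (\int[mu]_(x in D) powR (g x) q) q^-1.
Proof.
move=> p0 q0 pq bf bg f0 g0.
have := @hoelder _ T R mu (f \_ D) (g \_ D) p q (bmeas_restrict bf) (bmeas_restrict bg) p0 q0 pq.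
rewrite !Lnorm_restrict// -EFinM => H.
rewrite -lee_fin -bmeas_EFin; last exact: bmeasM.
apply: le_trans H; rewrite Lnorm1 integral_mkcond le_eqVlt; apply/orP; left; apply/eqP.
apply: eq_integral => x _; rewrite /patch /=.
case: ifPn => [/set_mem Dx|_]; last by rewrite mulr0 normr0.
by rewrite ger0_norm// mulr_ge0// ?f0 ?g0.
Qed.

Lemma bmeas_minkowski f g p : 1 <= p -> bmeas D f -> bmeas D g ->
  (forall x, D x -> 0 <= f x) -> (forall x, D x -> 0 <= g x) ->
  powR (\int[mu]_(x in D) powR (f x + g x) p) p^-1 <=
    powR (\int[mu]_(x in D) powR (f x) p) p^-1 + powR (\int[mu]_(x in D) powR (g x) p) p^-1.
Proof.
move=> p1 bf bg f0 g0; have p0 : 0 < p by exact: lt_le_trans p1.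
have := @minkowski_EFin _ T R mu (f \_ D) (g \_ D) p (bmeas_restrict bf) (bmeas_restrict bg) p1.
have -> : (f \_ D \+ g \_ D) = (fun x => f x + g x) \_ D.
  by apply/funext => x; rewrite /patch /=; case: ifP => // _; rewrite addr0.
rewrite !Lnorm_restrict// -?EFinD ?lee_fin//; first exact: bmeasD.
by move=> x Dx; rewrite addr_ge0 ?f0 ?g0.
Qed.

(** Hoelder's inequality against the constant 1 with exponents r/s and its conjugate. The cases s =
    0 and s = r are separated because one of these exponents then degenerates. *)
Lemma bmeas_pow_le f (s r : R) : 0 <= s -> s <= r -> 0 < r ->
  bmeas D f -> (forall x, D x -> 0 <= f x) ->
  \int[mu]_(x in D) powR (f x) s <=
    powR (\int[mu]_(x in D) powR (f x) r) (s / r) * powR (fine (mu D)) (1 - s / r).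
Proof.
move=> s0 sr r0 bf f0.
have muD0 : 0 <= fine (mu D) by exact: fine_ge0.
have [s00|sn0] := eqVneq s 0.
  rewrite s00 mul0r subr0 powRr0 mul1r powRr1//.
  under eq_Rintegral do rewrite powRr0.
  by rewrite Rintegral_cst// mul1r.
have [srE|srn] := eqVneq s r.
  rewrite srE divff ?gt_eqF// subrr powRr0 mulr1 powRr1//.
  by apply: Rintegral_ge0 => x _; exact: powR_ge0.
have sp : 0 < s by rewrite lt_neqAle eq_sym sn0.
have slr : s < r by rewrite lt_neqAle srn.
have bs : bmeas D (fun x => powR (f x) s) by exact: bmeas_powR.
have c0 : 0 < 1 - s / r by rewrite subr_gt0 ltr_pdivrMr// mul1r.
have E1 : \int[mu]_(x in D) powR (f x) s = \int[mu]_(x in D) (powR (f x) s * 1).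
  by apply: eq_Rintegral => x _; rewrite mulr1.
have E2 : \int[mu]_(x in D) powR (f x) r = \int[mu]_(x in D) powR (powR (f x) s) (r / s).
  by apply: eq_Rintegral => x _; rewrite -powRrM mulrCA divff// mulr1.
have E3 : fine (mu D) = \int[mu]_(x in D) powR 1 ((1 - s / r)^-1).
  by under eq_Rintegral do rewrite powR1; rewrite Rintegral_cst// mul1r.
rewrite E1 E2 E3.
suff : \int[mu]_(x in D) (powR (f x) s * 1) <=
    powR (\int[mu]_(x in D) powR (powR (f x) s) (r / s)) (r / s)^-1 *
    powR (\int[mu]_(x in D) powR 1 ((1 - s / r)^-1)) ((1 - s / r)^-1)^-1.
  by rewrite invrK invf_div.
apply: (@bmeas_hoelder (fun x => powR (f x) s) (fun=> 1) (r / s) ((1 - s / r)^-1)).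
- exact: divr_gt0.
- by rewrite invr_gt0.
- by rewrite invrK invf_div addrC subrK.
- exact: bs.
- exact: bmeas_cst.
- by move=> x _; exact: powR_ge0.
- by move=> x _.
Qed.

End BoundedMeasurable.

Lemma bmeas_subset d (T : measurableType d) (R : realType) (mu : {measure set T -> \bar R})
    (D E : set T) (f : T -> R) :
  measurable D -> (mu D < +oo)%E -> measurable E -> E `<=` D -> bmeas D f ->
  (forall x, D x -> 0 <= f x) ->
  \int[mu]_(x in E) f x <= \int[mu]_(x in D) f x.
Proof.
move=> mD fD mE ED bf f0; have bE := bmeas_sub mD mE ED bf.
have fE : (mu E < +oo)%E by apply: le_lt_trans fD; apply: le_measure; rewrite ?inE.
rewrite -lee_fin -!bmeas_EFin//; apply: ge0_subset_integral => //.
by apply/measurable_EFinP; case: bf.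
Qed.

(** * Iterated product measures and Fubini's theorem *)

Section SigmaFiniteProduct.
Context d1 d2 (T1 : measurableType d1) (T2 : measurableType d2) (R : realType).
Variable m1 : {sigma_finite_measure set T1 -> \bar R}.
Variable m2 : {sigma_finite_measure set T2 -> \bar R}.

(** The product measure under a name of its own, so that it can carry a sigma-finite structure and
    be multiplied again; the measures on space and on space-time are such iterated products. *)
Definition sprod_fun : set (T1 * T2)%type -> \bar R := (m1 \x m2)%E.
Lemma sprod_sigma_finite : sigma_finite setT sprod_fun.
Proof.
have /sigma_finiteP[F [TF ndF Foo]] := sigma_finiteT m1.
have /sigma_finiteP[G [TG ndG Goo]] := sigma_finiteT m2.
exists (fun n => F n `*` G n).
  rewrite -setXTT TF TG predeqE => -[x y]; split; last first.
    by move=> [n _ []/= ? ?]; split; exists n.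
  move=> [/= [n _ Fnx] [k _ Gky]]; exists (maxn n k) => //; split.
  - by move: x Fnx; exact/subsetPset/ndF/leq_maxl.
  - by move: y Gky; exact/subsetPset/ndG/leq_maxr.
move=> k; have [? ?] := Foo k; have [? ?] := Goo k.
split; first exact: measurableX.
by rewrite /sprod_fun product_measure1E// lte_mul_pinfty// ge0_fin_numE.
Qed.
HB.instance Definition _ := Measure.on sprod_fun.
HB.instance Definition _ := Measure_isSigmaFinite.Build _ _ _ sprod_fun sprod_sigma_finite.
Definition sprod : {sigma_finite_measure set (T1 * T2)%type -> \bar R} := sprod_fun.
End SigmaFiniteProduct.

Section Fubini.
Context d1 d2 (T1 : measurableType d1) (T2 : measurableType d2) (R : realType).
Variables (m1 : {sigma_finite_measure set T1 -> \bar R})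
          (m2 : {sigma_finite_measure set T2 -> \bar R}).
Variables (D1 : set T1) (D2 : set T2).
Hypotheses (mD1 : measurable D1) (mD2 : measurable D2).
Hypotheses (f1 : (m1 D1 < +oo)%E) (f2 : (m2 D2 < +oo)%E).
Variable f : T1 * T2 -> R.
Hypothesis bf : bmeas (D1 `*` D2) f.

Let mD : measurable (D1 `*` D2). Proof. exact: measurableX. Qed.
Let fD : ((m1 \x m2)%E (D1 `*` D2) < +oo)%E.
Proof.
rewrite product_measure1E//.
by apply: lte_mul_pinfty => //; rewrite ge0_fin_numE.
Qed.

(** Extension by zero outside the rectangle reduces Fubini on [D1] x [D2] to Fubini on the whole
    product. *)
Let g := f \_ (D1 `*` D2).
Let mg : measurable_fun setT g. Proof. by case: bf => mf _; apply/(measurable_restrictT f mD). Qed.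
Let ig : (m1 \x m2)%E.-integrable setT (EFin \o g).
Proof.
have := bmeas_integrable mD fD bf.
by rewrite integrable_mkcond// restrict_EFin.
Qed.

Lemma bmeas_slice1 y : D2 y -> bmeas D1 (fun x => f (x, y)).
Proof.
move=> D2y; split; last first.
  case: bf => _ [M hM]; exists M => x D1x; exact: hM.
have h : measurable_fun setT (fun x => g (x, y)) by exact: measurableT_comp.
have : measurable_fun setT ((fun x => f (x, y)) \_ D1).
  rewrite (_ : _ \_ _ = (fun x => g (x, y)))//; apply/funext => x.
  rewrite /g /patch; case: ifPn => [/set_mem D1x|nD1x].
    by rewrite mem_set.
  case: ifPn => // /set_mem[/= D1x _].
  by rewrite mem_set in nD1x.
by move/(measurable_restrictT _ mD1).
Qed.

Lemma bmeas_slice2 x : D1 x -> bmeas D2 (fun y => f (x, y)).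
Proof.
move=> D1x; split; last first.
  case: bf => _ [M hM]; exists M => y D2y; exact: hM.
have h : measurable_fun setT (fun y => g (x, y)) by exact: measurableT_comp.
have : measurable_fun setT ((fun y => f (x, y)) \_ D2).
  rewrite (_ : _ \_ _ = (fun y => g (x, y)))//; apply/funext => y.
  rewrite /g /patch; case: ifPn => [/set_mem D2y|nD2y].
    by rewrite mem_set.
  case: ifPn => // /set_mem[/= _ D2y].
  by rewrite mem_set in nD2y.
by move/(measurable_restrictT _ mD2).
Qed.

Let GE y : fubini_G m1 (EFin \o g) y =
  ((fun y => (\int[m1]_(x in D1) f (x, y))%:E) \_ D2) y.
Proof.
rewrite /fubini_G /patch; case: ifPn => [/set_mem D2y|nD2y].
  rewrite -bmeas_EFin//; last exact: bmeas_slice1.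
  rewrite [RHS]integral_mkcond; apply: eq_integral => x _.
  rewrite /= /g /patch; case: ifPn => [/set_mem[/= D1x _]|nD]; first by rewrite mem_set.
  case: ifPn => // /set_mem D1x; by rewrite mem_set in nD.
rewrite integral0_eq// => x _; rewrite /= /g /patch; case: ifPn => // /set_mem[/= _ D2y].
by rewrite mem_set in nD2y.
Qed.

Let FE x : fubini_F m2 (EFin \o g) x =
  ((fun x => (\int[m2]_(y in D2) f (x, y))%:E) \_ D1) x.
Proof.
rewrite /fubini_F /patch; case: ifPn => [/set_mem D1x|nD1x].
  rewrite -bmeas_EFin//; last exact: bmeas_slice2.
  rewrite [RHS]integral_mkcond; apply: eq_integral => y _.
  rewrite /= /g /patch; case: ifPn => [/set_mem[/= _ D2y]|nD]; first by rewrite mem_set.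
  case: ifPn => // /set_mem D2y; by rewrite mem_set in nD.
rewrite integral0_eq// => y _; rewrite /= /g /patch; case: ifPn => // /set_mem[/= D1x _].
by rewrite mem_set in nD1x.
Qed.

Lemma bmeas_int1 : bmeas D2 (fun y => \int[m1]_(x in D1) f (x, y)).
Proof.
split.
  have := measurable_fubini_G ig; rewrite (funext GE) => h.
  have : measurable_fun D2 (fun y => (\int[m1]_(x in D1) f (x, y))%:E).
    by apply/(measurable_restrictT _ mD2).
  by move/measurable_EFinP.
have [_ [M hM]] := bf; exists (M * fine (m1 D1)) => y D2y.
have bs := bmeas_slice1 D2y.
apply: (le_trans (le_normr_Rintegral mD1 (bmeas_integrable mD1 f1 bs))).
rewrite -(Rintegral_cst m1 mD1); apply: bmeas_le => //; first exact: bmeas_norm.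
  exact: bmeas_cst.
by move=> x D1x; exact: hM.
Qed.

Lemma bmeas_int2 : bmeas D1 (fun x => \int[m2]_(y in D2) f (x, y)).
Proof.
split.
  have := measurable_fubini_F ig; rewrite (funext FE) => h.
  have : measurable_fun D1 (fun x => (\int[m2]_(y in D2) f (x, y))%:E).
    by apply/(measurable_restrictT _ mD1).
  by move/measurable_EFinP.
have [_ [M hM]] := bf; exists (M * fine (m2 D2)) => x D1x.
have bs := bmeas_slice2 D1x.
apply: (le_trans (le_normr_Rintegral mD2 (bmeas_integrable mD2 f2 bs))).
rewrite -(Rintegral_cst m2 mD2); apply: bmeas_le => //; first exact: bmeas_norm.
  exact: bmeas_cst.
by move=> y D2y; exact: hM.
Qed.

Let EgE : (\int[(m1 \x m2)%E]_z (EFin \o g) z = \int[(m1 \x m2)%E]_(z in D1 `*` D2) (f z)%:E)%E.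
Proof. by rewrite [RHS]integral_mkcond; apply: eq_integral => z _; rewrite /= /g /patch; case: ifP. Qed.

Lemma bmeas_fubini1 :
  \int[sprod m1 m2]_(z in D1 `*` D2) f z = \int[m1]_(x in D1) \int[m2]_(y in D2) f (x, y).
Proof.
rewrite {1}/Rintegral -[X in fine X]EgE -(integral12_prod_meas1 ig).
rewrite (funext FE) -integral_mkcond bmeas_EFin//; exact: bmeas_int2.
Qed.

Lemma bmeas_fubini2 :
  \int[sprod m1 m2]_(z in D1 `*` D2) f z = \int[m2]_(y in D2) \int[m1]_(x in D1) f (x, y).
Proof.
rewrite {1}/Rintegral -[X in fine X]EgE -(integral21_prod_meas1 ig).
rewrite (funext GE) -integral_mkcond bmeas_EFin//; exact: bmeas_int1.
Qed.

End Fubini.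

Lemma sprodE d1 d2 (T1 : measurableType d1) (T2 : measurableType d2) (R : realType)
    (m1 : {sigma_finite_measure set T1 -> \bar R})
    (m2 : {sigma_finite_measure set T2 -> \bar R}) (A : set T1) (B : set T2) :
  measurable A -> measurable B -> (sprod m1 m2 (A `*` B) = m1 A * m2 B)%E.
Proof. exact: product_measure1E. Qed.

Lemma sprod_lty d1 d2 (T1 : measurableType d1) (T2 : measurableType d2) (R : realType)
    (m1 : {sigma_finite_measure set T1 -> \bar R})
    (m2 : {sigma_finite_measure set T2 -> \bar R}) (A : set T1) (B : set T2) :
  measurable A -> measurable B -> (m1 A < +oo)%E -> (m2 B < +oo)%E ->
  (sprod m1 m2 (A `*` B) < +oo)%E.
Proof.
by move=> mA mB fA fB; rewrite sprodE// lte_mul_pinfty// ge0_fin_numE.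
Qed.

Lemma bmeas_le_ae d (T : measurableType d) (R : realType) (mu : {measure set T -> \bar R})
    (D : set T) (f g : T -> R) :
  measurable D -> (mu D < +oo)%E -> bmeas D f -> bmeas D g ->
  (forall x, D x -> 0 <= f x) -> (forall x, D x -> 0 <= g x) ->
  {ae mu, forall x, D x -> f x <= g x} ->
  \int[mu]_(x in D) f x <= \int[mu]_(x in D) g x.
Proof.
move=> mD fD bf bg f0 g0 fg.
rewrite -lee_fin -!bmeas_EFin//; apply: ae_ge0_le_integral => //.
- by apply/measurable_EFinP; case: bf.
- by apply/measurable_EFinP; case: bg.
Qed.

(** * Lebesgue measure in coordinates and measurability of open sets *)

Notation T1 R := (measurableTypeR R).
Notation T2 R := (T1 R * T1 R)%type.
Notation T3 R := (T2 R * T1 R)%type.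
Notation T4 R := (T3 R * T1 R)%type.

Section Lebesgue.
Context (R : realType).

Definition sleb1 : {sigma_finite_measure set T1 R -> \bar R} := @lebesgue_measure R.
Definition sleb2 : {sigma_finite_measure set T2 R -> \bar R} := sprod sleb1 sleb1.
Definition sleb3 : {sigma_finite_measure set T3 R -> \bar R} := sprod sleb2 sleb1.
Definition sleb4 : {sigma_finite_measure set T4 R -> \bar R} := sprod sleb3 sleb1.

Lemma sleb3E : sleb3 = @leb3 R :> (set _ -> _). Proof. by []. Qed.
Lemma sleb4E : sleb4 = @leb4 R :> (set _ -> _). Proof. by []. Qed.

End Lebesgue.

Section OpenMeasurable.
Context (R : realType).

(** The row-vector topology is matched with the product sigma-algebra of the coordinates: an open
    set is the union of the countably many boxes with rational centre and radius 1/(n+1) that it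
    contains. *)
Let measurable_mk4_default (O : set ('rV[R]_3 * R)) : open O -> measurable (mk4 (R:=R) @^-1` O).
Proof.
move=> oO.
pose mk (c : rat * rat * rat * rat) : 'rV[R]_3 * R :=
  mk4 (((ratr c.1.1.1, ratr c.1.1.2), ratr c.1.2), ratr c.2).
pose box (i : (rat * rat * rat * rat) * nat) : set (((R * R) * R) * R) :=
  [set z | [/\ `|z.1.1.1 - ratr i.1.1.1.1| < i.2.+1%:R^-1, `|z.1.1.2 - ratr i.1.1.1.2| < i.2.+1%:R^-1,
               `|z.1.2 - ratr i.1.1.2| < i.2.+1%:R^-1 & `|z.2 - ratr i.1.2| < i.2.+1%:R^-1]].
have mbox i : measurable (box i).
  have ms (c r : R) : measurable [set x : R | `|x - c| < r].
    apply: open_measurable; rewrite (_ : [set _ | _] = ball c r).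
      exact: ball_open.
    by apply/seteqP; split => x /=; rewrite /ball /= distrC.
  have -> : box i = (([set x | `|x - ratr i.1.1.1.1| < i.2.+1%:R^-1] `*`
     [set x | `|x - ratr i.1.1.1.2| < i.2.+1%:R^-1]) `*`
     [set x | `|x - ratr i.1.1.2| < i.2.+1%:R^-1]) `*` [set x | `|x - ratr i.1.2| < i.2.+1%:R^-1].
    by apply/seteqP; split => z /=; [case=> *; split => //; split | move=> [[[]]]].
  by do 3 (apply: measurableX => //).
have -> : mk4 (R:=R) @^-1` O = \bigcup_i (if `[< box i `<=` mk4 (R:=R) @^-1` O >] then box i else set0).
  apply/seteqP; split => [z Oz|z [i _]]; last by case: ifPn => // /asboolP h /h.
  have [e /= e0 eO] : exists2 e : R, 0 < e & ball (mk4 z) e `<=` O.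
    have /nbhs_ballP[e e0 eO] : nbhs (mk4 z) O by exact: open_nbhs_nbhs.
    by exists e.
  (* Two points of a box of radius 1/(n+1) differ by less than 2/(n+1) < e in each coordinate, so a
     box containing z stays inside the ball around z. *)
  have [n ne] : exists n : nat, n.+1%:R^-1 < e / 2.
    have := near_infty_natSinv_lt (PosNum (divr_gt0 e0 (ltr0n _ 2))).
    by move=> [n _ /(_ n)] /= h; exists n; exact: h.
  have n0 : 0 < n.+1%:R^-1 :> R by rewrite invr_gt0.
  have app (x : R) : exists c : rat, `|x - ratr c| < n.+1%:R^-1.
    have lt : x - n.+1%:R^-1 < x + n.+1%:R^-1 by rewrite ltrBlDr -addrA ltrDl addr_gt0.
    have [c] := rat_in_itvoo lt.
    rewrite in_itv /= => /andP[h1 h2]; exists c; rewrite ltr_norml.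
    by rewrite ltrBlDl -ltrBlDr h1 andbT ltrBrDr addrC ltrBlDr.
  have [c1 h1] := app z.1.1.1; have [c2 h2] := app z.1.1.2.
  have [c3 h3] := app z.1.2; have [c4 h4] := app z.2.
  exists (((c1, c2), c3), c4, n) => //; rewrite asboolT; first by split.
  move=> w [] /= k1 k2 k3 k4; apply: eO.
  have D (x y c : R) : `|x - c| < n.+1%:R^-1 -> `|y - c| < n.+1%:R^-1 -> `|x - y| < e.
    move=> hx hy; rewrite -(subrKA c); apply: (le_lt_trans (ler_normD _ _)).
    rewrite (distrC _ y); apply: (lt_trans (ltrD hx hy)).
    by rewrite [ltRHS](splitr e) ltrD.
  split => /=; last exact: (D _ _ _ h4 k4).
  split=> // i j; rewrite !mxE /ball /=.
  by case: ifP => _; [|case: ifP => _]; [exact: (D _ _ _ h1 k1)|exact: (D _ _ _ h2 k2)|exact: (D _ _ _ h3 k3)].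
apply: (@countable_bigcupT_measurable) => // i.
by case: ifPn.
Qed.

(** The cylinder over [O] is open in space-time, and the set in question is its slice at time 0. *)
Let measurable_mk3_default (O : set 'rV[R]_3) : open O -> measurable (mk3 (R:=R) @^-1` O).
Proof.
move=> oO.
have oO' : open (O `*` [set: R]).
  rewrite (_ : _ `*` _ = fst @^-1` O); last by apply/seteqP; split => z // [].
  by apply: open_comp => // z _; exact: cvg_fst.
have m := measurable_mk4_default oO'.
have : measurable_fun setT (fun p : (R * R) * R => (p, 0 : R)) by [].
move=> /(_ measurableT _ m); rewrite setTI => h.
rewrite (_ : _ @^-1` _ = (fun p : R * R * R => (p, 0 : R)) @^-1` (mk4 (R:=R) @^-1` (O `*` setT)))//.
by apply/seteqP; split => z //= [].
Qed.

Lemma measurable_mk4 (O : set ('rV[R]_3 * R)) : open O -> measurable (mk4 (R:=R) @^-1` O : set (T4 R)).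
Proof. by move=> oO; exact: (measurable_mk4_default oO). Qed.

Lemma measurable_mk3 (O : set 'rV[R]_3) : open O -> measurable (mk3 (R:=R) @^-1` O : set (T3 R)).
Proof. by move=> oO; exact: (measurable_mk3_default oO). Qed.

(** Intersected with the open set [D], preimages of open intervals are open, and these generate the
    Borel sets. The map [m] stands for [mk3] or [mk4]. *)
Lemma open_fun_measurable d (T : measurableType d) (S : topologicalType) (m : T -> S)
   (D : set S) (h : S -> R) :
  (forall O, open O -> measurable (m @^-1` O)) -> open D ->
  (forall p, D p -> {for p, continuous h}) -> measurable_fun (m @^-1` D) (h \o m).
Proof.
move=> mm oD hc mD; apply: (measurability _ (RGenOpens.measurableE R)) => //.
move=> _ [_ [a [b ->] <-]].
rewrite (_ : _ `&` _ = m @^-1` (D `&` h @^-1` `]a, b[)); last by apply/seteqP; split.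
apply: mm; rewrite openE => p [Dp hp]; apply: filterI; first exact: open_nbhs_nbhs.
by apply: hc => //; apply: open_nbhs_nbhs; split => //; exact: interval_open.
Qed.

End OpenMeasurable.

(** * Derivatives along lines and the fundamental theorem of calculus *)

Section Line.
Context (R : realType) (V W : normedModType R).

(** The two difference quotients are the same function of h, so directional derivability and
    one-variable derivability along the line imply each other. *)
Lemma line_quotient (F : V -> W) (x v : V) (s : R) :
  (fun h : R => h^-1 *: (((fun s => F (x + s *: v)) \o shift s) (h *: (1 : R^o)) - F (x + s *: v))) =
  (fun h : R => h^-1 *: ((F \o shift (x + s *: v)) (h *: v) - F (x + s *: v))).
Proof.
apply/funext => h /=; congr (_ *: (F _ - _)).
by rewrite [h *: _]mulr1 scalerDl addrCA.
Qed.

Lemma derivable_line (F : V -> W) (x v : V) (s : R) :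
  derivable F (x + s *: v) v -> derivable (fun s : R => F (x + s *: v)) s 1.
Proof. by rewrite /derivable line_quotient. Qed.

Lemma derive_line (F : V -> W) (x v : V) (s : R) :
  derive1 (fun s : R => F (x + s *: v)) s = 'D_v F (x + s *: v).
Proof. by rewrite derive1E /derive line_quotient. Qed.

Lemma line_derivable (F : V -> W) (x v : V) :
  derivable (fun s : R => F (x + s *: v)) 0 1 -> derivable F x v.
Proof. by rewrite /derivable line_quotient scale0r addr0. Qed.

Lemma derive_line0 (F : V -> W) (x v : V) :
  'D_v F x = derive1 (fun s : R => F (x + s *: v)) 0.
Proof. by rewrite derive_line scale0r addr0. Qed.

End Line.

Section FTC.
Context (R : realType).
Notation mu := (@lebesgue_measure R).

Lemma invn_cvg0 : (fun n : nat => n.+1%:R^-1 : R) @ \oo --> (0 : R)^'.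
Proof.
move=> P hP; have H : \forall n \near \oo, (n.+1%:R^-1 : R) != 0 -> P (n.+1%:R^-1) := @cvg_harmonic R _ hP.
by apply: (filterS _ H) => n; apply; rewrite invr_eq0 pnatr_eq0.
Qed.

Lemma derivable_seq (V W : normedModType R) (f : V -> W) (x v : V) : derivable f x v ->
  (fun n : nat => n.+1%:R *: (f (n.+1%:R^-1 *: v + x) - f x)) @ \oo --> 'D_v f x.
Proof.
move=> df.
have := @cvg_comp _ _ _ (fun n : nat => n.+1%:R^-1 : R) _ _ _ _ invn_cvg0 df.
rewrite (_ : (_ \o _) = (fun n : nat => n.+1%:R *: (f (n.+1%:R^-1 *: v + x) - f x)))//.
by apply/funext => n /=; rewrite invrK.
Qed.

Lemma MVT_bound (f : R -> R) (C a b : R) :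
  (forall x, derivable f x 1) -> (forall x, `|derive1 f x| <= C) -> a <= b ->
  `|f b - f a| <= C * (b - a).
Proof.
move=> df hC ab.
have [c _ ->] := @MVT_segment R f (derive1 f) a b ab
  (fun x _ => ltac:(rewrite derive1E; exact: derivableP))
  ltac:(by apply: continuous_subspaceT => x; apply/differentiable_continuous/derivable1_diffP).
by rewrite normrM (ger0_norm (_ : 0 <= b - a)) ?subr_ge0// ler_wpM2r ?subr_ge0.
Qed.

Lemma is_derive_derive1 (f : R -> R) (x l : R) :
  derivable f x 1 -> derive1 f x = l -> is_derive x 1 f l.
Proof. by move=> d e; apply: DeriveDef => //; rewrite -derive1E. Qed.

(** If G is a primitive of f, then x |-> G(h+x) - G(x) is a primitive of the translated difference
    of f. *)
Lemma int_increment (f G : R -> R) (a b h : R) : a < b -> 0 < h -> continuous f ->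
  (forall x, a <= x -> x <= b + h -> is_derive x 1 G (f x)) ->
  \int[mu]_(x in `[a, b]) (f (h + x) - f x) = (G (h + b) - G b) - (G (h + a) - G a).
Proof.
move=> ab h0 cf dG.
pose H x := G (h + x) - G x.
have dH x : a <= x -> x <= b -> is_derive x 1 H (f (h + x) - f x).
  move=> ax xb.
  have i1 : is_derive x 1 G (f x) by apply: dG; lra.
  have i2 : is_derive (h + x) 1 G (f (h + x)) by apply: dG; lra.
  have i4 : is_derive x 1 (fun x : R => h + x) (1 : R).
    rewrite -[X in is_derive _ _ _ X]add0r.
    exact: (@is_deriveD _ _ _ (cst h) id _ _ _ _ (is_derive_cst _ _ _) (is_derive_id _ _)).
  have i3 : is_derive x 1 (fun x : R => G (h + x)) (f (h + x)).
    by have := @is_derive1_comp R G (fun x => h + x) x _ _ i2 i4; rewrite mulr1.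
  exact: (is_deriveB i3 i1).
rewrite /Rintegral (@continuous_FTC2 R _ H a b ab).
- by [].
- apply: continuous_subspaceT => x; apply: cvgB; last exact: cf.
  apply: (@continuous_comp _ _ _ (fun x => h + x) f); last exact: cf.
  by apply: cvgD; [exact: cvg_cst | exact: cvg_id].
- have cH x : a <= x -> x <= b -> H y @[y --> x] --> H x.
    move=> ax xb; have [dd _] := dH x ax xb.
    by apply/differentiable_continuous/derivable1_diffP.
  split.
  + by move=> x; rewrite in_itv /= => /andP[/ltW ax /ltW xb]; have [] := dH x ax xb.
  + by apply: cvg_at_right_filter; apply: cH => //; exact: ltW.
  + by apply: cvg_at_left_filter; apply: cH => //; exact: ltW.
- move=> x; rewrite in_itv /= => /andP[/ltW ax /ltW xb].
  by rewrite derive1E; have /@derive_val := dH x ax xb.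
Qed.

Lemma primitive_exists (f : R -> R) (A B : R) : continuous f ->
  exists G : R -> R, forall x, A < x -> x < B -> is_derive x 1 G (f x).
Proof.
move=> cf; exists (fun x => \int[mu]_(t in `[A, x]) f t) => x Ax xB.
have [d1 e1] : derivable (fun x => \int[mu]_(t in `[A, x]) f t) x 1 /\
   derive1 (fun x => \int[mu]_(t in `[A, x]) f t) x = f x.
  apply: (@continuous_FTC1_closed R f A x B) => //; last exact: cf.
  apply: continuous_compact_integrable; first exact: segment_compact.
  exact: continuous_subspaceT.
exact: is_derive_derive1.
Qed.

(** The derivative is bounded but need not be continuous; this is the regularity available for the
    flux. The difference quotients with step 1/(n+1) are bounded by [C] through the mean value
    theorem, so their integrals converge to the integral of the derivative by dominated convergence.
    The same integrals, computed with a primitive [G] of f, are difference quotients of [G] at b and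
    at a, and tend to f b - f a. *)
Lemma FTC_bounded_derivative (f : R -> R) (C a b : R) : a < b ->
  (forall x, derivable f x 1) -> (forall x, `|derive1 f x| <= C) ->
  \int[mu]_(x in `[a, b]) derive1 f x = f b - f a.
Proof.
move=> ab df hC.
have cf : continuous f by move=> x; apply/differentiable_continuous/derivable1_diffP.
(* The interval is enlarged so that b + 1/(n+1) still lies inside it. *)
have [G dG] := @primitive_exists f (a - 1) (b + 2) cf.
have mab : measurable (`[a, b]%classic : set R) by [].
have fab : (mu `[a, b]%classic < +oo)%E.
  by rewrite lebesgue_measure_itv /=; case: ifP => _; rewrite ?ltry// -EFinB ltry.
have mf0 n : measurable_fun [set: R] (fun x : R => f (n.+1%:R^-1 + x) - f x).
  apply: measurable_funB; last exact: continuous_measurable_fun.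
  apply: (measurableT_comp (continuous_measurable_fun cf)).
  by apply: measurable_funD => //; exact: measurable_cst.
have fC n x : `|f (n.+1%:R^-1 + x) - f x| <= C * n.+1%:R^-1.
  have := @MVT_bound f C x (n.+1%:R^-1 + x) df hC.
  by rewrite lerDr invr_ge0 ler0n addrK; exact.
have gC n x : `|n.+1%:R * (f (n.+1%:R^-1 + x) - f x)| <= C.
  rewrite normrM ger0_norm// mulrC -ler_pdivlMr//.
have bg0 n : bmeas (`[a, b]%classic : set R) (fun x : R => f (n.+1%:R^-1 + x) - f x).
  by split; [exact: measurable_funTS | exists (C * n.+1%:R^-1) => x _].
have bg n : bmeas (`[a, b]%classic : set R) (fun x : R => n.+1%:R * (f (n.+1%:R^-1 + x) - f x)).
  by apply: bmeasM => //; exact: bmeas_cst.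
have cG x : a - 1 < x -> x < b + 2 ->
    n.+1%:R * (G (n.+1%:R^-1 + x) - G x) @[n --> \oo] --> f x.
  move=> h1 h2; have [d e] := dG x h1 h2; rewrite -e; have := derivable_seq d.
  by under eq_fun do rewrite [_ *: 1]mulr1.
have gc x : n.+1%:R * (f (n.+1%:R^-1 + x) - f x) @[n --> \oo] --> derive1 f x.
  rewrite derive1E; have := derivable_seq (df x).
  by under eq_fun do rewrite [_ *: 1]mulr1.
have mdf : measurable_fun [set: R] (derive1 f).
  apply: (@measurable_fun_cvg _ _ _ [set: R] (fun n (x : R) => n.+1%:R * (f (n.+1%:R^-1 + x) - f x))).
    by move=> n; apply: measurable_funM => //; exact: measurable_cst.
  by move=> x _; exact: gc.
have bdf : bmeas `[a, b]%classic (derive1 f).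
  by split; [exact: measurable_funTS | exists C => x _; exact: hC].
have mg n : measurable_fun (`[a, b]%classic : set R) (fun x : R => (n.+1%:R * (f (n.+1%:R^-1 + x) - f x))%:E).
  by apply/measurable_EFinP; case: (bg n).
have mdf' : measurable_fun (`[a, b]%classic : set R) (fun x : R => (derive1 f x)%:E).
  by apply/measurable_EFinP; case: bdf.
have hc : {ae mu, forall x, `[a, b]%classic x ->
    (n.+1%:R * (f (n.+1%:R^-1 + x) - f x))%:E @[n --> \oo] --> (derive1 f x)%:E}.
  by apply: aeW => x _; apply: cvg_EFin; [exact: nearW | exact: gc].
have hd : {ae mu, forall x n, `[a, b]%classic x ->
    (`|(n.+1%:R * (f (n.+1%:R^-1 + x) - f x))%:E| <= C%:E)%E}.
  by apply: aeW => x n xab; rewrite lee_fin; exact: gC.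
have [_ _] := @dominated_convergence _ _ _ mu _ mab _ _ _ mg mdf' hc (@bmeas_integrable _ _ _ _ mu mab fab _ (bmeas_cst _ C)) hd.
rewrite bmeas_EFin//.
rewrite (_ : (fun n => _) = (fun n =>
    (\int[mu]_(x in `[a, b]) (n.+1%:R * (f (n.+1%:R^-1 + x) - f x)))%:E)); last first.
  apply/funext => n. rewrite -(@bmeas_EFin _ _ _ _ mu mab fab _ (bg n)). by [].
move=> /fine_cvg /= cv.
have E n : \int[mu]_(x in `[a, b]) (n.+1%:R * (f (n.+1%:R^-1 + x) - f x)) =
   n.+1%:R * (G (n.+1%:R^-1 + b) - G b) - n.+1%:R * (G (n.+1%:R^-1 + a) - G a).
  have h0 : 0 < n.+1%:R^-1 :> R by rewrite invr_gt0.
  have h1 : n.+1%:R^-1 <= 1 :> R by rewrite invf_le1// ler1n.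
  rewrite bmeas_intZ//; last exact: bg0.
  have dG' x : a <= x -> x <= b + n.+1%:R^-1 -> is_derive x 1 G (f x).
    move: (n.+1%:R^-1) h1 => h h1 ax xb; apply: dG; lra.
  by rewrite (@int_increment f G a b _ ab h0 cf dG') mulrBr.
have L : (fun n => \int[mu]_(x in `[a, b]) (n.+1%:R * (f (n.+1%:R^-1 + x) - f x))) @ \oo -->
   f b - f a.
  by rewrite (funext E); apply: cvgB; [apply: cG; lra | apply: cG; lra].
exact: (cvg_unique _ cv L).
Qed.
End FTC.

(** * Partial derivatives integrate to zero over a large box *)

Section Box.
Context (R : realType).
Notation mu := (@lebesgue_measure R).

Lemma sleb1_itv_lty (a b : R) (l r : bool) :
  (sleb1 R [set` Interval (BSide l a) (BSide r b)] < +oo)%E.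
Proof.
rewrite /sleb1 /= lebesgue_measure_itv /=; case: ifP => _; rewrite ?ltry//.
Qed.

Definition box (M : R) : set (T3 R) := (`[- M, M] `*` `[- M, M]) `*` `[- M, M].

Lemma mk3_line0 (s y z : R) : mk3 ((s, y), z) = mk3 ((0, y), z) + s *: ev R 0.
Proof.
apply/rowP => j; rewrite !mxE /=; case: j => -[|[|[|//]]] h /=; lra.
Qed.

Lemma mk3_line1 (x s z : R) : mk3 ((x, s), z) = mk3 ((x, 0), z) + s *: ev R 1.
Proof.
apply/rowP => j; rewrite !mxE /=; case: j => -[|[|[|//]]] h /=; lra.
Qed.

Lemma mk3_line2 (x y s : R) : mk3 ((x, y), s) = mk3 ((x, y), 0) + s *: ev R 2.
Proof.
apply/rowP => j; rewrite !mxE /=; case: j => -[|[|[|//]]] h /=; lra.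
Qed.

(** A partial derivative is a pointwise limit of difference quotients, which are continuous. *)
Lemma measurable_partial (F : 'rV[R]_3 -> R) (i : 'I_3) :
  (forall x : 'rV[R]_3, derivable F x (ev R i)) -> continuous F ->
  measurable_fun [set: T3 R] (fun p : T3 R => 'D_(ev R i) F (mk3 p)).
Proof.
move=> dF cF.
have mF : measurable_fun [set: T3 R] (F \o (@mk3 R)).
  have := @open_fun_measurable R _ _ _ (@mk3 R) setT F (@measurable_mk3 R) openT (fun x _ => cF x).
  by rewrite preimage_setT.
  apply: (@measurable_fun_cvg _ _ _ [set: T3 R]
    (fun n (p : T3 R) => n.+1%:R * (F (n.+1%:R^-1 *: ev R i + mk3 p) - F (mk3 p)))).
    move=> n; apply: measurable_funM; first exact: measurable_cst.
    apply: measurable_funB => //.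
    have := @open_fun_measurable R _ _ _ (@mk3 R) setT (fun x => F (n.+1%:R^-1 *: ev R i + x)) (@measurable_mk3 R) openT.
    rewrite preimage_setT; apply=> x _.
    apply: (@continuous_comp _ _ _ (fun x => n.+1%:R^-1 *: ev R i + x) F); last exact: cF.
    apply: (@continuousD _ 'rV[R]_3 'rV[R]_3 (cst (n.+1%:R^-1 *: ev R i)) id x).
      exact: cst_continuous.
    exact: cvg_id.
  by move=> p _; exact: (derivable_seq (dF (mk3 p))).
Qed.

(** By Fubini the i-th variable can be integrated innermost; along each such segment the integral is
    the difference of the end values of F, and both vanish. *)
Lemma int_box_partial (F : 'rV[R]_3 -> R) (i : 'I_3) (C M : R) : 0 < M ->
  (forall x : 'rV[R]_3, derivable F x (ev R i)) ->
  (forall x : 'rV[R]_3, `|'D_(ev R i) F x| <= C) ->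
  continuous F -> (forall x : 'rV[R]_3, (exists j, M <= `|x 0 j|) -> F x = 0) ->
  \int[sleb3 R]_(p in box M) 'D_(ev R i) F (mk3 p) = 0.
Proof.
move=> M0 dF bF cF sF.
pose I : set (T1 R) := `[- M, M]%classic.
have mI : measurable I by exact: measurable_itv.
have fI : (sleb1 R I < +oo)%E by exact: sleb1_itv_lty.
have mII : measurable (I `*` I) by exact: measurableX.
have fII : (sleb2 R (I `*` I) < +oo)%E by exact: sprod_lty.
have bD : bmeas (box M) (fun p : T3 R => 'D_(ev R i) F (mk3 p)).
  split; last by exists C => x _; exact: bF.
  by apply: measurable_funTS; exact: measurable_partial.
have line (v : 'rV[R]_3) : F (v + - M *: ev R i) = F (v + M *: ev R i) ->
    \int[mu]_(s in `[- M, M]) 'D_(ev R i) F (v + s *: ev R i) = 0.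
  move=> E; pose f (s : R) : R := F (v + s *: ev R i).
  transitivity (\int[mu]_(s in `[- M, M]) derive1 f s).
    by apply: eq_Rintegral => s _; rewrite derive_line.
  rewrite (@FTC_bounded_derivative R f C); first by rewrite /f E subrr.
  - by lra.
  - by move=> s; apply: derivable_line; exact: dF.
  - by move=> s; rewrite derive_line.
(* A base point on the plane where the i-th coordinate is 0 puts the ends of the segment at
   coordinate M and -M, where F is zero. *)
have {}line (v : 'rV[R]_3) : v 0 i = 0 ->
    \int[mu]_(s in `[- M, M]) 'D_(ev R i) F (v + s *: ev R i) = 0.
  move=> v0; apply: line; rewrite !sF//; exists i; rewrite !mxE !eqxx /= v0 mulr1 add0r ?normrN;
    by rewrite ger0_norm// ltW.
have Z0 (D : set (T1 R)) : \int[sleb1 R]_(x in D) (0 : R) = 0 by rewrite /Rintegral integral0.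
have Z02 (D : set (T2 R)) : \int[sleb2 R]_(x in D) (0 : R) = 0 by rewrite /Rintegral integral0.
case: i dF bF bD line => -[|[|[|//]]] hi dF bF bD line.
- rewrite (@bmeas_fubini2 _ _ _ _ R (sleb2 R) (sleb1 R) _ _ mII mI fII fI _ bD).
  rewrite (@eq_Rintegral _ _ _ _ _ (fun=> 0)) ?Z0// => z /set_mem hz.
  rewrite (@bmeas_fubini2 _ _ _ _ R (sleb1 R) (sleb1 R) _ _ mI mI fI fI _ (bmeas_slice1 mII mI bD hz)).
  rewrite (@eq_Rintegral _ _ _ _ _ (fun=> 0)) ?Z0// => y /set_mem hy.
  have := line (mk3 ((0, y), z)); rewrite !mxE => /(_ erefl) L; rewrite -[RHS]L.
  by apply: eq_Rintegral => s _; rewrite mk3_line0 (_ : Ordinal hi = 0)//; exact: val_inj.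
- rewrite (@bmeas_fubini2 _ _ _ _ R (sleb2 R) (sleb1 R) _ _ mII mI fII fI _ bD).
  rewrite (@eq_Rintegral _ _ _ _ _ (fun=> 0)) ?Z0// => z /set_mem hz.
  rewrite (@bmeas_fubini1 _ _ _ _ R (sleb1 R) (sleb1 R) _ _ mI mI fI fI _ (bmeas_slice1 mII mI bD hz)).
  rewrite (@eq_Rintegral _ _ _ _ _ (fun=> 0)) ?Z0// => x /set_mem hx.
  have := line (mk3 ((x, 0), z)); rewrite !mxE => /(_ erefl) L; rewrite -[RHS]L.
  by apply: eq_Rintegral => s _; rewrite mk3_line1 (_ : Ordinal hi = 1)//; exact: val_inj.
- rewrite (@bmeas_fubini1 _ _ _ _ R (sleb2 R) (sleb1 R) _ _ mII mI fII fI _ bD).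
  rewrite (@eq_Rintegral _ _ _ _ _ (fun=> 0)) ?Z02// => -[x y] hxy.
  have := line (mk3 ((x, y), 0)); rewrite !mxE => /(_ erefl) L; rewrite -[RHS]L.
  by apply: eq_Rintegral => s _; rewrite mk3_line2 (_ : Ordinal hi = 2)//; exact: val_inj.
Qed.

End Box.

Ltac nonneg := repeat first [assumption | exact: powR_ge0 | exact: sqr_ge0
  | exact: normr_ge0 | exact: ler0n | exact: ler01
  | match goal with H : is_true (0 < ?x) |- is_true (0 <= ?x) => exact: (ltW H) end
  | rewrite subr_ge0 | rewrite invr_ge0 | apply: mulr_ge0 | apply: addr_ge0].

(** * Inequalities for real powers and vector algebra in three dimensions *)

Section Powers.
Context (R : realType).
Implicit Types x y p r s : R.

Lemma powRD_gt0 x r s : 0 < x -> powR x (r + s) = powR x r * powR x s.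
Proof. by move=> x0; rewrite powRD// (gt_eqF x0) implybT. Qed.

Lemma powRD_ge0 x r s : 0 <= r -> 0 < s -> powR x (r + s) = powR x r * powR x s.
Proof. by move=> r0 s0; rewrite powRD// gt_eqF// ltr_wpDl. Qed.

Lemma ler_powR2l x y p : 0 <= p -> 0 <= x -> x <= y -> powR x p <= powR y p.
Proof. by move=> p0 x0 xy; rewrite ge0_ler_powR ?nnegrE// (le_trans x0). Qed.

Lemma ler_powR2r x r s : 1 <= x -> r <= s -> powR x r <= powR x s.
Proof. by move=> x1 rs; exact: ler_powR. Qed.

Lemma powR_ge1 x p : 0 <= p -> 1 <= x -> 1 <= powR x p.
Proof. by move=> p0 x1; rewrite -(powRr0 x) ler_powR. Qed.

(** Hoelder's inequality for the two-term sum x 1 + y 1, raised to the power p; the sharp constant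
    2^(p-1) is what produces the constants of the theorem. *)
Lemma powR_le_mean x y p : 1 <= p -> 0 <= x -> 0 <= y ->
  powR (x + y) p <= powR 2 (p - 1) * (powR x p + powR y p).
Proof.
rewrite le_eqVlt => /predU1P[<-|p1] x0 y0.
  by rewrite subrr powRr0 mul1r !powRr1// addr_ge0.
have p0 : 0 < p by exact: lt_trans p1.
pose q := p / (p - 1).
have q0 : 0 < q by rewrite divr_gt0// subr_gt0.
have pq : p^-1 + q^-1 = 1.
  by rewrite /q invf_div -[X in X + _]mul1r -mulrDl addrC subrK divff// gt_eqF.
have := @hoelder2 R x y 1 1 p q x0 y0 ler01 ler01 p0 q0 pq.
rewrite !mulr1 powR1 => /(ler_powR2l (ltW p0) (addr_ge0 x0 y0)).
rewrite powRM ?powR_ge0// -!powRrM mulVf ?gt_eqF// powRr1 ?addr_ge0 ?powR_ge0//.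
move=> /le_trans; apply; rewrite mulrC ler_wpM2r ?addr_ge0 ?powR_ge0//.
by rewrite /q invf_div divfK ?gt_eqF.
Qed.

(** The sum is at most twice the larger term; unlike the convexity bound this covers exponents below
    1. *)
Lemma powR_le_max x y p : 0 <= p -> 0 <= x -> 0 <= y ->
  powR (x + y) p <= powR 2 p * (powR x p + powR y p).
Proof.
move=> p0 x0 y0; wlog xy : x y x0 y0 / x <= y.
  by move=> h; case: (leP x y) => [|/ltW] xy; [|rewrite addrC [X in _ * X]addrC]; exact: h.
apply: (@le_trans _ _ (powR (2 * y) p)); first by apply: ler_powR2l => //; lra.
by rewrite powRM// ler_wpM2l ?powR_ge0// lerDr powR_ge0.
Qed.

Lemma powR_interval x (r s t : R) : 0 < x -> r <= s -> s <= t ->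
  powR x s <= Num.max (powR x r) (powR x t).
Proof.
move=> x0 rs st; have [x1|x1] := leP 1 x.
  by rewrite le_max (ler_powR x1 st) orbT.
by rewrite le_max ger_powR// x0 ltW.
Qed.

End Powers.

Section Vectors.
Context (R : realType).
Notation vec := 'rV[R]_3.
Implicit Types u v w k : vec.

Definition dotp u v : R := \sum_(i < 3) u 0 i * v 0 i.

Lemma sum3 (f : 'I_3 -> R) : \sum_(i < 3) f i = f 0 + f 1 + f 2.
Proof.
rewrite !big_ord_recl big_ord0 addr0 addrA.
by congr (f _ + f _ + f _); exact: val_inj.
Qed.

Lemma dotpE u v : dotp u v = u 0 0 * v 0 0 + u 0 1 * v 0 1 + u 0 2 * v 0 2.
Proof. exact: sum3. Qed.

Lemma vnormE v : vnorm v = Num.sqrt (dotp v v).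
Proof. by congr Num.sqrt; apply: eq_bigr => i _; rewrite expr2. Qed.

Lemma dotp_ge0 v : 0 <= dotp v v.
Proof. by apply: sumr_ge0 => i _; rewrite -expr2 sqr_ge0. Qed.

Lemma vnorm_ge0 v : 0 <= vnorm v.
Proof. exact: sqrtr_ge0. Qed.

Lemma vnorm_sqr v : vnorm v ^+ 2 = dotp v v.
Proof. by rewrite vnormE sqr_sqrtr// dotp_ge0. Qed.

Lemma crossE k x : [/\ cross k x 0 0 = k 0 1 * x 0 2 - k 0 2 * x 0 1,
  cross k x 0 1 = k 0 2 * x 0 0 - k 0 0 * x 0 2 &
  cross k x 0 2 = k 0 0 * x 0 1 - k 0 1 * x 0 0].
Proof.
have i0 : (inord 0 : 'I_3) = 0 by apply: val_inj; rewrite /= inordK.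
have i1 : (inord 1 : 'I_3) = 1 by apply: val_inj; rewrite /= inordK.
have i2 : (inord 2 : 'I_3) = 2 by apply: val_inj; rewrite /= inordK.
by split; rewrite mxE /= ?i0 ?i1 ?i2.
Qed.

(** Lagrange's identity: the defect is the sum of squares of the 2 x 2 minors. *)
Lemma cauchy_schwarz u v : dotp u v <= vnorm u * vnorm v.
Proof.
have [h|h] := leP (dotp u v) 0.
  by apply: (le_trans h); rewrite mulr_ge0 ?vnorm_ge0.
rewrite -(@ler_pXn2r _ 2)// ?nnegrE ?mulr_ge0 ?vnorm_ge0 ?(ltW h)//.
rewrite exprMn !vnorm_sqr !dotpE -subr_ge0.
rewrite (_ : _ - _ = (u 0 0 * v 0 1 - u 0 1 * v 0 0) ^+ 2 +
  (u 0 0 * v 0 2 - u 0 2 * v 0 0) ^+ 2 + (u 0 1 * v 0 2 - u 0 2 * v 0 1) ^+ 2); last by ring.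
by rewrite !addr_ge0 ?sqr_ge0.
Qed.

Lemma dotpDr u v w : dotp u (v + w) = dotp u v + dotp u w.
Proof. by rewrite !dotpE !mxE; ring. Qed.
Lemma dotpDl u v w : dotp (u + v) w = dotp u w + dotp v w.
Proof. by rewrite !dotpE !mxE; ring. Qed.
Lemma dotpZr (c : R) u v : dotp u (c *: v) = c * dotp u v.
Proof. by rewrite !dotpE !mxE; ring. Qed.
Lemma dotpZl (c : R) u v : dotp (c *: u) v = c * dotp u v.
Proof. by rewrite !dotpE !mxE; ring. Qed.
Lemma dotpNr u v : dotp u (- v) = - dotp u v.
Proof. by rewrite !dotpE !mxE; ring. Qed.
Lemma dotpNl u v : dotp (- u) v = - dotp u v.
Proof. by rewrite !dotpE !mxE; ring. Qed.
Lemma dotpC u v : dotp u v = dotp v u.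
Proof. by rewrite !dotpE; ring. Qed.

Lemma dotp_cross k v : dotp (cross k v) v = 0.
Proof. by rewrite dotpE; case: (crossE k v) => -> -> ->; ring. Qed.

Lemma vnorm_le v (c : R) : 0 <= c -> dotp v v <= c ^+ 2 -> vnorm v <= c.
Proof.
by move=> c0 h; rewrite -(@ler_pXn2r _ 2)// ?nnegrE ?vnorm_ge0// vnorm_sqr.
Qed.

Lemma vnormD u v : vnorm (u + v) <= vnorm u + vnorm v.
Proof.
apply: vnorm_le; first by rewrite addr_ge0 ?vnorm_ge0.
rewrite dotpDl !dotpDr sqrrD !vnorm_sqr (dotpC v u).
by have := cauchy_schwarz u v; lra.
Qed.

Lemma vnormZ (c : R) v : vnorm (c *: v) = `|c| * vnorm v.
Proof.
by rewrite !vnormE dotpZl dotpZr mulrA -expr2 sqrtrM ?sqr_ge0// sqrtr_sqr.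
Qed.

Lemma vnormN v : vnorm (- v) = vnorm v.
Proof. by rewrite !vnormE dotpNl dotpNr opprK. Qed.

Lemma vnorm0 : vnorm (0 : vec) = 0.
Proof. by rewrite -(scale0r 0) vnormZ normr0 mul0r. Qed.

Lemma ler_coord_vnorm v i : `|v 0 i| <= vnorm v.
Proof.
rewrite -(@ler_pXn2r _ 2)// ?nnegrE ?vnorm_ge0// vnorm_sqr real_normK ?num_real//.
rewrite /dotp (bigD1 i)//= -expr2 lerDl; apply: sumr_ge0 => j _.
by rewrite -expr2 sqr_ge0.
Qed.

Lemma vnorm_cross k v : vnorm k = 1 -> vnorm (cross k v) <= vnorm v.
Proof.
move=> k1; apply: vnorm_le; first exact: vnorm_ge0.
have h : dotp k k = 1 by rewrite -vnorm_sqr k1 expr1n.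
rewrite vnorm_sqr -[X in _ <= X]mul1r -h -subr_ge0 !dotpE.
case: (crossE k v) => -> -> ->.
rewrite (_ : _ - _ = (k 0 0 * v 0 0 + k 0 1 * v 0 1 + k 0 2 * v 0 2) ^+ 2); last by ring.
exact: sqr_ge0.
Qed.

Lemma crossB k u v : cross k (u - v) = cross k u - cross k v.
Proof. by apply/rowP => i; rewrite !mxE; ring. Qed.

End Vectors.

(** * The map F_z: coercivity, growth and monotonicity *)

Section Forchheimer.
Context (R : realType) (N : nat) (al aa : 'I_N.+1 -> R).
Hypotheses (N1 : (1 <= N)%N) (al0 : al 0 = 0)
  (al_mono : forall i j : 'I_N.+1, (i < j)%N -> al i < al j)
  (aa_gt0 : forall i, 0 < aa i).
Context (k : 'rV[R]_3) (k1 : vnorm k = 1).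
Notation vec := 'rV[R]_3.
Notation g := (gfun al aa).
Notation F := (Fmap al aa k).
Notation aN := (al ord_max).
Notation a := (aexp al).
Notation m := (Num.min 1 (Num.min (aa 0) (aa ord_max))).
Notation c := (m / powR 2 aN).

Let max_neq0 : (ord_max : 'I_N.+1) != 0.
Proof. by rewrite -(inj_eq val_inj) /= -lt0n. Qed.

Lemma al_gt0 : 0 < aN.
Proof. by rewrite -al0; apply: al_mono. Qed.

Lemma al_ge0 i : 0 <= al i.
Proof.
have [->|i0] := eqVneq i 0; first by rewrite al0.
by rewrite ltW// -al0; apply: al_mono; rewrite lt0n -(inj_eq val_inj) in i0 *.
Qed.

Lemma al_le_max i : al i <= aN.
Proof.
have [->//|im] := eqVneq i ord_max.
by apply/ltW/al_mono; rewrite ltn_neqAle -(inj_eq val_inj) /= in im *; rewrite im -ltnS ltn_ord.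
Qed.

Lemma aexp_gt0 : 0 < a.
Proof. by rewrite /aexp divr_gt0 ?addr_gt0 ?al_gt0. Qed.

Lemma aexp_lt1 : a < 1.
Proof. by rewrite /aexp ltr_pdivrMr ?addr_gt0 ?al_gt0// mul1r ltrDr. Qed.

Lemma aexpE : (1 + aN) * a = aN.
Proof. by rewrite /aexp mulrCA divff ?mulr1// gt_eqF// addr_gt0// al_gt0. Qed.

Lemma aexp1E : (1 + aN) * (1 - a) = 1.
Proof. by rewrite mulrBr aexpE mulr1 addrK. Qed.

Lemma m_gt0 : 0 < m. Proof. by rewrite !lt_min ltr01 !aa_gt0. Qed.
Lemma m_le1 : m <= 1. Proof. by rewrite ge_min lexx. Qed.
Lemma m_le0 : m <= aa 0. Proof. by rewrite !ge_min lexx orbT. Qed.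
Lemma m_leN : m <= aa ord_max. Proof. by rewrite !ge_min lexx !orbT. Qed.
Lemma c_gt0 : 0 < c. Proof. by rewrite divr_gt0 ?m_gt0 ?powR_gt0. Qed.
Lemma chi0_gt0 : 0 < chi0 aa.
Proof.
by rewrite /chi0 (bigD1 0)//= ltr_pwDl//; apply: sumr_ge0 => i _; exact: ltW.
Qed.

Lemma c4_gt0 : 0 < c4 al aa. Proof. by rewrite powR_gt0// c_gt0. Qed.

Lemma gfun_lower s : 0 <= s -> aa 0 + aa ord_max * powR s aN <= g s.
Proof.
move=> s0; rewrite /gfun (bigD1 0)//= al0 powRr0 mulr1 lerD2l.
rewrite (bigD1 ord_max)//= lerDl; apply: sumr_ge0 => i _.
by rewrite mulr_ge0 ?powR_ge0// ltW.
Qed.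

Lemma gfun_ge0 s : 0 <= s -> 0 <= g s.
Proof.
move=> /gfun_lower; apply: le_trans.
by rewrite addr_ge0 ?mulr_ge0 ?powR_ge0// ltW.
Qed.

(** Only the constant and the top-degree terms of g are kept, and (1+s)^(alpha_N) <= 2^(alpha_N) (1
    + s^(alpha_N)) compares them with a single power. *)
Lemma gfun_lower1 s : 0 <= s -> c * powR (1 + s) aN <= g s.
Proof.
move=> s0; apply: le_trans (gfun_lower s0).
have h : powR (1 + s) aN <= powR 2 aN * (1 + powR s aN).
  by have := powR_le_max (ltW al_gt0) ler01 s0; rewrite powR1.
apply: (@le_trans _ _ (m * (1 + powR s aN))).
  rewrite mulrAC ler_pdivrMr ?powR_gt0// -mulrA ler_wpM2l ?(ltW m_gt0)//.
  by rewrite mulrC.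
by rewrite mulrDr mulr1 lerD ?m_le0// ler_wpM2r ?powR_ge0 ?m_leN.
Qed.

(** Here the summand 1 plays the role of the constant term, and convexity of the power 1 + alpha_N
    yields the same constant as in [gfun_lower1]. *)
Lemma gfun_lower2 s : 0 <= s -> c * powR (1 + s) (1 + aN) <= 1 + g s * s.
Proof.
move=> s0.
have h : powR (1 + s) (1 + aN) <= powR 2 aN * (1 + powR s (1 + aN)).
  have := @powR_le_mean R 1 s (1 + aN) _ ler01 s0; rewrite powR1 addrAC subrr add0r.
  by apply; rewrite lerDl ltW// al_gt0.
apply: (@le_trans _ _ (m * (1 + powR s (1 + aN)))).
  rewrite mulrAC ler_pdivrMr ?powR_gt0// -mulrA ler_wpM2l ?(ltW m_gt0)//.
  by rewrite mulrC.
rewrite mulrDr mulr1 lerD ?m_le1//.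
rewrite addrC powRD_ge0 ?(ltW al_gt0)// powRr1// mulrA ler_wpM2r//.
apply: le_trans (gfun_lower s0).
by rewrite ler_wpDl ?(ltW (aa_gt0 _))// ler_wpM2r ?powR_ge0 ?m_leN.
Qed.

Lemma gfun_upper s : 0 <= s -> g s <= chi0 aa * powR (1 + s) aN.
Proof.
move=> s0; rewrite /gfun /chi0 mulr_suml; apply: ler_sum => i _.
rewrite ler_wpM2l ?(ltW (aa_gt0 _))//.
apply: (@le_trans _ _ (powR (1 + s) (al i))).
  by apply: ler_powR2l => //; [exact: al_ge0 | rewrite lerDr].
by apply: ler_powR; [rewrite lerDl | exact: al_le_max].
Qed.

Lemma dotp_Fmap z v : dotp v (F z v) = g (vnorm v) * vnorm v ^+ 2.
Proof.
by rewrite /Fmap dotpDr !dotpZr vnorm_sqr (dotpC v (cross k v)) dotp_cross mulr0 addr0.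
Qed.

(** Since v . F_z(v) = g(|v|)|v|^2 whatever z is, Cauchy-Schwarz gives the bound after division by
    |v|. *)
Lemma Fmap_norm_ge z v : g (vnorm v) * vnorm v <= vnorm (F z v).
Proof.
have [v0|v0] := eqVneq (vnorm v) 0; first by rewrite v0 mulr0 vnorm_ge0.
have vp : 0 < vnorm v by rewrite lt_neqAle eq_sym v0 vnorm_ge0.
rewrite -(ler_pM2l vp) mulrCA mulrA -mulrA -expr2 -(dotp_Fmap z).
exact: cauchy_schwarz.
Qed.

Lemma Fmap_norm_le z v : 0 <= z -> vnorm (F z v) <= (g (vnorm v) + z) * vnorm v.
Proof.
move=> z0; rewrite /Fmap; apply: (le_trans (vnormD _ _)).
rewrite !vnormZ mulrDl ger0_norm ?gfun_ge0 ?vnorm_ge0// lerD2l ger0_norm//.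
by rewrite ler_wpM2l// vnorm_cross.
Qed.

(** Let s = |v|, Y = |F_z(v)|. From above, Y <= (chi0 + z)(1+s)^(alpha_N) s. From below, 1 + Y >= c
    (1+s)^(1+alpha_N), whose a-th power is (1+Y)^a >= c^a (1+s)^(alpha_N) because (1+alpha_N) a =
    alpha_N. Finally v . F_z(v) = g(s) s^2 >= c (1+s)^(alpha_N) s^2. Multiplying these produces
    c^(1+a), which is [c4]. *)
Lemma Fmap_coercive z v : 0 <= z ->
  c4 al aa * (vnorm (F z v) ^+ 2 / powR (1 + vnorm (F z v)) a) <=
  (chi0 aa + z) ^+ 2 * dotp v (F z v).
Proof.
move=> z0; set y := F z v; set s := vnorm v; set Y := vnorm y.
have s0 : 0 <= s by exact: vnorm_ge0.
have Y0 : 0 <= Y by exact: vnorm_ge0.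
have a0 := aexp_gt0.
have Yg : g s * s <= Y by exact: Fmap_norm_ge.
have Yle : Y <= (chi0 aa + z) * (powR (1 + s) aN * s).
  apply: (le_trans (Fmap_norm_le v z0)); rewrite mulrA ler_wpM2r//.
  rewrite mulrDl lerD ?gfun_upper// ler_peMr// powR_ge1 ?(ltW al_gt0)//.
  by rewrite lerDl.
have h1 : powR c a * powR (1 + s) aN <= powR (1 + Y) a.
  have -> : powR (1 + s) aN = powR (powR (1 + s) (1 + aN)) a by rewrite -powRrM aexpE.
  rewrite -powRM ?powR_ge0 ?(ltW c_gt0)//.
  apply: ler_powR2l; first exact: ltW.
    by rewrite mulr_ge0 ?powR_ge0 ?(ltW c_gt0).
  by apply: (le_trans (gfun_lower2 s0)); rewrite lerD2l.
have c4E : c4 al aa = c * powR c a.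
  by rewrite /c4 powRD_gt0 ?c_gt0// powRr1// ltW// c_gt0.
have P0 : 0 < powR (1 + Y) a by rewrite powR_gt0// ltr_pwDl.
rewrite mulrA ler_pdivrMr// dotp_Fmap -/s.
set p := powR (1 + s) aN in Yle h1.
have p0 : 0 <= p by exact: powR_ge0.
have Y2 : Y ^+ 2 <= (chi0 aa + z) ^+ 2 * (p * s) ^+ 2.
  by rewrite -exprMn ler_pXn2r// ?nnegrE// (le_trans Y0).
have c40 := c4_gt0.
apply: (le_trans (ler_wpM2l (ltW c40) Y2)).
suff K : c4 al aa * (p * s) ^+ 2 <= g s * s ^+ 2 * powR (1 + Y) a.
  by rewrite [leLHS]mulrCA -[leRHS]mulrA ler_wpM2l ?sqr_ge0.
rewrite [X in _ <= X](_ : _ = g s * powR (1 + Y) a * s ^+ 2); last by ring.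
rewrite [X in X <= _](_ : _ = (c * p) * (powR c a * p) * s ^+ 2); last by rewrite c4E; ring.
apply: ler_wpM2r; first exact: sqr_ge0.
apply: ler_pM => //; first by rewrite mulr_ge0// ltW// c_gt0.
  by rewrite mulr_ge0// powR_ge0.
exact: gfun_lower1.
Qed.

(** For |y| <= 1 the left side is not positive; for |y| > 1 one has 1 + |y| <= 2|y|, which costs the
    factor 2^(-a). *)
Lemma Fmap_coercive_power z v : 0 <= z ->
  powR 2 (- a) * c4 al aa * (powR (vnorm (F z v)) (2 - a) - 1) <=
  (chi0 aa + z) ^+ 2 * dotp v (F z v).
Proof.
move=> z0; have a0 := aexp_gt0; have a1 := aexp_lt1.
have c40 := c4_gt0.
have [Y1|Y1] := leP (vnorm (F z v)) 1.
  apply: (@le_trans _ _ 0); last first.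
    by rewrite mulr_ge0 ?sqr_ge0// dotp_Fmap mulr_ge0 ?sqr_ge0 ?gfun_ge0 ?vnorm_ge0.
  rewrite mulr_ge0_le0 ?mulr_ge0 ?powR_ge0 ?(ltW c40)// subr_le0.
  apply: (@le_trans _ _ (powR 1 (2 - a))); last by rewrite powR1.
  by apply: ler_powR2l; [lra | exact: vnorm_ge0 | ].
apply: le_trans (Fmap_coercive v z0).
set Y := vnorm _ in Y1 *; have Y0 : 0 < Y by exact: lt_trans Y1.
rewrite mulrAC [leLHS]mulrC ler_wpM2l ?(ltW c40)//.
apply: (@le_trans _ _ (powR 2 (- a) * powR Y (2 - a))).
  by rewrite ler_wpM2l ?powR_ge0// gerBl.
rewrite powRD_gt0// !powRN (_ : powR Y 2 = Y ^+ 2); last by rewrite powR_mulrn// ltW.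
rewrite mulrCA ler_wpM2l ?sqr_ge0// -invfM lef_pV2 ?posrE ?mulr_gt0 ?powR_gt0 ?ltr_pwDl ?(ltW Y0)//.
rewrite -powRM ?(ltW Y0)//; apply: ler_powR2l; lra.
Qed.

(** The top-degree term alone gives a_N |v|^(1+alpha_N) <= |F_z(v)|; take the power 1 - a =
    1/(1+alpha_N). *)
Lemma Fmap_growth z v :
  vnorm v <= powR (aa ord_max) (a - 1) * powR (vnorm (F z v)) (1 - a).
Proof.
have s0 := vnorm_ge0 v; have a1 := aexp_lt1.
have aN0 := aa_gt0 ord_max.
have h : aa ord_max * powR (vnorm v) (1 + aN) <= vnorm (F z v).
  apply: le_trans (Fmap_norm_ge z v).
  rewrite addrC powRD_ge0 ?(ltW al_gt0)// powRr1// mulrA ler_wpM2r//.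
  by apply: le_trans (gfun_lower s0); rewrite lerDr ltW.
rewrite -(opprB 1 a) powRN mulrC ler_pdivlMr ?powR_gt0//.
apply: le_trans (ler_powR2l (_ : 0 <= 1 - a) _ h); last 2 first.
- by lra.
- by rewrite mulr_ge0 ?powR_ge0// ltW.
by rewrite powRM ?powR_ge0 ?(ltW aN0)// -powRrM aexp1E powRr1// mulrC.
Qed.

(** After Cauchy-Schwarz on the mixed terms this is the monotonicity of the scalar function s |->
    s^p s. *)
Lemma power_monotone (p : R) v w : 0 <= p ->
  0 <= dotp (powR (vnorm v) p *: v - powR (vnorm w) p *: w) (v - w).
Proof.
move=> p0; set P := powR (vnorm v) p; set Q := powR (vnorm w) p.
have P0 : 0 <= P by exact: powR_ge0.
have Q0 : 0 <= Q by exact: powR_ge0.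
rewrite dotpDl !dotpDr !dotpNl !dotpNr !dotpZl -!vnorm_sqr (dotpC w v).
have cs := cauchy_schwarz v w.
have V0 := vnorm_ge0 v; have W0 := vnorm_ge0 w.
have h : 0 <= (P * vnorm v - Q * vnorm w) * (vnorm v - vnorm w).
  case: (leP (vnorm v) (vnorm w)) => vw.
    apply: mulr_le0; rewrite subr_le0 //.
    by apply: (ler_pM P0 V0 _ vw); exact: ler_powR2l.
  apply: mulr_ge0; rewrite subr_ge0; last exact: ltW.
  by apply: (ler_pM Q0 W0 _ (ltW vw)); apply: ler_powR2l => //; exact: ltW.
have h2 : (P + Q) * dotp v w <= (P + Q) * (vnorm v * vnorm w).
  by rewrite ler_wpM2l// addr_ge0.
move: h h2; rewrite expr2 expr2; lra.
Qed.

(** As alpha_0 = 0, the first term of F is linear and gives the quadratic lower bound; the other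
    terms are monotone and the rotation is skew. *)
Lemma Fmap_monotone z v w : aa 0 * vnorm (v - w) ^+ 2 <= dotp (F z v - F z w) (v - w).
Proof.
have -> : F z v - F z w = \sum_(i < N.+1) aa i *: (powR (vnorm v) (al i) *: v - powR (vnorm w) (al i) *: w)
    + z *: cross k (v - w).
  rewrite /Fmap /gfun !scaler_suml crossB scalerBr opprD addrACA; congr (_ + _).
  by rewrite -sumrB; apply: eq_bigr => i _; rewrite scalerBr !scalerA.
rewrite dotpDl dotpZl dotp_cross mulr0 addr0.
have dsum (G : 'I_N.+1 -> vec) w' : dotp (\sum_i G i) w' = \sum_i dotp (G i) w'.
  apply: (big_morph (fun v => dotp v w')); first by move=> *; rewrite dotpDl.
  by rewrite -(scale0r 0) dotpZl mul0r.
rewrite dsum (bigD1 0)//= al0 !powRr0 !scale1r dotpZl -vnorm_sqr lerDl.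
by apply: sumr_ge0 => i _; rewrite dotpZl mulr_ge0 ?(ltW (aa_gt0 _))// power_monotone// al_ge0.
Qed.

(** Strong monotonicity read backwards: v depends on F_z(v) and on z in a Lipschitz way. This is the
    source of all regularity of the flux X(u, .) near the boundary. *)
Lemma Fmap_lipschitz z z' v v' :
  aa 0 * vnorm (v - v') <= vnorm (F z v - F z' v') + `|z - z'| * vnorm v'.
Proof.
have [e0|e0] := eqVneq (vnorm (v - v')) 0.
  by rewrite e0 mulr0 addr_ge0 ?mulr_ge0 ?vnorm_ge0.
have ep : 0 < vnorm (v - v') by rewrite lt_neqAle eq_sym e0 vnorm_ge0.
rewrite -(ler_pM2r ep) -mulrA -expr2; apply: (le_trans (Fmap_monotone z v v')).
apply: (le_trans (cauchy_schwarz _ _)); rewrite ler_wpM2r ?vnorm_ge0//.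
have -> : F z v - F z v' = (F z v - F z' v') + (z' - z) *: cross k v'.
  by rewrite /Fmap opprD scalerBl opprD !addrA; apply/rowP => i; rewrite !mxE; ring.
apply: (le_trans (vnormD _ _)); rewrite lerD2l vnormZ distrC ler_wpM2l//.
exact: vnorm_cross.
Qed.

End Forchheimer.

(** * Pointwise bounds for the tested flux *)

Section Pointwise.
Context (R : realType) (a : R) (a0 : 0 < a) (a1 : a < 1).

Lemma powR_1D (x p : R) : 1 <= p -> 0 <= x -> 1 + powR x p <= powR (1 + x) p.
Proof.
move=> p1 x0; have p0 : 0 < p by lra.
rewrite -(mulr_powRB1 x0 p0) -(mulr_powRB1 (_ : 0 <= 1 + x) p0) ?addr_ge0//.
rewrite mulrDl mul1r lerD//; first by rewrite powR_ge1; lra.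
by rewrite ler_wpM2l//; apply: ler_powR2l; lra.
Qed.

(** [s] is the size of the argument y of the flux, [n] that of grad ubar and [B] bounds their
    difference. Either c3 B <= (c4/32) W s, and the mixed term is absorbed by the coercive one, or s
    is at most (32 c3/c4) B / W, and the mixed term is a multiple of B^(2-a). Convexity then trades
    s^(2-a) for n^(2-a) with the fraction c4/4 left over. *)
Lemma absorb_flux (c3 c4 W s n B : R) : 0 < c3 -> 0 < c4 -> 0 < W -> 0 <= s -> 0 <= n ->
  0 <= B -> n <= s + B ->
  - (powR 2 (- a) * c4 * W * (powR s (2 - a) - 1)) + c3 * powR s (1 - a) * B <=
  - (c4 / 4 * W * powR n (2 - a)) + powR 2 (- a) * c4 * W + powR 2 (- a) * c4 * W * powR B (2 - a)
  + c3 * powR (32 * c3 / c4) (1 - a) * powR W^-1 (1 - a) * powR B (2 - a).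
Proof.
have ha0 := a0; have ha1 := a1.
move=> c30 c40 W0 s0 n0 B0 nsB.
have S0 := powR_ge0 s (2 - a); have B1 := powR_ge0 B (2 - a).
(* This lower bound leaves enough of the coercive term after a loss of c4/32 to keep half of it. *)
have t0 : 1 / 2 <= powR 2 (- a) :> R.
  by rewrite div1r -powR_inv1//; apply: ler_powR2r; [rewrite ler1n | rewrite lerN2 ltW].
have split : c3 * powR s (1 - a) * B <= c4 / 32 * W * powR s (2 - a) +
   c3 * powR (32 * c3 / c4) (1 - a) * powR W^-1 (1 - a) * powR B (2 - a).
  have E (x : R) : 0 <= x -> powR x (2 - a) = x * powR x (1 - a).
    move=> x0; rewrite -[X in _ = _ * powR _ X](_ : (2 - a) - 1 = 1 - a); last by ring.
    by rewrite mulr_powRB1//; lra.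
  have [h|h] := leP (c3 * B) (c4 / 32 * W * s).
    apply: ler_wpDr; first by nonneg.
    by rewrite mulrAC E// mulrA ler_wpM2r ?powR_ge0.
  apply: ler_wpDl; first by rewrite !mulr_ge0 ?powR_ge0// ?ltW// divr_gt0.
  have sle : s <= (32 * c3 / c4) * W^-1 * B.
    rewrite -(@ler_pM2l _ (c4 / 32 * W)); last by rewrite !mulr_gt0.
    rewrite [leRHS](_ : _ = c3 * B); first exact: ltW.
    by field; rewrite !gt_eqF.
  have r0 : 0 <= 32 * c3 / c4 by rewrite divr_ge0 ?mulr_ge0// ltW.
  have h2 : powR s (1 - a) <= powR (32 * c3 / c4) (1 - a) * powR W^-1 (1 - a) * powR B (1 - a).
    have iW : 0 <= W^-1 by rewrite invr_ge0 ltW.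
    rewrite -(powRM _ r0 iW) -(powRM _ (mulr_ge0 r0 iW) B0).
    apply: (@ler_powR2l R); [lra | exact: s0 | exact: sle].
  rewrite (E B B0).
  set q := powR (32 * c3 / c4) (1 - a) in h2 *; set r := powR W^-1 (1 - a) in h2 *.
  rewrite [leLHS](_ : _ = c3 * B * powR s (1 - a)); last by ring.
  rewrite [leRHS](_ : _ = c3 * B * (q * r * powR B (1 - a))); last by ring.
  by rewrite ler_wpM2l// mulr_ge0// ltW.
have mean : powR n (2 - a) <= powR 2 (1 - a) * (powR s (2 - a) + powR B (2 - a)).
  apply: le_trans (ler_powR2l (_ : 0 <= 2 - a) n0 nsB) _; first lra.
  rewrite -[1 - a](_ : 2 - a - 1 = _); last by ring.
  apply: powR_le_mean => //; lra.
have E2 : powR 2 (1 - a) = 2 * powR 2 (- a) :> R by rewrite powRD_gt0// powRr1.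
rewrite E2 in mean.
set t := powR 2 (- a) in t0 mean *.
set S := powR s (2 - a) in split mean S0 *; set Bp := powR B (2 - a) in split mean B1 *.
have h3 : c4 / 4 * W * powR n (2 - a) <= c4 / 4 * W * (2 * t * (S + Bp)).
  by apply: ler_wpM2l => //; nonneg.
have h4 : 0 <= c4 * W * S * (t - 1 / 2) by nonneg.
have h5 : 0 <= c4 * W * S by nonneg.
have h6 : 0 <= c4 * W * Bp * t by nonneg.
move: split h3 h4 h5 h6; lra.
Qed.

(** The terms left over once the coercive part has been extracted, with [u] the solution and [g] the
    size of grad Psi. The worst one, D^(3-2a), arises when B^(2-a), with B at most D + g, is
    multiplied by W^(-(1-a)) = D^(1-a). *)
Definition remainder (c3 c4 chi u g : R) : R :=
  let c5 := powR 2 (- a) * c4 in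
  let c3k := c3 * powR (32 * c3 / c4) (1 - a) in
  let D := chi * (1 + u) ^+ 2 in
  c5 + powR 2 (1 - a) * (c5 + c3k) * (powR D (1 - a) * powR (1 + g) (2 - a))
  + powR 2 (1 - a) * c3k * powR D (3 - 2 * a).

Lemma remainder_ge0 (c3 c4 chi u g : R) : 0 < c3 -> 0 < c4 -> 0 <= remainder c3 c4 chi u g.
Proof.
move=> h3 h4; rewrite /remainder.
by nonneg.
Qed.

(** [absorb_flux] with B = chi u^2 + g. Since chi u^2 <= D and W D = 1, the term W B^(2-a) only
    costs D^(1-a), while the term carrying 1/W costs D^(3-2a). *)
Lemma flux_bound (c3 c4 chi u g s n W : R) : W = (chi * (1 + u) ^+ 2)^-1 -> 0 < c3 -> 0 < c4 -> 1 <= chi -> 0 <= u -> 0 <= g ->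
  0 <= s -> 0 <= n -> n <= s + (chi * u ^+ 2 + g) ->
  - (powR 2 (- a) * c4 * W * (powR s (2 - a) - 1)) + c3 * powR s (1 - a) * (chi * u ^+ 2 + g) <=
  - (c4 / 4 * W * powR n (2 - a)) + remainder c3 c4 chi u g.
Proof.
have ha0 := a0; have ha1 := a1.
move=> WE c30 c40 chi1 u0 g0 s0 n0 nsB.
pose D := chi * (1 + u) ^+ 2.
have D1 : 1 <= D.
  rewrite /D -[1]mulr1 ler_pM// exprn_ege1//; lra.
have D0 : 0 < D by exact: lt_le_trans D1.
have W0 : 0 < W by rewrite WE invr_gt0.
have chi0 : 0 <= chi by lra.
have B0 : 0 <= chi * u ^+ 2 + g by rewrite addr_ge0// mulr_ge0// sqr_ge0.
apply: (le_trans (absorb_flux c30 c40 W0 s0 n0 B0 nsB)).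
rewrite -!addrA lerD2l !addrA /remainder -/D.
set c5 := powR 2 (- a) * c4; set c3k := c3 * powR (32 * c3 / c4) (1 - a).
have c50 : 0 <= c5 by nonneg.
have c3k0 : 0 <= c3k by nonneg.
have W1 : W <= 1 by rewrite WE invf_le1.
set t := powR 2 (1 - a); have t0 : 0 <= t by exact: powR_ge0.
set Dp := powR D (1 - a).
have Dp1 : 1 <= Dp by apply: powR_ge1 => //; lra.
set G := powR (1 + g) (2 - a).
have hB : powR (chi * u ^+ 2 + g) (2 - a) <= t * (powR D (2 - a) + powR g (2 - a)).
  apply: (@le_trans _ _ (t * (powR (chi * u ^+ 2) (2 - a) + powR g (2 - a)))).
    rewrite /t -[1 - a](_ : 2 - a - 1 = _); last by ring.
    apply: powR_le_mean => //; [lra | by rewrite mulr_ge0// sqr_ge0].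
  rewrite ler_wpM2l// lerD2r; apply: ler_powR2l; [lra | by rewrite mulr_ge0// sqr_ge0 |].
  rewrite ler_wpM2l// ler_pXn2r ?nnegrE//; lra.
have E1 : powR D (2 - a) = D * Dp.
  by rewrite /Dp -[X in _ = _ * powR _ X](_ : (2 - a) - 1 = 1 - a) ?mulr_powRB1//; [exact: ltW | lra | ring].
have E2 : powR D (3 - 2 * a) = Dp * powR D (2 - a).
  by rewrite -powRD_gt0//; congr powR; ring.
have G1 : 1 + powR g (2 - a) <= G by apply: powR_1D => //; lra.
have g1 := powR_ge0 g (2 - a).
have h1 : c5 * W <= c5 by rewrite ler_piMr.
have WD : W * D = 1 by rewrite WE mulVf// gt_eqF.
have h2 : c5 * W * powR (chi * u ^+ 2 + g) (2 - a) <= c5 * (t * (Dp * G)).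
  rewrite -mulrA ler_wpM2l//; apply: (le_trans (ler_wpM2l (ltW W0) hB)).
  rewrite mulrCA ler_wpM2l// mulrDr E1 mulrA WD mul1r.
  apply: (@le_trans _ _ (Dp + Dp * powR g (2 - a))).
    rewrite lerD2l; apply: (@le_trans _ _ (1 * powR g (2 - a))).
      by rewrite ler_wpM2r.
    by rewrite ler_wpM2r.
  rewrite -[X in X + _]mulr1 -mulrDr ler_wpM2l//; lra.
have h3 : c3k * powR W^-1 (1 - a) * powR (chi * u ^+ 2 + g) (2 - a) <=
   c3k * (t * (powR D (3 - 2 * a) + Dp * G)).
  rewrite -mulrA ler_wpM2l// WE invrK -/D -/Dp.
  have Dp0 : 0 <= Dp by lra.
  apply: (le_trans (ler_wpM2l Dp0 hB)).
  rewrite mulrCA ler_wpM2l// mulrDr E2 lerD2l ler_wpM2l//; lra.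
move: h1 h2 h3; rewrite -/c3k -/D; lra.
Qed.

(** Here [b] stands for |ubar|, [psi] for 1 + |Psi| and [al] for the energy exponent m. Powers of 1
    + u are split by 1 + u <= psi + b. The last term is the only one whose exponent of [b] exceeds
    m. *)
Lemma remainder_split (c3 c4 chi u g psi b al : R) : 0 < c3 -> 0 < c4 -> 1 <= chi ->
  0 <= u -> 0 <= g -> 0 <= psi -> 0 <= b -> 1 + u <= psi + b -> 2 < al ->
  forall c5 c3k K1 K2, c5 = powR 2 (- a) * c4 ->
  c3k = c3 * powR (32 * c3 / c4) (1 - a) ->
  K1 = powR 2 (1 - a) * powR 4 (1 - a) * (c5 + c3k) ->
  K2 = powR 2 (1 - a) * powR 2 (5 - 4 * a) * c3k ->
  remainder c3 c4 chi u g * powR b (al - 2) <=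
  c5 * powR b (al - 2)
  + K1 * (powR chi (1 - a) * (powR psi (2 * (1 - a)) * powR (1 + g) (2 - a) * powR b (al - 2)))
  + K1 * (powR chi (1 - a) * (powR (1 + g) (2 - a) * powR b (al - 2 * a)))
  + K2 * (powR chi (3 - 2 * a) * (powR psi (6 - 4 * a) * powR b (al - 2)))
  + K2 * (powR chi (3 - 2 * a) * powR b (al + 4 * (1 - a))).
Proof.
have ha0 := a0; have ha1 := a1.
move=> c30 c40 chi1 u0 g0 psi0 b0 ub al2 c5 c3k K1 K2 E5 E3k EK1 EK2.
have c50 : 0 <= c5 by rewrite E5; nonneg.
have c3k0 : 0 <= c3k by rewrite E3k; nonneg.
have chi0 : 0 <= chi by lra.
have D1 p : 0 <= p -> powR (chi * (1 + u) ^+ 2) p <= powR chi p * powR (psi + b) (2 * p).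
  move=> p0; rewrite powRM ?sqr_ge0// ler_wpM2l ?powR_ge0//.
  rewrite -powR_mulrn ?(addr_ge0 ler01 u0)// -powRrM; apply: ler_powR2l => //; lra.
have D2 : powR (chi * (1 + u) ^+ 2) (1 - a) <=
    powR 4 (1 - a) * (powR chi (1 - a) * (powR psi (2 * (1 - a)) + powR b (2 * (1 - a)))).
  apply: (le_trans (D1 (1 - a) _)); first lra.
  rewrite [leRHS]mulrCA ler_wpM2l ?powR_ge0//.
  have -> : powR 4 (1 - a) = powR 2 (2 * (1 - a)) :> R.
    by rewrite powRrM; congr powR; rewrite powR_mulrn//; lra.
  apply: powR_le_max => //; lra.
have D3 : powR (chi * (1 + u) ^+ 2) (3 - 2 * a) <=
    powR 2 (5 - 4 * a) * (powR chi (3 - 2 * a) * (powR psi (6 - 4 * a) + powR b (6 - 4 * a))).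
  apply: (le_trans (D1 (3 - 2 * a) _)); first lra.
  rewrite [leRHS]mulrCA ler_wpM2l ?powR_ge0//.
  rewrite (_ : 2 * (3 - 2 * a) = 6 - 4 * a); last by ring.
  rewrite (_ : 5 - 4 * a = 6 - 4 * a - 1); last by ring.
  apply: powR_le_mean => //; lra.
have e1 : powR b (al - 2 * a) = powR b (2 * (1 - a)) * powR b (al - 2).
  by rewrite -powRD_ge0; [congr powR; ring | lra | lra].
have e2 : powR b (al + 4 * (1 - a)) = powR b (6 - 4 * a) * powR b (al - 2).
  by rewrite -powRD_ge0; [congr powR; ring | lra | lra].
rewrite e1 e2 /remainder -E5 -E3k.
set bb := powR b (al - 2); have bb0 : 0 <= bb by exact: powR_ge0.
set G := powR (1 + g) (2 - a); have G0 : 0 <= G by exact: powR_ge0.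
set t := powR 2 (1 - a); have t0 : 0 <= t by exact: powR_ge0.
have h1 := ler_wpM2l (mulr_ge0 t0 (addr_ge0 c50 c3k0)) (ler_wpM2r (mulr_ge0 G0 bb0) D2).
have h2 := ler_wpM2l (mulr_ge0 t0 c3k0) (ler_wpM2r bb0 D3).
move: h1 h2; rewrite EK1 EK2 -/t; lra.
Qed.

(** All powers of 2 and 4 are expressed by w = 2^(1-a), which lies between 1 and 2; the rest is a
    comparison of coefficients. *)
Lemma c16_bound (c3 c4 c9 : R) : 0 < c3 -> 0 < c4 -> 0 <= c9 ->
  forall c5 k c3k K1 K2, c5 = powR 2 (- a) * c4 ->
  k = powR (32 * c3 / c4) (1 - a) -> c3k = c3 * k ->
  K1 = powR 2 (1 - a) * powR 4 (1 - a) * (c5 + c3k) ->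
  K2 = powR 2 (1 - a) * powR 2 (5 - 4 * a) * c3k ->
  1 + c5 + K1 + 2 * K2 <= 2 * (9 * (1 + (powR 4 (1 - a) * c5 + c9 + 2 * c3 * k + c4 / 4)
    + 2 * powR 4 (1 - a) * c3 * (1 + k))).
Proof.
have ha0 := a0; have ha1 := a1.
move=> c30 c40 c90 c5 k c3k K1 K2 E5 Ek E3k EK1 EK2.
have c50 : 0 <= c5 by rewrite E5; nonneg.
have c3k0 : 0 <= c3k by rewrite E3k Ek; nonneg.
rewrite EK1 EK2.
have -> : powR 4 (1 - a) = powR 2 (1 - a) ^+ 2 :> R.
  rewrite (_ : 4 = 2 * 2 :> R); last by ring.
  by rewrite powRM// expr2.
set w := powR 2 (1 - a).
have -> : powR 2 (5 - 4 * a) = 2 * w ^+ 4 :> R.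
  rewrite /w -powR_mulrn ?powR_ge0// -powRrM -[X in _ = X * _]powRr1// -powRD_gt0//.
  by congr powR; ring.
have w1 : 1 <= w by apply: powR_ge1 => //; lra.
have w2 : w <= 2.
  by rewrite -[leRHS]powRr1//; apply: ler_powR2r; lra.
have q0 : w ^+ 2 <= 4 by rewrite (_ : 4 = 2 ^+ 2 :> R) ?ler_pXn2r ?nnegrE//; [lra | ring].
have p1 : 1 <= w ^+ 2 by rewrite exprn_ege1.
have h3 : w ^+ 3 <= 2 * w ^+ 2 by rewrite exprS ler_wpM2r ?sqr_ge0.
have h5 : w ^+ 5 <= 8 * w ^+ 2.
  rewrite (_ : w ^+ 5 = w ^+ 3 * w ^+ 2); last by ring.
  rewrite ler_wpM2r ?sqr_ge0//; lra.
have hA : w ^+ 3 * c5 <= 2 * w ^+ 2 * c5 by rewrite ler_wpM2r.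
have hB : w ^+ 3 * c3k <= 2 * w ^+ 2 * c3k by rewrite ler_wpM2r.
have hC : w ^+ 5 * c3k <= 8 * w ^+ 2 * c3k by rewrite ler_wpM2r.
have hD : c5 <= w ^+ 2 * c5 by rewrite ler_peMl.
have hE : 0 <= w ^+ 2 * c3 by rewrite mulr_ge0 ?sqr_ge0// ltW.
have hF : 0 <= w ^+ 2 * c3k by rewrite mulr_ge0 ?sqr_ge0.
have hG : 0 <= c3k * w ^+ 2 by rewrite mulrC.
rewrite E3k in hA hB hC hD hE hF hG c3k0 *; move: hA hB hC hD hE hF c3k0 c50.
rewrite (_ : w * w ^+ 2 = w ^+ 3); last by ring.
rewrite (_ : w * (2 * w ^+ 4) = 2 * w ^+ 5); last by ring.
lra.
Qed.

End Pointwise.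

(** * The abstract Moser iteration *)

Section GeometricSums.
Context (R : realType).
Implicit Types x : R.

Lemma sum_geom x n : 0 <= x -> x < 1 -> \sum_(i < n) x ^+ i <= (1 - x)^-1.
Proof.
move=> x0 x1; rewrite -[leRHS]div1r ler_pdivlMr ?subr_gt0//.
have -> : (\sum_(i < n) x ^+ i) * (1 - x) = 1 - x ^+ n.
  elim: n => [|n ih]; first by rewrite big_ord0 mul0r expr0 subrr.
  by rewrite big_ord_recr /= mulrDl ih (exprS x n); ring.
by rewrite gerBl exprn_ge0.
Qed.

Lemma sum_arith_geom x n : 0 <= x -> x < 1 ->
  \sum_(i < n) i%:R * x ^+ i <= x / (1 - x) ^+ 2.
Proof.
move=> x0 x1; rewrite ler_pdivlMr ?exprn_gt0 ?subr_gt0//.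
have -> : (\sum_(i < n) i%:R * x ^+ i) * (1 - x) ^+ 2 = x - x ^+ n * (n%:R * (1 - x) + x).
  elim: n => [|n ih]; first by rewrite big_ord0 mul0r expr0; ring.
  by rewrite big_ord_recr /= mulrDl ih (exprS x n) -natr1; ring.
rewrite gerBl mulr_ge0 ?exprn_ge0// addr_ge0// mulr_ge0// subr_ge0; exact: ltW.
Qed.

End GeometricSums.

Section MoserIteration.
Context (R : realType) (a kap alpha0 : R).
Hypotheses (a0 : 0 < a) (a1 : a < 1) (kap1 : 1 < kap) (alpha2 : 2 < alpha0).
Let beta (j : nat) : R := kap ^+ j * alpha0.
Let rt j := beta j - 2.
Let st j := (beta j + 4 * (1 - a)) * (1 + a / (beta j - a)).
Let x := kap^-1.
Let mut := infprod (fun j => rt j / beta j).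
Let nut := infprod (fun j => st j / beta j).
Let Rn n := \prod_(j < n) (rt j / beta j).
Let Sn n := \prod_(j < n) (st j / beta j).

Let x0 : 0 < x. Proof. by rewrite invr_gt0 (lt_trans ltr01). Qed.
Let x1 : x < 1. Proof. by rewrite invf_lt1 ?(lt_trans ltr01). Qed.
Let xk : x * kap = 1. Proof. by rewrite mulVf// gt_eqF// (lt_trans ltr01). Qed.

Let beta_gt2 j : 2 < beta j.
Proof.
apply: (lt_le_trans alpha2); rewrite ler_peMl ?(ltW (lt_trans _ alpha2))//.
by rewrite exprn_ege1// ltW.
Qed.

Let beta_inv j : (beta j)^-1 = x ^+ j / alpha0.
Proof. by rewrite /beta /x invfM exprVn mulrC mulrC. Qed.

Let rr_gt0 j : 0 < rt j / beta j.
Proof.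
by rewrite divr_gt0 ?subr_gt0 ?beta_gt2// (lt_trans _ (beta_gt2 j)).
Qed.

Let rr_le1 j : rt j / beta j <= 1.
Proof.
have b := beta_gt2 j; rewrite ler_pdivrMr ?(lt_trans _ b)//.
by rewrite mul1r gerBl.
Qed.

Let ss_ge1 j : 1 <= st j / beta j.
Proof.
have b := beta_gt2 j; have h := a0; have h1 := a1.
rewrite ler_pdivlMr ?(lt_trans _ b)// mul1r /st.
rewrite -[leLHS]mulr1; apply: ler_pM => //; [lra | lra |].
by rewrite lerDl divr_ge0//; lra.
Qed.

Let Rn_gt0 n : 0 < Rn n. Proof. by apply: prodr_gt0 => i _. Qed.
Let Rn_rec n : Rn n.+1 = Rn n * (rt n / beta n). Proof. by rewrite /Rn big_ord_recr. Qed.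
Let Sn_rec n : Sn n.+1 = Sn n * (st n / beta n). Proof. by rewrite /Sn big_ord_recr. Qed.

Let Rn_le1 n : Rn n <= 1.
Proof.
elim: n => [|n ih]; first by rewrite /Rn big_ord0.
by rewrite Rn_rec; apply: mulr_ile1 => //; exact: ltW.
Qed.

Let Sn_ge1 n : 1 <= Sn n.
Proof.
elim: n => [|n ih]; first by rewrite /Sn big_ord0.
rewrite Sn_rec -[leLHS]mulr1; apply: ler_pM => //; exact: ss_ge1.
Qed.

Let Rn_decr : nonincreasing_seq Rn.
Proof.
apply/nonincreasing_seqP => n. rewrite Rn_rec.
by apply: ler_piMr => //; exact: ltW.
Qed.

Let Sn_incr : nondecreasing_seq Sn.
Proof.
apply/nondecreasing_seqP => n; rewrite Sn_rec.
by rewrite ler_peMr ?ss_ge1// (le_trans ler01)// Sn_ge1.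
Qed.

Lemma mut_le n : mut <= Rn n.
Proof.
apply: (nonincreasing_cvgn_ge Rn_decr); apply: nonincreasing_is_cvgn => //.
by exists 0 => _ [m _ <-]; exact: ltW.
Qed.

(** Each factor is (1 + 4(1-a)/beta_n)(1 + a/(beta_n - a)), at most exp(6/beta_n), and 1/beta_n is a
    geometric sequence. Hence the increasing partial products stay bounded and the infinite product
    is a true limit. *)
Let Sn_bound n : Sn n <= expR (6 / alpha0 * \sum_(i < n) x ^+ i).
Proof.
elim: n => [|n ih]; first by rewrite /Sn !big_ord0 mulr0 expR0.
rewrite Sn_rec big_ord_recr /= mulrDr expRD.
have b := beta_gt2 n; have h := a0; have h1 := a1.
apply: ler_pM => //; first by rewrite (le_trans ler01)// Sn_ge1.
  by rewrite (le_trans ler01)// ss_ge1.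
have bp : 0 < beta n by lra.
have -> : st n / beta n = (1 + 4 * (1 - a) / beta n) * (1 + a / (beta n - a)).
  by rewrite /st; field; rewrite !gt_eqF//; lra.
apply: (@le_trans _ _ (expR (4 * (1 - a) / beta n) * expR (a / (beta n - a)))).
  apply: ler_pM; rewrite ?expR_ge1Dx//.
    by rewrite addr_ge0// divr_ge0//; lra.
  by rewrite addr_ge0// divr_ge0//; lra.
rewrite -expRD ler_expR.
have -> : 6 / alpha0 * x ^+ n = 6 / beta n by rewrite beta_inv; ring.
(* This uses a < 1 and beta_n > 2: then a beta_n <= beta_n and 2a < beta_n. *)
have h2 : a / (beta n - a) <= 2 / beta n.
  rewrite ler_pdivrMr ?subr_gt0; last lra.
  rewrite mulrAC ler_pdivlMr//.
  have : a * beta n <= 1 * beta n by rewrite ler_wpM2r; lra.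
  lra.
have h3 : 4 * (1 - a) / beta n <= 4 / beta n.
  by rewrite ler_wpM2r ?invr_ge0; lra.
have -> : 6 / beta n = 4 / beta n + 2 / beta n by field; rewrite gt_eqF.
exact: lerD.
Qed.

Lemma nut_ge n : Sn n <= nut.
Proof.
apply: (nondecreasing_cvgn_le Sn_incr); apply: nondecreasing_is_cvgn => //.
exists (expR (6 / alpha0 * (1 - x)^-1)) => _ [m _ <-].
apply: (le_trans (Sn_bound m)); rewrite ler_expR ler_wpM2l//.
  by rewrite divr_ge0// (le_trans _ (ltW alpha2)).
by apply: sum_geom => //; exact: ltW.
Qed.

(** The base may be 0: positivity of the middle exponent makes its power vanish. *)
Let pow_between (y r s t : R) : 0 <= y -> 0 < s -> r <= s -> s <= t ->
  powR y s <= Num.max (powR y r) (powR y t).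
Proof.
rewrite le_eqVlt => /predU1P[<-|y0] s0 rs st'; last exact: powR_interval.
by rewrite powR0 ?gt_eqF// le_max powR_ge0.
Qed.

Context (Y : nat -> R) (A P X K : R).
Hypotheses (Y0 : forall n, 0 <= Y n) (A1 : 1 <= A) (P1 : 1 <= P) (X1 : 1 <= X) (K0 : 0 <= K).
Hypothesis PXA : P * X <= A.
Hypothesis Kbound : K * (1 - x) <= x * (1 + x).
Hypothesis step : forall n, powR (Y n.+1) (beta n) <=
  A * P ^+ n * powR X (K * x ^+ n) * Num.max (powR (Y n) (rt n)) (powR (Y n) (st n)).

(** The logarithm of the constant in step n. [P] carries the geometric growth of the constants, [X]
    the power of chi whose exponent decays like x^n. *)
Let l n : R := ln A + n%:R * ln P + K * x ^+ n * ln X.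
Let Ln n : R := \sum_(i < n) l i / beta i.

Let lnA0 : 0 <= ln A. Proof. exact: ln_ge0. Qed.
Let lnP0 : 0 <= ln P. Proof. exact: ln_ge0. Qed.
Let lnX0 : 0 <= ln X. Proof. exact: ln_ge0. Qed.

Let l_ge0 n : 0 <= l n.
Proof.
rewrite !addr_ge0// ?mulr_ge0// exprn_ge0//; exact: ltW.
Qed.

Let Ln_ge0 n : 0 <= Ln n.
Proof.
by apply: sumr_ge0 => i _; rewrite divr_ge0// (le_trans _ (ltW (beta_gt2 i))).
Qed.

Let exp_l n : expR (l n) = A * P ^+ n * powR X (K * x ^+ n).
Proof.
have pA : 0 < A by exact: lt_le_trans A1.
have pP : 0 < P by exact: lt_le_trans P1.
have pX : 0 < X by exact: lt_le_trans X1.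
rewrite /l !expRD lnK ?posrE//; congr (_ * _ * _).
  by rewrite expRM_natl lnK.
by rewrite /powR gt_eqF.
Qed.

(** With 1/beta_i = x^i/alpha0 the sum splits into sums of x^i, i x^i and K x^(2i), bounded by
    1/(1-x) and twice by x/(1-x)^2; [Kbound] is exactly what makes the third bound equal to the
    second. Then ln P + ln X <= ln A merges all three. *)
Lemma Ln_le n : Ln n <= ln A * (kap ^+ 2 / (alpha0 * (kap - 1) ^+ 2)).
Proof.
have pA : 0 < A by exact: lt_le_trans A1.
have ap : 0 < alpha0 by exact: lt_trans alpha2.
have -> : Ln n = alpha0^-1 * (ln A * (\sum_(i < n) x ^+ i) + ln P * (\sum_(i < n) i%:R * x ^+ i)
    + ln X * (K * \sum_(i < n) (x ^+ 2) ^+ i)).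
  rewrite /Ln !mulr_sumr -!big_split /= mulr_sumr; apply: eq_bigr => i _.
  by rewrite /l beta_inv -exprM mulnC exprM; ring.
have h0 := ltW x0; have h1 := x1; have h2 := x0.
have q0 : 0 < 1 - x by rewrite subr_gt0.
have x2 : x ^+ 2 < 1 by rewrite exprn_ilt1.
have e1 := sum_geom n h0 h1.
have e2 := sum_arith_geom n h0 h1.
have e3 : K * (\sum_(i < n) (x ^+ 2) ^+ i) <= x / (1 - x) ^+ 2.
  apply: (@le_trans _ _ (K / (1 - x ^+ 2))).
    by rewrite ler_wpM2l//; apply: sum_geom => //; exact: sqr_ge0.
  rewrite ler_pdivrMr ?subr_gt0// mulrAC ler_pdivlMr ?exprn_gt0//.
  have -> : x * (1 - x ^+ 2) = (x * (1 + x)) * (1 - x) by ring.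
  have -> : K * (1 - x) ^+ 2 = (K * (1 - x)) * (1 - x) by ring.
  by rewrite ler_wpM2r// ltW.
have PXln : ln P + ln X <= ln A.
  have pP : 0 < P by exact: lt_le_trans P1.
  have pX : 0 < X by exact: lt_le_trans X1.
  by rewrite -lnM ?posrE// ler_ln ?posrE// mulr_gt0.
set q := x / (1 - x) ^+ 2 in e2 e3.
have qp : 0 <= q by rewrite /q divr_ge0// exprn_ge0//; exact: ltW.
have -> : ln A * (kap ^+ 2 / (alpha0 * (kap - 1) ^+ 2)) = alpha0^-1 * (ln A * ((1 - x)^-1 + q)).
  (* The left side is 1/(1-x)^2; this is where the factor kap^2/(kap-1)^2 of omega comes from. *)
  have -> : (1 - x)^-1 + q = kap ^+ 2 / (kap - 1) ^+ 2.
    have kn : kap != 0 by rewrite gt_eqF// (lt_trans ltr01).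
    have k1n : kap - 1 != 0 by rewrite gt_eqF// subr_gt0.
    by rewrite /q /x; field; rewrite ?kn ?k1n.
  by rewrite invfM; ring.
rewrite ler_wpM2l ?invr_ge0 ?(ltW ap)//.
have f1 := ler_wpM2l lnA0 e1; have f2 := ler_wpM2l lnP0 e2; have f3 := ler_wpM2l lnX0 e3.
have f4 := ler_wpM2r qp PXln.
move: f1 f2 f3 f4; lra.
Qed.

(** For n >= 1 this is the product of s_j/beta_j over 1 <= j < n, the power to which the constant of
    step 0 has been raised after n steps. It is the largest such power, all factors being at least
    1, and serves for the constants of every step. *)
Let Tn n := Sn n * beta 0%N / st 0%N.

Let st_gt0 n : 0 < st n.
Proof.
have b := beta_gt2 n; have := ss_ge1 n; rewrite ler_pdivlMr; last lra.
by move=> h; apply: lt_le_trans h; lra.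
Qed.

Let Tn_ge1 n : 1 <= Tn n.+1.
Proof.
have b := beta_gt2 0%N; have s := st_gt0 0%N.
rewrite /Tn ler_pdivlMr// mul1r -ler_pdivrMr; last lra.
rewrite (_ : st 0%N / beta 0%N = Sn 1); first exact: Sn_incr.
by rewrite /Sn big_ord_recr /= big_ord0 mul1r.
Qed.

Let Tn_ge0 n : 0 <= Tn n.
Proof.
have b := beta_gt2 0%N; have s := st_gt0 0%N.
rewrite /Tn divr_ge0 ?(ltW s)// mulr_ge0//; last lra.
by rewrite (le_trans ler01)// Sn_ge1.
Qed.

Let Rn_le_Sn n : Rn n <= Sn n.
Proof. exact: le_trans (Rn_le1 n) (Sn_ge1 n). Qed.

(** Induction: take the root of order beta_n in the step and insert the bound for Y_n. The powers of
    Y_0 stay between R_(n+1) and S_(n+1), so their maximum is attained at the ends. *)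
Let iterate n : Y n <= expR (Tn n * Ln n) * Num.max (powR (Y 0%N) (Rn n)) (powR (Y 0%N) (Sn n)).
Proof.
elim: n => [|n ih].
  by rewrite /Ln big_ord0 mulr0 expR0 mul1r /Rn /Sn !big_ord0 powRr1// maxxx.
have b := beta_gt2 n; have bp : 0 < beta n by lra.
set y := Y 0%N in ih *; have y0 : 0 <= y by exact: Y0.
set M := Num.max _ _ in ih.
have M0 : 0 <= M by rewrite le_max powR_ge0.
set B := expR _ in ih; have B1 : 1 <= B by rewrite -expR0 ler_expR mulr_ge0.
have B0 : 0 <= B by lra.
set M' := Num.max (powR y (Rn n.+1)) _.
have M'0 : 0 <= M' by rewrite le_max powR_ge0.
(* Both powers in the step, after the root of order beta_n, have exponents in this range; on it the
   bound for Y_n can be raised to the power e at the expense of the largest exponent on the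
   constant. *)
have key e : rt n / beta n <= e -> e <= st n / beta n -> powR (Y n) e <= powR B (st n / beta n) * M'.
  move=> e1 e2; have e0 : 0 < e by exact: lt_le_trans e1.
  apply: (@le_trans _ _ (powR (B * M) e)); first by apply: ler_powR2l => //; exact: ltW.
  rewrite powRM//; apply: ler_pM; rewrite ?powR_ge0//; first exact: ler_powR2r.
  have ev (r : R) : Rn n <= r -> r <= Sn n -> powR (powR y r) e <= M'.
    move=> r1 r2; rewrite -powRrM; apply: pow_between => //.
    - by rewrite mulr_gt0// (lt_le_trans (Rn_gt0 n)).
    - by rewrite Rn_rec; apply: ler_pM => //; exact: ltW.
    - rewrite Sn_rec; apply: ler_pM => //; last exact: ltW.
      exact: le_trans (ltW (Rn_gt0 n)) r1.
  by rewrite /M; case: (leP (powR y (Rn n)) _) => _; apply: ev => //; exact: Rn_le_Sn.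
have mono : rt n / beta n <= st n / beta n by exact: le_trans (rr_le1 n) (ss_ge1 n).
have k1 := key _ (lexx _) mono; have k2 := key _ mono (lexx _).
have bi : 0 <= (beta n)^-1 by rewrite invr_ge0 ltW.
have := ler_powR2l bi (powR_ge0 _ _) (step n).
rewrite -powRrM mulfV ?gt_eqF// powRr1// -exp_l.
rewrite powRM ?expR_ge0//; last by rewrite le_max powR_ge0.
rewrite {1}/powR gt_eqF ?expR_gt0// expRK => h; apply: (le_trans h).
have h2 : powR (Num.max (powR (Y n) (rt n)) (powR (Y n) (st n))) (beta n)^-1 <=
    powR B (st n / beta n) * M'.
  case: (leP (powR (Y n) (rt n)) _) => _; rewrite -powRrM //.
apply: (le_trans (ler_wpM2l (expR_ge0 _) h2)).
rewrite mulrA ler_wpM2r// /B {1}/powR gt_eqF ?expR_gt0// expRK -expRD ler_expR.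
have ET : Tn n.+1 = st n / beta n * Tn n by rewrite /Tn Sn_rec; ring.
have EL : Ln n.+1 = Ln n + l n / beta n by rewrite /Ln big_ord_recr.
have f : l n / beta n <= Tn n.+1 * (l n / beta n).
  by rewrite ler_peMl ?Tn_ge1// divr_ge0// ltW.
have g : Tn n.+1 * Ln n = st n / beta n * (Tn n * Ln n) by rewrite ET; ring.
rewrite [leRHS](_ : _ = Tn n.+1 * (l n / beta n) + st n / beta n * (Tn n * Ln n)); last first.
  by rewrite -g EL addrC -mulrDr.
by rewrite lerD2r; apply: le_trans f; rewrite mulrC.
Qed.

Lemma moser_iteration n :
  Y n <= powR A (nut * beta 0%N / st 0%N * (kap ^+ 2 / (alpha0 * (kap - 1) ^+ 2)))
    * Num.max (powR (Y 0%N) mut) (powR (Y 0%N) nut).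
Proof.
apply: (le_trans (iterate n)); apply: ler_pM; first exact: expR_ge0.
- by rewrite le_max powR_ge0.
- rewrite /powR gt_eqF ?(lt_le_trans ltr01)// ler_expR.
  have s := st_gt0 0%N; have b := beta_gt2 0%N.
  rewrite -[leRHS]mulrA [X in _ <= _ * X]mulrC.
  apply: (ler_pM (Tn_ge0 n) (Ln_ge0 n) _ (Ln_le n)).
  rewrite /Tn -[leLHS]mulrA -[leRHS]mulrA; apply: ler_wpM2r (nut_ge n).
  by rewrite divr_ge0//; lra.
- have h (e : R) : Rn n <= e -> e <= Sn n -> powR (Y 0%N) e <= Num.max (powR (Y 0%N) mut) (powR (Y 0%N) nut).
    move=> h1 h2; apply: pow_between => //; first exact: lt_le_trans h1.
      exact: le_trans (mut_le n) h1.
    exact: le_trans h2 (nut_ge n).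
  by rewrite ge_max !h// Rn_le_Sn.
Qed.

End MoserIteration.

(** * Truncated powers *)

Section TruncatedPowers.
Context (R : realType).
Implicit Types (e p s : R).

(** Truncation at a height e > 0 makes the test functions vanish where |ubar| is small, in
    particular near the lateral boundary. For p > 1 the truncated power is differentiable
    everywhere, including at s = e. *)
Definition cutp e p s : R := powR (Num.max 0 (s - e)) p.
Definition cut e s : R := Num.max 0 (`|s| - e).

Lemma cut_ge0 e s : 0 <= cut e s.
Proof. by rewrite /cut le_max lexx. Qed.

Lemma cut_le e s : 0 <= e -> cut e s <= `|s|.
Proof. by move=> e0; rewrite /cut ge_max normr_ge0 gerBl. Qed.

Lemma cut0P e s : `|s| <= e -> cut e s = 0.
Proof. by move=> h; rewrite /cut; apply/max_idPl; rewrite subr_le0. Qed.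

Lemma cutp_le e p s : 0 < p -> s <= e -> cutp e p s = 0.
Proof.
by move=> p0 h; rewrite /cutp (max_idPl _) ?subr_le0// powR0// gt_eqF.
Qed.

Lemma cutp_gt e p s : e < s -> cutp e p s = powR (s - e) p.
Proof. by move=> h; rewrite /cutp (max_idPr _)// subr_ge0 ltW. Qed.

Lemma near_lt_r (s e : R) : s < e -> \forall t \near s, t < e.
Proof. by move=> se; apply: open_nbhs_nbhs; split; [exact: open_lt | ]. Qed.

Lemma near_lt_l (s e : R) : e < s -> \forall t \near s, e < t.
Proof. by move=> se; apply: open_nbhs_nbhs; split; [exact: open_gt | ]. Qed.

Lemma is_derive_shift e s : is_derive s 1 (fun s : R => s - e) 1.
Proof.
rewrite -[X in is_derive _ _ _ X]addr0.
exact: (@is_deriveD _ _ _ id (cst (- e)) _ _ _ _ (is_derive_id _ _) (is_derive_cst _ _ _)).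
Qed.

(** Only the point s = e needs an argument: there the difference quotient is at most |h|^(p-1),
    which tends to 0 because p > 1. *)
Lemma is_derive_cutp e p s : 1 < p -> is_derive s 1 (cutp e p) (p * cutp e (p - 1) s).
Proof.
move=> p1; have p0 : 0 < p by lra.
have p10 : 0 < p - 1 by lra.
have [se|se|se] := ltgtP s e.
- rewrite cutp_le ?mulr0 ?(ltW se)//.
  apply: (@near_eq_is_derive _ _ _ (cst 0)) => //.
  near=> t; rewrite /= cutp_le//; apply: ltW; near: t; exact: near_lt_r.
- rewrite cutp_gt//.
  apply: (@near_eq_is_derive _ _ _ ((@powR R ^~ p) \o (fun s => s - e))) => //.
    near=> t; rewrite /= cutp_gt//; near: t; exact: near_lt_l.
  rewrite -[X in is_derive _ _ _ X]mulr1.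
  apply: is_derive1_comp; last exact: is_derive_shift.
  by apply: is_derive1_powR; rewrite subr_gt0.
- rewrite -{}se cutp_le// mulr0.
  have H : (fun h : R => h^-1 *: ((cutp s p \o shift s) (h *: 1) - cutp s p s)) @ 0^' --> (0 : R).
    have E : \forall h \near (0 : R)^', `|h^-1 *: ((cutp s p \o shift s) (h *: 1) - cutp s p s)| <= powR `|h| (p - 1).
      near=> h; have h0 : h != 0 by near: h; exact: nbhs_dnbhs_neq.
      rewrite (cutp_le p0 (lexx s)) subr0 /= [h *: 1]mulr1 [_ *: _]/(_ * _) normrM normfV.
      rewrite ler_pdivrMl ?normr_gt0// mulr_powRB1//.
      rewrite /cutp addrK ger0_norm ?powR_ge0//; apply: ler_powR2l; [exact: ltW| |].
        by rewrite le_max lexx.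
      by rewrite ge_max normr_ge0 ler_norm.
    apply/cvgr0Pnorm_le => {}e e0.
    have d0 : 0 < powR e (p - 1)^-1 by exact: powR_gt0.
    near=> h; apply: (@le_trans _ _ (powR `|h| (p - 1))); first by near: h; exact: E.
    have he : `|h| <= powR e (p - 1)^-1.
      near: h; apply: dnbhs0_le => //.
    apply: (le_trans (ler_powR2l (ltW p10) (normr_ge0 h) he)).
    by rewrite -powRrM mulVf ?gt_eqF// powRr1// ltW.
  apply: DeriveDef; first by apply/cvg_ex; exists 0.
  exact/cvg_lim.
Unshelve. all: by end_near. Qed.

Lemma is_derive_cutpN e p s : 1 < p -> is_derive s 1 (fun s => cutp e p (- s)) (- (p * cutp e (p - 1) (- s))).
Proof.
move=> p1; have i1 := @is_derive_cutp e p (- s) p1.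
have i2 : is_derive s 1 (fun s : R => - s) (-1) by exact: (is_deriveN (is_derive_id _ _)).
by have := @is_derive1_comp R (cutp e p) (fun s => - s) s _ _ i1 i2; rewrite mulrN1.
Qed.

(** As e >= 0, at most one of the two one-sided powers is nonzero. *)
Lemma cut_powE e p s : 0 <= e -> 0 < p -> powR (cut e s) p = cutp e p s + cutp e p (- s).
Proof.
move=> e0 p0; rewrite /cut; have [s0|s0] := leP 0 s.
  rewrite ger0_norm// (@cutp_le e p (- s)) ?addr0//; lra.
rewrite ltr0_norm// (@cutp_le e p s) ?add0r//; lra.
Qed.

(** The odd function sign(s)(|s|-e)_+^p. It is the test nonlinearity, and up to a factor it is the
    derivative of the even power of order p+1. *)
Definition scut e p s : R := cutp e p s - cutp e p (- s).

Lemma scut_abs e p s : 0 <= e -> 0 < p -> `|scut e p s| = powR (cut e s) p.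
Proof.
move=> e0 p0; rewrite cut_powE// /scut; have [s0|s0] := leP 0 s.
  by rewrite (@cutp_le e p (- s)) ?subr0 ?addr0 ?ger0_norm ?powR_ge0//; lra.
by rewrite (@cutp_le e p s) ?sub0r ?add0r ?normrN ?ger0_norm ?powR_ge0//; lra.
Qed.

Lemma is_derive_cut_pow e p s : 0 <= e -> 1 < p ->
  is_derive s 1 (fun s => powR (cut e s) p) (p * scut e (p - 1) s).
Proof.
move=> e0 p1.
rewrite (_ : (fun s => _) = (cutp e p \+ (fun s => cutp e p (- s)))); last first.
  by apply/funext => t; rewrite cut_powE//; lra.
rewrite /scut mulrBr; apply: is_deriveD; first exact: is_derive_cutp.
exact: is_derive_cutpN.
Qed.

Lemma is_derive_scut e p s : 0 <= e -> 1 < p ->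
  is_derive s 1 (scut e p) (p * powR (cut e s) (p - 1)).
Proof.
move=> e0 p1; rewrite cut_powE//; last by lra.
rewrite mulrDr -[X in _ + X]opprK.
apply: (@is_deriveB _ _ _ (cutp e p) (fun s => cutp e p (- s))); first exact: is_derive_cutp.
exact: is_derive_cutpN.
Qed.

Lemma continuous_cut e : continuous (cut e).
Proof.
move=> s; apply: (@continuous_max _ _ (cst 0) (fun s => `|s| - e)); first exact: cst_continuous.
apply: (@cvgB _ _ _ _ _ (fun s : R => `|s|) (cst e)); last exact: cvg_cst.
exact: norm_continuous.
Qed.

Lemma continuous_cutp e p : 0 < p -> continuous (cutp e p).
Proof.
move=> p0 s; have [se|se|se] := ltgtP s e.
- rewrite /continuous_at cutp_le ?(ltW se)//.
  apply/cvgr0Pnorm_le => d d0; near=> t.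
  rewrite cutp_le ?normr0 ?(ltW d0)//; apply: ltW; near: t; exact: near_lt_r.
- rewrite /continuous_at cutp_gt//.
  apply: (@cvg_trans _ (((@powR R ^~ p) \o (fun s => s - e)) @ s)).
    apply: near_eq_cvg; near=> t; rewrite /= cutp_gt//; near: t; exact: near_lt_l.
  have se0 : 0 < s - e by rewrite subr_gt0.
  apply: (@continuous_comp _ _ _ (fun s => s - e) (@powR R ^~ p)).
    by apply: (@cvgB _ _ _ _ _ id (cst e)); [exact: cvg_id | exact: cvg_cst].
  have [d _] := is_derive1_powR p se0.
  exact/differentiable_continuous/derivable1_diffP.
- rewrite /continuous_at -{}se cutp_le//.
  apply/cvgr0Pnorm_le => {}e e0.
  have d0 : 0 < powR e p^-1 by exact: powR_gt0.
  near=> t; rewrite ger0_norm ?powR_ge0//.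
  have ht : Num.max 0 (t - s) <= powR e p^-1.
    rewrite ge_max ltW//=; apply: (le_trans (ler_norm _)); rewrite distrC.
    near: t; apply: cvgr_dist_le => //; exact: cvg_id.
  apply: (@le_trans _ _ (powR (powR e p^-1) p)).
    by apply: ler_powR2l => //; [exact: ltW | rewrite le_max lexx].
  by rewrite -powRrM mulVf ?gt_eqF// powRr1// ltW.
Unshelve. all: by end_near. Qed.

Lemma continuous_cut_pow e p : 0 <= e -> 0 < p -> continuous (fun s => powR (cut e s) p).
Proof.
move=> e0 p0; rewrite (_ : (fun s => _) = (cutp e p \+ (cutp e p \o -%R))); last first.
  by apply/funext => t; rewrite cut_powE.
move=> s; apply: cvgD; first exact: continuous_cutp.
apply: continuous_comp; first exact: opp_continuous.
exact: continuous_cutp.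
Qed.

Lemma continuous_scut e p : 0 < p -> continuous (scut e p).
Proof.
move=> p0 s; apply: cvgB; first exact: continuous_cutp.
apply: continuous_comp; first exact: opp_continuous.
exact: continuous_cutp.
Qed.

End TruncatedPowers.

(** * Zero extension and integration by parts for compactly supported functions *)

Section ChainRule.
Context (R : realType) (V : normedModType R).

(** Only a directional derivative of f is available, so the chain rule is taken along the line
    through x in direction v. *)
Lemma is_derive_comp1 (h : R -> R) (dh : R) (f : V -> R) (x v : V) :
  derivable f x v -> is_derive (f x) 1 h dh -> is_derive x v (h \o f) (dh * 'D_v f x).
Proof.
move=> df dhx; pose g (s : R) : R := f (x + s *: v).
have g0 : g 0 = f x by rewrite /g scale0r addr0.
have dg : derivable g 0 1 by apply: derivable_line; rewrite scale0r addr0.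
have ig : is_derive (0 : R) 1 g ('D_v f x).
  by apply: is_derive_derive1 => //; rewrite derive_line scale0r addr0.
have dhx' : is_derive (g 0) 1 h dh by rewrite g0.
have [d e] := @is_derive1_comp R h g 0 _ _ dhx' ig.
apply: DeriveDef; first exact: (@line_derivable R V R (h \o f)).
by rewrite derive_line0 derive1E.
Qed.

End ChainRule.

Section ZeroExtension.
Context (R : realType).
Notation vec := 'rV[R]_3.
Context (U K : set vec).
Hypotheses (oU : open U) (cK : compact K) (KU : K `<=` U).

Definition zext (f : vec -> R) (x : vec) : R := if `[< U x >] then f x else 0.

Lemma zext_in (f : vec -> R) (x : vec) : U x -> zext f x = f x.
Proof. by move=> Ux; rewrite /zext asboolT. Qed.

Lemma zext_out (f : vec -> R) (x : vec) : ~ U x -> zext f x = 0.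
Proof. by move=> Ux; rewrite /zext asboolF. Qed.

Let oKC : open (~` K).
Proof. by apply: closed_openC; apply: compact_closed => //; exact: norm_hausdorff. Qed.

(** U and the complement of K are open and cover the space; near any point the extension coincides
    with f or with 0. Continuity and derivatives of the extension follow locally. *)
Lemma zext_near (f : vec -> R) (x : vec) : (forall x, U x -> ~ K x -> f x = 0) ->
  (U x /\ \forall y \near x, f y = zext f y) \/ (~ U x /\ \forall y \near x, 0 = zext f y).
Proof.
move=> f0; have [Ux|nUx] := pselect (U x); [left|right]; split => //.
  have : \forall y \near x, U y by exact: open_nbhs_nbhs.
  by apply: filterS => y Uy; rewrite zext_in.
have : \forall y \near x, (~` K) y by apply: open_nbhs_nbhs; split => // /KU.
apply: filterS => y nKy; have [Uy|nUy] := pselect (U y); last by rewrite zext_out.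
by rewrite zext_in// f0.
Qed.

Lemma zext_out_near (f : vec -> R) (x : vec) : (forall x, U x -> ~ K x -> f x = 0) -> ~ K x ->
  \forall y \near x, 0 = zext f y.
Proof.
move=> f0 nKx.
have : \forall y \near x, (~` K) y by exact: open_nbhs_nbhs.
apply: filterS => y nKy; have [Uy|nUy] := pselect (U y); last by rewrite zext_out.
by rewrite zext_in// f0.
Qed.

Lemma derive_zero_outside (f : vec -> R) (v : vec) : (forall x, U x -> ~ K x -> f x = 0) ->
  forall x, U x -> ~ K x -> 'D_v f x = 0.
Proof.
move=> f0 x Ux nKx; rewrite -(@near_eq_derive _ _ _ (cst (0 : R)) f x v) ?derive_cst//.
have U1 : \forall y \near x, U y by exact: open_nbhs_nbhs.
have U2 : \forall y \near x, (~` K) y by exact: open_nbhs_nbhs.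
by near=> y; rewrite f0//; near: y.
Unshelve. all: by end_near. Qed.

Lemma is_derive_zext (f : vec -> R) (v : vec) : (forall x, U x -> ~ K x -> f x = 0) ->
  (forall x, U x -> derivable f x v) ->
  forall x, is_derive x v (zext f) (zext ('D_v f) x).
Proof.
move=> f0 df x; have [[Ux nx]|[Ux nx]] := zext_near x f0.
  rewrite zext_in//; apply: near_eq_is_derive nx _.
  by apply: DeriveDef => //; exact: df.
by rewrite zext_out//; apply: (@near_eq_is_derive _ _ _ (cst (0 : R))).
Qed.

Lemma continuous_zext (f : vec -> R) : (forall x, U x -> ~ K x -> f x = 0) ->
  (forall x, U x -> {for x, continuous f}) -> continuous (zext f).
Proof.
move=> f0 cf x; have [[Ux nx]|[Ux nx]] := zext_near x f0.
  rewrite /continuous_at zext_in//; have H : f @ x --> f x := cf x Ux.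
  exact: (cvg_trans (near_eq_cvg nx) H).
rewrite /continuous_at zext_out//.
have H : cst (0 : R) @ x --> (0 : R) by exact: (@cst_continuous vec R 0 x).
have nx' : \forall y \near x, cst 0 y = zext f y by exact: nx.
exact: (cvg_trans (near_eq_cvg nx') H).
Qed.

Lemma bounded_on_compact (S : topologicalType) (A : set S) (f : S -> R) :
  compact A -> {within A, continuous f} -> exists M, 0 <= M /\ forall x, A x -> `|f x| <= M.
Proof.
move=> cA cf; have /compact_bounded[M [Mr HM]] := continuous_compact cf cA.
exists (`|M| + 1); split; first by rewrite addr_ge0.
move=> x Ax; apply: (HM (`|M| + 1)); last by exists x.
by rewrite (le_lt_trans (ler_norm M))// ltrDl.
Qed.

Lemma bounded_on_compact_at (S : topologicalType) (A : set S) (f : S -> R) :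
  compact A -> (forall x, A x -> {for x, continuous f}) ->
  exists M, 0 <= M /\ forall x, A x -> `|f x| <= M.
Proof.
move=> cA cf; apply: bounded_on_compact => //; apply: continuous_in_subspaceT => x.
by rewrite inE; exact: cf.
Qed.

Lemma zext_bounded (f : vec -> R) : (forall x, U x -> ~ K x -> f x = 0) ->
  (exists C, forall x, K x -> `|f x| <= C) -> exists C, forall x, `|zext f x| <= C.
Proof.
move=> f0 [C hC]; exists (Num.max 0 C) => x; rewrite le_max.
have [Ux|nUx] := pselect (U x); last by rewrite zext_out// normr0 lexx.
rewrite zext_in//; have [Kx|nKx] := pselect (K x); first by rewrite hC// orbT.
by rewrite f0// normr0 lexx.
Qed.

Lemma compact_in_box : exists M : R, 0 < M /\ forall x, K x -> forall j, `|x 0 j| < M.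
Proof.
have /compact_bounded[M [Mr HM]] := cK.
exists (`|M| + 2); split; first by rewrite ltr_wpDl.
move=> x Kx j; have := HM (`|M| + 1) _ x Kx.
rewrite (le_lt_trans (ler_norm M)) ?ltrDl// => /(_ isT) h.
apply: (@le_lt_trans _ _ `|x|); last by apply: (le_lt_trans h); rewrite ltrD2l ltr1n.
rewrite /Num.norm /= mx_normrE.
by apply: (le_trans _ (le_bigmax _ (fun i => `|x i.1 i.2|) (ord0, j))); rewrite //= ord1.
Qed.

Context (f : vec -> R) (v : 'I_3 -> vec -> R).
Hypotheses (f0 : forall x, U x -> ~ K x -> f x = 0)
  (df : forall i x, U x -> derivable f x (ev R i))
  (cdf : forall i x, U x -> {for x, continuous (fun y => 'D_(ev R i) f y)})
  (cf : forall x, U x -> {for x, continuous f})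
  (dv : forall i x, U x -> derivable (v i) x (ev R i))
  (bv : forall i, exists C, forall x, K x -> `|'D_(ev R i) (v i) x| <= C)
  (cv : forall i x, U x -> {for x, continuous (v i)}).

Let U3 : set (T3 R) := @mk3 R @^-1` U.
Let mU3 : measurable U3. Proof. exact: measurable_mk3. Qed.

Let vf i x := v i x * f x.
Let vf0 i x : U x -> ~ K x -> vf i x = 0. Proof. by move=> Ux Kx; rewrite /vf f0// mulr0. Qed.
Let dvf i x : U x -> derivable (vf i) x (ev R i).
Proof. by move=> Ux; apply: derivableM; [exact: dv | exact: df]. Qed.
Let DvfE i x : U x ->
  'D_(ev R i) (vf i) x = 'D_(ev R i) (v i) x * f x + v i x * 'D_(ev R i) f x.
Proof.
move=> Ux; rewrite /vf deriveM; [|exact: dv|exact: df].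
by rewrite [RHS]addrC; congr (_ + _); exact: mulrC.
Qed.

Let zext_facts i : [/\ forall x, derivable (zext (vf i)) x (ev R i),
  forall x, 'D_(ev R i) (zext (vf i)) x = zext ('D_(ev R i) (vf i)) x,
  exists C, forall x, `|'D_(ev R i) (zext (vf i)) x| <= C & continuous (zext (vf i))].
Proof.
have isd := is_derive_zext (@vf0 i) (@dvf i).
have Dz x : 'D_(ev R i) (zext (vf i)) x = zext ('D_(ev R i) (vf i)) x.
  by have /@derive_val := isd x.
have [C hC] : exists C, forall x, `|zext ('D_(ev R i) (vf i)) x| <= C.
  apply: zext_bounded; first by apply: derive_zero_outside => x; exact: vf0.
  have [C hC] := bv i.
  have [C1 [C10 hC1]] := bounded_on_compact_at cK (fun x Kx => @cf x (@KU x Kx)).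
  have [C2 [C20 hC2]] := bounded_on_compact_at cK (fun x Kx => @cv i x (@KU x Kx)).
  have [C3 [C30 hC3]] := bounded_on_compact_at cK (fun x Kx => @cdf i x (@KU x Kx)).
  exists (C * C1 + C2 * C3) => x Kx; rewrite DvfE; last exact: KU.
  apply: (le_trans (ler_normD _ _)); rewrite !normrM.
  apply: lerD; apply: ler_pM; try exact: normr_ge0.
  - exact: hC.
  - exact: hC1.
  - exact: hC2.
  - exact: hC3.
have cz : continuous (zext (vf i)).
  apply: continuous_zext => [x|x Ux]; first exact: vf0.
  exact: (cvgM (@cv i x Ux) (@cf x Ux)).
split; [by move=> x; have [] := isd x | exact: Dz | | exact: cz].
by exists C => x; rewrite Dz.
Qed.

Lemma bmeas_div_test i : bmeas U3 (fun p : T3 R =>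
  'D_(ev R i) (v i) (mk3 p) * f (mk3 p) + v i (mk3 p) * 'D_(ev R i) f (mk3 p)).
Proof.
have [dz Dz [C hC] cz] := zext_facts i.
apply: (@bmeas_eq _ _ _ _ (fun p : T3 R => 'D_(ev R i) (zext (vf i)) (mk3 p))).
  by move=> p /set_mem Up; rewrite Dz zext_in// DvfE.
split; first by apply: measurable_funTS; exact: measurable_partial.
by exists C => p _; exact: hC.
Qed.

(** The product v_i f, extended by zero, is a continuous function on the whole space with bounded
    i-th partial derivative and support in K. Its partial derivative integrates to zero over a box
    containing K, so no boundary term and no boundary regularity enter. *)
Lemma int_div_test_i i :
  \int[sleb3 R]_(p in U3) ('D_(ev R i) (v i) (mk3 p) * f (mk3 p) + v i (mk3 p) * 'D_(ev R i) f (mk3 p)) = 0.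
Proof.
have [M [M0 HM]] := compact_in_box.
have [dz Dz [C H1] cz] := zext_facts i.
have H2 : forall x : vec, (exists j, M <= `|x 0 j|) -> zext (vf i) x = 0.
  move=> x [j xj]; have [Ux|nUx] := pselect (U x); last by rewrite zext_out.
  rewrite zext_in//; apply: vf0 => // Kx.
  by have := le_lt_trans xj (HM x Kx j); rewrite ltxx.
have I0 := int_box_partial M0 dz H1 cz H2.
rewrite -[RHS]I0 [LHS]Rintegral_mkcond [RHS]Rintegral_mkcond.
apply: eq_Rintegral => p _; rewrite /patch Dz; case: ifPn => [/set_mem Up|nUp].
  rewrite zext_in// DvfE//; case: ifPn => // nbox.
  rewrite -DvfE//; apply: derive_zero_outside => // [x|Kp]; first exact: vf0.
   move: nbox.
  rewrite notin_setE; apply; have h := HM _ Kp.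
  have := h 0; have := h 1; have := h 2; rewrite /mk3 !mxE /= !ltr_norml.
  move=> /andP[a1 a2] /andP[b1 b2] /andP[c1 c2].
  by split; [split|]; rewrite /= in_itv /= ?(ltW a1) ?(ltW b1) ?(ltW c1) ?(ltW a2) ?(ltW b2) ?(ltW c2).
case: ifPn => // _; rewrite zext_out//.
by move: nUp; rewrite notin_setE.
Qed.

End ZeroExtension.

(** * Transfer of continuity and of derivative bounds *)

Section ContinuityTools.
Context (R : realType).

Lemma continuous_majorant (S : topologicalType) (f r : S -> R) (p : S) :
  (forall q, `|f p - f q| <= r q) -> r p = 0 -> {for p, continuous r} ->
  {for p, continuous f}.
Proof.
move=> fr r0 cr; apply/cvgrPdist_le => e e0.
have H : \forall q \near p, `|r p - r q| <= e by apply: cvgr_dist_le.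
apply: (filterS _ H) => q; rewrite r0 sub0r normrN => h.
by apply: (le_trans (fr q)); apply: le_trans h; exact: ler_norm.
Qed.

Lemma cvg_finsum (T : Type) (F : set_system T) {FF : Filter F} (I : finType)
    (f : I -> T -> R) (l : I -> R) :
  (forall i, f i @ F --> l i) -> (fun x => \sum_i f i x) @ F --> \sum_i l i.
Proof.
move=> fl.
suff H (s : seq I) : (fun x => \sum_(i <- s) f i x) @ F --> \sum_(i <- s) l i by exact: H.
elim: s => [|i s ih].
  rewrite big_nil (_ : (fun x => _) = (fun=> 0)); first exact: cvg_cst.
  by apply/funext => x; rewrite big_nil.
rewrite big_cons (_ : (fun x => _) = (fun x => f i x + \sum_(j <- s) f j x)).
  by apply: cvgD; [exact: fl | exact: ih].
by apply/funext => x; rewrite big_cons.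
Qed.

Lemma seq_lim_le (u w : nat -> R) (a b : R) : u @ \oo --> a -> w @ \oo --> b ->
  (forall n, u n <= w n) -> a <= b.
Proof.
move=> ua wb uw; rewrite -(cvg_lim (@Rhausdorff R) ua) -(cvg_lim (@Rhausdorff R) wb).
apply: ler_lim; [by apply/cvg_ex; exists a | by apply/cvg_ex; exists b | exact: nearW].
Qed.

(** The inequality between increments holds for all difference quotients with step 1/(n+1) and
    passes to the limit. It bounds the partial derivatives of the flux, whose continuity is not
    known. *)
Lemma derive_majorant (V : normedModType R) (I : finType) (f w : V -> R) (g : I -> V -> R)
    (c d : R) (x v : V) :
  derivable f x v -> (forall i, derivable (g i) x v) -> derivable w x v ->
  (forall y, `|f y - f x| <= c * (\sum_i `|g i y - g i x|) + d * `|w y - w x|) ->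
  `|'D_v f x| <= c * (\sum_i `|'D_v (g i) x|) + d * `|'D_v w x|.
Proof.
move=> df dg dw fg.
have cf : (fun n : nat => `|n.+1%:R *: (f (n.+1%:R^-1 *: v + x) - f x)|) @ \oo --> `|'D_v f x|.
  exact: (cvg_norm (derivable_seq df)).
have cg : (fun n : nat => c * (\sum_i `|n.+1%:R *: (g i (n.+1%:R^-1 *: v + x) - g i x)|)
    + d * `|n.+1%:R *: (w (n.+1%:R^-1 *: v + x) - w x)|) @ \oo -->
    c * (\sum_i `|'D_v (g i) x|) + d * `|'D_v w x|.
  apply: cvgD; (apply: cvgM; first exact: cvg_cst); last exact: (cvg_norm (derivable_seq dw)).
  by apply: cvg_finsum => i; exact: (cvg_norm (derivable_seq (dg i))).
apply: (seq_lim_le cf cg) => n.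
rewrite normrM.
rewrite [leRHS](_ : _ = `|n.+1%:R| * (c * (\sum_i `|g i (n.+1%:R^-1 *: v + x) - g i x|) +
    d * `|w (n.+1%:R^-1 *: v + x) - w x|)); first by rewrite ler_wpM2l.
rewrite mulrDr mulrCA; congr (_ + _); last by rewrite [n.+1%:R *: _]/(_ * _) normrM mulrCA.
congr (_ * _); rewrite mulr_sumr; apply: eq_bigr => i _.
by rewrite [n.+1%:R *: _]/(_ * _) normrM.
Qed.

Lemma is_derive_coord (x v : 'rV[R]_3) (j : 'I_3) :
  is_derive x v (fun y : 'rV[R]_3 => y 0 j) (v 0 j).
Proof.
have H : (fun h : R => h^-1 *: (((fun y : 'rV[R]_3 => y 0 j) \o shift x) (h *: v) - x 0 j)) @ 0^' --> v 0 j.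
  have E (h : R) : h != 0 ->
      h^-1 *: (((fun y : 'rV[R]_3 => y 0 j) \o shift x) (h *: v) - x 0 j) = v 0 j.
    by move=> h0; rewrite /= !mxE addrK; exact: mulKf.
  have H : cst (v 0 j) @ (0 : R)^' --> v 0 j by exact: cvg_cst.
  apply: cvg_trans H; apply: near_eq_cvg; near=> h; rewrite E//.
  near: h; exact: nbhs_dnbhs_neq.
apply: DeriveDef; first by apply/cvg_ex; exists (v 0 j).
exact/cvg_lim.
Unshelve. all: by end_near. Qed.

Lemma continuous_slice (h : 'rV[R]_3 -> R -> R) (p : 'rV[R]_3 * R) :
  {for p, continuous (uncurry h)} -> {for p.1, continuous (fun x => h x p.2)}.
Proof.
case: p => x t ch /=.
apply: (@continuous_comp _ _ _ (fun x => (x, t)) (uncurry h)); last exact: ch.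
have H1 : id @ x --> x by exact: cvg_id.
have H2 : cst t @ x --> t by exact: cst_continuous.
exact: (cvg_pair H1 H2).
Qed.

Lemma continuous_slice2 (h : 'rV[R]_3 -> R -> R) (p : 'rV[R]_3 * R) :
  {for p, continuous (uncurry h)} -> {for p.2, continuous (h p.1)}.
Proof.
case: p => x t ch /=.
apply: (@continuous_comp _ _ _ (fun t => (x, t)) (uncurry h)); last exact: ch.
have H1 : cst x @ t --> x by exact: cst_continuous.
have H2 : id @ t --> t by exact: cvg_id.
exact: (cvg_pair H1 H2).
Qed.

Lemma vnorm_le_sum (v : 'rV[R]_3) : vnorm v <= \sum_(j < 3) `|v 0 j|.
Proof.
apply: vnorm_le; first by apply: sumr_ge0.
rewrite sum3 dotpE -!expr2 -(real_normK (num_real (v 0 0))) -(real_normK (num_real (v 0 1))).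
rewrite -(real_normK (num_real (v 0 2))).
have h0 := normr_ge0 (v 0 0); have h1 := normr_ge0 (v 0 1); have h2 := normr_ge0 (v 0 2).
have g0 := mulr_ge0 h0 h1; have g1 := mulr_ge0 h0 h2; have g2 := mulr_ge0 h1 h2.
by rewrite -subr_ge0; move: g0 g1 g2; lra.
Qed.

(** The identity k x (k x x) = (k . x) k - x for a unit vector; it shows that the force field is
    affine in space, with explicit constant partial derivatives. *)
Lemma cross_cross (k x : 'rV[R]_3) : vnorm k = 1 -> cross k (cross k x) = dotp k x *: k - x.
Proof.
move=> k1; have h : dotp k k = 1 by rewrite -vnorm_sqr k1 expr1n.
have [c0 c1 c2] := crossE k x; have [d0 d1 d2] := crossE k (cross k x).
rewrite c0 c1 c2 in d0 d1 d2; move: h; rewrite dotpE => h.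
apply/rowP => j; have : (j == 0) || (j == 1) || (j == 2) by case: j => -[|[|[|//]]] hj.
have -> : (dotp k x *: k - x) 0 j = dotp k x * k 0 j - x 0 j by rewrite !mxE.
rewrite dotpE => /orP[/orP[]|] /eqP ->; rewrite ?d0 ?d1 ?d2.
- rewrite [LHS](_ : _ = (k 0 0 * x 0 0 + k 0 1 * x 0 1 + k 0 2 * x 0 2) * k 0 0 -
    (k 0 0 * k 0 0 + k 0 1 * k 0 1 + k 0 2 * k 0 2) * x 0 0); last by ring.
  by rewrite h mul1r.
- rewrite [LHS](_ : _ = (k 0 0 * x 0 0 + k 0 1 * x 0 1 + k 0 2 * x 0 2) * k 0 1 -
    (k 0 0 * k 0 0 + k 0 1 * k 0 1 + k 0 2 * k 0 2) * x 0 1); last by ring.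
  by rewrite h mul1r.
- rewrite [LHS](_ : _ = (k 0 0 * x 0 0 + k 0 1 * x 0 1 + k 0 2 * x 0 2) * k 0 2 -
    (k 0 0 * k 0 0 + k 0 1 * k 0 1 + k 0 2 * k 0 2) * x 0 2); last by ring.
  by rewrite h mul1r.
Qed.

End ContinuityTools.

(** * Space-time cylinders *)

Section SpaceTime.
Context (R : realType) (U : set 'rV[R]_3).
Hypotheses (oU : open U) (bU : bounded_set U).
Notation vec := 'rV[R]_3.

Definition U3 : set (T3 R) := @mk3 R @^-1` U.
Definition QT (t1 t2 : R) : set (T4 R) := U3 `*` `]t1, t2[.

Lemma QTE t1 t2 : @mk4 R @^-1` (U `*` `]t1, t2[) = QT t1 t2.
Proof. by apply/seteqP; split. Qed.

Lemma measurable_U3 : measurable U3.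
Proof. exact: measurable_mk3. Qed.

Lemma measurable_itvT (t1 t2 : R) : measurable (`]t1, t2[%classic : set (T1 R)).
Proof. exact: measurable_itv. Qed.

Lemma measurable_QT t1 t2 : measurable (QT t1 t2).
Proof. by apply: measurableX; [exact: measurable_U3 | exact: measurable_itvT]. Qed.

Lemma closure_bounded : bounded_set (closure U).
Proof.
have [M [Mr HM]] := bU; exists M; split => // y My.
have cl : closed [set x : vec | `|x| <= y].
  rewrite (_ : [set x | _] = (fun x : vec => `|x|) @^-1` [set r | r <= y]) //.
  apply: closed_comp; last exact: closed_le.
  by move=> x _; exact: norm_continuous.
move=> x Ux.
have : closure [set x : vec | `|x| <= y] x by apply: closure_subset Ux => z Uz; exact: HM.
by rewrite -(closure_id _).1.
Qed.

Lemma compact_closureU : compact (closure U).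
Proof. by apply: bounded_closed_compact; [exact: closure_bounded | exact: closed_closure]. Qed.

Lemma U3_lty : (sleb3 R U3 < +oo)%E.
Proof.
have [M [M0 HM]] := compact_in_box compact_closureU.
have fI : (sleb1 R `[(- M)%R, M]%classic < +oo)%E by exact: sleb1_itv_lty.
have mI : measurable (`[- M, M]%classic : set (T1 R)) by exact: measurable_itv.
apply: (@le_lt_trans _ _ (sleb3 R (box M))); last first.
  by apply: sprod_lty => //; [exact: measurableX | exact: sprod_lty].
apply: le_measure; rewrite ?inE; first exact: measurable_U3.
  by apply: measurableX => //; exact: measurableX.
move=> p Up; have h := HM (mk3 p) (@subset_closure _ U (mk3 p) Up).
have := h 0; have := h 1; have := h 2; rewrite /mk3 !mxE /= !ltr_norml.
move=> /andP[a1 a2] /andP[b1 b2] /andP[c1 c2].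
by split; [split|]; rewrite /= in_itv /= ?(ltW a1) ?(ltW b1) ?(ltW c1) ?(ltW a2) ?(ltW b2) ?(ltW c2).
Qed.

Lemma itvT_lty (t1 t2 : R) : (sleb1 R `]t1, t2[%classic < +oo)%E.
Proof. exact: sleb1_itv_lty. Qed.

Lemma QT_lty t1 t2 : (sleb4 R (QT t1 t2) < +oo)%E.
Proof.
apply: sprod_lty; [exact: measurable_U3 | exact: measurable_itvT | exact: U3_lty | exact: itvT_lty].
Qed.

Lemma QT_vol t1 t2 : t1 <= t2 -> fine (sleb4 R (QT t1 t2)) = (t2 - t1) * volU U.
Proof.
move=> t12; rewrite sprodE; [|exact: measurable_U3 | exact: measurable_itvT].
rewrite /volU -/U3 -sleb3E /sleb1 /= lebesgue_measure_itv /=.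
have fU : sleb3 R U3 \is a fin_num by rewrite ge0_fin_numE// U3_lty.
move: t12; rewrite le_eqVlt => /predU1P[->|t12]; first by rewrite ltxx mule0 subrr mul0r.
by rewrite lte_fin t12 -EFinB fineM//= mulrC.
Qed.

(** Measurability comes from pointwise continuity inside, boundedness from relative continuity on
    the compact closure. The two are separated because at time 0 the solution is only known to be
    continuous relative to its domain. *)
Lemma bmeas_QT (h : vec * R -> R) (t1 t2 : R) :
  (forall p, U p.1 -> t1 < p.2 -> {for p, continuous h}) ->
  {within closure U `*` `[t1, t2], continuous h} ->
  bmeas (QT t1 t2) (h \o @mk4 R).
Proof.
move=> ch cw; split.
  rewrite -QTE; apply: (open_fun_measurable (@measurable_mk4 R)).
    rewrite (_ : _ `*` _ = (fst @^-1` U) `&` (snd @^-1` `]t1, t2[%classic)); last by apply/seteqP; split.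
    apply: openI; first by apply: open_comp => // z _; exact: cvg_fst.
    by apply: open_comp; [move=> z _; exact: cvg_snd | exact: interval_open].
  move=> p [/= Up]; rewrite /= in_itv /= => /andP[h1 _]; exact: ch.
have cK : compact (closure U `*` `[t1, t2]%classic).
  by apply: compact_setX; [exact: compact_closureU | exact: segment_compact].
have [M [_ hM]] := bounded_on_compact cK cw; exists M => z [/= Uz].
rewrite /= in_itv /= => /andP[h1 h2]; apply: hM; split; first exact: subset_closure.
by rewrite /= in_itv /= !ltW.
Qed.

Lemma bmeas_QT_pos (h : vec * R -> R) (t1 t2 : R) : 0 < t1 ->
  (forall p, closure U p.1 -> 0 < p.2 -> {for p, continuous h}) ->
  bmeas (QT t1 t2) (h \o @mk4 R).
Proof.
move=> t0 ch; apply: bmeas_QT.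
  by move=> p Up tp; apply: ch; [exact: subset_closure | exact: lt_trans tp].
apply: continuous_in_subspaceT => p; rewrite inE => -[/= Up].
by rewrite /= in_itv /= => /andP[h1 _]; apply: ch => //; exact: lt_le_trans h1.
Qed.

Lemma bmeas_QT_nneg (h : vec * R -> R) (t1 t2 : R) : 0 <= t1 ->
  (forall p, closure U p.1 -> 0 <= p.2 -> {for p, continuous h}) ->
  bmeas (QT t1 t2) (h \o @mk4 R).
Proof.
move=> t0 ch; apply: bmeas_QT.
  by move=> p Up tp; apply: ch; [exact: subset_closure | exact: le_trans (ltW tp)].
apply: continuous_in_subspaceT => p; rewrite inE => -[/= Up].
by rewrite /= in_itv /= => /andP[h1 _]; apply: ch => //; exact: le_trans h1.
Qed.

Lemma QT_fubini t1 t2 (f : T4 R -> R) : bmeas (QT t1 t2) f ->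
  \int[sleb4 R]_(z in QT t1 t2) f z =
  \int[sleb1 R]_(t in `]t1, t2[) \int[sleb3 R]_(p in U3) f (p, t).
Proof.
by move=> bf; rewrite (@bmeas_fubini2 _ _ _ _ R (sleb3 R) (sleb1 R) _ _ measurable_U3
  (measurable_itvT t1 t2) U3_lty (itvT_lty t1 t2) _ bf).
Qed.

Lemma QT_fubini' t1 t2 (f : T4 R -> R) : bmeas (QT t1 t2) f ->
  \int[sleb4 R]_(z in QT t1 t2) f z =
  \int[sleb3 R]_(p in U3) \int[sleb1 R]_(t in `]t1, t2[) f (p, t).
Proof.
by move=> bf; rewrite (@bmeas_fubini1 _ _ _ _ R (sleb3 R) (sleb1 R) _ _ measurable_U3
  (measurable_itvT t1 t2) U3_lty (itvT_lty t1 t2) _ bf).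
Qed.

End SpaceTime.

(** * Testing the equation at a fixed time *)

Section FixedTime.
Context (R : realType) (N : nat) (al aa : 'I_N.+1 -> R).
Hypotheses (N1 : (1 <= N)%N) (al0 : al 0 = 0)
  (al_mono : forall i j : 'I_N.+1, (i < j)%N -> al i < al j)
  (aa_gt0 : forall i, 0 < aa i).
Context (k : 'rV[R]_3) (k1 : vnorm k = 1).
Notation vec := 'rV[R]_3.
Notation a := (aexp al).
Notation D i f x := ('D_(ev R i) f x).
Context (U : set vec) (oU : open U) (bU : bounded_set U).
Context (Rs chi : R) (w ps : vec -> R) (V Z : vec -> vec).
Hypotheses (Rs0 : 0 <= Rs) (chi1 : 1 <= chi) (chiR : Rs ^+ 2 <= chi) (chi0a : chi0 aa ^+ 2 <= chi).
Hypothesis chiZ : forall x, U x -> vnorm (Z x) <= chi.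
Hypotheses (dw : forall i x, closure U x -> derivable w x (ev R i))
  (cw : forall x, closure U x -> {for x, continuous w})
  (cdw : forall i x, closure U x -> {for x, continuous (fun y => D i w y)})
  (ddw : forall i j x, closure U x -> derivable (fun y => D i w y) x (ev R j))
  (cddw : forall i j x, closure U x -> {for x, continuous (fun y => D j (fun z => D i w z) y)})
  (dps : forall i x, closure U x -> derivable ps x (ev R i))
  (cps : forall x, closure U x -> {for x, continuous ps})
  (cdps : forall i x, closure U x -> {for x, continuous (fun y => D i ps y)})
  (dZ : forall i j x, derivable (fun y => Z y 0 j) x (ev R i))
  (cZ : forall j, continuous (fun y => Z y 0 j))
  (cdZ : forall i j, continuous (fun y => D i (fun z => Z z 0 j) y)).
Hypotheses (w0 : forall x, U x -> 0 <= w x) (bd : forall x, bdry U x -> w x = ps x).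

(** The second argument of the flux. The hypothesis [VE] says that V is the preimage of Phi under F
    with z = Rs w, which is all that is known about V besides its derivability in U. *)
Let Phi (x : vec) : vec := \row_(j < 3) D j w x + w x ^+ 2 *: Z x.
Hypothesis VE : forall x, Fmap al aa k (Rs * w x) (V x) = Phi x.
Hypothesis dV : forall i x, U x -> derivable (fun y => V y 0 i) x (ev R i).

Let v x := w x - ps x.
Let PhiE j x : Phi x 0 j = D j w x + w x ^+ 2 * Z x 0 j.
Proof. by rewrite !mxE. Qed.

Let subU x : U x -> closure U x. Proof. exact: subset_closure. Qed.

Let dPhi i j x : closure U x -> is_derive x (ev R i) (fun y => Phi y 0 j)
  (D i (fun z => D j w z) x + (w x ^+ 2 * D i (fun z => Z z 0 j) x + Z x 0 j * (2 * w x * D i w x))).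
Proof.
move=> Ux; have -> : (fun y => Phi y 0 j) = (fun y => D j w y + (w y * w y) * Z y 0 j).
  by apply/funext => y; rewrite PhiE expr2.
have h1 : is_derive x (ev R i) w (D i w x) by apply/derivableP; exact: dw.
have h2 : is_derive x (ev R i) (fun y => D j w y) (D i (fun z => D j w z) x).
  by apply/derivableP; exact: ddw.
have h3 : is_derive x (ev R i) (fun z => Z z 0 j) (D i (fun z => Z z 0 j) x).
  by apply/derivableP; exact: dZ.
have h4 : is_derive x (ev R i) (fun y => w y * w y) (w x *: D i w x + w x *: D i w x).
  by apply: is_deriveM.
have h5 := is_deriveM h4 h3; have h6 := is_deriveD h2 h5.
apply: is_derive_eq; rewrite /GRing.scale /= expr2; congr (_ + (_ + _)).
by ring.
Qed.

Let cPhi j x : closure U x -> {for x, continuous (fun y => Phi y 0 j)}.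
Proof.
move=> Ux; have -> : (fun y => Phi y 0 j) = (fun y => D j w y + w y ^+ 2 * Z y 0 j).
  by apply/funext => y; rewrite PhiE.
apply: continuousD; first exact: cdw.
apply: continuousM; last exact: cZ.
by apply: (continuousM (cw Ux) (cw Ux)).
Qed.

Let aa0 := aa_gt0 0.

(** [Fmap_lipschitz] with z = Rs w: increments of V are controlled by those of Phi and of w, which
    are regular up to the boundary. *)
Let V_lip x y i : `|V y 0 i - V x 0 i| <=
  (aa 0)^-1 * (\sum_j `|Phi y 0 j - Phi x 0 j|) + (aa 0)^-1 * Rs * vnorm (V x) * `|w y - w x|.
Proof.
have h := Fmap_lipschitz al0 al_mono aa_gt0 k1 (Rs * w y) (Rs * w x) (V y) (V x).
rewrite !VE -mulrBr normrM (ger0_norm Rs0) in h.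
have h1 := vnorm_le_sum (Phi y - Phi x); have h2 := ler_coord_vnorm (V y - V x) i.
have -> : V y 0 i - V x 0 i = (V y - V x) 0 i by rewrite !mxE.
apply: (le_trans h2); have a0 := aa0.
rewrite -(ler_pM2l a0) mulrDr !mulrA divff ?gt_eqF// !mul1r.
apply: (le_trans h); rewrite mulrAC lerD2r.
apply: (le_trans h1); rewrite le_eqVlt; apply/orP; left; apply/eqP.
by apply: eq_bigr => j _; rewrite !mxE.
Qed.

Let cV i x : closure U x -> {for x, continuous (fun y => V y 0 i)}.
Proof.
move=> Ux; apply: (@continuous_majorant _ _ _ (fun y =>
   (aa 0)^-1 * (\sum_j `|Phi y 0 j - Phi x 0 j|) + (aa 0)^-1 * Rs * vnorm (V x) * `|w y - w x|)).
- by move=> y; rewrite distrC; exact: V_lip.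
- by rewrite big1 ?subrr ?normr0 ?mulr0 ?addr0// => j _; rewrite subrr normr0.
apply: continuousD; (apply: continuousM; first exact: cst_continuous).
  apply: (@cvg_finsum R vec (nbhs x) (nbhs_filter x)) => j; have h1 := @cPhi j x Ux.
  have h2 : cst (Phi x 0 j) @ x --> Phi x 0 j by exact: cst_continuous.
  exact: cvg_norm (cvgB h1 h2).
have h1 := cw Ux; have h2 : cst (w x) @ x --> w x by exact: cst_continuous.
exact: cvg_norm (cvgB h1 h2).
Qed.

Let bV : exists C, forall x, closure U x -> vnorm (V x) <= C.
Proof.
have H i : exists M, 0 <= M /\ forall x, closure U x -> `|V x 0 i| <= M.
  by apply: bounded_on_compact_at; [exact: compact_closureU | exact: cV].
have [C0 [_ h0]] := H 0; have [C1 [_ h1]] := H 1; have [C2 [_ h2]] := H 2.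
exists (C0 + C1 + C2) => x Ux; apply: (le_trans (vnorm_le_sum _)); rewrite sum3.
by rewrite !lerD ?h0 ?h1 ?h2.
Qed.

(** [derive_majorant] applied to [V_lip]; the derivatives of Phi and w are continuous on the compact
    closure, hence bounded. *)
Let bdV i : exists C, forall x, U x -> `|D i (fun y => V y 0 i) x| <= C.
Proof.
have [C hC] := bV.
have H j : exists M, 0 <= M /\ forall x, closure U x -> `|D i (fun y => Phi y 0 j) x| <= M.
  have [M [M0 hM]] : exists M, 0 <= M /\ forall x, closure U x ->
      `|D i (fun z => D j w z) x + (w x ^+ 2 * D i (fun z => Z z 0 j) x + Z x 0 j * (2 * w x * D i w x))| <= M.
    apply: bounded_on_compact_at; first exact: compact_closureU.
    move=> x Ux; apply: continuousD; first exact: cddw.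
    apply: continuousD; apply: continuousM.
    - by apply: (continuousM (cw Ux) (cw Ux)).
    - exact: cdZ.
    - exact: cZ.
    - apply: continuousM; last exact: cdw.
      by apply: continuousM; [exact: cst_continuous | exact: cw].
  exists M; split => // x Ux.
  by have h := dPhi i j Ux; rewrite derive_val; exact: hM.
have [C0 [_ h0]] := H 0; have [C1 [_ h1]] := H 1; have [C2 [_ h2]] := H 2.
have [Cw [_ hw]] : exists M, 0 <= M /\ forall x, closure U x -> `|D i w x| <= M.
  by apply: bounded_on_compact_at; [exact: compact_closureU | exact: cdw].
exists ((aa 0)^-1 * (C0 + C1 + C2) + (aa 0)^-1 * Rs * C * Cw) => x Ux.
have cx := subU Ux; have a0 := aa0.
have ia : 0 <= (aa 0)^-1 by rewrite invr_ge0 ltW.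
have dP j : derivable (fun y => Phi y 0 j) x (ev R i) by have h := dPhi i j cx.
have := @derive_majorant _ _ _ (fun y => V y 0 i) w (fun j y => Phi y 0 j) (aa 0)^-1
  ((aa 0)^-1 * Rs * vnorm (V x)) x (ev R i) (dV Ux) dP (@dw i x cx) (fun y => V_lip x y i).
rewrite sum3 => h; apply: (le_trans h).
have H1 := lerD (lerD (h0 x cx) (h1 x cx)) (h2 x cx).
have H2 := ler_wpM2l ia H1.
have H3 := ler_pM (vnorm_ge0 (V x)) (normr_ge0 _) (hC x cx) (hw x cx).
have H4 := ler_wpM2l (mulr_ge0 ia Rs0) H3.
by rewrite !mulrA in H4; exact: lerD H2 H4.
Qed.

Context (e p : R) (e0 : 0 < e) (p1 : 1 < p).
Let f x := scut e p (v x).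
(** The set carrying the test function. It is compact, and it lies in the open set U because w = ps
    on the boundary. *)
Let K : set vec := closure U `&` [set x | e <= `|v x|].

Let cv x : closure U x -> {for x, continuous v}.
Proof. by move=> Ux; apply: continuousB; [exact: cw | exact: cps]. Qed.

Let compactK : compact K.
Proof.
apply: (subclosed_compact _ (compact_closureU bU)); last by move=> x [].
move=> x Kx.
have cx : closure U x by apply: (@closed_closure _ U); apply: closure_subset Kx => y [].
split => //=; rewrite leNgt; apply/negP => vx.
have H : \forall y \near x, `|v y| < e.
  exact: (cvgr_norm_lt _ (cv cx) _ vx).
by have [y [[_ /= Ky] /(le_lt_trans Ky)]] := Kx _ H; rewrite ltxx.
Qed.

Let KU : K `<=` U.
Proof.
move=> x [cx /= ex]; apply: contrapT => nU.
by move: ex; rewrite /v (bd (conj cx nU)) subrr normr0 leNgt e0.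
Qed.

Let p0 : 0 < p. Proof. exact: lt_trans p1. Qed.

Let cutK x : U x -> ~ K x -> cut e (v x) = 0.
Proof.
move=> Ux nK; apply: cut0P; rewrite leNgt; apply/negP => h; apply: nK.
by split; [exact: subU | exact: ltW].
Qed.

Let f0 x : U x -> ~ K x -> f x = 0.
Proof.
move=> Ux nK; apply/eqP; rewrite -normr_eq0 /f (scut_abs _ (ltW e0) p0) cutK//.
by rewrite powR0// gt_eqF// p0.
Qed.

Let dv i x : closure U x -> is_derive x (ev R i) v (D i w x - D i ps x).
Proof.
move=> cx; have h1 : is_derive x (ev R i) w (D i w x) by apply/derivableP; exact: dw.
have h2 : is_derive x (ev R i) ps (D i ps x) by apply/derivableP; exact: dps.
exact: is_deriveB.
Qed.

Let df i x : closure U x ->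
  is_derive x (ev R i) f (p * powR (cut e (v x)) (p - 1) * (D i w x - D i ps x)).
Proof.
move=> cx; have h := dv i cx.
have g := is_derive_comp1 (@ex_derive _ _ _ _ _ _ _ h) (is_derive_scut (v x) (ltW e0) p1).
by rewrite derive_val in g.
Qed.

Let DfE i x : closure U x -> D i f x = p * powR (cut e (v x)) (p - 1) * (D i w x - D i ps x).
Proof. by move=> cx; have h := df i cx; rewrite derive_val. Qed.

Let cf x : closure U x -> {for x, continuous f}.
Proof.
move=> cx; apply: (@continuous_comp _ _ _ v (scut e p)); first exact: cv.
exact: continuous_scut.
Qed.

Let cdf i x : U x -> {for x, continuous (fun y => D i f y)}.
Proof.
move=> Ux.
have H : {for x, continuous (fun y => p * powR (cut e (v y)) (p - 1) * (D i w y - D i ps y))}.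
  have cx := subU Ux; apply: continuousM.
    apply: continuousM; first exact: cst_continuous.
    apply: (@continuous_comp _ _ _ v (fun s => powR (cut e s) (p - 1))); first exact: cv.
    by apply: continuous_cut_pow; [exact: ltW | rewrite subr_gt0].
  by apply: continuousB; [exact: cdw | exact: cdps].
have E : \forall y \near x, (fun y => p * powR (cut e (v y)) (p - 1) * (D i w y - D i ps y)) y = D i f y.
  have nU : nbhs x U by apply: open_nbhs_nbhs.
  by apply: filterS nU => y /subU cy; rewrite DfE.
have : D i f x = (fun y => p * powR (cut e (v y)) (p - 1) * (D i w y - D i ps y)) x.
  by rewrite DfE//; exact: subU.
rewrite /prop_for /continuous_at => ->.
exact: (cvg_trans (near_eq_cvg E) H).
Qed.

Let grad x : vec := \row_(i < 3) (D i w x - D i ps x).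

(** The first factor is the derivative of the test nonlinearity; the bracket is the bound of
    [flux_bound] for -V . grad(w - ps), with the weight W = 1/(chi (1+w)^2). *)
Definition flux_density x : R :=
  p * powR (cut e (v x)) (p - 1) *
   (- (c4 al aa / 4 * (chi * (1 + w x) ^+ 2)^-1 * powR (vnorm (\row_(i < 3) (D i w x - D i ps x))) (2 - a))
    + remainder a (powR (aa ord_max) (a - 1)) (c4 al aa) chi (w x) (vnorm (\row_(i < 3) D i ps x))).

(** Write grad(w - ps) = Phi - (w^2 Z + grad ps). The pairing V . Phi is bounded below by
    coercivity, the pairing with the rest is bounded by Cauchy-Schwarz and the growth of V, and
    [flux_bound] combines the two. *)
Lemma flux_pointwise x : U x ->
  - (\sum_i V x 0 i * D i f x) <= flux_density x.
Proof.
move=> Ux; have cx := subU Ux.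
have -> : \sum_i V x 0 i * D i f x = p * powR (cut e (v x)) (p - 1) * dotp (V x) (grad x).
  rewrite /dotp mulr_sumr; apply: eq_bigr => i _; rewrite DfE// !mxE; ring.
rewrite -mulrN /flux_density -/(grad x); apply: ler_wpM2l.
  by rewrite mulr_ge0 ?powR_ge0// ltW.
have wx := w0 Ux; set g := vnorm (\row_(i < 3) D i ps x); set s := vnorm (Phi x).
have c40 := c4_gt0 al aa_gt0.
have c30 : 0 < powR (aa ord_max) (a - 1) by rewrite powR_gt0.
have g0 : 0 <= g := vnorm_ge0 _.
pose dps' : vec := \row_(i < 3) D i ps x.
have gE : grad x = Phi x - w x ^+ 2 *: Z x - dps'.
  by apply/rowP => j; rewrite !mxE; ring.
have ZB : vnorm (w x ^+ 2 *: Z x + dps') <= chi * w x ^+ 2 + g.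
  apply: (le_trans (vnormD _ _)); rewrite lerD2r vnormZ ger0_norm ?sqr_ge0// mulrC.
  by rewrite ler_wpM2r ?sqr_ge0 ?chiZ.
have n1 : vnorm (grad x) <= s + (chi * w x ^+ 2 + g).
  rewrite gE -addrA -opprD; apply: (le_trans (vnormD _ _)); rewrite vnormN.
  by rewrite lerD2l.
have a0 := aexp_gt0 N1 al0 al_mono; have a1 := aexp_lt1 N1 al0 al_mono.
have := flux_bound a0 a1 (erefl _) c30 c40 chi1 wx g0 (vnorm_ge0 (Phi x)) (vnorm_ge0 (grad x)) n1.
apply: le_trans.
have z0 : 0 <= Rs * w x by rewrite mulr_ge0.
have h1 := Fmap_coercive_power N1 al0 al_mono aa_gt0 k1 (V x) z0.
have h2 := Fmap_growth N1 al0 al_mono aa_gt0 k (Rs * w x) (V x).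
have h3 : 0 <= dotp (V x) (Fmap al aa k (Rs * w x) (V x)).
  rewrite dotp_Fmap// mulr_ge0 ?sqr_ge0//.
  by apply: gfun_ge0 => //; exact: vnorm_ge0.
rewrite VE in h1 h2 h3.
have h4 := cauchy_schwarz (V x) (w x ^+ 2 *: Z x + dps').
have h5 : dotp (V x) (w x ^+ 2 *: Z x + dps') <=
    powR (aa ord_max) (a - 1) * powR s (1 - a) * (chi * w x ^+ 2 + g).
  by apply: (le_trans h4); rewrite ler_pM ?vnorm_ge0.
have -> : dotp (V x) (grad x) = dotp (V x) (Phi x) - dotp (V x) (w x ^+ 2 *: Z x + dps').
  by rewrite gE -addrA -opprD dotpDr dotpNr.
rewrite opprB addrC; apply: lerD => //.
rewrite lerN2.
have chi00 := chi0_gt0 aa_gt0.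
have W0 : 0 < chi * (1 + w x) ^+ 2.
  by rewrite mulr_gt0 ?exprn_gt0 ?(lt_le_trans ltr01) ?lerDl.
(* Both chi0 and Rs are at most the square root of chi, so the degenerating coercivity constant is
   dominated by chi (1+w)^2. *)
have den : (chi0 aa + Rs * w x) ^+ 2 <= chi * (1 + w x) ^+ 2.
  have c0 : 0 <= chi by rewrite (le_trans ler01).
  rewrite -(sqr_sqrtr c0) -exprMn; set m := Num.sqrt chi.
  have m0 : 0 <= m by exact: sqrtr_ge0.
  have mR : Rs <= m by rewrite -(ger0_norm Rs0) -sqrtr_sqr ler_wsqrtr.
  have mC : chi0 aa <= m by rewrite -(ger0_norm (ltW chi00)) -sqrtr_sqr ler_wsqrtr.
  have H : chi0 aa + Rs * w x <= m * (1 + w x) by rewrite mulrDr mulr1 lerD// ler_wpM2r.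
  have H1 : 0 <= chi0 aa + Rs * w x by rewrite addr_ge0// ltW.
  by rewrite ler_pXn2r// ?nnegrE// (le_trans H1).
rewrite mulrAC ler_pdivrMr//.
apply: (le_trans h1).
by rewrite mulrC ler_wpM2l.
Qed.

(** The integral of (div V) f + V . grad f vanishes, by [int_div_test_i] in each coordinate; so the
    left side is the integral of -V . grad f, bounded pointwise. *)
Lemma flux_ibp : bmeas (@U3 R U) (fun q => flux_density (mk3 q)) ->
  bmeas (@U3 R U) (fun q => (\sum_i D i (fun y => V y 0 i) (mk3 q)) * f (mk3 q)) ->
  \int[sleb3 R]_(q in @U3 R U) ((\sum_i D i (fun y => V y 0 i) (mk3 q)) * f (mk3 q)) <=
  \int[sleb3 R]_(q in @U3 R U) flux_density (mk3 q).
Proof.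
move=> bF bS; have mU := measurable_U3 oU; have fU := U3_lty oU bU.
have dff i x : U x -> derivable f x (ev R i) by move=> /subU cx; have h := df i cx.
have bdVK i : exists C, forall x, K x -> `|D i (fun y => V y 0 i) x| <= C.
  by have [C hC] := bdV i; exists C => x /KU /hC.
have cfU x : U x -> {for x, continuous f} by move=> /subU; exact: cf.
have cVU i x : U x -> {for x, continuous (fun y => V y 0 i)} by move=> /subU; exact: cV.
have B i := @bmeas_div_test R U K oU compactK KU f (fun i y => V y 0 i) f0 dff cdf cfU dV bdVK cVU i.
have I i := @int_div_test_i R U K oU compactK KU f (fun i y => V y 0 i) f0 dff cdf cfU dV bdVK cVU i.
pose A q := \sum_i (D i (fun y => V y 0 i) (mk3 q) * f (mk3 q) + V (mk3 q) 0 i * D i f (mk3 q)).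
have bA : bmeas (@U3 R U) A by apply: bmeas_sum.
have AI : \int[sleb3 R]_(q in @U3 R U) A q = 0.
  have -> : A = (fun q => (D 0 (fun y => V y 0 0) (mk3 q) * f (mk3 q) + V (mk3 q) 0 0 * D 0 f (mk3 q))
    + (D 1 (fun y => V y 0 1) (mk3 q) * f (mk3 q) + V (mk3 q) 0 1 * D 1 f (mk3 q))
    + (D 2 (fun y => V y 0 2) (mk3 q) * f (mk3 q) + V (mk3 q) 0 2 * D 2 f (mk3 q))).
    by apply/funext => q; rewrite /A sum3.
  have E1 := bmeas_intD mU fU (bmeasD (B 0) (B 1)) (B 2).
  have E2 := bmeas_intD mU fU (B 0) (B 1).
  have E3 := etrans E2 (f_equal2 +%R (I 0) (I 1)).
  have E4 := etrans E1 (f_equal2 +%R E3 (I 2)).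
  by rewrite !addr0 in E4; exact: E4.
rewrite -[leLHS]subr0 -{2}AI -bmeas_intB//.
apply: bmeas_le => //; first exact: bmeasB.
move=> q Uq; apply: le_trans (flux_pointwise Uq).
by rewrite /A mulr_suml -sumrB -sumrN; apply: ler_sum => i _; rewrite opprD addNKr.
Qed.
End FixedTime.

Lemma eqr_le (R : realType) (x y : R) : x = y -> x <= y. Proof. by move->. Qed.

Lemma rearrange (R : realType) (x y z w : R) : x - y <= z - w -> x + w <= y + z. Proof. by move=> h; lra. Qed.

(** * The energy inequality for the solution in space-time *)

Section OpenIntervalFTC.
Context (R : realType).

Lemma FTC_open_interval (f F : R -> R) (c d : R) : c < d ->
  (forall t, c <= t -> t <= d -> is_derive t 1 F (f t)) ->
  (forall t, c <= t -> t <= d -> {for t, continuous f}) ->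
  \int[sleb1 R]_(t in `]c, d[) f t = F d - F c.
Proof.
move=> cd dF cf.
have wf : {within `[c, d], continuous f}.
  by apply: continuous_in_subspaceT => t; rewrite inE /= in_itv /= => /andP[ct td]; exact: cf.
have i1 := continuous_compact_integrable (@segment_compact R c d) wf.
have i2 : lebesgue_measure.-integrable `]c, d[ (EFin \o f).
  by apply: integrableS i1 => //; exact: subset_itv_oo_cc.
have i3 : lebesgue_measure.-integrable `]c, d] (EFin \o f).
  by apply: integrableS i1 => //; exact: subset_itv_oc_cc.
rewrite [LHS](Rintegral_itv_bndo_bndc i2) (Rintegral_itv_obnd_cbnd i3) /Rintegral.
have cF t : c <= t -> t <= d -> F @ t --> F t.
  move=> ct td; have h := dF t ct td.
  by apply: differentiable_continuous; apply/derivable1_diffP.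
have H := @continuous_FTC2 _ f F c d cd wf.
rewrite H//; first split.
- by move=> t; rewrite in_itv /= => /andP[/ltW ct /ltW td]; have h := dF t ct td.
- by apply: cvg_within_filter; apply: cF => //; exact: ltW.
- by apply: cvg_within_filter; apply: cF => //; exact: ltW.
- move=> t; rewrite in_itv /= => /andP[/ltW ct /ltW td]; have h := dF t ct td.
  by rewrite derive1E derive_val.
Qed.
End OpenIntervalFTC.

Lemma C1_on_at (R : realType) (W : set ('rV[R]_3 * R)) (h : 'rV[R]_3 -> R -> R) (x : 'rV[R]_3) (t : R) :
  C1_on W h -> W (x, t) -> [/\ {for (x, t), continuous (uncurry h)},
  derivable (h x) t 1, {for (x, t), continuous (uncurry (dt h))},
  forall i, derivable (h ^~ t) x (ev R i) &
  forall i, {for (x, t), continuous (uncurry (fun x t => 'D_(ev R i) (h ^~ t) x))}].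
Proof.
move=> [_ [/(_ (x, t)) hd /(_ (x, t)) hc]] Wx; have [d1 d2] := hd Wx; have [c1 [c2 c3]] := hc Wx.
by split; [exact: c1 | exact: d1 | exact: c2 | exact: d2 | exact: c3].
Qed.

Section Solution.
Context (R : realType) (N : nat) (al aa : 'I_N.+1 -> R).
Hypotheses (N1 : (1 <= N)%N) (al0 : al 0 = 0)
  (al_mono : forall i j : 'I_N.+1, (i < j)%N -> al i < al j)
  (aa_gt0 : forall i, 0 < aa i).
Context (k : 'rV[R]_3) (k1 : vnorm k = 1).
Notation vec := 'rV[R]_3.
Notation a := (aexp al).
Notation D i f x := ('D_(ev R i) f x).
Context (Rs : R) (X : R -> vec -> vec) (G Om : R) (e0 : R -> vec) (U : set vec).
Hypotheses (Rs0 : 0 <= Rs) (XE : forall z y, Fmap al aa k (Rs * z) (X z y) = y)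
  (G0 : 0 < G) (e01 : forall t, vnorm (e0 t) = 1) (oU : open U) (bU : bounded_set U).
Notation chi := (chistar aa Rs G Om U).
Context (u0 : vec -> R) (psi Psi u : vec -> R -> R).
Hypotheses (solu : regular_solution X (Zfield k G Om e0) U u0 psi u)
  (u_ge0 : forall x t, U x -> 0 < t -> 0 <= u x t)
  (bdPsi : forall x t, bdry U x -> 0 < t -> Psi x t = psi x t)
  (regPsi : exists W, C1_on W Psi /\ (closure U `*` `[0, +oo[%classic) `<=` W).

Let oo0 (x : vec) (t : R) : closure U x -> 0 < t -> (closure U `*` `]0, +oo[) (x, t).
Proof. by move=> cx t0; split => //=; rewrite in_itv /= t0. Qed.

Let co0 (x : vec) (t : R) : closure U x -> 0 <= t -> (closure U `*` `[0, +oo[) (x, t).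
Proof. by move=> cx t0; split => //=; rewrite in_itv /= t0. Qed.

Lemma chi_ge1 : 1 <= chi. Proof. by rewrite /chistar le_max lexx. Qed.
Let chiR : Rs ^+ 2 <= chi. Proof. by rewrite /chistar !le_max lexx !orbT. Qed.
Let chi0a : chi0 aa ^+ 2 <= chi. Proof. by rewrite /chistar !le_max lexx !orbT. Qed.

Let chiZ x t : U x -> vnorm (Zfield k G Om e0 x t) <= chi.
Proof.
move=> Ux; apply: (@le_trans _ _ (G + Om ^+ 2 * rU U)); last by rewrite /chistar !le_max lexx !orbT.
apply: (le_trans (vnormD _ _)); apply: lerD.
  by rewrite vnormN vnormZ e01 mulr1 gtr0_norm.
rewrite vnormZ ger0_norm ?sqr_ge0//; apply: ler_wpM2l; first exact: sqr_ge0.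
apply: (le_trans (vnorm_cross _ k1)); apply: (le_trans (vnorm_cross _ k1)).
apply: ub_le_sup; last by exists x => //; exact: subset_closure.
have [M [M0 HM]] := compact_in_box (compact_closureU bU).
exists (M + M + M) => _ [y cy <-]; apply: (le_trans (vnorm_le_sum _)); rewrite sum3.
by rewrite !lerD ?ltW// HM.
Qed.

Lemma u_regular (x : vec) (t : R) : closure U x -> 0 < t -> [/\ {for (x, t), continuous (uncurry u)},
  derivable (u x) t 1, {for (x, t), continuous (uncurry (dt u))},
  forall i, derivable (u ^~ t) x (ev R i) &
  forall i, {for (x, t), continuous (uncurry (fun x t => D i (u ^~ t) x))}].
Proof.
case: solu => -[W [[uC1 _] sW]] _ cx t0.
exact: (C1_on_at uC1 (sW _ (oo0 cx t0))).
Qed.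

Lemma u_dxx i j (x : vec) (t : R) : closure U x -> 0 < t -> derivable (fun y => D i (u ^~ t) y) x (ev R j) /\
  {for (x, t), continuous (uncurry (fun x t => D j (fun y => D i (u ^~ t) y) x))}.
Proof.
case: solu => -[W [[_ h] sW]] _ cx t0; have Wx := sW _ (oo0 cx t0).
by have [h1 h2] := h i j; split; [exact: (h1 _ Wx) | exact: (h2 _ Wx)].
Qed.

Lemma Psi_regular (x : vec) (t : R) : closure U x -> 0 <= t -> [/\ {for (x, t), continuous (uncurry Psi)},
  derivable (Psi x) t 1, {for (x, t), continuous (uncurry (dt Psi))},
  forall i, derivable (Psi ^~ t) x (ev R i) &
  forall i, {for (x, t), continuous (uncurry (fun x t => D i (Psi ^~ t) x))}].
Proof.
case: regPsi => W [PC1 sW] cx t0.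
exact: (C1_on_at PC1 (sW _ (co0 cx t0))).
Qed.

Let Z0 t x j : Zfield k G Om e0 x t 0 j = - (G * e0 t 0 j) + Om ^+ 2 * (dotp k x * k 0 j - x 0 j).
Proof. by rewrite /Zfield cross_cross// !mxE. Qed.

Let dZ t i j x : is_derive x (ev R i) (fun y => Zfield k G Om e0 y t 0 j)
  (Om ^+ 2 * (k 0 i * k 0 j - (ev R i) 0 j)).
Proof.
have -> : (fun y => Zfield k G Om e0 y t 0 j) =
   (fun y : vec => - (G * e0 t 0 j) + (Om ^+ 2 * k 0 j) * (k 0 0 * y 0 0 + k 0 1 * y 0 1 + k 0 2 * y 0 2) - Om ^+ 2 * y 0 j).
  by apply/funext => y; rewrite Z0 dotpE; ring.
have c0 := is_derive_coord x (ev R i) 0; have c1 := is_derive_coord x (ev R i) 1.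
have c2 := is_derive_coord x (ev R i) 2; have cj := is_derive_coord x (ev R i) j.
apply: is_derive_eq.
have E : k 0 i = dotp k (ev R i).
  rewrite /dotp (bigD1 i)//= big1 ?addr0; last first.
    by move=> l li; rewrite !mxE /= (negbTE li) mulr0.
  by rewrite !mxE !eqxx mulr1.
rewrite E dotpE /GRing.scale /=; ring.
Qed.

Let cZ t j x : {for x, continuous (fun y => Zfield k G Om e0 y t 0 j)}.
Proof.
have -> : (fun y => Zfield k G Om e0 y t 0 j) =
   (fun y : vec => - (G * e0 t 0 j) + (Om ^+ 2 * k 0 j) * (k 0 0 * y 0 0 + k 0 1 * y 0 1 + k 0 2 * y 0 2) - Om ^+ 2 * y 0 j).
  by apply/funext => y; rewrite Z0 dotpE; ring.
have H l c : {for x, continuous (fun y : vec => c * y 0 l)}.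
  by apply: continuousM; [exact: cst_continuous | exact: coord_continuous].
apply: continuousB; last exact: H.
apply: continuousD; first exact: cst_continuous.
apply: continuousM; first exact: cst_continuous.
by apply: continuousD; [apply: continuousD|]; exact: H.
Qed.

Definition ubar x t := u x t - Psi x t.
Definition grad_ubar x t : vec := \row_(i < 3) (D i (u ^~ t) x - D i (Psi ^~ t) x).
Definition rem4 x t : R :=
  remainder a (powR (aa ord_max) (a - 1)) (c4 al aa) chi (u x t) (vnorm (gradx Psi x t)).
(** The gradient energy with the weight (1+u)^(-2) inherited from the coercivity of the flux; the
    factor 1/chi is kept outside. *)
Definition dissip x t : R := (1 + u x t) ^- 2 * powR (vnorm (grad_ubar x t)) (2 - a).

Lemma energy_fixed_time e p t : 0 < e -> 1 < p -> 0 < t ->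
  bmeas (U3 U) (fun q => p * powR (cut e (ubar (mk3 q) t)) (p - 1) *
    (- (c4 al aa / 4 / chi * dissip (mk3 q) t) + rem4 (mk3 q) t)) ->
  bmeas (U3 U) (fun q => dt u (mk3 q) t * scut e p (ubar (mk3 q) t)) ->
  \int[sleb3 R]_(q in U3 U) (dt u (mk3 q) t * scut e p (ubar (mk3 q) t)) <=
  \int[sleb3 R]_(q in U3 U) (p * powR (cut e (ubar (mk3 q) t)) (p - 1) *
    (- (c4 al aa / 4 / chi * dissip (mk3 q) t) + rem4 (mk3 q) t)).
Proof.
move=> e_gt0 p1 t0 b1 b2.
case: (solu) => _ [_ [pde [_ bdu]]].
pose w := u ^~ t; pose ps := Psi ^~ t; pose Z := Zfield k G Om e0 ^~ t.
pose V y := X (w y) (\row_(i < 3) D i w y + (w y) ^+ 2 *: Z y).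
have FE x : p * powR (cut e (ubar x t)) (p - 1) *
    (- (c4 al aa / 4 / chi * dissip x t) + rem4 x t) =
    flux_density al aa chi w ps e p x.
  rewrite /flux_density /rem4 /dissip -/(ubar x t); congr (_ * (- _ + _)).
  have E : (chi * (1 + w x) ^+ 2)^-1 = chi^-1 * (1 + u x t) ^- 2 by rewrite invfM.
  by rewrite E !mulrA.
have dtE x : U x -> dt u x t = \sum_i D i (fun y => V y 0 i) x.
  by move=> Ux; have [_ ->] := pde x t Ux t0.
have E1 : \int[sleb3 R]_(q in U3 U) (dt u (mk3 q) t * scut e p (ubar (mk3 q) t)) =
  \int[sleb3 R]_(q in U3 U) ((\sum_i D i (fun y => V y 0 i) (mk3 q)) * scut e p (w (mk3 q) - ps (mk3 q))).
  by apply: eq_Rintegral => q; rewrite inE => /dtE ->.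
have b3 : bmeas (U3 U) (fun q => (\sum_i D i (fun y => V y 0 i) (mk3 q)) * scut e p (w (mk3 q) - ps (mk3 q))).
  by apply: bmeas_eq b2 => q; rewrite inE => /dtE ->.
have E2 : (fun q => p * powR (cut e (ubar (mk3 q) t)) (p - 1) *
    (- (c4 al aa / 4 / chi * dissip (mk3 q) t) + rem4 (mk3 q) t)) =
    (fun q : T3 R => flux_density al aa chi w ps e p (mk3 q)).
  by apply/funext => q; exact: FE.
rewrite E1; move: b1; rewrite E2 => b1.
have t0' := ltW t0.
apply: (@flux_ibp R N al aa N1 al0 al_mono aa_gt0 k k1 U oU bU Rs chi w ps V Z Rs0 chi_ge1 chiR chi0a) => //.
- by move=> x Ux; exact: chiZ.
- by move=> i x cx; have [_ _ _ h _] := u_regular cx t0; exact: h.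
- by move=> x cx; have [h _ _ _ _] := u_regular cx t0; exact: (continuous_slice h).
- by move=> i x cx; have [_ _ _ _ h] := u_regular cx t0; exact: (continuous_slice (h i)).
- by move=> i j x cx; have [h _] := u_dxx i j cx t0; exact: h.
- by move=> i j x cx; have [_ h] := u_dxx i j cx t0; exact: (continuous_slice h).
- by move=> i x cx; have [_ _ _ h _] := Psi_regular cx t0'; exact: h.
- by move=> x cx; have [h _ _ _ _] := Psi_regular cx t0'; exact: (continuous_slice h).
- by move=> i x cx; have [_ _ _ _ h] := Psi_regular cx t0'; exact: (continuous_slice (h i)).
- by move=> i j x; have h := dZ t i j x.
- by move=> j x; exact: cZ.
- move=> i j; have -> : (fun y => D i (fun z => Z z 0 j) y) = cst (Om ^+ 2 * (k 0 i * k 0 j - (ev R i) 0 j)).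
    by apply/funext => y; have h := dZ t i j y; rewrite derive_val.
  exact: cst_continuous.
- by move=> x Ux; exact: u_ge0.
- by move=> x bx; rewrite /w /ps bdu// bdPsi.
- by move=> x; exact: XE.
- by move=> i x Ux; have [h _] := pde x t Ux t0; exact: h.
Qed.
Lemma bmeas_cut d (T : measurableType d) (A : set T) (v : T -> R) e :
  bmeas A v -> bmeas A (fun z => cut e (v z)).
Proof.
move=> bv; apply: bmeas_max; first exact: bmeas_cst.
by apply: bmeasB; [exact: bmeas_norm | exact: bmeas_cst].
Qed.

Lemma bmeas_cutp d (T : measurableType d) (A : set T) (v : T -> R) e p : 0 <= p ->
  bmeas A v -> bmeas A (fun z => cutp e p (v z)).
Proof.
move=> p0 bv; apply: bmeas_powR => //; apply: bmeas_max; first exact: bmeas_cst.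
by apply: bmeasB => //; exact: bmeas_cst.
Qed.

Lemma bmeas_scut d (T : measurableType d) (A : set T) (v : T -> R) e p : 0 <= p ->
  bmeas A v -> bmeas A (fun z => scut e p (v z)).
Proof.
by move=> p0 bv; apply: bmeasB; apply: bmeas_cutp => //; exact: bmeasN.
Qed.

Lemma bmeas_vnorm d (T : measurableType d) (A : set T) (v : 'I_3 -> T -> R) :
  (forall i, bmeas A (v i)) -> bmeas A (fun z => vnorm (\row_(i < 3) v i z)).
Proof.
move=> bv.
have -> : (fun z => vnorm (\row_(i < 3) v i z)) = (fun z => powR (\sum_i v i z ^+ 2) 2^-1).
  apply/funext => z; rewrite powR12_sqrt ?sumr_ge0// => [|i _]; last exact: sqr_ge0.
  by congr Num.sqrt; apply: eq_bigr => i _; rewrite !mxE.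
by apply: bmeas_powR; [rewrite invr_ge0 | apply: bmeas_sum => i; exact: bmeas_exprn].
Qed.

Notation at4 h := (fun z : T4 R => h (mk3 z.1) z.2).

Lemma bmeas_dPsi t1 t2 : 0 <= t1 -> forall i,
  bmeas (QT U t1 t2) (at4 (fun x t => D i (Psi ^~ t) x)).
Proof.
move=> t10 i; apply: (@bmeas_QT_nneg _ _ oU bU (uncurry (fun x t => D i (Psi ^~ t) x))) => // -[x t] /= cx tt.
by have [_ _ _ _ h] := Psi_regular cx tt; exact: h.
Qed.

Lemma bmeas_Psi t1 t2 : 0 <= t1 -> bmeas (QT U t1 t2) (at4 Psi).
Proof.
move=> t10; apply: (@bmeas_QT_nneg _ _ oU bU (uncurry Psi)) => // -[x t] /= cx tt.
by have [h _ _ _ _] := Psi_regular cx tt.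
Qed.

Lemma bmeas_dtPsi t1 t2 : 0 <= t1 -> bmeas (QT U t1 t2) (at4 (dt Psi)).
Proof.
move=> t10; apply: (@bmeas_QT_nneg _ _ oU bU (uncurry (dt Psi))) => // -[x t] /= cx tt.
by have [_ _ h _ _] := Psi_regular cx tt.
Qed.

Lemma bmeas_u t1 t2 : 0 <= t1 -> bmeas (QT U t1 t2) (at4 u).
Proof.
move=> t10; apply: (@bmeas_QT _ _ oU bU (uncurry u)).
  move=> -[x t] /= Ux tt; have t0 := le_lt_trans t10 tt.
  by have [h _ _ _ _] := u_regular (subset_closure Ux) t0.
case: solu => _ [h _]; apply: continuous_subspaceW h.
by move=> [x t] [cx /=]; rewrite in_itv /= => /andP[tt _]; split => //=; rewrite in_itv /= (le_trans t10 tt).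
Qed.

Lemma bmeas_du t1 t2 : 0 < t1 -> forall i,
  bmeas (QT U t1 t2) (at4 (fun x t => D i (u ^~ t) x)).
Proof.
move=> t10 i; apply: (@bmeas_QT_pos _ _ oU bU (uncurry (fun x t => D i (u ^~ t) x))) => // -[x t] /= cx tt.
by have [_ _ _ _ h] := u_regular cx tt; exact: h.
Qed.

Lemma bmeas_dtu t1 t2 : 0 < t1 -> bmeas (QT U t1 t2) (at4 (dt u)).
Proof.
move=> t10; apply: (@bmeas_QT_pos _ _ oU bU (uncurry (dt u))) => // -[x t] /= cx tt.
by have [_ _ h _ _] := u_regular cx tt.
Qed.

Lemma bmeas_ubar t1 t2 : 0 <= t1 -> bmeas (QT U t1 t2) (at4 ubar).
Proof. by move=> t10; apply: bmeasB; [exact: bmeas_u | exact: bmeas_Psi]. Qed.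

Let a0 : 0 < a. Proof. exact: aexp_gt0 N1 al0 al_mono. Qed.
Let a1 : a < 1. Proof. exact: aexp_lt1 N1 al0 al_mono. Qed.

Lemma bmeas_gradPsi t1 t2 : 0 <= t1 -> bmeas (QT U t1 t2) (at4 (fun x t => vnorm (gradx Psi x t))).
Proof. by move=> t10; apply: bmeas_vnorm => i; exact: bmeas_dPsi. Qed.

Lemma bmeas_rem4 t1 t2 : 0 <= t1 -> bmeas (QT U t1 t2) (at4 rem4).
Proof.
move=> t10; have h0 := a0; have h1 := a1.
have bD : bmeas (QT U t1 t2) (fun z => chi * (1 + u (mk3 z.1) z.2) ^+ 2).
  apply: bmeasM; first exact: bmeas_cst.
  by apply: bmeas_exprn; apply: bmeasD; [exact: bmeas_cst | exact: bmeas_u].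
apply: bmeasD; last first.
  by apply: bmeasM; [exact: bmeas_cst | apply: bmeas_powR bD; lra].
apply: bmeasD; first exact: bmeas_cst.
apply: bmeasM; first exact: bmeas_cst.
apply: bmeasM; first by apply: bmeas_powR bD; lra.
apply: bmeas_powR; first lra.
by apply: bmeasD; [exact: bmeas_cst | exact: bmeas_gradPsi].
Qed.

Lemma bmeas_dissip t1 t2 : 0 < t1 -> bmeas (QT U t1 t2) (at4 dissip).
Proof.
move=> t10; have h0 := a0; have h1 := a1; apply: bmeasM.
  apply: (@bmeas_inv _ _ _ _ _ 1) => //.
    move=> [q t] [/= Uq]; rewrite in_itv /= => /andP[tt _].
    have := u_ge0 Uq (lt_trans t10 tt) => w0.
    by rewrite expr_ge1// ?addr_ge0// lerDl.
  by apply: bmeas_exprn; apply: bmeasD; [exact: bmeas_cst | apply: bmeas_u; exact: ltW].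
apply: bmeas_powR; first lra.
apply: bmeas_vnorm => i; apply: bmeasB; first exact: bmeas_du.
by apply: bmeas_dPsi; exact: ltW.
Qed.

Lemma bmeas_slice t1 t2 (f : T4 R -> R) t : t1 < t -> t < t2 -> bmeas (QT U t1 t2) f ->
  bmeas (U3 U) (fun q => f (q, t)).
Proof.
move=> t1t tt2 bf; apply: (bmeas_slice1 (measurable_U3 oU) (measurable_itvT t1 t2) bf).
by rewrite /= in_itv /= t1t.
Qed.

Let bS t1 t2 e p : 0 < t1 -> 0 <= p ->
  bmeas (QT U t1 t2) (fun z => dt u (mk3 z.1) z.2 * scut e p (ubar (mk3 z.1) z.2)).
Proof.
move=> t10 p0; apply: bmeasM; first exact: bmeas_dtu.
by apply: bmeas_scut => //; apply: bmeas_ubar; exact: ltW.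
Qed.

Let bcut t1 t2 e p : 0 <= t1 -> 0 <= p ->
  bmeas (QT U t1 t2) (fun z => powR (cut e (ubar (mk3 z.1) z.2)) p).
Proof.
by move=> t10 p0; apply: bmeas_powR => //; apply: bmeas_cut; exact: bmeas_ubar.
Qed.

(** Along each fixed x, the derivative in time of the truncated power of ubar is the integrand. *)
Let cut_increment e m x t1 t2 : 0 < e -> 1 < m -> 0 < t1 -> t1 < t2 -> U x ->
  \int[sleb1 R]_(t in `]t1, t2[) (m * scut e (m - 1) (ubar x t) * (dt u x t - dt Psi x t)) =
  powR (cut e (ubar x t2)) m - powR (cut e (ubar x t1)) m.
Proof.
move=> e_gt0 m1 t10 t12 /subset_closure cx.
have dub t : t1 <= t -> is_derive t 1 (ubar x) (dt u x t - dt Psi x t).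
  move=> tt; have t0 := lt_le_trans t10 tt.
  have [_ du _ _ _] := u_regular cx t0; have [_ dP _ _ _] := Psi_regular cx (ltW t0).
  have h1 : is_derive t 1 (u x) (dt u x t) by rewrite /dt derive1E; exact: (@derivableP _ _ _ (u x) t 1 du).
  have h2 : is_derive t 1 (Psi x) (dt Psi x t) by rewrite /dt derive1E; exact: (@derivableP _ _ _ (Psi x) t 1 dP).
  exact: is_deriveB.
have cub t : t1 <= t -> {for t, continuous (ubar x)}.
  move=> tt; have h := dub t tt.
  by apply: differentiable_continuous; apply/derivable1_diffP.
apply: (@FTC_open_interval R _ (fun t => powR (cut e (ubar x t)) m)) => //.
  move=> t tt _; have h := dub t tt.
  have g := is_derive_comp1 (@ex_derive _ _ _ _ _ _ _ h) (is_derive_cut_pow (ubar x t) (ltW e_gt0) m1).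
  by rewrite derive_val in g.
move=> t tt _; have t0 := lt_le_trans t10 tt.
have [_ _ cu _ _] := u_regular cx t0; have [_ _ cP _ _] := Psi_regular cx (ltW t0).
apply: continuousM; last first.
  by apply: continuousB; [exact: (continuous_slice2 cu) | exact: (continuous_slice2 cP)].
apply: continuousM; first exact: cst_continuous.
apply: (@continuous_comp _ _ _ (ubar x) (scut e (m - 1))); first exact: cub.
by apply: continuous_scut; rewrite subr_gt0.
Qed.

(** Test with m times the truncated odd power of order m-1. The condition m > 2 makes that power
    differentiable. The time derivative of u is replaced by that of ubar, at the price of the term
    with the time derivative of Psi. *)
Lemma energy e m t1 t2 : 0 < e -> 2 < m -> 0 < t1 -> t1 < t2 ->
  bmeas (U3 U) (fun q => powR (cut e (ubar (mk3 q) t1)) m) ->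
  bmeas (U3 U) (fun q => powR (cut e (ubar (mk3 q) t2)) m) ->
  \int[sleb3 R]_(q in U3 U) powR (cut e (ubar (mk3 q) t2)) m +
  m * (m - 1) * (c4 al aa / 4 / chi) * \int[sleb4 R]_(z in QT U t1 t2)
    (dissip (mk3 z.1) z.2 * powR (cut e (ubar (mk3 z.1) z.2)) (m - 2)) <=
  \int[sleb3 R]_(q in U3 U) powR (cut e (ubar (mk3 q) t1)) m +
  \int[sleb4 R]_(z in QT U t1 t2)
    (m * (m - 1) * (rem4 (mk3 z.1) z.2 * powR (cut e (ubar (mk3 z.1) z.2)) (m - 2))
     + m * (powR (cut e (ubar (mk3 z.1) z.2)) (m - 1) * `|dt Psi (mk3 z.1) z.2|)).
Proof.
move=> e_gt0 m2 t10 t12 b1 b2.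
have m1 : 1 < m - 1 by lra.
have m0 : 0 <= m - 1 by lra.
have p3 : 0 <= m - 1 - 1 by lra.
have M0 : 0 <= m by lra.
have m10 : 0 < m - 1 by lra.
have m1' : 1 < m by lra.
have m20 : 0 <= m - 2 by lra.
have mU := measurable_U3 oU; have fU := U3_lty oU bU.
have mQ := measurable_QT oU t1 t2; have fQ := QT_lty oU bU t1 t2.
have t10' := ltW t10.
set Q := QT U t1 t2.
pose f (z : T4 R) := m * (dt u (mk3 z.1) z.2 * scut e (m - 1) (ubar (mk3 z.1) z.2)).
pose g (z : T4 R) := m * (dt Psi (mk3 z.1) z.2 * scut e (m - 1) (ubar (mk3 z.1) z.2)).
pose cz p (z : T4 R) := powR (cut e (ubar (mk3 z.1) z.2)) p.
pose H (z : T4 R) := m * (m - 1) * (c4 al aa / 4 / chi) * (dissip (mk3 z.1) z.2 * cz (m - 2) z).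
pose P (z : T4 R) := m * (m - 1) * (rem4 (mk3 z.1) z.2 * cz (m - 2) z)
     + m * (cz (m - 1) z * `|dt Psi (mk3 z.1) z.2|).
have bf : bmeas Q f by apply: bmeasM; [exact: bmeas_cst | exact: bS].
have bg : bmeas Q g.
  apply: bmeasM; [exact: bmeas_cst | apply: bmeasM; first exact: bmeas_dtPsi].
  by apply: bmeas_scut => //; exact: bmeas_ubar.
have bfg : bmeas Q (fun z => f z - g z) by exact: bmeasB.
have bH0 : bmeas Q (fun z => dissip (mk3 z.1) z.2 * cz (m - 2) z).
  by apply: bmeasM; [exact: bmeas_dissip | exact: bcut].
have bR0 : bmeas Q (fun z => rem4 (mk3 z.1) z.2 * cz (m - 2) z).
  by apply: bmeasM; [exact: bmeas_rem4 | exact: bcut].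
have bH : bmeas Q H by apply: bmeasM => //; exact: bmeas_cst.
have bP : bmeas Q P.
  apply: bmeasD; first by apply: bmeasM => //; exact: bmeas_cst.
  apply: bmeasM; [exact: bmeas_cst | apply: bmeasM; first exact: bcut].
  by apply: bmeas_norm; exact: bmeas_dtPsi.
have bPH : bmeas Q (fun z => P z - H z) by exact: bmeasB.
(* Fubini with time innermost turns the time derivative into the difference of the energies at t2
   and t1. *)
have incr : \int[sleb4 R]_(z in Q) (f z - g z) =
  \int[sleb3 R]_(q in U3 U) powR (cut e (ubar (mk3 q) t2)) m -
  \int[sleb3 R]_(q in U3 U) powR (cut e (ubar (mk3 q) t1)) m.
  rewrite (QT_fubini' oU bU bfg) -(bmeas_intB mU fU b2 b1).
  apply: eq_Rintegral => q; rewrite inE => Uq.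
  rewrite -cut_increment//.
  apply: eq_Rintegral => t _; rewrite /f /g /=; ring.
(* Fubini in the other order, with space innermost, allows the fixed-time inequality to be applied
   at every t. *)
have main : \int[sleb4 R]_(z in Q) (f z - g z) <= \int[sleb4 R]_(z in Q) (P z - H z).
  rewrite (QT_fubini oU bU bfg) (QT_fubini oU bU bPH).
  have b1' := @bmeas_int1 _ _ _ _ R (sleb3 R) (sleb1 R) _ _ mU (measurable_itvT t1 t2) fU (itvT_lty t1 t2) _ bfg.
  have b2' := @bmeas_int1 _ _ _ _ R (sleb3 R) (sleb1 R) _ _ mU (measurable_itvT t1 t2) fU (itvT_lty t1 t2) _ bPH.
  apply: (@bmeas_le _ _ _ _ (sleb1 R) (measurable_itvT t1 t2) (itvT_lty t1 t2) _ _ b1' b2') => t.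
  rewrite /= in_itv /= => /andP[t1t tt2]; have t0 := lt_trans t10 t1t.
  have sl h := @bmeas_slice t1 t2 h t t1t tt2.
  have sf := sl _ (@bS t1 t2 e (m - 1) t10 m0).
  have bF1 : bmeas Q (fun z => (m - 1) * cz (m - 1 - 1) z *
    (- (c4 al aa / 4 / chi * dissip (mk3 z.1) z.2) + rem4 (mk3 z.1) z.2)).
    apply: (bmeasM (bmeasM (bmeas_cst Q (m - 1)) (@bcut t1 t2 e (m - 1 - 1) t10' p3))).
    apply: bmeasD; last exact: bmeas_rem4.
    by apply: bmeasN; apply: bmeasM; [exact: bmeas_cst | exact: bmeas_dissip].
  have sF := sl _ bF1.
  have h1 := energy_fixed_time e_gt0 m1 t0 sF sf.
  have I1 := bmeas_intZ mU fU m sf.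
  have bN : bmeas Q (fun z => m * (cz (m - 1) z * `|dt Psi (mk3 z.1) z.2|)).
    apply: bmeasM; [exact: bmeas_cst | apply: bmeasM; first exact: bcut].
    by apply: bmeas_norm; exact: bmeas_dtPsi.
  have sN := sl _ bN.
  have I2 := bmeas_intB mU fU (sl _ bf) (sl _ bg).
  have I3 := bmeas_intZ mU fU m sF.
  have I4 := bmeas_intD mU fU (bmeasM (bmeas_cst (U3 U) m) sF) sN.
  have h2 : - (\int[sleb3 R]_(q in U3 U) g (q, t)) <= \int[sleb3 R]_(q in U3 U)
      (m * (cz (m - 1) (q, t) * `|dt Psi (mk3 q) t|)).
    have I8 := etrans (bmeas_intZ mU fU (- 1) (sl _ bg)) (mulN1r _).
    apply: (@le_trans _ _ (\int[sleb3 R]_(q in U3 U) (- 1 * g (q, t)))).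
      exact: (eqr_le (esym I8)).
    apply: (bmeas_le mU fU (bmeasM (bmeas_cst (U3 U) (- 1)) (sl _ bg)) sN) => q Uq.
    rewrite /g /= mulrCA; apply: ler_wpM2l => //.
    rewrite mulN1r; apply: (le_trans (ler_norm _)); rewrite normrN normrM mulrC.
    by rewrite /cz -scut_abs// ltW.
  have E5 : \int[sleb3 R]_(q in U3 U) (P (q, t) - H (q, t)) =
    \int[sleb3 R]_(q in U3 U) (m * ((m - 1) * cz (m - 1 - 1) (q, t) *
    (- (c4 al aa / 4 / chi * dissip (mk3 q) t) + rem4 (mk3 q) t)) +
    m * (cz (m - 1) (q, t) * `|dt Psi (mk3 q) t|)).
    apply: eq_Rintegral => q _; rewrite /P /H /=.
    have -> : m - 1 - 1 = m - 2 by ring.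
    by ring.
  have h3 := ler_wpM2l M0 h1.
  rewrite [leRHS]E5 [leRHS]I4 [leLHS]I2.
  apply: lerD; last exact: h2.
  by apply: (le_trans (eqr_le I1)); apply: (le_trans h3); rewrite -I3.
rewrite incr in main.
have I6 := bmeas_intB mQ fQ bP bH.
have I7 := bmeas_intZ mQ fQ (m * (m - 1) * (c4 al aa / 4 / chi)) bH0.
have main2 := le_trans main (eqr_le (etrans I6 (f_equal2 (fun x y : R => x - y) (erefl _) I7))).
exact: (rearrange main2).
Qed.
End Solution.

(** * The Sobolev inequality for truncated powers *)

Section SobolevTruncation.
Context (R : realType).
Notation vec := 'rV[R]_3.
Notation D i f x := ('D_(ev R i) f x).
Context (U : set vec) (oU : open U) (bU : bounded_set U) (w ps : vec -> R).
Hypotheses (dw : forall i x, closure U x -> derivable w x (ev R i))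
  (cw : forall x, closure U x -> {for x, continuous w})
  (cdw : forall i x, closure U x -> {for x, continuous (fun y => D i w y)})
  (dps : forall i x, closure U x -> derivable ps x (ev R i))
  (cps : forall x, closure U x -> {for x, continuous ps})
  (cdps : forall i x, closure U x -> {for x, continuous (fun y => D i ps y)})
  (bd : forall x, bdry U x -> w x = ps x).
Let v x := w x - ps x.
Let subU x : U x -> closure U x. Proof. exact: subset_closure. Qed.

Let cv x : closure U x -> {for x, continuous v}.
Proof. by move=> Ux; apply: continuousB; [exact: cw | exact: cps]. Qed.

Let dv i x : closure U x -> is_derive x (ev R i) v (D i w x - D i ps x).
Proof.
move=> cx; have h1 : is_derive x (ev R i) w (D i w x) by apply/derivableP; exact: dw.
have h2 : is_derive x (ev R i) ps (D i ps x) by apply/derivableP; exact: dps.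
exact: is_deriveB.
Qed.

Definition level_set e : set vec := closure U `&` [set x | e <= `|v x|].

Lemma compact_level_set e : compact (level_set e).
Proof.
apply: (subclosed_compact _ (compact_closureU bU)); last by move=> x [].
move=> x Kx.
have cx : closure U x by apply: (@closed_closure _ U); apply: closure_subset Kx => y [].
split => //=; rewrite leNgt; apply/negP => vx.
have H : \forall y \near x, `|v y| < e.
  exact: (cvgr_norm_lt _ (cv cx) _ vx).
by have [y [[_ /= Ky] /(le_lt_trans Ky)]] := Kx _ H; rewrite ltxx.
Qed.

Lemma level_set_sub e : 0 < e -> level_set e `<=` U.
Proof.
move=> e0 x [cx /= ex]; apply: contrapT => nU.
by move: ex; rewrite /v (bd (conj cx nU)) subrr normr0 leNgt e0.
Qed.

Lemma cut_out_level_set e x : U x -> ~ level_set e x -> cut e (v x) = 0.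
Proof.
move=> Ux nK; apply: cut0P; rewrite leNgt; apply/negP => h; apply: nK.
by split; [exact: subU | exact: ltW].
Qed.

Context (e g : R) (e0 : 0 < e) (g1 : 1 < g).
Let f x := powR (cut e (v x)) g.

Let df i x : closure U x ->
  is_derive x (ev R i) f (g * scut e (g - 1) (v x) * (D i w x - D i ps x)).
Proof.
move=> cx; have h := dv i cx.
have G := is_derive_comp1 (@ex_derive _ _ _ _ _ _ _ h) (is_derive_cut_pow (v x) (ltW e0) g1).
by rewrite derive_val in G.
Qed.

Let DfE i x : closure U x -> D i f x = g * scut e (g - 1) (v x) * (D i w x - D i ps x).
Proof. by move=> cx; have h := df i cx; rewrite derive_val. Qed.

Let cdf i x : U x -> {for x, continuous (fun y => D i f y)}.
Proof.
move=> Ux.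
have H : {for x, continuous (fun y => g * scut e (g - 1) (v y) * (D i w y - D i ps y))}.
  have cx := subU Ux; apply: continuousM.
    apply: continuousM; first exact: cst_continuous.
    apply: (@continuous_comp _ _ _ v (scut e (g - 1))); first exact: cv.
    by apply: continuous_scut; rewrite subr_gt0.
  by apply: continuousB; [exact: cdw | exact: cdps].
have E : \forall y \near x, (fun y => g * scut e (g - 1) (v y) * (D i w y - D i ps y)) y = D i f y.
  have nU : nbhs x U by apply: open_nbhs_nbhs.
  by apply: filterS nU => y /subU cy; rewrite DfE.
have : D i f x = (fun y => g * scut e (g - 1) (v y) * (D i w y - D i ps y)) x.
  by rewrite DfE//; exact: subU.
rewrite /prop_for /continuous_at => ->.
exact: (cvg_trans (near_eq_cvg E) H).
Qed.

Let g0 : 0 < g. Proof. exact: lt_trans g1. Qed.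

Let f0 x : U x -> ~ level_set e x -> f x = 0.
Proof. by move=> Ux nK; rewrite /f cut_out_level_set// powR0// gt_eqF// g0. Qed.

Let dfU i x : U x -> derivable f x (ev R i).
Proof. by move=> /subU cx; have h := df i cx. Qed.

Let dz i x := is_derive_zext oU (@compact_level_set e) (level_set_sub e0) f0 (@dfU i) x.

(** The support lies in the compact superlevel set inside U, so the truncated power is itself an
    admissible function in the Sobolev inequality and no approximation is required. *)
Lemma Cc1_truncation : Cc1 U (zext U f).
Proof.
split; [|split].
- exists (level_set e); split; [exact: compact_level_set|split; first exact: level_set_sub].
  move=> x nK; have [Ux|nU] := pselect (U x); last exact: zext_out.
  by rewrite zext_in// f0.
- by move=> i x; have h := dz i x.
- move=> i; have -> : (fun x => D i (zext U f) x) = zext U (fun x => D i f x).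
    by apply/funext => x; have h := dz i x; rewrite derive_val.
  apply: (continuous_zext oU (@compact_level_set e) (level_set_sub e0)); last exact: cdf.
  exact: (derive_zero_outside oU (@compact_level_set e) _ f0).
Qed.

Lemma sobolev_truncation q cbar : 0 < q -> sobolev_const U q cbar ->
  powR (\int[sleb3 R]_(p in U3 U) powR (cut e (v (mk3 p))) (g * (3 * q / (3 - q)))) (3 * q / (3 - q))^-1 <=
  cbar * powR (\int[sleb3 R]_(p in U3 U)
    powR (g * powR (cut e (v (mk3 p))) (g - 1) * vnorm (\row_(i < 3) (D i w (mk3 p) - D i ps (mk3 p)))) q) q^-1.
Proof.
move=> q0 [_ /(_ _ Cc1_truncation)].
have E1 s : LpU s U (zext U f) = powR (\int[sleb3 R]_(p in U3 U) powR (cut e (v (mk3 p))) (g * s)) s^-1.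
  apply: (congr1 (fun z => powR (fine z) s^-1)).
  apply: eq_integral => p; rewrite inE => Up.
  by rewrite zext_in// ger0_norm ?powR_ge0// -powRrM.
have E2 : LpU q U (gradnorm (zext U f)) = powR (\int[sleb3 R]_(p in U3 U)
    powR (g * powR (cut e (v (mk3 p))) (g - 1) * vnorm (\row_(i < 3) (D i w (mk3 p) - D i ps (mk3 p)))) q) q^-1.
  apply: (congr1 (fun z => powR (fine z) q^-1)).
  apply: eq_integral => p; rewrite inE => Up; congr (powR _ _)%:E.
  rewrite ger0_norm ?vnorm_ge0// /gradnorm.
  have -> : \row_(i < 3) D i (zext U f) (mk3 p) =
     (g * scut e (g - 1) (v (mk3 p))) *: \row_(i < 3) (D i w (mk3 p) - D i ps (mk3 p)).
    apply/rowP => i; rewrite !mxE; have h := dz i (mk3 p); rewrite derive_val zext_in//.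
    by rewrite DfE//; exact: subU.
  by rewrite vnormZ normrM gtr0_norm ?g0// scut_abs ?ltW// subr_gt0.
by rewrite E1 E2.
Qed.
End SobolevTruncation.

(** * Averaging the energy inequality over the starting time *)

Section Averaging.
Context (R : realType) (U : set 'rV[R]_3) (oU : open U) (bU : bounded_set U).
Context (f h n : T4 R -> R) (c T1 T2 T T' : R).
Hypotheses (T12 : T1 < T2) (T2T : T2 < T) (TT' : T < T') (c0 : 0 <= c).
Hypotheses (bf : bmeas (QT U T1 T') f) (bh : bmeas (QT U T1 T') h) (bn : bmeas (QT U T1 T') n).
Hypotheses (f0 : forall z, 0 <= f z) (h0 : forall z, QT U T1 T' z -> 0 <= h z)
  (n0 : forall z, QT U T1 T' z -> 0 <= n z).
Hypothesis energy : forall t1 t2, T1 < t1 -> t1 < t2 -> t2 <= T ->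
  \int[sleb3 R]_(q in U3 U) f (q, t2) + c * \int[sleb4 R]_(z in QT U t1 t2) h z <=
  \int[sleb3 R]_(q in U3 U) f (q, t1) + \int[sleb4 R]_(z in QT U t1 t2) n z.

Lemma QT_sub s1 s2 t1 t2 : t1 <= s1 -> s2 <= t2 -> QT U s1 s2 `<=` QT U t1 t2.
Proof.
move=> ts st [q t] [/= Uq]; rewrite in_itv /= => /andP[h1 h2]; split => //=.
by rewrite in_itv /= (le_lt_trans ts h1) (lt_le_trans h2 st).
Qed.

Lemma bmeas_QT_sub s1 s2 t1 t2 (g : T4 R -> R) : t1 <= s1 -> s2 <= t2 -> bmeas (QT U t1 t2) g -> bmeas (QT U s1 s2) g.
Proof.
move=> ts st bg; have sub := QT_sub ts st.
exact: (bmeas_sub (measurable_QT oU t1 t2) (measurable_QT oU s1 s2) sub bg).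
Qed.

Lemma le_int_QT_sub s1 s2 t1 t2 (g : T4 R -> R) : t1 <= s1 -> s2 <= t2 -> bmeas (QT U t1 t2) g ->
  (forall z, QT U t1 t2 z -> 0 <= g z) ->
  \int[sleb4 R]_(z in QT U s1 s2) g z <= \int[sleb4 R]_(z in QT U t1 t2) g z.
Proof.
move=> ts st bg g0; have sub := QT_sub ts st.
exact: (bmeas_subset (measurable_QT oU t1 t2) (QT_lty oU bU t1 t2) (measurable_QT oU s1 s2) sub bg g0).
Qed.

(** The energy inequality holds from every starting time tau in (T1,T2). Enlarging the integral of n
    and shrinking that of h makes everything except the initial energy independent of tau; the mean
    over tau bounds the initial energy by the space-time integral of f divided by T2 - T1. *)
Lemma energy_average t : T2 < t -> t <= T ->
  \int[sleb3 R]_(q in U3 U) f (q, t) + c * \int[sleb4 R]_(z in QT U T2 t) h z <=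
  (T2 - T1)^-1 * \int[sleb4 R]_(z in QT U T1 T) f z + \int[sleb4 R]_(z in QT U T1 T) n z.
Proof.
move=> T2t tT; have tT' := le_lt_trans tT TT'.
have T12' := ltW T12; have T1t := lt_trans T12 T2t.
set L := _ + _; set Nn := \int[sleb4 R]_(z in QT U T1 T) n z.
have fI := itvT_lty T1 T2; have mI := measurable_itvT T1 T2.
have key tau : `]T1, T2[%classic tau -> L - Nn <= \int[sleb3 R]_(q in U3 U) f (q, tau).
  rewrite /= in_itv /= => /andP[h1 h2]; have taut := lt_trans h2 T2t.
  have e := energy h1 taut tT.
  have bh' := bmeas_QT_sub (ltW h1) (ltW tT') bh.
  have i1 : \int[sleb4 R]_(z in QT U T2 t) h z <= \int[sleb4 R]_(z in QT U tau t) h z.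
    apply: (le_int_QT_sub (ltW h2) (lexx t) bh') => z Qz; apply: h0.
    by apply: QT_sub Qz; exact: ltW.
  have i2 : \int[sleb4 R]_(z in QT U tau t) n z <= Nn.
    have bn' := bmeas_QT_sub (lexx T1) (ltW TT') bn.
    apply: (le_int_QT_sub (ltW h1) tT bn') => z Qz; apply: n0.
    by apply: QT_sub Qz => //; exact: ltW.
  have i3 := ler_wpM2l c0 i1.
  rewrite lerBlDr; apply: le_trans (le_trans e (lerD (lexx _) i2)).
  exact: lerD (lexx _) i3.
have bf2 := bmeas_QT_sub (lexx T1) (ltW (lt_trans T2T TT')) bf.
have bI := @bmeas_int1 _ _ _ _ R (sleb3 R) (sleb1 R) _ _ (measurable_U3 oU) mI (U3_lty oU bU) fI _ bf2.
have H := bmeas_le mI fI (bmeas_cst _ (L - Nn)) bI key.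
have E1 : \int[sleb1 R]_(t in `]T1, T2[) (L - Nn) = (L - Nn) * (T2 - T1).
  rewrite Rintegral_cst//; congr (_ * _).
  by rewrite /sleb1 /= lebesgue_measure_itv /= lte_fin T12 -EFinB.
have E2 := QT_fubini oU bU bf2.
have H2 : (L - Nn) * (T2 - T1) <= \int[sleb4 R]_(z in QT U T1 T2) f z.
  by apply: (le_trans (eqr_le (esym E1))); apply: (le_trans H); apply: eqr_le; exact: esym E2.
have H3 : \int[sleb4 R]_(z in QT U T1 T2) f z <= \int[sleb4 R]_(z in QT U T1 T) f z.
  by apply: (le_int_QT_sub (lexx T1) (ltW T2T) (bmeas_QT_sub (lexx T1) (ltW TT') bf)).
have d0 : 0 < T2 - T1 by rewrite subr_gt0.
rewrite -lerBlDr -(ler_pM2l d0) mulrA divff ?gt_eqF// mul1r mulrC.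
exact: le_trans H2 H3.
Qed.
End Averaging.

(** * Weighted Gagliardo-Nirenberg interpolation at a fixed time *)

Section Interpolation.
Context d (T : measurableType d) (R : realType) (mu : {measure set T -> \bar R}) (D : set T).
Hypotheses (mD : measurable D) (fD : (mu D < +oo)%E).
Context (c n w : T -> R) (bc : bmeas D c) (bn : bmeas D n) (bw : bmeas D w).
Hypotheses (c0 : forall x, D x -> 0 <= c x) (n0 : forall x, D x -> 0 <= n x)
  (w0 : forall x, D x -> 0 <= w x).
Context (a r m cbar : R).
Hypotheses (a0 : 0 < a) (a1 : a < 1) (r0 : 0 < r) (r1 : r < 1) (m2 : 2 < m) (cb0 : 0 < cbar).
Let q := r * (2 - a).
Let g := (m - a) / (2 - a).
Let lam0 := (r * (5 - a) - 3) / (3 * r).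
Hypotheses (lam0_gt0 : 0 < lam0).
Hypothesis sob : powR (\int[mu]_(x in D) powR (c x) (g * (3 * q / (3 - q)))) (3 * q / (3 - q))^-1 <=
  cbar * powR (\int[mu]_(x in D) powR (g * powR (c x) (g - 1) * n x) q) q^-1.

Lemma gn_interpolation :
  \int[mu]_(x in D) powR (c x) (m * (1 + lam0) - a) <=
  powR (\int[mu]_(x in D) powR (c x) m) lam0 *
  (powR (cbar * g) (2 - a) *
   (\int[mu]_(x in D) ((1 + w x) ^- 2 * powR (n x) (2 - a) * powR (c x) (m - 2))) *
   powR (\int[mu]_(x in D) powR (1 + w x) (2 * r / (1 - r))) ((1 - r) / r)).
Proof.
have a0' := a0; have a1' := a1; have r0' := r0; have r1' := r1; have m2' := m2; have l0 := lam0_gt0.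
have ta : 0 < 2 - a by lra.
have ma : 0 < m - a by lra.
have g0 : 0 < g by rewrite divr_gt0.
have q0 : 0 < q by rewrite mulr_gt0.
have lamE : 1 - lam0 = (3 - q) / (3 * r).
  rewrite /lam0 /q; field; by rewrite gt_eqF.
have q2 : q < 3.
  have : r * (2 - a) <= 1 * (2 - a) by rewrite ler_wpM2r// ltW.
  rewrite -/q; lra.
have q3 : 0 < 3 - q by lra.
have l1 : 0 < 1 - lam0 by rewrite lamE divr_gt0// mulr_gt0.
have qs0 : 0 < 3 * q / (3 - q) by rewrite divr_gt0// mulr_gt0.
have E1 : g * (3 * q / (3 - q)) = (m - a) / (1 - lam0).
  by rewrite lamE /g /q; field; rewrite !gt_eqF.
have E2 : (3 * q / (3 - q))^-1 * (2 - a) = 1 - lam0.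
  by rewrite lamE /q; field; rewrite !gt_eqF.
have m0 : 0 < m by lra.
have ml0 : 0 <= m * lam0 by rewrite mulr_ge0// ltW.
have m20 : 0 <= m - 2 by lra.
have gm : (g - 1) * (2 - a) = m - 2 by rewrite /g; field; rewrite gt_eqF.
have g1 : 0 <= g - 1 by rewrite -(pmulr_lge0 _ ta) gm.
have ir : 0 < r^-1 by rewrite invr_gt0.
have r1p : 0 < 1 - r by lra.
pose Y x := powR (c x) ((m - a) / (1 - lam0)).
(* Hoelder with exponents 1/lam0 and 1/(1-lam0). *)
have H1 : \int[mu]_(x in D) powR (c x) (m * (1 + lam0) - a) <=
    powR (\int[mu]_(x in D) powR (c x) m) lam0 * powR (\int[mu]_(x in D) Y x) (1 - lam0).
  have bX : bmeas D (fun x => powR (c x) (m * lam0)) by exact: bmeas_powR.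
  have bZ : bmeas D (fun x => powR (c x) (m - a)) by apply: bmeas_powR => //; exact: ltW.
  have inv : lam0^-1^-1 + (1 - lam0)^-1^-1 = 1 by rewrite !invrK addrC subrK.
  have i1 : 0 < lam0^-1 by rewrite invr_gt0.
  have i2 : 0 < (1 - lam0)^-1 by rewrite invr_gt0.
  have := bmeas_hoelder mD fD i1 i2 inv bX bZ (fun x _ => powR_ge0 _ _) (fun x _ => powR_ge0 _ _).
  rewrite !invrK => h; apply: le_trans (le_trans h _).
    apply: eqr_le; apply: eq_Rintegral => x; rewrite inE => Dx.
    by rewrite -powRD_ge0//; congr powR; ring.
  have Ea : \int[mu]_(x in D) powR (powR (c x) (m * lam0)) lam0^-1 = \int[mu]_(x in D) powR (c x) m.
    by apply: eq_Rintegral => x _; rewrite -powRrM mulfK// gt_eqF.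
  have Eb : \int[mu]_(x in D) powR (powR (c x) (m - a)) (1 - lam0)^-1 = \int[mu]_(x in D) Y x.
    by apply: eq_Rintegral => x _; rewrite -powRrM.
  exact: (eqr_le (f_equal2 *%R (congr1 (fun z => powR z lam0) Ea) (congr1 (fun z => powR z (1 - lam0)) Eb))).
apply: (le_trans H1); apply: ler_wpM2l; first exact: powR_ge0.
have bX : bmeas D (fun x => (1 + w x) ^- 2 * powR (n x) (2 - a) * powR (c x) (m - 2)).
  apply: bmeasM; last exact: bmeas_powR.
  apply: bmeasM; last by apply: bmeas_powR => //; exact: ltW.
  apply: (@bmeas_inv _ _ _ _ _ 1) => //.
    by move=> x Dx; rewrite expr_ge1// ?addr_ge0 ?w0// lerDl w0.
  by apply: bmeas_exprn; apply: bmeasD => //; exact: bmeas_cst.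
set J := \int[mu]_(x in D) (_ * _ * _).
set B := \int[mu]_(x in D) powR (1 + w x) _.
have X0 x : D x -> 0 <= (1 + w x) ^- 2 * powR (n x) (2 - a) * powR (c x) (m - 2).
  by move=> Dx; rewrite !mulr_ge0 ?powR_ge0// invr_ge0 sqr_ge0.
(* Since q = r(2-a), the gradient power is the r-th power of the weighted dissipation times
   (1+w)^(2r); Hoelder with 1/r and 1/(1-r) separates them. *)
have H2 : \int[mu]_(x in D) powR (g * powR (c x) (g - 1) * n x) q <=
    powR g q * (powR J r * powR B (1 - r)).
  have bXr : bmeas D (fun x => powR ((1 + w x) ^- 2 * powR (n x) (2 - a) * powR (c x) (m - 2)) r).
    by apply: bmeas_powR => //; exact: ltW.
  have bW : bmeas D (fun x => powR (1 + w x) (2 * r)).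
    by apply: bmeas_powR; [rewrite mulr_ge0// ltW | apply: bmeasD => //; exact: bmeas_cst].
  have inv : r^-1^-1 + (1 - r)^-1^-1 = 1 by rewrite !invrK addrC subrK.
  have i2 : 0 < (1 - r)^-1 by rewrite invr_gt0.
  have h := bmeas_hoelder mD fD ir i2 inv bXr bW (fun x _ => powR_ge0 _ _) (fun x _ => powR_ge0 _ _).
  rewrite !invrK in h.
  have g00 := powR_ge0 g q.
  apply: le_trans (le_trans (ler_wpM2l g00 h) _).
    apply: eqr_le; apply: (etrans _ (bmeas_intZ mD fD (powR g q) (bmeasM bXr bW))).
    apply: eq_Rintegral => x; rewrite inE => Dx.
    have w1 : 0 < 1 + w x by rewrite (lt_le_trans ltr01)// lerDl w0.
    have c1 := c0 Dx; have n1 := n0 Dx; have g0' := ltW g0.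
    have w2 : 0 <= (1 + w x) ^- 2 by rewrite invr_ge0 sqr_ge0.
    have e1 := powRM q (mulr_ge0 g0' (powR_ge0 (c x) (g - 1))) n1.
    have e2 := powRM q g0' (powR_ge0 (c x) (g - 1)).
    have e3 := powRM r (mulr_ge0 w2 (powR_ge0 (n x) (2 - a))) (powR_ge0 (c x) (m - 2)).
    have e4 := powRM r w2 (powR_ge0 (n x) (2 - a)).
    rewrite e1 e2 e3 e4 -!powRrM.
    have -> : (g - 1) * q = (m - 2) * r by rewrite /q mulrCA gm mulrC.
    have -> : (2 - a) * r = q by rewrite /q mulrC.
    have -> : (1 + w x) ^- 2 = powR (1 + w x) (- 2) by rewrite powRN powR_mulrn// ltW.
    rewrite -powRrM mulNr.
    have E : powR (1 + w x) (- (2 * r)) * powR (1 + w x) (2 * r) = 1.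
      by rewrite powRN mulVf// gt_eqF// powR_gt0.
    transitivity (powR g q * (powR (n x) q * powR (c x) ((m - 2) * r)) * (powR (1 + w x) (- (2 * r)) * powR (1 + w x) (2 * r))).
      by rewrite E; ring.
    by ring.
  have Ea : \int[mu]_(x in D) powR (powR ((1 + w x) ^- 2 * powR (n x) (2 - a) * powR (c x) (m - 2)) r) r^-1 = J.
    by apply: eq_Rintegral => x; rewrite inE => Dx; rewrite -powRrM mulfV ?gt_eqF// powRr1// X0.
  have Eb : \int[mu]_(x in D) powR (powR (1 + w x) (2 * r)) (1 - r)^-1 = B.
    by apply: eq_Rintegral => x _; rewrite -powRrM.
  exact: (eqr_le (f_equal2 (fun y z => powR g q * (powR y r * powR z (1 - r))) Ea Eb)).
have H3 : powR (\int[mu]_(x in D) Y x) (3 * q / (3 - q))^-1 <= cbar * powR (powR g q * (powR J r * powR B (1 - r))) q^-1.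
  have S := sob; rewrite E1 in S; apply: (le_trans S); apply: ler_wpM2l; first exact: ltW.
  by apply: ler_powR2l H2; [rewrite invr_ge0 ltW | apply: Rintegral_ge0 => x _; exact: powR_ge0].
have H4 := ler_powR2l (ltW ta) (powR_ge0 _ _) H3.
rewrite -powRrM E2 in H4.
have J0 : 0 <= J by apply: Rintegral_ge0 => x; exact: X0.
have B0 : 0 <= B by apply: Rintegral_ge0 => x _; exact: powR_ge0.
apply: (le_trans H4); clear H1 H2 H3 H4 X0; clearbody J B.
set P := powR g q * (powR J r * powR B (1 - r)).
have e1 := powRM (2 - a) (ltW cb0) (powR_ge0 P q^-1).
have e2 := powRrM P q^-1 (2 - a).
have e3 := powRM (q^-1 * (2 - a)) (powR_ge0 g q) (mulr_ge0 (powR_ge0 J r) (powR_ge0 B (1 - r))).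
have e4 := powRM (q^-1 * (2 - a)) (powR_ge0 J r) (powR_ge0 B (1 - r)).
have e5 := powRM (2 - a) (ltW cb0) (ltW g0).
rewrite e1 -e2 e3 e4 -!powRrM e5.
have -> : q * (q^-1 * (2 - a)) = 2 - a by rewrite mulrA mulfV ?mul1r// gt_eqF.
have -> : r * (q^-1 * (2 - a)) = 1 by rewrite /q; field; rewrite !gt_eqF.
have -> : (1 - r) * (q^-1 * (2 - a)) = (1 - r) / r by rewrite /q; field; rewrite !gt_eqF.
by rewrite (powRr1 J0) !mulrA.
Qed.
End Interpolation.

(** * Gain of integrability in space-time *)

Section Gain.
Context (R : realType) (U : set 'rV[R]_3) (oU : open U) (bU : bounded_set U).
Context (v n w : T4 R -> R) (T2 T : R) (T2T : T2 < T).
Hypotheses (bv : bmeas (QT U T2 T) v) (bn : bmeas (QT U T2 T) n) (bw : bmeas (QT U T2 T) w).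
Hypotheses (n0 : forall z, 0 <= n z) (w0 : forall z, QT U T2 T z -> 0 <= w z).
Context (a r m cbar chi cc E Dv : R).
Hypotheses (a0 : 0 < a) (a1 : a < 1) (r0 : 0 < r) (r1 : r < 1) (m2 : 2 < m) (cb0 : 0 < cbar)
  (chi1 : 1 <= chi) (cc0 : 0 < cc) (E1 : 1 <= E) (D0 : 0 <= Dv).
Let q := r * (2 - a).
Let g := (m - a) / (2 - a).
Let lam0 := (r * (5 - a) - 3) / (3 * r).
Hypotheses (lam0_gt0 : 0 < lam0).
Hypothesis ae_E : {ae (sleb1 R), forall t, `]T2, T[%classic t ->
  powR (\int[sleb3 R]_(q in U3 U) powR (1 + w (q, t)) (2 * r / (1 - r))) ((1 - r) / r) <= 2 * E}.

(** The interpolation inequality is integrated over time: the energy is at most Dv at every time,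
    the norm of the weight is at most 2E at almost every time, and what remains is the space-time
    dissipation, bounded by Dv through the energy inequality. *)
Lemma gain_cut e : 0 < e ->
  (forall t, `]T2, T[%classic t ->
  powR (\int[sleb3 R]_(p in U3 U) powR (cut e (v (p, t))) (g * (3 * q / (3 - q)))) (3 * q / (3 - q))^-1 <=
  cbar * powR (\int[sleb3 R]_(p in U3 U) powR (g * powR (cut e (v (p, t))) (g - 1) * n (p, t)) q) q^-1) ->
  (forall t, `]T2, T[%classic t -> \int[sleb3 R]_(p in U3 U) powR (cut e (v (p, t))) m <= Dv) ->
  m * (m - 1) * (cc / 4 / chi) * \int[sleb4 R]_(z in QT U T2 T)
    ((1 + w z) ^- 2 * powR (n z) (2 - a) * powR (cut e (v z)) (m - 2)) <= Dv ->
  \int[sleb4 R]_(z in QT U T2 T) powR (cut e (v z)) (m * (1 + lam0) - a) <=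
  4 * E * chi * Num.max 1 (4 / cc * powR (cbar / (2 - a)) (2 - a)) * powR m (- a) * powR Dv (1 + lam0).
Proof.
move=> e0 sob S JD.
have a0' := a0; have a1' := a1; have m2' := m2; have l0 := lam0_gt0; have E1' := E1; have chi1' := chi1.
have mU := measurable_U3 oU; have fU := U3_lty oU bU.
have mI := measurable_itvT T2 T; have fI := itvT_lty T2 T.
have ta : 0 < 2 - a by lra.
have ma : 0 < m - a by lra.
have m0 : 0 < m by lra.
have m10 : 0 < m - 1 by lra.
have m20 : 0 <= m - 2 by lra.
have g0 : 0 < g by rewrite divr_gt0.
have E0 : 0 <= 2 * E by lra.
have chi0 : 0 < chi by lra.
have pw : 0 <= m * (1 + lam0) - a by have := mulr_gt0 m0 l0; lra.
have bc : bmeas (QT U T2 T) (fun z => cut e (v z)) by exact: bmeas_cut.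
pose h z := (1 + w z) ^- 2 * powR (n z) (2 - a) * powR (cut e (v z)) (m - 2).
have bh : bmeas (QT U T2 T) h.
  apply: bmeasM; last exact: bmeas_powR.
  apply: bmeasM; last by apply: bmeas_powR => //; exact: ltW.
  apply: (@bmeas_inv _ _ _ _ _ 1) => //.
    by move=> z Qz; rewrite expr_ge1// ?addr_ge0 ?w0// lerDl w0.
  by apply: bmeas_exprn; apply: bmeasD => //; exact: bmeas_cst.
pose P z := powR (cut e (v z)) (m * (1 + lam0) - a).
have bP : bmeas (QT U T2 T) P by exact: bmeas_powR.
pose K := powR Dv lam0 * powR (cbar * g) (2 - a) * (2 * E).
have K0 : 0 <= K := mulr_ge0 (mulr_ge0 (powR_ge0 _ _) (powR_ge0 _ _)) E0.
pose J t := \int[sleb3 R]_(p in U3 U) h (p, t).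
have bJ : bmeas `]T2, T[ J by exact: (@bmeas_int1 _ _ _ _ R (sleb3 R) (sleb1 R) _ _ mU mI fU fI _ bh).
have bPt : bmeas `]T2, T[ (fun t => \int[sleb3 R]_(p in U3 U) P (p, t)).
  exact: (@bmeas_int1 _ _ _ _ R (sleb3 R) (sleb1 R) _ _ mU mI fU fI _ bP).
have Qin p t : U3 U p -> `]T2, T[%classic t -> QT U T2 T (p, t) by move=> Up It; split.
have J0 t : `]T2, T[%classic t -> 0 <= J t.
  move=> It; apply: Rintegral_ge0 => p Up; have wp := w0 (Qin _ _ Up It).
  by rewrite !mulr_ge0 ?powR_ge0// invr_ge0 sqr_ge0.
have H : \int[sleb4 R]_(z in QT U T2 T) P z <= K * \int[sleb4 R]_(z in QT U T2 T) h z.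
  apply: (le_trans (eqr_le (QT_fubini oU bU bP))).
  apply: (@le_trans _ _ (\int[sleb1 R]_(t in `]T2, T[) (K * J t))); last first.
    apply: eqr_le; apply: (etrans (bmeas_intZ mI fI K bJ)).
    by congr (_ * _); exact: esym (QT_fubini oU bU bh).
  apply: (bmeas_le_ae mI fI bPt (bmeasM (bmeas_cst _ K) bJ)).
  - by move=> t It; apply: Rintegral_ge0 => p Up; exact: powR_ge0.
  - by move=> t It; rewrite mulr_ge0 ?J0.
  apply: (@filterS _ _ (ae_filter_ringOfSetsType (sleb1 R)) _ _ _ ae_E) => t HE It; have Et := HE It.
  have sl (f : T4 R -> R) : bmeas (QT U T2 T) f -> bmeas (U3 U) (fun q => f (q, t)).
    by move=> bf; exact: (bmeas_slice1 mU mI bf It).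
  have sw : forall p, U3 U p -> 0 <= w (p, t) by move=> p Up; apply: w0; exact: Qin.
  pose A := \int[sleb3 R]_(p in U3 U) powR (cut e (v (p, t))) m.
  pose B := powR (\int[sleb3 R]_(q in U3 U) powR (1 + w (q, t)) (2 * r / (1 - r))) ((1 - r) / r).
  have G : \int[sleb3 R]_(p in U3 U) P (p, t) <= powR A lam0 * (powR (cbar * g) (2 - a) * J t * B).
    exact: (@gn_interpolation _ _ R (sleb3 R) _ mU fU _ _ _ (sl _ bc) (sl _ bn) (sl _ bw)
    (fun p _ => cut_ge0 _ _) (fun p _ => n0 _) sw a r m cbar a0 a1 r0 r1 m2 cb0 lam0_gt0 (sob t It)).
  have A0 : 0 <= A by apply: Rintegral_ge0 => p _; exact: powR_ge0.
  have AD : A <= Dv by exact: S.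
  have Jt := J0 t It.
  have B0 : 0 <= B by exact: powR_ge0.
  have BE : B <= 2 * E by exact: Et.
  move: Jt G; set Jt := J t; clearbody A B Jt => Jt0 G; apply: (le_trans G); rewrite /K -!mulrA.
  apply: ler_pM; first exact: powR_ge0.
  - by rewrite !mulr_ge0// powR_ge0.
  - by apply: ler_powR2l AD => //; exact: ltW.
  apply: ler_wpM2l; first exact: powR_ge0.
  by rewrite mulrC [leRHS]mulrA; apply: ler_wpM2r.
apply: (le_trans H); move: JD; set I := \int[sleb4 R]_(z in _) _ => JD.
have I0 : 0 <= I.
  apply: Rintegral_ge0 => z Qz; have wp := w0 Qz.
  by rewrite !mulr_ge0 ?powR_ge0// invr_ge0 sqr_ge0.
clearbody I; clear H bJ bPt J0 sob S.
have k0 : 0 < m * (m - 1) * (cc / 4 / chi) by rewrite !mulr_gt0 ?invr_gt0.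
have IB : I <= Dv / (m * (m - 1) * (cc / 4 / chi)) by rewrite ler_pdivlMr// mulrC.
apply: (le_trans (ler_wpM2l K0 IB)).
set M := Num.max _ _.
have Mge : 4 / cc * powR (cbar / (2 - a)) (2 - a) <= M by rewrite le_max lexx orbT.
have M0 : 0 <= M by rewrite le_max ler01.
have cg : powR (cbar * g) (2 - a) = powR (cbar / (2 - a)) (2 - a) * powR (m - a) (2 - a).
  rewrite -powRM ?divr_ge0 ?ltW//; congr powR; rewrite /g; ring.
(* The power g^(2-a) grows like m^(2-a) and the energy inequality divides by m(m-1), which is at
   least m^2/2 for m > 2; the net factor is m^(-a). *)
have pm : powR (m - a) (2 - a) / (m * (m - 1)) <= 2 * powR m (- a).
  rewrite ler_pdivrMr ?mulr_gt0//.
  apply: (@le_trans _ _ (powR m (2 - a))).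
    by apply: ler_powR2l; [exact: ltW | exact: ltW | lra].
  rewrite (powRD_gt0 2 (- a) m0) (powR_mulrn 2 (ltW m0)) -subr_ge0.
  rewrite (_ : _ - _ = powR m (- a) * m * (m - 2)); last by ring.
  by rewrite !mulr_ge0 ?powR_ge0// ltW.
have DD : powR Dv (1 + lam0) = powR Dv lam0 * Dv.
  rewrite addrC powRD; last by rewrite gt_eqF// addr_gt0.
  by rewrite powRr1.
rewrite /K cg DD.
have -> : powR Dv lam0 * (powR (cbar / (2 - a)) (2 - a) * powR (m - a) (2 - a)) * (2 * E) *
    (Dv / (m * (m - 1) * (cc / 4 / chi))) =
  (2 * E * chi * (powR Dv lam0 * Dv)) * ((4 / cc * powR (cbar / (2 - a)) (2 - a)) * (powR (m - a) (2 - a) / (m * (m - 1)))).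
  by field; rewrite !gt_eqF.
have -> : 4 * E * chi * M * powR m (- a) * (powR Dv lam0 * Dv) =
  (2 * E * chi * (powR Dv lam0 * Dv)) * (M * (2 * powR m (- a))) by ring.
apply: ler_wpM2l; first exact: (mulr_ge0 (mulr_ge0 E0 (ltW chi0)) (mulr_ge0 (powR_ge0 _ _) D0)).
apply: ler_pM => //.
- by rewrite mulr_ge0 ?powR_ge0// divr_ge0// ltW.
- by rewrite divr_ge0 ?powR_ge0// mulr_ge0// ltW.
Qed.

(** As |v| <= cut + e, Minkowski bounds the norm of v by that of the truncation plus e times the
    p-th root of the volume; let e tend to 0. *)
Lemma int_cut_limit p B : 1 <= p -> 0 <= B ->
  (forall e, 0 < e -> \int[sleb4 R]_(z in QT U T2 T) powR (cut e (v z)) p <= B) ->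
  \int[sleb4 R]_(z in QT U T2 T) powR `|v z| p <= B.
Proof.
move=> p1 B0 H; have p0 : 0 < p by exact: lt_le_trans p1.
have mQ := measurable_QT oU T2 T; have fQ := QT_lty oU bU T2 T.
set I := \int[sleb4 R]_(z in _) _.
have I0 : 0 <= I by apply: Rintegral_ge0 => z _; exact: powR_ge0.
pose V := powR (fine (sleb4 R (QT U T2 T))) p^-1.
have V0 : 0 <= V by exact: powR_ge0.
have ip0 : 0 <= p^-1 by rewrite invr_ge0 ltW.
have key e : 0 < e -> powR I p^-1 <= powR B p^-1 + e * V.
  move=> e0; have e0' := ltW e0.
  have bc := bmeas_cut e bv.
  have h := bmeas_minkowski mQ fQ p1 bc (bmeas_cst (QT U T2 T) e) (fun z _ => cut_ge0 _ _) (fun z _ => e0').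
  have bS : bmeas (QT U T2 T) (fun z => powR (cut e (v z) + e) p).
    by apply: bmeas_powR; [exact: ltW | exact: bmeasD bc (bmeas_cst _ e)].
  have b1 : bmeas (QT U T2 T) (fun z => powR `|v z| p) by apply: bmeas_powR; [exact: ltW | exact: bmeas_norm].
  have i1 : I <= \int[sleb4 R]_(z in QT U T2 T) powR (cut e (v z) + e) p.
    apply: (bmeas_le mQ fQ b1 bS) => z _; apply: ler_powR2l; [exact: ltW | exact: normr_ge0 |].
    by rewrite -lerBlDr /cut le_max lexx orbT.
  apply: (le_trans (ler_powR2l ip0 I0 i1)); apply: (le_trans h); apply: lerD.
    have c0 : 0 <= \int[sleb4 R]_(z in QT U T2 T) powR (cut e (v z)) p.
      by apply: Rintegral_ge0 => z _; exact: powR_ge0.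
    exact: (ler_powR2l ip0 c0 (H e e0)).
  have E2 : \int[sleb4 R]_(z in QT U T2 T) powR e p = powR e p * fine (sleb4 R (QT U T2 T)).
    by rewrite Rintegral_cst.
  apply: (le_trans (eqr_le (congr1 (fun z => powR z p^-1) E2))).
  have f0 : 0 <= fine (sleb4 R (QT U T2 T)) by rewrite fine_ge0.
  apply: eqr_le; apply: (etrans (powRM p^-1 (powR_ge0 e p) f0)); congr (_ * _).
  by rewrite -powRrM mulfV ?gt_eqF// powRr1.
have lim : powR I p^-1 <= powR B p^-1.
  rewrite leNgt; apply/negP => lt.
  pose dlt := powR I p^-1 - powR B p^-1.
  have d0 : 0 < dlt by rewrite subr_gt0.
  have V1 : 0 < V + 1 by rewrite ltr_wpDl.
  have e0 : 0 < dlt / (2 * (V + 1)) by rewrite divr_gt0// mulr_gt0.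
  have := key _ e0; rewrite -lerBlDl -/dlt leNgt => /negP; apply.
  rewrite mulrAC ltr_pdivrMr ?mulr_gt0// ltr_pM2l//; lra.
have := ler_powR2l (ltW p0) (powR_ge0 _ _) lim.
by rewrite -!powRrM mulVf ?gt_eqF// !powRr1.
Qed.
End Gain.

(** * Bounding the right-hand side of the energy inequality by the data *)

Lemma powRD_nneg (R : realType) (x r s : R) : 0 <= r -> 0 <= s -> powR x (r + s) = powR x r * powR x s.
Proof.
move=> r0; rewrite le_eqVlt => /predU1P[<-|s0]; first by rewrite addr0 powRr0 mulr1.
exact: powRD_ge0.
Qed.

Lemma powR_le_1D (R : realType) (x s : R) : 0 <= x -> 0 <= s -> s <= 1 -> powR x s <= 1 + x.
Proof.
move=> x0 s0 s1; apply: (@le_trans _ _ (powR (1 + x) s)).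
  by apply: ler_powR2l => //; rewrite lerDr.
apply: (@le_trans _ _ (powR (1 + x) 1)); last by rewrite powRr1// addr_ge0.
by apply: ler_powR2r => //; rewrite lerDl.
Qed.

Lemma le_sum_parts (R : realType) (x1 x2 x3 x4 : R) : 0 <= x1 -> 0 <= x2 -> 0 <= x3 -> 0 <= x4 ->
  [/\ 1 <= 1 + x1 + x2 + x3 + x4, x1 <= 1 + x1 + x2 + x3 + x4, x2 <= 1 + x1 + x2 + x3 + x4,
   x3 <= 1 + x1 + x2 + x3 + x4 & x4 <= 1 + x1 + x2 + x3 + x4].
Proof. by move=> h1 h2 h3 h4; split; lra. Qed.

(* The factor [chi ^ c] is shared between [M] and a power of [chi] whose exponent decays with [xj]. *)
Lemma share_power (R : realType) (chi Q M xj iq c dlt : R) : 1 <= chi -> 0 <= Q -> 1 <= M ->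
  0 <= xj -> xj <= 1 -> 0 <= iq -> 0 <= c -> powR chi c * powR Q iq <= M ->
  iq * (1 - xj) <= dlt -> dlt <= 1 ->
  powR chi c * powR Q dlt <= M * powR chi (c * xj) * (1 + Q).
Proof.
move=> chi1 Q0 M_ge1 xj0 xj1 iq0 c0 MQ de d1.
have chi_gt0 : 0 < chi by exact: lt_le_trans chi1.
have x10 : 0 <= 1 - xj by lra.
have x11 : 1 - xj <= 1 by lra.
have e0 : 0 <= iq * (1 - xj) by rewrite mulr_ge0.
have e1 : 0 <= dlt - iq * (1 - xj) by rewrite subr_ge0.
have e2 : dlt - iq * (1 - xj) <= 1 by lra.
have E1 : powR chi c = powR chi (c * xj) * powR (powR chi c) (1 - xj).
  by rewrite -powRrM -(powRD_gt0 _ _ chi_gt0); congr powR; ring.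
have E2 : powR Q dlt = powR (powR Q iq) (1 - xj) * powR Q (dlt - iq * (1 - xj)).
  by rewrite -powRrM -(powRD_nneg _ e0 e1); congr powR; ring.
have C0 : 0 <= powR chi c * powR Q iq by rewrite mulr_ge0 ?powR_ge0.
have H1 : powR (powR chi c * powR Q iq) (1 - xj) <= M.
  apply: (le_trans (ler_powR2l x10 C0 MQ)).
  apply: (le_trans (ler_powR2r M_ge1 x11)).
  by rewrite powRr1// (le_trans ler01).
rewrite powRM ?powR_ge0// in H1.
have H2 := powR_le_1D Q0 e1 e2.
rewrite E1 E2.
have shuffle (x z t s : R) : x * z * (t * s) = (z * t) * x * s by ring.
rewrite shuffle.
apply: ler_pM => //; try by rewrite !mulr_ge0 ?powR_ge0.
  exact: powR_ge0.
by apply: ler_wpM2r => //; exact: powR_ge0.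
Qed.

(** Each piece is at most M X (1+Q) Y; adding coefficients and using m(m-1) <= m^2 and m <= m^2
    gives one product. *)
Lemma sum_data_bound (R : realType) (m W X M M1 M2 M3 M4 c5 K1 K2 dl i0 I J Q Y : R) :
  2 < m -> 0 <= Q -> 0 <= Y -> W = Y * (1 + Q) -> 1 <= X -> M = 1 + M1 + M2 + M3 + M4 ->
  0 <= M1 -> 0 <= M2 -> 0 <= M3 -> 0 <= M4 -> 0 <= c5 -> 0 <= K1 -> 0 <= K2 -> 0 < dl ->
  i0 <= W -> I <= c5 * W + K1 * (M2 * W) + K1 * (M1 * W) + K2 * (M3 * W) + K2 * (M * X * (1 + Q) * Y) ->
  J <= M4 * W ->
  dl^-1 * i0 + (m * (m - 1) * I + m * J) <=
  m ^+ 2 * (1 + c5 + K1 + 2 * K2) * (1 + dl^-1) * (1 + Q) * M * X * Y.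
Proof.
move=> m2 Q0 Y0 WE X1 ME h1 h2 h3 h4 hc hk1 hk2 dl0 H0 HI HJ.
have W0 : 0 <= W by rewrite WE mulr_ge0// addr_ge0.
have id0 : 0 <= dl^-1 by rewrite invr_ge0 ltW.
have M_ge1 : 1 <= M by rewrite ME; lra.
have MX1 : M <= M * X by rewrite ler_peMr//; lra.
have MX0 : 0 <= M * X by lra.
have part z : z <= M -> z * W <= M * X * W.
  by move=> zM; apply: ler_wpM2r => //; exact: le_trans MX1.
pose V := M * X * W.
have V0 : 0 <= V by rewrite mulr_ge0.
have p0 : W <= V by rewrite -[leLHS]mul1r; apply: part.
have p1 : M1 * W <= V by apply: part; rewrite ME; lra.
have p2 : M2 * W <= V by apply: part; rewrite ME; lra.
have p3 : M3 * W <= V by apply: part; rewrite ME; lra.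
have p4 : M4 * W <= V by apply: part; rewrite ME; lra.
have VE : M * X * (1 + Q) * Y = V by rewrite /V WE; ring.
have p12 : M1 * W + M2 * W <= V.
  by rewrite -mulrDl; apply: part; rewrite ME; lra.
have I1 : I <= (c5 + K1 + 2 * K2) * V.
  rewrite VE in HI; apply: (le_trans HI).
  have q1 := ler_wpM2l hc p0; have q2 := ler_wpM2l hk1 p12; have q3 := ler_wpM2l hk2 p3.
  rewrite mulrDr in q2; move: q1 q2 q3; clear.
  set a1 := c5 * W; set a2 := K1 * (M1 * W); set a3 := K1 * (M2 * W); set a4 := K2 * (M3 * W).
  rewrite !mulrDl -mulrA; set b1 := c5 * V; set b2 := K1 * V; set b3 := K2 * V; lra.
have mm : 0 <= m * (m - 1) by rewrite mulr_ge0; lra.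
have m20 : 0 <= m ^+ 2 by exact: sqr_ge0.
have mm2 : m * (m - 1) <= m ^+ 2 by rewrite expr2 ler_wpM2l; lra.
have mm1 : m <= m ^+ 2 by rewrite expr2 ler_peMl; lra.
have cK : 0 <= c5 + K1 + 2 * K2 by lra.
have A1 : m * (m - 1) * I <= m ^+ 2 * ((c5 + K1 + 2 * K2) * V).
  apply: (le_trans (ler_wpM2l mm I1)); apply: ler_wpM2r => //; exact: mulr_ge0.
have m0 : 0 <= m by lra.
have A2 : m * J <= m ^+ 2 * V.
  apply: (le_trans (ler_wpM2l m0 (le_trans HJ p4))); exact: ler_wpM2r.
have A0 : dl^-1 * i0 <= m ^+ 2 * (dl^-1 * V).
  apply: (@le_trans _ _ (dl^-1 * V)); first by apply: ler_wpM2l => //; exact: le_trans p0.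
  by rewrite ler_peMl ?mulr_ge0//; lra.
apply: (@le_trans _ _ (m ^+ 2 * (dl^-1 * V) + (m ^+ 2 * ((c5 + K1 + 2 * K2) * V) + m ^+ 2 * V))).
  exact: lerD A0 (lerD A1 A2).
rewrite [leRHS](_ : _ = m ^+ 2 * ((1 + c5 + K1 + 2 * K2) * (1 + dl^-1) * V)); last by rewrite /V WE; ring.
rewrite -!mulrDr; apply: ler_wpM2l => //.
have d1 : 0 <= dl^-1 * ((c5 + K1 + 2 * K2) * V) by rewrite mulr_ge0// mulr_ge0.
rewrite -subr_ge0 (_ : _ - _ = dl^-1 * ((c5 + K1 + 2 * K2) * V))//; ring.
Qed.

Section DataBound.
Context d (T : measurableType d) (R : realType) (mu : {measure set T -> \bar R}) (D D1 : set T).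
Hypotheses (mD : measurable D) (fD : (mu D < +oo)%E) (mD1 : measurable D1) (sD : D1 `<=` D).
Let Q := fine (mu D).
Let Q0 : 0 <= Q. Proof. by rewrite fine_ge0. Qed.

Let fD1 : (mu D1 < +oo)%E.
Proof. by apply: le_lt_trans fD; apply: le_measure => //; rewrite inE. Qed.

Let Q1 : fine (mu D1) <= Q.
Proof.
apply: fine_le.
- by rewrite ge0_fin_numE.
- by rewrite ge0_fin_numE.
- by apply: le_measure => //; rewrite inE.
Qed.

Context (b : T -> R) (bb : bmeas D b) (b0 : forall x, D x -> 0 <= b x) (L : R) (L0 : 0 < L).
Let y := powR (\int[mu]_(x in D1) powR (b x) L) L^-1.
Let y0 : 0 <= y. Proof. exact: powR_ge0. Qed.
Let bb1 : bmeas D1 b. Proof. exact: (bmeas_sub mD mD1 sD bb). Qed.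
Let b01 x : D1 x -> 0 <= b x. Proof. by move=> /sD; exact: b0. Qed.

Lemma int_pow_le s : 0 <= s -> s <= L ->
  \int[mu]_(x in D1) powR (b x) s <= powR y s * powR Q (1 - s / L).
Proof.
move=> s0 sL; apply: (le_trans (bmeas_pow_le mD1 fD1 s0 sL L0 bb1 b01)).
have e : 0 <= 1 - s / L by rewrite subr_ge0 ler_pdivrMr// mul1r.
rewrite /y -powRrM (mulrC L^-1).
apply: ler_wpM2l; first exact: powR_ge0.
by apply: ler_powR2l e _ Q1; exact: fine_ge0.
Qed.

Lemma int_pow_le1 s : 0 <= s -> s <= L -> \int[mu]_(x in D1) powR (b x) s <= powR y s * (1 + Q).
Proof.
move=> s0 sL; apply: (le_trans (int_pow_le s0 sL)); apply: ler_wpM2l; first exact: powR_ge0.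
apply: powR_le_1D => //; first by rewrite subr_ge0 ler_pdivrMr// mul1r.
by rewrite gerBl divr_ge0// ltW.
Qed.

(** Hoelder with q on the weight and p on the power of b; the condition s p <= L allows the latter
    to be compared with the norm of order L. What remains is a power of the volume with exponent in
    [0,1], at most 1 + Q. *)
Lemma int_weight_pow_le (F : T -> R) (p q s : R) : bmeas D F -> (forall x, D x -> 0 <= F x) ->
  1 < p -> 1 / p + 1 / q = 1 -> 0 <= s -> s * p <= L ->
  \int[mu]_(x in D1) (F x * powR (b x) s) <=
  powR (\int[mu]_(x in D) powR (F x) q) q^-1 * (powR y s * (1 + Q)).
Proof.
move=> bF F0 p1 pq s0 spL; have p0 : 0 < p by exact: lt_trans p1.
rewrite !div1r in pq.
have q0 : 0 < q.
  have pi1 : p^-1 < 1 by rewrite invf_lt1.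
  by rewrite -invr_gt0; lra.
have qp : q^-1 + p^-1 = 1 by rewrite addrC.
have bF1 := bmeas_sub mD mD1 sD bF.
have bs : bmeas D1 (fun x => powR (b x) s) by exact: bmeas_powR.
have h := bmeas_hoelder mD1 fD1 q0 p0 qp bF1 bs (fun x Dx => F0 x (sD Dx)) (fun x _ => powR_ge0 _ _).
apply: (le_trans h); apply: ler_pM; try exact: powR_ge0.
  apply: ler_powR2l; first by rewrite invr_ge0 ltW.
    by apply: Rintegral_ge0 => x _; exact: powR_ge0.
  have bq : bmeas D (fun x => powR (F x) q) by apply: bmeas_powR => //; exact: ltW.
  exact: (bmeas_subset mD fD mD1 sD bq (fun x _ => powR_ge0 _ _)).
have E : \int[mu]_(x in D1) powR (powR (b x) s) p = \int[mu]_(x in D1) powR (b x) (s * p).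
  by apply: eq_Rintegral => x _; rewrite -powRrM.
have sp0 : 0 <= s * p by rewrite mulr_ge0// ltW.
have h2 := int_pow_le sp0 spL.
have ip : 0 <= p^-1 by rewrite invr_ge0 ltW.
have I0 : 0 <= \int[mu]_(x in D1) powR (b x) (s * p) by apply: Rintegral_ge0 => x _; exact: powR_ge0.
apply: (le_trans (eqr_le (congr1 (fun z => powR z p^-1) E))).
apply: (le_trans (ler_powR2l ip I0 h2)).
have e1 := powRM p^-1 (powR_ge0 y (s * p)) (powR_ge0 Q (1 - s * p / L)).
rewrite e1 -!powRrM (mulfK (lt0r_neq0 p0)); apply: ler_wpM2l; first exact: powR_ge0.
have e : 0 <= 1 - s * p / L by rewrite subr_ge0 ler_pdivrMr// mul1r.
apply: (powR_le_1D Q0 (mulr_ge0 e ip)).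
rewrite ler_pdivrMr// mul1r; apply: le_trans (ltW p1).
by rewrite gerBl divr_ge0// ltW.
Qed.

Context (a kap m chi xj c3 c4 dl : R) (p q : 'I_4 -> R) (u g psi dP : T -> R).
Hypotheses (a0 : 0 < a) (a1 : a < 1) (kap1 : 1 < kap) (m2 : 2 < m) (LE : L = kap * m)
  (chi1 : 1 <= chi) (c30 : 0 < c3) (c40 : 0 < c4) (dl0 : 0 < dl)
  (xj0 : 0 <= xj) (xj1 : xj <= 1)
  (pk : forall i, 1 < p i /\ p i < kap) (pq : forall i, 1 / p i + 1 / q i = 1)
  (sL : m + 4 * (1 - a) <= L) (dE : (1 - kap^-1) * (1 - xj) <= 1 - (m + 4 * (1 - a)) / L).
Hypotheses (bu : bmeas D u) (bg : bmeas D g) (bpsi : bmeas D psi) (bdP : bmeas D dP)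
  (u0 : forall x, D x -> 0 <= u x) (g0 : forall x, D x -> 0 <= g x)
  (psi1 : forall x, D x -> 1 <= psi x) (dP0 : forall x, D x -> 0 <= dP x)
  (upsi : forall x, D x -> 1 + u x <= psi x + b x).
Let s4 := m + 4 * (1 - a).
Let Ymax := Num.max (powR y (m - 2)) (powR y s4).
Let I (F : T -> R) i := powR (\int[mu]_(x in D) powR (F x) (q i)) (q i)^-1.
Let M1 := powR chi (1 - a) * I (fun x => powR (1 + g x) (2 - a)) 0.
Let M2 := powR chi (1 - a) * I (fun x => powR (psi x) (2 * (1 - a)) * powR (1 + g x) (2 - a)) 1.
Let M3 := powR chi (3 - a) * I (fun x => powR (psi x) (2 * Num.max (2 - a) (3 - 2 * a))) 2.
Let M4 := I dP 3.
Let M := 1 + M1 + M2 + M3 + M4.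

Let I_ge0 F i : 0 <= I F i. Proof. exact: powR_ge0. Qed.
Let M1_ge0 : 0 <= M1. Proof. by rewrite mulr_ge0 ?powR_ge0. Qed.
Let M2_ge0 : 0 <= M2. Proof. by rewrite mulr_ge0 ?powR_ge0. Qed.
Let M3_ge0 : 0 <= M3. Proof. by rewrite mulr_ge0 ?powR_ge0. Qed.

Let M_parts : [/\ 1 <= M, M1 <= M, M2 <= M, M3 <= M & M4 <= M].
Proof. exact: (le_sum_parts M1_ge0 M2_ge0 M3_ge0 (I_ge0 dP 3)). Qed.

Lemma pow_le_Ymax s : m - 2 <= s -> s <= s4 -> powR y s <= Ymax.
Proof.
move=> h1 h2; have [y_gt0|] := ltP 0 y; first exact: powR_interval.
move=> yle; have -> : y = 0 by apply/eqP; rewrite eq_le yle y0.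
have m2' := m2; rewrite powR0; last by rewrite gt_eqF//; lra.
by rewrite le_max powR_ge0.
Qed.

Let p_gt1 i : 1 < p i. Proof. by have [] := pk i. Qed.
Let q_inv i : (q i)^-1 = 1 - (p i)^-1.
Proof. by have := pq i; rewrite !div1r => <-; rewrite addrC addKr. Qed.
Let q_gt0 i : 0 < q i.
Proof.
rewrite -invr_gt0 q_inv subr_gt0 invf_lt1 ?p_gt1//; exact: lt_trans (p_gt1 i).
Qed.
Let chi_gt0 : 0 < chi. Proof. exact: lt_le_trans chi1. Qed.

Let sp_le i s : 0 <= s -> s <= m -> s * p i <= L.
Proof.
move=> s0 sm; rewrite LE mulrC; have [h1 h2] := pk i.
by apply: ler_pM => //; [apply: ltW; exact: lt_trans h1 | exact: ltW].
Qed.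

(** The term b^(m+4(1-a)) comes with chi^(3-2a) but no data weight. Since psi >= 1, the third term
    of M dominates chi^(3-2a) Q^(1/q_3); [share_power] uses the fraction 1 - xj of this and leaves
    chi^((3-2a) xj). *)
Let supercritical : powR chi (3 - 2 * a) * powR Q (1 - s4 / L) <= M * powR chi ((3 - 2 * a) * xj) * (1 + Q).
Proof.
have a0' := a0; have a1' := a1.
have a32 : 0 <= 3 - 2 * a by lra.
have a33 : 3 - 2 * a <= 3 - a by lra.
have mx : 0 <= 2 * Num.max (2 - a) (3 - 2 * a) by rewrite mulr_ge0// le_max a32 orbT.
have s40 : 0 <= s4 / L by rewrite divr_ge0 ?(ltW L0)// /s4; have m2' := m2; lra.
(* Index 2 is the third exponent; p_3 < kap gives 1/q_3 = 1 - 1/p_3 <= 1 - 1/kap. *)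
have q2le : (q 2)^-1 <= 1 - kap^-1.
  have [h1 h2] := pk 2; rewrite q_inv lerD2l lerN2.
  have p20 : 0 < p 2 by exact: lt_trans h1.
  have k0 : 0 < kap by exact: lt_trans kap1.
  by rewrite lef_pV2 ?posrE// ltW.
have iq : 0 <= (q 2)^-1 by rewrite invr_ge0 ltW.
have x10 : 0 <= 1 - xj by rewrite subr_ge0.
have de : (q 2)^-1 * (1 - xj) <= 1 - s4 / L by apply: le_trans dE; rewrite ler_wpM2r.
have d1 : 1 - s4 / L <= 1 by rewrite gerBl.
have [M_ge1 _ _ M3M _] := M_parts.
apply: (share_power chi1 Q0 M_ge1 xj0 xj1 iq a32 _ de d1).
apply: le_trans M3M; apply: ler_pM; try exact: powR_ge0.
  exact: (ler_powR2r chi1 a33).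
apply: (ler_powR2l iq Q0).
have E : \int[mu]_(x in D) (1 : R) = Q by rewrite Rintegral_cst// mul1r.
apply: (le_trans (eqr_le (esym E))).
have bq : bmeas D (fun x => powR (powR (psi x) (2 * Num.max (2 - a) (3 - 2 * a))) (q 2)).
  exact: (bmeas_powR (ltW (q_gt0 2)) (bmeas_powR mx bpsi)).
apply: (bmeas_le mD fD (bmeas_cst D 1) bq) => x Dx.
exact: (powR_ge1 (ltW (q_gt0 2)) (powR_ge1 mx (psi1 Dx))).
Qed.
(** The remainder is split by [remainder_split]. The terms with exponent at most m are paired with
    their data weights by Hoelder, which is possible because p_i < kap and L = kap m; the last term
    is handled by [supercritical]. All powers of y lie between m-2 and m+4(1-a) and are replaced by
    the maximum of the two ends. *)
Lemma data_bound c5 c3k K1 K2 : c5 = powR 2 (- a) * c4 ->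
  c3k = c3 * powR (32 * c3 / c4) (1 - a) ->
  K1 = powR 2 (1 - a) * powR 4 (1 - a) * (c5 + c3k) ->
  K2 = powR 2 (1 - a) * powR 2 (5 - 4 * a) * c3k ->
  bmeas D (fun x => remainder a c3 c4 chi (u x) (g x)) ->
  dl^-1 * \int[mu]_(x in D1) powR (b x) m +
  \int[mu]_(x in D1) (m * (m - 1) * (remainder a c3 c4 chi (u x) (g x) * powR (b x) (m - 2)) +
     m * (powR (b x) (m - 1) * dP x)) <=
  m ^+ 2 * (1 + c5 + K1 + 2 * K2) * (1 + dl^-1) * (1 + Q) * M * powR chi ((3 - 2 * a) * xj) * Ymax.
Proof.
move=> c5E c3kE K1E K2E brem.
have a0' := a0; have a1' := a1; have m2' := m2; have xj0' := xj0.
have a32 : 0 <= 3 - 2 * a by lra.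
have ta : 0 <= 2 - a by lra.
have oa : 0 <= 2 * (1 - a) by lra.
have m20 : 0 <= m - 2 by lra.
have m10 : 0 <= m - 1 by lra.
have m0 : 0 <= m by lra.
have ma0 : 0 <= m - 2 * a by lra.
have s40 : 0 <= s4 by rewrite /s4; lra.
have a33 : 3 - 2 * a <= 3 - a by lra.
have l1 : m - 2 <= m by lra.
have l2 : m - 1 <= m by lra.
have l3 : m - 2 * a <= m by lra.
have l4 : m <= s4 by rewrite /s4; lra.
have l5 : m - 2 <= m - 1 by lra.
have l6 : m - 2 <= m - 2 * a by lra.
have l7 : m - 1 <= s4 by rewrite /s4; lra.
have l8 : m - 2 * a <= s4 by rewrite /s4; lra.
have l9 : m - 2 <= s4 by rewrite /s4; lra.
have mm0 : 0 <= m * (m - 1) by rewrite mulr_ge0.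
have mx : 0 <= 2 * Num.max (2 - a) (3 - 2 * a) by rewrite mulr_ge0// le_max a32 orbT.
have e64 : 6 - 4 * a <= 2 * Num.max (2 - a) (3 - 2 * a).
  have h : 3 - 2 * a <= Num.max (2 - a) (3 - 2 * a) by rewrite le_max lexx orbT.
  lra.
have mL : m <= L by exact: le_trans sL.
have Y0 : 0 <= Ymax by rewrite le_max powR_ge0.
have Q1' : 0 <= 1 + Q by rewrite addr_ge0.
have yY s : m - 2 <= s -> s <= s4 -> powR y s * (1 + Q) <= Ymax * (1 + Q).
  by move=> h1 h2; apply: ler_wpM2r => //; exact: pow_le_Ymax.
have c3k0 : 0 <= c3k by rewrite c3kE mulr_ge0 ?powR_ge0// ltW.
have c50 : 0 <= c5 by rewrite c5E mulr_ge0 ?powR_ge0// ltW.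
have K10 : 0 <= K1 by rewrite K1E !mulr_ge0 ?powR_ge0// addr_ge0.
have K20 : 0 <= K2 by rewrite K2E !mulr_ge0 ?powR_ge0.
pose F1 x := powR (1 + g x) (2 - a).
pose F2 x := powR (psi x) (2 * (1 - a)) * powR (1 + g x) (2 - a).
pose F3 x := powR (psi x) (2 * Num.max (2 - a) (3 - 2 * a)).
have bF1 : bmeas D F1 by apply: bmeas_powR => //; exact: (bmeasD (bmeas_cst _ _) bg).
have bF2 : bmeas D F2 by exact: (bmeasM (bmeas_powR oa bpsi) bF1).
have bF3 : bmeas D F3 by exact: bmeas_powR.
have bpw s : 0 <= s -> bmeas D1 (fun x => powR (b x) s) by move=> s0; exact: bmeas_powR.
have sub (f : T -> R) : bmeas D f -> bmeas D1 f by exact: bmeas_sub.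
have bt2 : bmeas D1 (fun x => F2 x * powR (b x) (m - 2)) by exact: (bmeasM (sub _ bF2) (bpw _ m20)).
have bt1 : bmeas D1 (fun x => F1 x * powR (b x) (m - 2 * a)) by exact: (bmeasM (sub _ bF1) (bpw _ ma0)).
have bt3 : bmeas D1 (fun x => F3 x * powR (b x) (m - 2)) by exact: (bmeasM (sub _ bF3) (bpw _ m20)).
have bt4 : bmeas D1 (fun x => dP x * powR (b x) (m - 1)) by exact: (bmeasM (sub _ bdP) (bpw _ m10)).
have h2 := int_weight_pow_le bF2 (fun x _ => mulr_ge0 (powR_ge0 _ _) (powR_ge0 _ _)) (p_gt1 1) (pq 1) m20 (sp_le 1 m20 l1).
have h1 := int_weight_pow_le bF1 (fun x _ => powR_ge0 _ _) (p_gt1 0) (pq 0) ma0 (sp_le 0 ma0 l3).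
have h3 := int_weight_pow_le bF3 (fun x _ => powR_ge0 _ _) (p_gt1 2) (pq 2) m20 (sp_le 2 m20 l1).
have h4 := int_weight_pow_le bdP dP0 (p_gt1 3) (pq 3) m10 (sp_le 3 m10 l2).
have chiP s : 0 <= powR chi s by exact: powR_ge0.
have H2 : powR chi (1 - a) * \int[mu]_(x in D1) (F2 x * powR (b x) (m - 2)) <= M2 * (Ymax * (1 + Q)).
  rewrite /M2 -mulrA; apply: ler_wpM2l => //; apply: (le_trans h2).
  by apply: ler_wpM2l; [exact: I_ge0 | exact: yY].
have H1 : powR chi (1 - a) * \int[mu]_(x in D1) (F1 x * powR (b x) (m - 2 * a)) <= M1 * (Ymax * (1 + Q)).
  rewrite /M1 -mulrA; apply: ler_wpM2l => //; apply: (le_trans h1).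
  by apply: ler_wpM2l; [exact: I_ge0 | exact: yY].
have H3 : powR chi (3 - 2 * a) * \int[mu]_(x in D1) (F3 x * powR (b x) (m - 2)) <= M3 * (Ymax * (1 + Q)).
  rewrite /M3 -mulrA; apply: ler_pM => //.
  - by apply: Rintegral_ge0 => x _; rewrite mulr_ge0 ?powR_ge0.
  - exact: (ler_powR2r chi1 a33).
  apply: (le_trans h3).
  by apply: ler_wpM2l; [exact: I_ge0 | exact: yY].
have H4 : \int[mu]_(x in D1) (dP x * powR (b x) (m - 1)) <= M4 * (Ymax * (1 + Q)).
  apply: (le_trans h4).
  by apply: ler_wpM2l; [exact: I_ge0 | exact: yY].
have H0 : \int[mu]_(x in D1) powR (b x) m <= Ymax * (1 + Q).
  exact: le_trans (int_pow_le1 m0 mL) (yY _ l1 l4).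
have m2L : m - 2 <= L by exact: le_trans l1 mL.
have H5 : \int[mu]_(x in D1) powR (b x) (m - 2) <= Ymax * (1 + Q).
  exact: le_trans (int_pow_le1 m20 m2L) (yY _ (lexx _) l9).
have H6 : powR chi (3 - 2 * a) * \int[mu]_(x in D1) powR (b x) s4 <= M * powR chi ((3 - 2 * a) * xj) * (1 + Q) * Ymax.
  apply: (le_trans (ler_wpM2l (chiP _) (int_pow_le s40 sL))).
  rewrite mulrCA mulrC; apply: ler_pM => //.
  - by rewrite mulr_ge0 ?powR_ge0.
  - exact: powR_ge0.
  - by apply: pow_le_Ymax.
have brem1 := sub _ brem.
pose f0 x := c5 * powR (b x) (m - 2).
pose f2 x := K1 * (powR chi (1 - a) * (F2 x * powR (b x) (m - 2))).
pose f1 x := K1 * (powR chi (1 - a) * (F1 x * powR (b x) (m - 2 * a))).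
pose f3 x := K2 * (powR chi (3 - 2 * a) * (F3 x * powR (b x) (m - 2))).
pose f4 x := K2 * (powR chi (3 - 2 * a) * powR (b x) s4).
have zc (c : R) (f : T -> R) : bmeas D1 f -> bmeas D1 (fun x => c * f x) by move=> bf; exact: (bmeasM (bmeas_cst _ _) bf).
have zi (c e : R) (f : T -> R) : bmeas D1 f ->
    \int[mu]_(x in D1) (c * (e * f x)) = c * (e * \int[mu]_(x in D1) f x).
  move=> bf; apply: (etrans (bmeas_intZ mD1 fD1 c (zc e f bf))).
  by congr (_ * _); exact: bmeas_intZ.
have bf0 : bmeas D1 f0 := zc _ _ (bpw _ m20).
have bf2 : bmeas D1 f2 := zc _ _ (zc _ _ bt2).
have bf1 : bmeas D1 f1 := zc _ _ (zc _ _ bt1).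
have bf3 : bmeas D1 f3 := zc _ _ (zc _ _ bt3).
have bf4 : bmeas D1 f4 := zc _ _ (zc _ _ (bpw _ s40)).
have bR : bmeas D1 (fun x => remainder a c3 c4 chi (u x) (g x) * powR (b x) (m - 2)) by exact: (bmeasM brem1 (bpw _ m20)).
have split x : D1 x -> remainder a c3 c4 chi (u x) (g x) * powR (b x) (m - 2) <= f0 x + f2 x + f1 x + f3 x + f4 x.
  move=> Dx; have Dx' := sD Dx.
  have ps1 := psi1 Dx'; have ps0 := le_trans ler01 ps1.
  have h := remainder_split a0 a1 c30 c40 chi1 (u0 Dx') (g0 Dx') ps0 (b0 Dx') (upsi Dx') m2 c5E c3kE K1E K2E.
  apply: (le_trans h); rewrite lerD2r lerD2l /f3; apply: ler_wpM2l => //; apply: ler_wpM2l => //.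
  by apply: ler_wpM2r; [exact: powR_ge0 | exact: (ler_powR2r ps1 e64)].
have HI : \int[mu]_(x in D1) (remainder a c3 c4 chi (u x) (g x) * powR (b x) (m - 2)) <=
  c5 * (Ymax * (1 + Q)) + K1 * (M2 * (Ymax * (1 + Q))) + K1 * (M1 * (Ymax * (1 + Q))) + K2 * (M3 * (Ymax * (1 + Q)))
  + K2 * (M * powR chi ((3 - 2 * a) * xj) * (1 + Q) * Ymax).
  have bs2 := bmeasD bf0 bf2; have bs1 := bmeasD bs2 bf1; have bs3 := bmeasD bs1 bf3.
  have bs := bmeasD bs3 bf4.
  have J4 : \int[mu]_(x in D1) f4 x <= K2 * (M * powR chi ((3 - 2 * a) * xj) * (1 + Q) * Ymax).
    by rewrite /f4 (zi K2 _ _ (bpw _ s40)); exact: (ler_wpM2l K20 H6).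
  have J3 : \int[mu]_(x in D1) f3 x <= K2 * (M3 * (Ymax * (1 + Q))).
    by rewrite /f3 (zi K2 _ _ bt3); exact: (ler_wpM2l K20 H3).
  have J1 : \int[mu]_(x in D1) f1 x <= K1 * (M1 * (Ymax * (1 + Q))).
    by rewrite /f1 (zi K1 _ _ bt1); exact: (ler_wpM2l K10 H1).
  have J2 : \int[mu]_(x in D1) f2 x <= K1 * (M2 * (Ymax * (1 + Q))).
    by rewrite /f2 (zi K1 _ _ bt2); exact: (ler_wpM2l K10 H2).
  have J0 : \int[mu]_(x in D1) f0 x <= c5 * (Ymax * (1 + Q)).
    exact: (le_trans (eqr_le (bmeas_intZ mD1 fD1 c5 (bpw _ m20))) (ler_wpM2l c50 H5)).
  apply: (le_trans (bmeas_le mD1 fD1 bR bs split)).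
  have e4 := bmeas_intD mD1 fD1 bs3 bf4; have e3 := bmeas_intD mD1 fD1 bs1 bf3.
  have e1 := bmeas_intD mD1 fD1 bs2 bf1; have e2 := bmeas_intD mD1 fD1 bf0 bf2.
  have k2 := le_trans (eqr_le e2) (lerD J0 J2); have k1 := le_trans (eqr_le e1) (lerD k2 J1).
  have k3 := le_trans (eqr_le e3) (lerD k1 J3).
  exact: (le_trans (eqr_le e4) (lerD k3 J4)).
have bt4' : bmeas D1 (fun x => powR (b x) (m - 1) * dP x) by exact: (bmeasM (bpw _ m10) (sub _ bdP)).
have HJ : \int[mu]_(x in D1) (powR (b x) (m - 1) * dP x) <= M4 * (Ymax * (1 + Q)).
  apply: le_trans H4; apply: eqr_le; apply: eq_Rintegral => x _; exact: mulrC.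
have E1 := bmeas_intD mD1 fD1 (zc (m * (m - 1)) _ bR) (zc m _ bt4').
have E2 := bmeas_intZ mD1 fD1 (m * (m - 1)) bR.
have E3 := bmeas_intZ mD1 fD1 m bt4'.
have E4 := etrans E1 (f_equal2 +%R E2 E3).
apply: (le_trans (lerD (lexx (dl^-1 * \int[mu]_(x in D1) powR (b x) m)) (eqr_le E4))).
have X1 : 1 <= powR chi ((3 - 2 * a) * xj) by apply: powR_ge1 => //; exact: mulr_ge0.
exact: (sum_data_bound m2 Q0 Y0 (erefl _) X1 (erefl _) M1_ge0 M2_ge0 M3_ge0 (I_ge0 dP 3) c50 K10 K20 dl0 H0 HI HJ).
Qed.
End DataBound.

(** * Exponents in one iteration step *)

Section StepExponents.
Context (R : realType) (a lam0 kap m : R).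
Hypotheses (a0 : 0 < a) (a1 : a < 1) (l0 : 0 < lam0) (m2 : 2 < m) (kap1 : 1 < kap)
  (km : kap ^+ 2 <= 1 + lam0 - a / m).
Let s := 1 + lam0.
(** The gained exponent is m ka. Taking the root of order ka leaves the power th = s/ka on the
    energy bound; khat and mu2 are the bounds for ka and th that no longer depend on m. *)
Let ka := s - a / m.
Let th := s / ka.
Let mu2 := 1 + a / s.
Let khat := s - a / 2.

Lemma ka_gt1 : 1 < ka.
Proof.
apply: lt_le_trans km; rewrite expr2; apply: (lt_trans kap1).
by rewrite ltr_pMr// (lt_trans ltr01).
Qed.

Lemma khat_le_ka : khat <= ka.
Proof.
have a0' := a0; have m2' := m2; rewrite lerD2l lerN2 ler_pM2l// lef_pV2 ?posrE//; first exact: ltW.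
exact: lt_trans m2.
Qed.

Lemma khat_gt0 : 0 < khat.
Proof. have a1' := a1; have l0' := l0; rewrite /khat /s; lra. Qed.

Lemma th_ge1 : 1 <= th.
Proof.
have k1 := ka_gt1; have k0 : 0 < ka by exact: lt_trans k1.
by rewrite ler_pdivlMr// mul1r gerBl divr_ge0 ?ltW// (lt_trans _ m2).
Qed.

(** Multiplied out, the difference is (a/m)(m - 1 - a/s), nonnegative since m > 2 and a/s < 1. *)
Lemma th_le_mu2 : th <= mu2.
Proof.
have k1 := ka_gt1; have k0 : 0 < ka by exact: lt_trans k1.
have s1 : 1 < s by rewrite ltrDl.
have s0 : 0 < s by exact: lt_trans s1.
have m0 : 0 < m by exact: lt_trans m2.
rewrite ler_pdivrMr// /mu2 /ka -subr_ge0.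
have -> : (1 + a / s) * (s - a / m) - s = a / m * (m - 1 - a / s).
  by field; rewrite !gt_eqF.
have h : a / s < 1 by rewrite ltr_pdivrMr// mul1r; exact: lt_trans s1.
rewrite mulr_ge0 ?divr_ge0 ?(ltW a0) ?(ltW m0)//.
by move: h m2; set z := a / s => h1 h2; lra.
Qed.

Lemma th_khat : th <= s / khat.
Proof.
have s0 : 0 <= s by rewrite addr_ge0// ltW.
rewrite ler_wpM2l// lef_pV2 ?posrE ?khat_gt0//; first exact: khat_le_ka.
by apply: lt_trans ka_gt1.
Qed.

Lemma pow_base (x : R) e : 1 <= x -> e <= th -> powR x e <= powR x mu2.
Proof. by move=> x1 eth; apply: ler_powR2r => //; exact: le_trans th_le_mu2. Qed.

Lemma th_st : (m + 4 * (1 - a)) * th <= (m + 4 * (1 - a)) * (1 + a / (m - a)).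
Proof.
have a0' := a0; have a1' := a1; have m2' := m2; have l0' := l0.
have k1 := ka_gt1; have k0 : 0 < ka by exact: lt_trans k1.
have m0 : 0 < m by lra.
have ma : 0 < m - a by lra.
apply: ler_wpM2l; first by lra.
rewrite ler_pdivrMr// -subr_ge0 /ka.
have -> : (1 + a / (m - a)) * (s - a / m) - s = a / (m - a) * (s - 1).
  by field; rewrite !gt_eqF.
by rewrite mulr_ge0 ?divr_ge0 ?(ltW ma) ?(ltW a0)// /s addrAC subrr add0r ltW.
Qed.

(** The power th moves the exponents m-2 and m+4(1-a) upwards, but by [th_st] not beyond the upper
    exponent of the step; powers in between are bounded by the ends. *)
Lemma max_pow_th (y : R) : 0 <= y ->
  powR (Num.max (powR y (m - 2)) (powR y (m + 4 * (1 - a)))) th <=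
  Num.max (powR y (m - 2)) (powR y ((m + 4 * (1 - a)) * (1 + a / (m - a)))).
Proof.
move=> y0; have a0' := a0; have a1' := a1; have m2' := m2.
have m20 : 0 < m - 2 by lra.
have s40 : 0 < m + 4 * (1 - a) by lra.
have ms : m - 2 <= m + 4 * (1 - a) by lra.
have t1 := th_ge1; have t0 := lt_le_trans ltr01 t1.
set rr := m - 2 in m20 ms *; set s4 := m + 4 * (1 - a) in s40 ms *.
set st := s4 * (1 + a / (m - a)).
have h1 : rr <= rr * th by rewrite ler_peMr// ltW.
have h2 : s4 * th <= st by exact: th_st.
have h3 : rr * th <= s4 * th by rewrite ler_wpM2r// ltW.
have H z : rr <= z -> z <= st -> powR y z <= Num.max (powR y rr) (powR y st).
  move=> z1 z2; have [y_gt0|yle] := ltP 0 y; first exact: powR_interval.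
  have -> : y = 0 by apply/eqP; rewrite eq_le yle y0.
  by rewrite powR0 ?le_max ?powR_ge0// gt_eqF// (lt_le_trans m20).
have [|] := leP (powR y rr) (powR y s4) => _; rewrite -powRrM; apply: H => //.
- exact: le_trans h3.
- exact: le_trans h2.
Qed.

(** Comparing exponents, 2 ka - (2s - a) = (a/m)(m-2) >= 0. The gain m^(-a) thus compensates for the
    power th > 1 acting on m^2, so that only m^2 enters the iteration. *)
Lemma m_power : powR m (- a / ka) * powR (m ^+ 2) th <= m ^+ 2.
Proof.
have a0' := a0; have m2' := m2; have k1 := ka_gt1; have k0 : 0 < ka by exact: lt_trans k1.
have m0 : 0 < m by lra.
have m1 : 1 <= m by lra.
rewrite -{1}(powR_mulrn 2 (ltW m0)) -powRrM -powRD_gt0//.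
rewrite -[leRHS](powR_mulrn 2 (ltW m0)); apply: ler_powR2r => //.
rewrite /th mulrA -mulrDl ler_pdivrMr// /ka -subr_ge0.
have -> : 2 * (s - a / m) - (- a + 2 * s) = a / m * (m - 2) by field; rewrite gt_eqF.
by rewrite mulr_ge0 ?divr_ge0 ?(ltW a0) ?(ltW m0)//; lra.
Qed.

(** Insert the energy bound [Dv] into the gain [P] and take the root of order ka. All bases other
    than m and y are at least 1, so ka and th can be replaced by their bounds uniform in m. *)
Lemma step_bound (Q P Dv E chi cb c M dl xj y yp : R) :
  0 <= Q -> 0 <= P -> 0 <= Dv -> 1 <= E -> 1 <= chi -> 1 <= cb -> 1 <= c -> 1 <= M -> 0 < dl ->
  0 <= xj -> 0 <= y ->
  P <= 4 * E * chi * cb * powR m (- a) * powR Dv s ->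
  Dv <= m ^+ 2 * c * (1 + dl^-1) * (1 + Q) * M * powR chi ((3 - 2 * a) * xj) *
    Num.max (powR y (m - 2)) (powR y (m + 4 * (1 - a))) ->
  powR yp m <= powR P ka^-1 * (1 + Q) ->
  powR yp m <= 4 * cb * powR c mu2 * powR (E * chi) khat^-1 * m ^+ 2 * powR (1 + dl^-1) mu2 *
    powR (1 + Q) (1 + mu2) * powR M mu2 * powR (powR chi khat^-1) ((3 - 2 * a) * s * xj) *
    Num.max (powR y (m - 2)) (powR y ((m + 4 * (1 - a)) * (1 + a / (m - a)))).
Proof.
move=> Q0 P0 D0 E1 chi1 cb1 c1 M_ge1 dl0 xj0 y0 HP HD Hy.
have a0' := a0; have a1' := a1; have m2' := m2.
have k1 := ka_gt1; have k0 : 0 < ka by exact: lt_trans k1.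
have ik0 : 0 <= ka^-1 by rewrite invr_ge0 ltW.
have ik1 : ka^-1 <= 1 by rewrite invf_le1// ltW.
have kk : ka^-1 <= khat^-1 by rewrite lef_pV2 ?posrE ?khat_gt0// khat_le_ka.
have t1 := th_ge1; have t0 := ltW (lt_le_trans ltr01 t1).
have a32 : 0 <= 3 - 2 * a by lra.
have m0 : 0 <= m by lra.
have id0 : 0 <= dl^-1 by rewrite invr_ge0 ltW.
have dl1 : 1 <= 1 + dl^-1 by rewrite lerDl.
have Q1 : 1 <= 1 + Q by rewrite lerDl.
have z1 (z : R) : 1 <= z -> 0 <= z by exact: le_trans.
have Ec1 : 1 <= E * chi by rewrite -[1]mulr1 ler_pM.
have cb4 : 1 <= 4 * cb.
  have : 0 <= cb by exact: z1.
  by move=> _; lra.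
apply: (le_trans Hy).
set Y := Num.max _ _ in HD; have Y0 : 0 <= Y by rewrite le_max powR_ge0.
have B1 : powR P ka^-1 <= (4 * cb) * powR (E * chi) khat^-1 * powR m (- a / ka) * powR Dv th.
  apply: (le_trans (ler_powR2l ik0 P0 HP)).
  have -> : 4 * E * chi * cb * powR m (- a) * powR Dv s = (4 * cb) * (E * chi) * powR m (- a) * powR Dv s.
    by move: (powR _ _) (powR _ _) => u1 u2; ring.
  have e1 := powRM ka^-1 (mulr_ge0 (mulr_ge0 (z1 _ cb4) (z1 _ Ec1)) (powR_ge0 m (- a))) (powR_ge0 Dv s).
  have e2 := powRM ka^-1 (mulr_ge0 (z1 _ cb4) (z1 _ Ec1)) (powR_ge0 m (- a)).
  have e3 := powRM ka^-1 (z1 _ cb4) (z1 _ Ec1).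
  rewrite e1 e2 e3 -!powRrM; do 2 (apply: ler_wpM2r; first exact: powR_ge0).
  apply: ler_pM; try exact: powR_ge0.
    by have := ler_powR2r cb4 ik1; rewrite powRr1// (z1 _ cb4).
  exact: (ler_powR2r Ec1 kk).
have c0 := z1 _ c1; have dl0' := z1 _ dl1; have Q0' := z1 _ Q1; have M0 := z1 _ M_ge1.
have B2 : powR Dv th <= powR (m ^+ 2) th * powR c mu2 * powR (1 + dl^-1) mu2 * powR (1 + Q) mu2 * powR M mu2 *
   powR (powR chi khat^-1) ((3 - 2 * a) * s * xj) * powR Y th.
  apply: (le_trans (ler_powR2l t0 D0 HD)).
  have p0 := sqr_ge0 m; have p1 := mulr_ge0 p0 c0; have p2 := mulr_ge0 p1 dl0'; have p3 := mulr_ge0 p2 Q0'.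
  have p4 := mulr_ge0 p3 M0; have p5 := mulr_ge0 p4 (powR_ge0 chi ((3 - 2 * a) * xj)).
  have e5 := powRM th p5 Y0; have e4 := powRM th p4 (powR_ge0 chi ((3 - 2 * a) * xj)).
  have e3 := powRM th p3 M0; have e2 := powRM th p2 Q0'; have e1 := powRM th p1 dl0'; have e0 := powRM th p0 c0.
  rewrite e5 e4 e3 e2 e1 e0; apply: ler_wpM2r; first exact: powR_ge0.
  apply: ler_pM; [by rewrite !mulr_ge0 ?powR_ge0 | exact: powR_ge0 | | ].
    do 4 (apply: ler_pM; [by rewrite ?mulr_ge0 ?powR_ge0// | exact: powR_ge0 | | exact: (pow_base _ (lexx th))]).
    exact: lexx.
  rewrite -!powRrM; apply: (ler_powR2r chi1).
  have -> : khat^-1 * ((3 - 2 * a) * s * xj) = (3 - 2 * a) * xj * (s / khat) by ring.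
  by apply: ler_wpM2l; [exact: mulr_ge0 | exact: th_khat].
have B3 := max_pow_th y0; rewrite -/Y in B3.
set Y' := Num.max _ _ in B3 *.
have B4 := m_power.
have Y'0 : 0 <= Y' by rewrite le_max powR_ge0.
have qm : powR (1 + Q) (1 + mu2) = (1 + Q) * powR (1 + Q) mu2.
  by rewrite powRD_gt0 ?powRr1// (lt_le_trans ltr01).
rewrite qm.
have g1 := powR_ge0 (E * chi) khat^-1; have g2 := powR_ge0 m (- a / ka); have g3 := powR_ge0 Dv th.
have g4 := powR_ge0 (m ^+ 2) th; have g5 := powR_ge0 c mu2; have g6 := powR_ge0 (1 + dl^-1) mu2.
have g7 := powR_ge0 (1 + Q) mu2; have g8 := powR_ge0 M mu2.
have g9 := powR_ge0 (powR chi khat^-1) ((3 - 2 * a) * s * xj); have g10 := powR_ge0 Y th.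
move: B1 B2 B3 B4 g1 g2 g3 g4 g5 g6 g7 g8 g9 g10; clear HP HD Hy.
move: (powR (E * chi) khat^-1) (powR m (- a / ka)) (powR Dv th) (powR (m ^+ 2) th) (powR c mu2)
  (powR (1 + dl^-1) mu2) (powR (1 + Q) mu2) (powR M mu2)
  (powR (powR chi khat^-1) ((3 - 2 * a) * s * xj)) (powR Y th) (powR P ka^-1) => x1 x2 x3 x4 x5 x6 x7 x8 x9 x10 x11.
move=> B1 B2 B3 B4 g1 g2 g3 g4 g5 g6 g7 g8 g9 g10.
have w0 : 0 <= 4 * cb * x1 by rewrite mulr_ge0// (z1 _ cb4).
have w1 : 0 <= 4 * cb * x1 * x2 by rewrite mulr_ge0.
have w2 : 0 <= x5 * x6 * x7 * x8 * x9 by rewrite !mulr_ge0.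
have C1 : x11 <= 4 * cb * x1 * x2 * (x4 * x5 * x6 * x7 * x8 * x9 * x10).
  by apply: (le_trans B1); exact: ler_wpM2l.
have C2 : x2 * x4 * x10 <= m ^+ 2 * Y'.
  by apply: ler_pM => //; rewrite mulr_ge0.
have C3 : 4 * cb * x1 * (x5 * x6 * x7 * x8 * x9) * (x2 * x4 * x10) <= 4 * cb * x1 * (x5 * x6 * x7 * x8 * x9) * (m ^+ 2 * Y').
  by apply: ler_wpM2l => //; exact: mulr_ge0.
have C4 : x11 <= 4 * cb * x1 * (x5 * x6 * x7 * x8 * x9) * (m ^+ 2 * Y').
  apply: (le_trans C1); apply: le_trans C3; apply: eqr_le; ring.
rewrite mulrC; apply: (le_trans (ler_wpM2l Q0' C4)); apply: eqr_le; ring.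
Qed.
End StepExponents.

(** * Essential suprema in time and norms of time slices *)

(** [esssupT] is the real part of an extended real, with value 0 at infinity. The bound C excludes
    the value +oo, so the real number is a genuine almost everywhere bound. *)
Lemma esssupT_ge (R : realType) (t1 t2 C : R) (phi : R -> R) :
  (forall t, t1 < t -> t < t2 -> phi t <= C) ->
  {ae (sleb1 R), forall t, t1 < t -> t < t2 -> phi t <= esssupT t1 t2 phi}.
Proof.
move=> phiC; pose f (t : T1 R) : \bar R := if `[< t1 < t < t2 >] then (phi t)%:E else -oo%E.
have fC : (ess_sup (sleb1 R) f <= C%:E)%E.
  apply/ess_supP; apply: (@filterE _ _ (ae_filter_ringOfSetsType (sleb1 R))) => t; rewrite /f.
  by case: asboolP => [/andP[h1 h2]|_]; rewrite ?leNye// lee_fin; exact: phiC.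
apply: (@filterS _ _ (ae_filter_ringOfSetsType (sleb1 R)) _ _ _ (ess_sup_ge (sleb1 R) f)) => t.
rewrite /esssupT -/f => ft h1 h2.
have fE : f t = (phi t)%:E by rewrite /f asboolT// h1.
rewrite fE in ft; move: fC ft; rewrite -/(f) /f -/f.
change (ess_sup lebesgue_measure f) with (ess_sup (sleb1 R) f).
by case: (ess_sup (sleb1 R) f) => [e| |] //= _; rewrite lee_fin.
Qed.

Section SliceNorms.
Context (R : realType) (U : set 'rV[R]_3) (oU : open U) (bU : bounded_set U).

Lemma LpU_E q (f : 'rV[R]_3 -> R) : (forall x, U x -> 0 <= f x) ->
  LpU q U f = powR (\int[sleb3 R]_(p in U3 U) powR (f (mk3 p)) q) q^-1.
Proof.
move=> f0; apply: (congr1 (fun z => powR (fine z) q^-1)).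
by apply: eq_integral => p; rewrite inE => Up; rewrite ger0_norm// f0.
Qed.

Lemma LpU_abs q (f : 'rV[R]_3 -> R) : LpU q U (fun x => `|f x|) = LpU q U f.
Proof.
apply: (congr1 (fun z => powR (fine z) q^-1)).
by apply: eq_integral => p _; rewrite normr_id.
Qed.

Lemma LpU_bound q (f : 'rV[R]_3 -> R) M : 0 < q -> 0 <= M -> (forall x, U x -> `|f x| <= M) ->
  bmeas (U3 U) (f \o @mk3 R) ->
  LpU q U f <= powR (powR M q * fine (sleb3 R (U3 U))) q^-1.
Proof.
move=> q0 M0 fM bf; have mU := measurable_U3 oU; have fU := U3_lty oU bU.
have iq : 0 <= q^-1 by rewrite invr_ge0 ltW.
have I0 : 0 <= \int[sleb3 R]_(p in U3 U) powR `|f (mk3 p)| q by apply: Rintegral_ge0 => p _; exact: powR_ge0.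
apply: (ler_powR2l iq I0).
have E : \int[sleb3 R]_(p in U3 U) powR M q = powR M q * fine (sleb3 R (U3 U)) by rewrite Rintegral_cst.
apply: le_trans (eqr_le E).
apply: (bmeas_le mU fU (bmeas_powR (ltW q0) (bmeas_norm bf)) (bmeas_cst _ _)) => p Up.
by apply: (ler_powR2l (ltW q0) (normr_ge0 _)); exact: fM.
Qed.

Context (u Psi : 'rV[R]_3 -> R -> R) (t1 T2 T T' r : R).
Hypotheses (t1T2 : t1 <= T2) (TT' : T < T') (r0 : 0 < r) (r1 : r < 1) (r3 : 1 / 3 <= r).
Hypotheses (bu : bmeas (QT U t1 T') (fun z => u (mk3 z.1) z.2))
  (bPsi : bmeas (QT U t1 T') (fun z => Psi (mk3 z.1) z.2))
  (u0 : forall x t, U x -> T2 < t -> 0 <= u x t).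
Let ex := 2 * r / (1 - r).

(** From 1 + u <= (1 + |Psi|) + |ubar|, Minkowski in L^ex and (y+z)^2 <= 2(y^2+z^2), which is the
    factor 2; the exponent (1-r)/r equals 2/ex. Minkowski needs ex >= 1, that is r >= 1/3. *)
Lemma ae_slice_norm :
  {ae (sleb1 R), forall t, `]T2, T[%classic t ->
  powR (\int[sleb3 R]_(q in U3 U) powR (1 + u (mk3 q) t) ex) ((1 - r) / r) <=
  2 * Num.max 1 (esssupT t1 T (fun t => LpU ex U (fun x => 1 + `|Psi x t|) ^+ 2)
      + esssupT t1 T (fun t => LpU ex U (fun x => u x t - Psi x t) ^+ 2))}.
Proof.
have mU := measurable_U3 oU; have fU := U3_lty oU bU.
have r1' := r1; have r0' := r0; have r3' := r3.
have ex0 : 0 < ex by rewrite divr_gt0 ?mulr_gt0// subr_gt0.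
have ex1 : 1 <= ex by rewrite ler_pdivlMr ?subr_gt0//; lra.
have exE : ex^-1 * 2 = (1 - r) / r by rewrite /ex; field; rewrite !gt_eqF//; lra.
have sl (t : R) (f : T4 R -> R) : t1 < t -> t < T -> bmeas (QT U t1 T') f -> bmeas (U3 U) (fun q => f (q, t)).
  by move=> h1 h2 bf; apply: (bmeas_slice oU h1 _ bf); exact: lt_trans TT'.
have bn : bmeas (QT U t1 T') (fun z => 1 + `|Psi (mk3 z.1) z.2|).
  by apply: bmeasD; [exact: bmeas_cst | exact: bmeas_norm].
have bd : bmeas (QT U t1 T') (fun z => u (mk3 z.1) z.2 - Psi (mk3 z.1) z.2) by exact: bmeasB.
have bnd (h : 'rV[R]_3 -> R -> R) : bmeas (QT U t1 T') (fun z => h (mk3 z.1) z.2) ->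
    exists C, forall t, t1 < t -> t < T -> LpU ex U (h ^~ t) ^+ 2 <= C.
  move=> bh; have [_ [M hM]] := bh.
  exists (powR (powR (Num.max 0 M) ex * fine (sleb3 R (U3 U))) ex^-1 ^+ 2) => t h1 h2.
  have L0 : 0 <= LpU ex U (h ^~ t) by exact: powR_ge0.
  rewrite ler_pXn2r ?nnegrE ?powR_ge0//.
  apply: LpU_bound => //; [by rewrite le_max lexx | | exact: (sl t _ h1 h2 bh)].
  move=> x Ux; rewrite le_max; apply/orP; right.
  have [q qE] : exists q : T3 R, mk3 q = x.
    by exists ((x 0 0, x 0 1), x 0 2); apply/rowP => -[[|[|[|//]]] hj]; rewrite mxE /=; congr (x _ _); exact/val_inj.
  rewrite -qE; apply: (hM (q, t)); split; first by rewrite /U3 /= qE.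
  by rewrite /= in_itv /= h1 (lt_trans h2).
have [C1 hC1] := bnd (fun x t => 1 + `|Psi x t|) bn.
have [C2 hC2] := bnd (fun x t => u x t - Psi x t) bd.
have F := ae_filter_ringOfSetsType (sleb1 R).
suff key e1 e2 :
    {ae (sleb1 R), forall t, t1 < t -> t < T -> LpU ex U (fun x => 1 + `|Psi x t|) ^+ 2 <= e1} ->
    {ae (sleb1 R), forall t, t1 < t -> t < T -> LpU ex U (fun x => u x t - Psi x t) ^+ 2 <= e2} ->
    {ae (sleb1 R), forall t, `]T2, T[%classic t ->
      powR (\int[sleb3 R]_(q in U3 U) powR (1 + u (mk3 q) t) ex) ((1 - r) / r) <= 2 * Num.max 1 (e1 + e2)}.
  by apply: key; [exact: (esssupT_ge hC1) | exact: (esssupT_ge hC2)].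
move=> A1 A2; apply: (@filterS2 _ _ F _ _ _ _ A1 A2) => t H1 H2 It.
have [h1 h2] : t1 < t /\ t < T.
  by move: It; rewrite /= in_itv /= => /andP[h1 h2]; split => //; exact: le_lt_trans h1.
have hT2 : T2 < t by move: It; rewrite /= in_itv /= => /andP[].
have {}H1 := H1 h1 h2; have {}H2 := H2 h1 h2.
apply: (@le_trans _ _ (2 * (e1 + e2))); last by rewrite ler_wpM2l// le_max lexx orbT.
rewrite -exE; set I := \int[sleb3 R]_(q in _) _.
have iex : 0 <= ex^-1 by rewrite invr_ge0 ltW.
rewrite powRrM (powR_mulrn 2 (powR_ge0 _ _)).
rewrite LpU_E in H1; last by move=> x _; rewrite addr_ge0.
rewrite -LpU_abs LpU_E in H2; last by [].
have mk := bmeas_minkowski mU fU ex1 (sl t _ h1 h2 bn) (bmeas_norm (sl t _ h1 h2 bd))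
  (fun x _ => addr_ge0 ler01 (normr_ge0 _)) (fun x _ => normr_ge0 _).
have le1 : powR I ex^-1 <= powR (\int[sleb3 R]_(q in U3 U) powR (1 + `|Psi (mk3 q) t|) ex) ex^-1 +
   powR (\int[sleb3 R]_(q in U3 U) powR `|u (mk3 q) t - Psi (mk3 q) t| ex) ex^-1.
  apply: le_trans mk; apply: (ler_powR2l iex).
    by apply: Rintegral_ge0 => q _; exact: powR_ge0.
  apply: (bmeas_le mU fU).
  - by apply: (bmeas_powR (ltW ex0)); exact: (bmeasD (bmeas_cst _ _) (sl t _ h1 h2 bu)).
  - by apply: (bmeas_powR (ltW ex0)); exact: (bmeasD (sl t _ h1 h2 bn) (bmeas_norm (sl t _ h1 h2 bd))).
  move=> q Uq; have uq := u0 Uq hT2; apply: (ler_powR2l (ltW ex0)); first by rewrite addr_ge0.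
  rewrite -addrA lerD2l; have := ler_norm (u (mk3 q) t); rewrite -{2}(subrK (Psi (mk3 q) t) (u (mk3 q) t)).
  by move=> h; apply: (le_trans h); rewrite addrC; exact: ler_normD.
have fin (x y z : R) : 0 <= x -> x <= y + z -> y ^+ 2 <= e1 -> z ^+ 2 <= e2 -> x ^+ 2 <= 2 * (e1 + e2).
  move=> x0 xyz hy hz; apply: (@le_trans _ _ ((y + z) ^+ 2)).
    by rewrite ler_pXn2r ?nnegrE// (le_trans x0).
  have sq : (y + z) ^+ 2 <= 2 * (y ^+ 2 + z ^+ 2).
    rewrite -subr_ge0 (_ : _ - _ = (y - z) ^+ 2) ?sqr_ge0//; ring.
  by apply: (le_trans sq); rewrite ler_wpM2l// lerD.
exact: (fin _ _ _ (powR_ge0 _ _) le1 H1 H2).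
Qed.
End SliceNorms.

(** * One step of the iteration for the solution *)

Section OneStep.
Context (R : realType) (N : nat) (al aa : 'I_N.+1 -> R).
Hypotheses (N1 : (1 <= N)%N) (al0 : al 0 = 0)
  (al_mono : forall i j : 'I_N.+1, (i < j)%N -> al i < al j)
  (aa_gt0 : forall i, 0 < aa i).
Context (k : 'rV[R]_3) (k1 : vnorm k = 1).
Notation vec := 'rV[R]_3.
Notation a := (aexp al).
Context (Rs : R) (X : R -> vec -> vec) (G Om : R) (e0 : R -> vec) (U : set vec).
Hypotheses (Rs0 : 0 <= Rs) (XE : forall z y, Fmap al aa k (Rs * z) (X z y) = y)
  (G0 : 0 < G) (e01 : forall t, vnorm (e0 t) = 1) (oU : open U) (bU : bounded_set U).
Notation chi := (chistar aa Rs G Om U).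
Context (u0 : vec -> R) (psi Psi u : vec -> R -> R).
Hypotheses (solu : regular_solution X (Zfield k G Om e0) U u0 psi u)
  (u_ge0 : forall x t, U x -> 0 < t -> 0 <= u x t)
  (bdPsi : forall x t, bdry U x -> 0 < t -> Psi x t = psi x t)
  (regPsi : exists W, C1_on W Psi /\ (closure U `*` `[0, +oo[%classic) `<=` W).
Notation ub := (ubar Psi u).
Notation c3 := (powR (aa ord_max) (a - 1)).
Notation c5 := (powR 2 (- a) * c4 al aa).
Notation c3k := (c3 * powR (32 * c3 / c4 al aa) (1 - a)).
Notation K1 := (powR 2 (1 - a) * powR 4 (1 - a) * (c5 + c3k)).
Notation K2 := (powR 2 (1 - a) * powR 2 (5 - 4 * a) * c3k).

Let a0 : 0 < a. Proof. exact: aexp_gt0 N1 al0 al_mono. Qed.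
Let a1 : a < 1. Proof. exact: aexp_lt1 N1 al0 al_mono. Qed.
Let c40 : 0 < c4 al aa := c4_gt0 al aa_gt0.
Let c30 : 0 < c3. Proof. by rewrite powR_gt0. Qed.

Let c50 : 0 <= c5 := mulr_ge0 (powR_ge0 _ _) (ltW c40).
Let c3k0 : 0 <= c3k := mulr_ge0 (ltW c30) (powR_ge0 _ _).
Let K10 : 0 <= K1 := mulr_ge0 (mulr_ge0 (powR_ge0 _ _) (powR_ge0 _ _)) (addr_ge0 c50 c3k0).
Let K20 : 0 <= K2 := mulr_ge0 (mulr_ge0 (powR_ge0 _ _) (powR_ge0 _ _)) c3k0.

Let c16_ge : 1 + c5 + K1 + 2 * K2 <= 2 * c16 al aa.
Proof.
have c90 : 0 <= c5 / chi0 aa ^+ 2 := divr_ge0 c50 (sqr_ge0 _).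
exact: (c16_bound a0 a1 c30 c40 c90 (erefl c5) (erefl _) (erefl c3k) (erefl K1) (erefl K2)).
Qed.

Let c16_ge1 : 1 <= 2 * c16 al aa.
Proof.
apply: le_trans c16_ge; move: c50 K10 K20; move: c5 K1 K2 => x y z hx hy hz; lra.
Qed.

(** The exponents are regrouped so that each integral is the q_i-th power of one weight, the form in
    which Hoelder produces it. *)
Lemma Mfun_E T q : Mfun a chi U Psi 0 T q =
  1 + powR chi (1 - a) * powR (\int[sleb4 R]_(z in QT U 0 T)
        powR (powR (1 + vnorm (gradx Psi (mk3 z.1) z.2)) (2 - a)) (q 0)) (q 0)^-1
    + powR chi (1 - a) * powR (\int[sleb4 R]_(z in QT U 0 T)
        powR (powR (1 + `|Psi (mk3 z.1) z.2|) (2 * (1 - a)) * powR (1 + vnorm (gradx Psi (mk3 z.1) z.2)) (2 - a)) (q 1)) (q 1)^-1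
    + powR chi (3 - a) * powR (\int[sleb4 R]_(z in QT U 0 T)
        powR (powR (1 + `|Psi (mk3 z.1) z.2|) (2 * Num.max (2 - a) (3 - 2 * a))) (q 2)) (q 2)^-1
    + powR (\int[sleb4 R]_(z in QT U 0 T) powR `|dt Psi (mk3 z.1) z.2| (q 3)) (q 3)^-1.
Proof.
have E (h1 : vec -> R -> R) (h2 : T4 R -> R) : (forall z, h1 (mk3 z.1) z.2 = h2 z) ->
    intST (U `*` `]0, T[) h1 = \int[sleb4 R]_(z in QT U 0 T) h2 z.
  move=> h12; apply: (congr1 (@fine R)); apply: eq_integral => z _.
  exact: (congr1 (@EFin R) (h12 z)).
have G4 (A B x1 y1 x2 y2 x3 y3 x4 y4 b1 b2 b3 b4 : R) : x1 = y1 -> x2 = y2 -> x3 = y3 -> x4 = y4 ->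
    1 + A * powR x1 b1 + A * powR x2 b2 + B * powR x3 b3 + powR x4 b4 =
    1 + A * powR y1 b1 + A * powR y2 b2 + B * powR y3 b3 + powR y4 b4 by move=> -> -> -> ->.
apply: G4; apply: E => z //; rewrite ?powRM ?powR_ge0// -?powRrM//.
Qed.

Context (rs cbar kap m T1 T2 T t1 xj : R) (p q : 'I_4 -> R).
Let lam0 := (rs * (5 - a) - 3) / (3 * rs).
Hypotheses (rs0 : 0 < rs) (rs1 : rs < 1) (rs3 : 1 / 3 <= rs) (l0 : 0 < lam0)
  (sob : sobolev_const U (rs * (2 - a)) cbar)
  (kap1 : 1 < kap) (km : kap ^+ 2 <= 1 + lam0 - a / m) (m2 : 2 < m)
  (pk : forall i, 1 < p i /\ p i < kap) (pq : forall i, 1 / p i + 1 / q i = 1)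
  (T10 : 0 < T1) (T12 : T1 < T2) (T2T : T2 < T) (t10 : 0 <= t1) (t1T2 : t1 <= T2)
  (xj0 : 0 <= xj) (xj1 : xj <= 1)
  (sL : m + 4 * (1 - a) <= kap * m)
  (dE : (1 - kap^-1) * (1 - xj) <= 1 - (m + 4 * (1 - a)) / (kap * m)).

Let pw (z : T4 R) s := powR `|ub (mk3 z.1) z.2| s.
(** The averaged right-hand side with |ubar| in place of its truncation, hence independent of e. *)
Let Dv := (T2 - T1)^-1 * \int[sleb4 R]_(z in QT U T1 T) pw z m +
  \int[sleb4 R]_(z in QT U T1 T) (m * (m - 1) *
    (rem4 al aa Rs G Om U Psi u (mk3 z.1) z.2 * pw z (m - 2)) + m * (pw z (m - 1) * `|dt Psi (mk3 z.1) z.2|)).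

Let rem_ge0 x t : 0 <= rem4 al aa Rs G Om U Psi u x t.
Proof. exact: (remainder_ge0 _ _ _ _ c30 c40). Qed.

Let m0 : 0 < m. Proof. exact: lt_trans m2. Qed.
Let m10 : 0 <= m - 1. Proof. have h := m2; lra. Qed.
Let m20 : 0 <= m - 2. Proof. have h := m2; lra. Qed.
Let T0 : 0 < T. Proof. exact: lt_trans T10 (lt_trans T12 T2T). Qed.
(** Measurability is recorded up to T+1 so that the time T itself is an interior slice. *)
Let TS : T < T + 1. Proof. by rewrite ltrDl. Qed.
Let mm0 : 0 <= m * (m - 1). Proof. by rewrite mulr_ge0// ltW. Qed.

(** The energy inequality averaged over the starting time; afterwards the truncation on the right is
    bounded by |ubar|, which removes e there. *)
Let energy_cut e : 0 < e -> forall t, T2 < t -> t <= T ->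
  \int[sleb3 R]_(x in U3 U) powR (cut e (ub (mk3 x) t)) m +
  m * (m - 1) * (c4 al aa / 4 / chi) * \int[sleb4 R]_(z in QT U T2 t)
    (dissip al Psi u (mk3 z.1) z.2 * powR (cut e (ub (mk3 z.1) z.2)) (m - 2)) <= Dv.
Proof.
move=> e_gt0 t T2t tT.
have T10' := ltW T10.
have bub := bmeas_ubar oU bU solu regPsi (T + 1) T10'.
have brem := bmeas_rem4 aa N1 al0 al_mono Rs oU bU solu regPsi (T + 1) T10'.
have bdis := bmeas_dissip N1 al0 al_mono oU bU solu u_ge0 regPsi (T + 1) T10.
have bdt := bmeas_norm (bmeas_dtPsi oU bU regPsi (T + 1) T10').
have bcut s : 0 <= s -> bmeas (QT U T1 (T + 1)) (fun z => powR (cut e (ub (mk3 z.1) z.2)) s).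
  by move=> s0; exact: (bmeas_powR s0 (bmeas_cut e bub)).
have bpw s : 0 <= s -> bmeas (QT U T1 (T + 1)) (fun z => pw z s).
  by move=> s0; exact: (bmeas_powR s0 (bmeas_norm bub)).
pose n (z : T4 R) := m * (m - 1) * (rem4 al aa Rs G Om U Psi u (mk3 z.1) z.2 * powR (cut e (ub (mk3 z.1) z.2)) (m - 2))
  + m * (powR (cut e (ub (mk3 z.1) z.2)) (m - 1) * `|dt Psi (mk3 z.1) z.2|).
pose n' (z : T4 R) := m * (m - 1) * (rem4 al aa Rs G Om U Psi u (mk3 z.1) z.2 * pw z (m - 2))
  + m * (pw z (m - 1) * `|dt Psi (mk3 z.1) z.2|).
have zc (c : R) (f : T4 R -> R) : bmeas (QT U T1 (T + 1)) f -> bmeas (QT U T1 (T + 1)) (fun z => c * f z).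
  by move=> bf; exact: (bmeasM (bmeas_cst _ _) bf).
have bn : bmeas (QT U T1 (T + 1)) n.
  exact: (bmeasD (zc (m * (m - 1)) _ (bmeasM brem (bcut _ m20))) (zc m _ (bmeasM (bcut _ m10) bdt))).
have bn' : bmeas (QT U T1 (T + 1)) n'.
  exact: (bmeasD (zc (m * (m - 1)) _ (bmeasM brem (bpw _ m20))) (zc m _ (bmeasM (bpw _ m10) bdt))).
have bf := bcut m (ltW m0).
have bh := bmeasM bdis (bcut _ m20).
have h0 z : QT U T1 (T + 1) z -> 0 <= dissip al Psi u (mk3 z.1) z.2 * powR (cut e (ub (mk3 z.1) z.2)) (m - 2).
  by move=> _; rewrite !mulr_ge0 ?powR_ge0// invr_ge0 sqr_ge0.
have n0 z : QT U T1 (T + 1) z -> 0 <= n z.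
  by move=> _; rewrite addr_ge0// !mulr_ge0 ?powR_ge0 ?rem_ge0// ltW.
have c0 : 0 <= m * (m - 1) * (c4 al aa / 4 / chi).
  by rewrite mulr_ge0// !divr_ge0// ?(ltW c40)// (le_trans ler01)// chi_ge1.
have en s1 s2 : T1 < s1 -> s1 < s2 -> s2 <= T ->
    \int[sleb3 R]_(x in U3 U) powR (cut e (ub (mk3 x) s2)) m + m * (m - 1) * (c4 al aa / 4 / chi) *
    \int[sleb4 R]_(z in QT U s1 s2) (dissip al Psi u (mk3 z.1) z.2 * powR (cut e (ub (mk3 z.1) z.2)) (m - 2)) <=
    \int[sleb3 R]_(x in U3 U) powR (cut e (ub (mk3 x) s1)) m + \int[sleb4 R]_(z in QT U s1 s2) n z.
  move=> h1 h2 h3; have T1s2 := lt_trans h1 h2.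
  have s2S := le_lt_trans h3 TS; have s1S := lt_trans h2 s2S.
  exact: (energy N1 al0 al_mono aa_gt0 k1 Rs0 XE G0 e01 oU bU solu u_ge0 bdPsi regPsi e_gt0 m2
    (lt_trans T10 h1) h2 (bmeas_slice oU h1 s1S bf) (bmeas_slice oU T1s2 s2S bf)).
have avg := energy_average oU bU T12 T2T TS c0 bf bh bn (fun z => powR_ge0 _ _) h0 n0 en T2t tT.
apply: (le_trans avg).
have mQ := measurable_QT oU T1 T; have fQ := QT_lty oU bU T1 T.
have sub (f : T4 R -> R) : bmeas (QT U T1 (T + 1)) f -> bmeas (QT U T1 T) f.
  by move=> b; exact: (bmeas_QT_sub oU (lexx T1) (ltW TS) b).
have cl s z : 0 <= s -> powR (cut e (ub (mk3 z.1) z.2)) s <= pw z s.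
  by move=> s0; apply: (ler_powR2l s0); [exact: cut_ge0 | exact: (cut_le _ (ltW e_gt0))].
have d0 : 0 <= (T2 - T1)^-1 by rewrite invr_ge0 subr_ge0 ltW.
apply: lerD.
  apply: (ler_wpM2l d0); apply: (bmeas_le mQ fQ (sub _ bf) (sub _ (bpw m (ltW m0)))) => z _.
  exact: (cl m z (ltW m0)).
apply: (bmeas_le mQ fQ (sub _ bn) (sub _ bn')) => z _; rewrite /n /n'; apply: lerD.
  by apply: ler_wpM2l => //; apply: ler_wpM2l; [exact: rem_ge0 | exact: cl].
by apply: ler_wpM2l; [exact: ltW | apply: ler_wpM2r; [exact: normr_ge0 | exact: cl]].
Qed.

Let Dv0 : 0 <= Dv.
Proof.
apply: addr_ge0.
  rewrite mulr_ge0 ?invr_ge0 ?subr_ge0 ?(ltW T12)//; apply: Rintegral_ge0 => z _; exact: powR_ge0.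
apply: Rintegral_ge0 => z _.
by rewrite addr_ge0// !mulr_ge0 ?powR_ge0 ?rem_ge0// ltW.
Qed.

Let ex := 2 * rs / (1 - rs).
Let Es := Num.max 1
     (esssupT t1 T (fun t => LpU ex U (fun x => 1 + `|Psi x t|) ^+ 2)
      + esssupT t1 T (fun t => LpU ex U (fun x => u x t - Psi x t) ^+ 2)).
Let cb := Num.max 1 ((4 / c4 al aa) * powR (cbar / (2 - a)) (2 - a)).

Let gain : \int[sleb4 R]_(z in QT U T2 T) powR `|ub (mk3 z.1) z.2| (m * (1 + lam0) - a) <=
  4 * Es * chi * cb * powR m (- a) * powR Dv (1 + lam0).
Proof.
have T20 : 0 < T2 := lt_trans T10 T12.
have T20' := ltW T20.
have a0' := a0; have a1' := a1; have m2' := m2; have l0' := l0.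
have bub := bmeas_ubar oU bU solu regPsi T T20'.
have bw := bmeas_u oU bU solu T T20'.
have bg : bmeas (QT U T2 T) (fun z => vnorm (grad_ubar Psi u (mk3 z.1) z.2)).
  apply: bmeas_vnorm => i.
  exact: (bmeasB (bmeas_du oU bU solu T T20 i) (bmeas_dPsi oU bU regPsi T T20' i)).
have w0 z : QT U T2 T z -> 0 <= u (mk3 z.1) z.2.
  move=> [Uz]; rewrite /= in_itv /= => /andP[h _]; apply: u_ge0 => //; exact: lt_trans T20 h.
have Es1 : 1 <= Es by rewrite le_max lexx.
have chi1 := chi_ge1 aa Rs G Om U.
have aeE := ae_slice_norm oU bU t1T2 TS rs0 rs1 rs3 (bmeas_u oU bU solu (T + 1) t10)
  (bmeas_Psi oU bU regPsi (T + 1) t10) (fun x t Ux tt => u_ge0 Ux (lt_trans T20 tt)).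
have cb0 : 0 < cbar by case: sob.
have q0 : 0 < rs * (2 - a) by rewrite mulr_gt0// subr_gt0 (lt_trans a1')// ltr1n.
have g1 : 1 < (m - a) / (2 - a).
  have ta : 0 < 2 - a by lra.
  by rewrite ltr_pdivlMr// mul1r; lra.
have p1 : 1 <= m * (1 + lam0) - a.
  have := mulr_ge0 (ltW m0) (ltW l0); rewrite mulrDr mulr1; set z := m * lam0; lra.
have B0 : 0 <= 4 * Es * chi * cb * powR m (- a) * powR Dv (1 + lam0).
  rewrite !mulr_ge0 ?powR_ge0// ?(le_trans ler01 Es1) ?(le_trans ler01 chi1)//.
  by rewrite le_max ler01.
(* The bound does not depend on e, so it suffices to prove it for the truncations. *)
apply: (int_cut_limit oU bU bub p1 B0) => e e_gt0.
apply: (gain_cut oU bU bub bg bw (fun z => vnorm_ge0 _) w0 a0 a1 rs0 rs1 m2 cb0 chi1 c40 Es1 Dv0 l0 aeE e_gt0).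
- move=> t It; have t0 : 0 < t.
    by move: It; rewrite /= in_itv /= => /andP[h _]; exact: lt_trans h.
  have t0' := ltW t0.
  apply: (@sobolev_truncation R U oU bU (u ^~ t) (Psi ^~ t) _ _ _ _ _ _ _ e _ e_gt0 g1 _ cbar q0 sob).
  + by move=> i x cx; have [_ _ _ h _] := u_regular solu cx t0; exact: h.
  + by move=> x cx; have [h _ _ _ _] := u_regular solu cx t0; exact: (continuous_slice h).
  + by move=> i x cx; have [_ _ _ _ h] := u_regular solu cx t0; exact: (continuous_slice (h i)).
  + by move=> i x cx; have [_ _ _ h _] := Psi_regular regPsi cx t0'; exact: h.
  + by move=> x cx; have [h _ _ _ _] := Psi_regular regPsi cx t0'; exact: (continuous_slice h).
  + by move=> i x cx; have [_ _ _ _ h] := Psi_regular regPsi cx t0'; exact: (continuous_slice (h i)).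
  + by move=> x bx; case: solu => _ [_ [_ [_ bdu]]]; rewrite bdu// bdPsi.
- move=> t; rewrite /= in_itv /= => /andP[h1 h2].
  have E := energy_cut e_gt0 h1 (ltW h2); apply: le_trans E; rewrite lerDl mulr_ge0//.
    by rewrite mulr_ge0// !divr_ge0// ?(ltW c40)// (le_trans ler01).
  by apply: Rintegral_ge0 => z _; rewrite !mulr_ge0 ?powR_ge0// invr_ge0 sqr_ge0.
have E := energy_cut e_gt0 T2T (lexx T); apply: le_trans E; rewrite lerDr.
by apply: Rintegral_ge0 => x _; exact: powR_ge0.
Qed.

Let Q := T * volU U.
Let QE : fine (sleb4 R (QT U 0 T)) = Q.
Proof. by rewrite QT_vol ?subr0// ltW. Qed.

Let Yn T' s := powR (\int[sleb4 R]_(z in QT U T' T) pw z s) s^-1.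

Let data : Dv <= m ^+ 2 * (2 * c16 al aa) * (1 + (T2 - T1)^-1) * (1 + Q) * Mfun a chi U Psi 0 T q *
  powR chi ((3 - 2 * a) * xj) *
  Num.max (powR (Yn T1 (kap * m)) (m - 2)) (powR (Yn T1 (kap * m)) (m + 4 * (1 - a))).
Proof.
have L0 : 0 < kap * m by rewrite mulr_gt0// (lt_trans ltr01).
have dl0 : 0 < T2 - T1 by rewrite subr_gt0.
have bub := bmeas_norm (bmeas_ubar oU bU solu regPsi T (lexx 0)).
have bg := bmeas_gradPsi oU bU regPsi T (lexx 0).
have bps := bmeasD (bmeas_cst (QT U 0 T) (1 : R)) (bmeas_norm (bmeas_Psi oU bU regPsi T (lexx 0))).
have bdt := bmeas_norm (bmeas_dtPsi oU bU regPsi T (lexx 0)).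
have brem := bmeas_rem4 aa N1 al0 al_mono Rs oU bU solu regPsi T (lexx 0).
have u00 z : QT U 0 T z -> 0 <= u (mk3 z.1) z.2.
  by move=> [Uz]; rewrite /= in_itv /= => /andP[h _]; exact: u_ge0.
have up z : QT U 0 T z -> 1 + u (mk3 z.1) z.2 <= 1 + `|Psi (mk3 z.1) z.2| + `|ub (mk3 z.1) z.2|.
  move=> Qz; rewrite -addrA lerD2l /ubar; move: (u _ _) (Psi _ _) => x y.
  apply: (le_trans (ler_norm x)); rewrite -{1}(subrK y x) addrC; exact: ler_normD.
have H := @data_bound _ _ R (sleb4 R) _ _ (measurable_QT oU 0 T) (QT_lty oU bU 0 T) (measurable_QT oU T1 T)
  (QT_sub (ltW T10) (lexx T)) _ bub (fun z _ => normr_ge0 _) _ L0 a kap m chi xj c3 (c4 al aa) (T2 - T1) p q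
  (fun z => u (mk3 z.1) z.2) (fun z => vnorm (gradx Psi (mk3 z.1) z.2)) (fun z => 1 + `|Psi (mk3 z.1) z.2|)
  (fun z => `|dt Psi (mk3 z.1) z.2|) a0 a1 kap1 m2 (erefl _) (chi_ge1 aa Rs G Om U) c30 c40 dl0 xj0 xj1 pk pq
  sL dE bg bps bdt u00 (fun z _ => vnorm_ge0 _) (fun z _ => ler_wpDr (normr_ge0 _) (lexx 1)) (fun z _ => normr_ge0 _) up
  _ _ _ _ (erefl c5) (erefl c3k) (erefl K1) (erefl K2) brem.
apply: (le_trans H); rewrite QE -Mfun_E.
have Q0 : 0 <= 1 + Q by rewrite -QE addr_ge0// fine_ge0.
have M0 : 0 <= Mfun a chi U Psi 0 T q.
  by rewrite Mfun_E !addr_ge0// ?mulr_ge0 ?powR_ge0.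
have d1 : 0 <= 1 + (T2 - T1)^-1 by rewrite addr_ge0// invr_ge0 ltW.
do 5 (apply: ler_wpM2r; first by rewrite ?le_max ?powR_ge0).
exact: (ler_wpM2l (sqr_ge0 m) c16_ge).
Qed.

(** The gained exponent m ka is at least kap^2 m, so Hoelder passes to the L^(kap^2 m) norm at the
    price of a factor 1 + Q; [step_bound] then combines the gain with the bound for [Dv]. *)
Lemma one_step :
  powR (Yn T2 (kap ^+ 2 * m)) m <= 4 * cb * powR (2 * c16 al aa) (1 + a / (1 + lam0)) *
    powR (Es * chi) (1 + lam0 - a / 2)^-1 * m ^+ 2 * powR (1 + (T2 - T1)^-1) (1 + a / (1 + lam0)) *
    powR (1 + Q) (1 + (1 + a / (1 + lam0))) * powR (Mfun a chi U Psi 0 T q) (1 + a / (1 + lam0)) *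
    powR (powR chi (1 + lam0 - a / 2)^-1) ((3 - 2 * a) * (1 + lam0) * xj) *
    Num.max (powR (Yn T1 (kap * m)) (m - 2))
      (powR (Yn T1 (kap * m)) ((m + 4 * (1 - a)) * (1 + a / (m - a)))).
Proof.
have a0' := a0; have m2' := m2.
pose P := \int[sleb4 R]_(z in QT U T2 T) powR `|ub (mk3 z.1) z.2| (m * (1 + lam0) - a).
have P0 : 0 <= P by apply: Rintegral_ge0 => z _; exact: powR_ge0.
have Q0 : 0 <= Q by rewrite -QE fine_ge0.
have Es1 : 1 <= Es by rewrite le_max lexx.
have cb1 : 1 <= cb by rewrite le_max lexx.
have chi1 := chi_ge1 aa Rs G Om U.
have M_ge1 : 1 <= Mfun a chi U Psi 0 T q.
  by rewrite Mfun_E -!addrA lerDl !addr_ge0// ?mulr_ge0 ?powR_ge0.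
have c1 := c16_ge1.
have dl0 : 0 < T2 - T1 by rewrite subr_gt0.
have k0 := lt_trans ltr01 kap1.
have kk0 : 0 < kap ^+ 2 by rewrite exprn_gt0.
have ka1 := @ka_gt1 R a lam0 kap m kap1 km.
have mk : m * (1 + lam0) - a = m * (1 + lam0 - a / m) by rewrite (mulrBr m) mulrCA mulfV ?mulr1 ?gt_eqF.
have km' := km.
set ka := 1 + lam0 - a / m in km' ka1 mk.
have ka0 : 0 < ka := lt_trans ltr01 ka1.
apply: (@step_bound R a lam0 kap m a0 a1 l0 m2 kap1 km Q P Dv Es chi cb (2 * c16 al aa)
  (Mfun a chi U Psi 0 T q) (T2 - T1) xj (Yn T1 (kap * m))) => //; first exact: powR_ge0.
have bub := bmeas_norm (bmeas_ubar oU bU solu regPsi T (ltW (lt_trans T10 T12))).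
have s0 : 0 <= kap ^+ 2 * m by rewrite mulr_ge0// ltW// m0.
have sr : kap ^+ 2 * m <= m * ka by rewrite mulrC; exact: (ler_wpM2l (ltW m0) km').
have r0 : 0 < m * ka by rewrite mulr_gt0 ?m0.
have B := bmeas_pow_le (measurable_QT oU T2 T) (QT_lty oU bU T2 T) s0 sr r0 bub (fun z _ => normr_ge0 _).
rewrite /Yn -powRrM.
have e1 : (kap ^+ 2 * m)^-1 * m = (kap ^+ 2)^-1 by rewrite invfM -mulrA mulVf ?mulr1 ?gt_eqF ?m0.
rewrite e1.
have ik : 0 <= (kap ^+ 2)^-1 by rewrite invr_ge0 ltW.
have I0 : 0 <= \int[sleb4 R]_(z in QT U T2 T) pw z (kap ^+ 2 * m).
  by apply: Rintegral_ge0 => z _; exact: powR_ge0.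
apply: (le_trans (ler_powR2l ik I0 B)).
have -> : \int[sleb4 R]_(z in QT U T2 T) powR `|ub (mk3 z.1) z.2| (m * ka) = P by rewrite /P mk.
have e2 := powRM (kap ^+ 2)^-1 (powR_ge0 P (kap ^+ 2 * m / (m * ka)))
  (powR_ge0 (fine (sleb4 R (QT U T2 T))) (1 - kap ^+ 2 * m / (m * ka))).
rewrite e2 -!powRrM.
have e3 : kap ^+ 2 * m / (m * ka) = kap ^+ 2 / ka by field; rewrite !gt_eqF ?m0.
have e4 : kap ^+ 2 / ka / kap ^+ 2 = ka^-1 by field; rewrite !gt_eqF.
rewrite e3 e4; apply: ler_wpM2l; first exact: powR_ge0.
have kle : kap ^+ 2 / ka <= 1 by rewrite (ler_pdivrMr _ _ ka0) mul1r.
have x0 : 0 <= (1 - kap ^+ 2 / ka) / kap ^+ 2 by rewrite divr_ge0 ?subr_ge0// ltW.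
have x1 : (1 - kap ^+ 2 / ka) / kap ^+ 2 <= 1.
  rewrite ler_pdivrMr// mul1r; apply: (@le_trans _ _ 1); first by rewrite gerBl divr_ge0 ?ltW.
  by rewrite exprn_ege1// ltW.
have f0 : 0 <= fine (sleb4 R (QT U T2 T)) by rewrite fine_ge0.
apply: (le_trans (powR_le_1D f0 x0 x1)); rewrite lerD2l QT_vol ?(ltW T2T)//.
have v0 : 0 <= volU U by rewrite fine_ge0.
by rewrite /Q ler_wpM2r// gerBl (ltW (lt_trans T10 T12)).
Qed.
End OneStep.

(** * The essential supremum from norms of unbounded order *)

Section EssentialSup.
Context (R : realType) (U : set 'rV[R]_3) (oU : open U) (bU : bounded_set U).
Context (h : 'rV[R]_3 -> R -> R) (c e B : R) (s : nat -> R).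
Hypotheses (bh : bmeas (QT U c e) (fun z => h (mk3 z.1) z.2)) (B0 : 0 <= B)
  (s0 : forall n, 0 < s n) (s_unbounded : forall C, exists n, C < s n)
  (normB : forall n, powR (\int[sleb4 R]_(z in QT U c e) powR `|h (mk3 z.1) z.2| (s n)) (s n)^-1 <= B).

Let E (d : R) : set (T4 R) := QT U c e `&` [set z | d <= `|h (mk3 z.1) z.2|].

Let mE d : measurable (E d).
Proof.
have [mh _] := bmeas_norm bh.
have := mh (measurable_QT oU c e) `[d, +oo[%classic (measurable_itv _).
by congr measurable; apply/seteqP; split => z [Qz /=]; rewrite in_itv /= andbT.
Qed.

(** Chebyshev: d^(s_n) times the measure of the superlevel set is at most B^(s_n). Since d > B and
    s_n is unbounded, a positive measure is impossible. *)
Lemma superlevel_null d : B < d -> sleb4 R (E d) = 0%E.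
Proof.
move=> Bd; have mQ := measurable_QT oU c e; have fQ := QT_lty oU bU c e.
have d0 : 0 < d by exact: le_lt_trans Bd.
have sub : E d `<=` QT U c e by move=> z [].
have fE : (sleb4 R (E d) < +oo)%E.
  by apply: le_lt_trans fQ; apply: le_measure => //; rewrite inE.
have finE : sleb4 R (E d) \is a fin_num by rewrite ge0_fin_numE.
apply/eqP; rewrite -(fineK finE) eqe; apply/eqP/le_anti; rewrite fine_ge0// andbT leNgt.
apply/negP => m0; set m := fine _ in m0.
have key n : powR d (s n) * m <= powR B (s n).
  have sn := s0 n; have sn' := ltW sn.
  have bp : bmeas (QT U c e) (fun z => powR `|h (mk3 z.1) z.2| (s n)) by exact: (bmeas_powR sn' (bmeas_norm bh)).
  have i1 := bmeas_subset mQ fQ (mE d) sub bp (fun z _ => powR_ge0 _ _).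
  have bp1 := bmeas_sub mQ (mE d) sub bp.
  have i2 : \int[sleb4 R]_(z in E d) powR d (s n) <= \int[sleb4 R]_(z in E d) powR `|h (mk3 z.1) z.2| (s n).
    apply: (bmeas_le (mE d) fE (bmeas_cst _ _) bp1) => z [_ /= dz].
    exact: (ler_powR2l sn' (ltW d0) dz).
  have i3 : \int[sleb4 R]_(z in E d) powR d (s n) = powR d (s n) * m by rewrite Rintegral_cst.
  have i4 := le_trans (eqr_le (esym i3)) (le_trans i2 i1).
  apply: (le_trans i4).
  have I0 : 0 <= \int[sleb4 R]_(z in QT U c e) powR `|h (mk3 z.1) z.2| (s n).
    by apply: Rintegral_ge0 => z _; exact: powR_ge0.
  have i5 := ler_powR2l sn' (powR_ge0 _ _) (normB n).
  by rewrite -powRrM mulVf ?gt_eqF// powRr1 in i5.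
have [B_gt0|Bn] := ltP 0 B; last first.
  have Bz : B = 0 by apply/eqP; rewrite eq_le Bn B0.
  have := key 0%N; rewrite Bz powR0 ?gt_eqF// leNgt => /negP; apply.
  by rewrite mulr_gt0// powR_gt0.
have q1 : 1 < d / B by rewrite ltr_pdivlMr// mul1r.
have q0 : 0 < d / B by exact: lt_trans q1.
have l0 : 0 < ln (d / B) by rewrite ln_gt0.
(* This s_n makes (d/B)^(s_n) exceed the reciprocal of the measure. *)
have [n hn] := s_unbounded (ln m^-1 / ln (d / B)).
have k : powR (d / B) (s n) <= m^-1.
  rewrite -(ler_pM2r m0) mulVf ?gt_eqF//.
  rewrite powRM ?invr_ge0 ?(ltW d0) ?(ltW B_gt0)// -powR_inv1 ?(ltW B_gt0)// -powRrM mulN1r powRN.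
  by rewrite mulrAC ler_pdivrMr ?powR_gt0// mul1r.
have lk : ln (powR (d / B) (s n)) <= ln m^-1 by rewrite ler_ln// posrE ?powR_gt0// invr_gt0.
rewrite ln_powR -ler_pdivlMr// in lk.
by move: (lt_le_trans hn lk); rewrite ltxx.
Qed.

(** The set where |h| > B is the countable union of the superlevel sets at heights B + 1/(n+1). *)
Lemma LinfST_le : LinfST (U `*` `]c, e[) h <= B.
Proof.
rewrite /LinfST; set f := (fun z => _).
have H : (ess_sup (sleb4 R) f <= B%:E)%E.
  apply/ess_supP.
  have N : (sleb4 R).-negligible (\bigcup_n E (B + n.+1%:R^-1)).
    apply: negligible_bigcup => n; exists (E (B + n.+1%:R^-1)); split => //.
    by apply: superlevel_null; rewrite ltrDl invr_gt0.
  apply: negligibleS N => z /= nz.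
  have Qz : QT U c e z.
    apply: contrapT => nQ; apply: nz; rewrite /f; case: asboolP => [[Uz Iz]|_]; last exact: leNye.
    by case: nQ; split.
  have Bz : B < `|h (mk3 z.1) z.2|.
    rewrite ltNge; apply/negP => le; apply: nz; rewrite /f; case: asboolP => _; last exact: leNye.
    by rewrite lee_fin.
  pose del := `|h (mk3 z.1) z.2| - B.
  have del0 : 0 < del by rewrite subr_gt0.
  exists (Num.truncn del^-1) => //; split => //=.
  have t := truncnS_gt del^-1; set N := (Num.truncn del^-1).+1 in t *.
  rewrite addrC -lerBrDr -/del -(lef_pV2 (x := del)) ?posrE ?invr_gt0// invrK.
  exact: ltW.
change (fine (ess_sup (sleb4 R) f) <= B).
(* The value +oo is excluded by the bound, and for -oo the real part is 0, at most B. *)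
by move: H; case: (ess_sup (sleb4 R) f) => [x| |] //=; rewrite lee_fin.
Qed.
End EssentialSup.

(** * Constants of the iteration *)

Section IterationConstants.
Context (R : realType).

Lemma expr_unbounded (kap alpha : R) : 1 < kap -> 0 < alpha -> forall C, exists n, C < kap ^+ n.+1 * alpha.
Proof.
move=> k1 al0 C.
have k0 : 0 < kap by exact: lt_trans k1.
have B n : 1 + n%:R * (kap - 1) <= kap ^+ n.
  elim: n => [|n ih]; first by rewrite mul0r addr0 expr0.
  have h : 0 <= n%:R * (kap - 1) ^+ 2 by rewrite mulr_ge0 ?sqr_ge0.
  rewrite exprS; apply: le_trans (ler_wpM2l (ltW k0) ih).
  rewrite -subr_ge0 -natr1; move: h; generalize (n%:R : R) => N h.
  by rewrite (_ : _ - _ = N * (kap - 1) ^+ 2)//; ring.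
pose y := `|C| / (alpha * (kap - 1)).
have d0 : 0 < alpha * (kap - 1) by rewrite mulr_gt0// subr_gt0.
exists (Num.truncn y); have := truncnS_gt y; set n := (Num.truncn y).+1 => yn.
apply: (@lt_le_trans _ _ ((1 + n%:R * (kap - 1)) * alpha)); last by rewrite ler_wpM2r ?B// ltW.
apply: (le_lt_trans (ler_norm C)).
have h : `|C| < n%:R * (alpha * (kap - 1)) by rewrite -ltr_pdivrMr.
apply: (lt_trans h); rewrite mulrDl mul1r (_ : n%:R * (kap - 1) * alpha = n%:R * (alpha * (kap - 1))) ?ltrDr//.
by rewrite -mulrA (mulrC (kap - 1)).
Qed.

Context (a r kap : R).
Let lam0 := (r * (5 - a) - 3) / (3 * r).
Hypotheses (a0 : 0 < a) (a1 : a < 1) (rl : 3 / (5 - a) < r) (r1 : r < 1)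
  (kap1 : 1 < kap) (kapS : kap < Num.sqrt (1 + lam0)).

Lemma r_gt0 : 0 < r.
Proof. have h := a1; apply: lt_trans rl; rewrite divr_gt0//; lra. Qed.

Lemma r_ge13 : 1 / 3 <= r.
Proof.
have h := a1; have h0 := a0; apply: ltW; apply: lt_trans rl.
rewrite ltr_pdivlMr; lra.
Qed.

Lemma lam0_pos : 0 < lam0.
Proof.
have h := a1; have h0 := a0; have r0 := r_gt0.
have rr := rl; rewrite ltr_pdivrMr in rr; last lra.
by rewrite divr_gt0 ?mulr_gt0// subr_gt0.
Qed.

Lemma lam0_le : lam0 <= (2 - a) / 3.
Proof.
have r0 := r_gt0; rewrite ler_pdivrMr ?mulr_gt0// -subr_ge0.
rewrite (_ : _ - _ = 3 * (1 - r)); last by field.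
by rewrite mulr_ge0// subr_ge0 ltW.
Qed.

Lemma kap_sqr_lt : kap ^+ 2 < 1 + lam0.
Proof.
have l0 := lam0_pos; have k1 := kap1.
have s0 : 0 <= 1 + lam0 by rewrite addr_ge0// ltW.
rewrite -[ltRHS](sqr_sqrtr s0) ltr_pXn2r// nnegrE ?sqrtr_ge0// ltW//; exact: lt_trans k1.
Qed.

Lemma chi_exponent_bound : (3 - 2 * a) * (1 + lam0) * (1 - kap^-1) <= kap^-1 * (1 + kap^-1).
Proof.
have h0 := a0; have h1 := a1; have k1 := kap1; have l0 := lam0_pos; have ll := lam0_le; have kS := kap_sqr_lt.
have k0 : 0 < kap by lra.
have k2 : 0 < kap ^+ 2 by rewrite exprn_gt0.
rewrite -(ler_pM2l k2).
have -> : kap ^+ 2 * ((3 - 2 * a) * (1 + lam0) * (1 - kap^-1)) = (3 - 2 * a) * (1 + lam0) * (kap * (kap - 1)).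
  by field; rewrite gt_eqF.
have -> : kap ^+ 2 * (kap^-1 * (1 + kap^-1)) = kap + 1 by field; rewrite gt_eqF.
have kk : 0 < kap + 1 by lra.
have SS : (3 - 2 * a) * (1 + lam0) * lam0 <= 4.
  have t0 : 0 <= 3 - 2 * a by lra.
  have t1 : 3 - 2 * a <= 3 by lra.
  have t2 : (1 + lam0) * lam0 <= 5 / 3 * (2 / 3) by apply: ler_pM; lra.
  rewrite -mulrA; apply: (@le_trans _ _ (3 * (5 / 3 * (2 / 3)))); last by lra.
  apply: ler_pM => //; rewrite mulr_ge0//; lra.
rewrite -(ler_pM2r kk).
have c0 : 0 <= (3 - 2 * a) * (1 + lam0) by rewrite mulr_ge0; lra.
have e1 : (3 - 2 * a) * (1 + lam0) * (kap * (kap - 1)) * (kap + 1) =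
   kap * ((3 - 2 * a) * (1 + lam0) * (kap ^+ 2 - 1)) by ring.
rewrite e1.
have e2 : (3 - 2 * a) * (1 + lam0) * (kap ^+ 2 - 1) <= 4.
  apply: le_trans SS; apply: ler_wpM2l => //; lra.
apply: (le_trans (ler_wpM2l (ltW k0) e2)).
rewrite -subr_ge0 (_ : _ - _ = (kap - 1) ^+ 2) ?sqr_ge0//; ring.
Qed.

Let mu2 := 1 + a / (1 + lam0).
Let mu3 := 2 + a / (1 + lam0).

Lemma mu2_bounds : [/\ 1 <= mu2, mu2 <= 2 & mu3 = mu2 + 1].
Proof.
have l0 := lam0_pos; have s0 : 0 < 1 + lam0 by rewrite addr_gt0.
have h : a / (1 + lam0) <= 1.
  by rewrite ler_pdivrMr// mul1r; have h1 := a1; lra.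
have h' : 0 <= a / (1 + lam0) := divr_ge0 (ltW a0) (ltW s0).
by split; rewrite /mu2 /mu3; move: (a / (1 + lam0)) h h' => z *; lra.
Qed.

(** Separates the dependence on j. The square of beta_j contributes kap^(2j), the dyadic time step
    2^(j mu2), and both are covered by the j-th power of (2 kap)^mu3, since mu3 >= 2 and mu3 >=
    mu2. *)
Lemma step_constant (j : nat) (c alpha0 S : R) : 1 <= c -> 1 <= alpha0 -> 0 < S ->
  4 * powR (2 * c) mu2 * (kap ^+ j * alpha0) ^+ 2 * powR (1 + (S * (2 ^- (j.+2)))^-1) mu2 <=
  powR (2 * kap) mu3 * powR 2 (4 + 1 / r) * c ^+ 2 * powR alpha0 mu3 * powR (1 + 1 / S) mu2 *
    powR (2 * kap) mu3 ^+ j.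
Proof.
move=> c1 al1 S0; have [m1 m2 m3] := mu2_bounds; have k1 := kap1; have r0 := r_gt0; have r1' := r1.
have k0 : 0 < kap by lra.
have c0 : 0 <= c by lra.
have al0 : 0 < alpha0 by lra.
have m0 : 0 <= mu2 by lra.
have r2 : 1 <= 1 / r by rewrite (ler_pdivlMr _ _ r0) mul1r; exact: ltW.
have iS : 0 <= S^-1 by rewrite invr_ge0 ltW.
have p2 : (0 : R) < 2 by [].
have e0 : powR (2 * c) mu2 = powR 2 mu2 * powR c mu2 by rewrite powRM.
have e1 : powR c mu2 <= c ^+ 2 by rewrite -powR_mulrn//; exact: ler_powR2r.
have e2 : (kap ^+ j * alpha0) ^+ 2 <= powR (kap ^+ j) mu3 * powR alpha0 mu3.
  rewrite exprMn; have h : 2 <= mu3 by lra.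
  have kj : 1 <= kap ^+ j by rewrite exprn_ege1// ltW.
  have kj0 : 0 <= kap ^+ j by rewrite (le_trans ler01).
  apply: ler_pM; try exact: sqr_ge0.
    by rewrite -(powR_mulrn 2 kj0); exact: ler_powR2r.
  by rewrite -(powR_mulrn 2 (ltW al0)); exact: ler_powR2r.
have e3 : powR (1 + (S * 2 ^- j.+2)^-1) mu2 <= powR 2 (j.+2%:R * mu2) * powR (1 + 1 / S) mu2.
  rewrite powRrM powR_mulrn// -powRM ?exprn_ge0 ?addr_ge0 ?divr_ge0 ?(ltW S0)//.
  apply: ler_powR2l => //; first by rewrite addr_ge0// invr_ge0 mulr_ge0 ?(ltW S0)// invr_ge0 exprn_ge0.
  rewrite invfM invrK div1r mulrC mulrDr mulr1 lerD2r.
  by rewrite exprn_ege1 ?ler1n.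
(* Comparing exponents of 2, the part free of j needs 2 mu2 <= 3 + 1/r, true because mu2 <= 2 and r
   < 1. *)
have e4 : 4 * powR 2 mu2 * powR 2 (j.+2%:R * mu2) <= powR 2 mu3 * powR 2 (4 + 1 / r) * powR 2 (j%:R * mu3).
  have -> : 4 * powR 2 mu2 = powR 2 (2 + mu2) by rewrite (powRD_gt0 2 mu2 p2) powR_mulrn// -natrX.
  rewrite -!(powRD_gt0 _ _ p2); apply: ler_powR2r; first by rewrite ler1n.
  have -> : (j.+2%:R : R) = j%:R + 2 by rewrite -addn2 natrD.
  have : 0 <= (j%:R : R) by [].
  rewrite m3; move: r2 m2; move: (1 / r) (j%:R : R) mu2 => ir n mu hir hmu n0.
  by rewrite !mulrDl !mulrDr; move: (n * mu) => nm; lra.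
have e5 : powR (2 * kap) mu3 ^+ j = powR 2 (j%:R * mu3) * powR (kap ^+ j) mu3.
  rewrite (powRM mu3 (ltW p2) (ltW k0)) exprMn.
  rewrite -(powR_mulrn j (powR_ge0 2 mu3)) -(powR_mulrn j (powR_ge0 kap mu3)) -!powRrM (mulrC mu3).
  by rewrite [X in _ * X]powRrM (powR_mulrn j (ltW k0)).
have e6 : powR 2 mu3 <= powR (2 * kap) mu3.
  by apply: ler_powR2l; [lra | | lra].
have q1 := powR_ge0 2 mu2; have q2 := powR_ge0 2 (j.+2%:R * mu2); have q3 := powR_ge0 (1 + 1 / S) mu2.
have q4 := powR_ge0 (kap ^+ j) mu3; have q5 := powR_ge0 alpha0 mu3; have q6 := powR_ge0 2 (4 + 1 / r).
have q7 := powR_ge0 2 (j%:R * mu3); have q8 := powR_ge0 2 mu3; have q9 := powR_ge0 c mu2.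
have q10 := powR_ge0 (1 + (S * 2 ^- j.+2)^-1) mu2.
rewrite e0 e5; move: e1 e2 e3 e4 e6 q1 q2 q3 q4 q5 q6 q7 q8 q9 q10.
move: (powR 2 mu2) (powR 2 (j.+2%:R * mu2)) (powR (1 + 1 / S) mu2) (powR (kap ^+ j) mu3) (powR alpha0 mu3)
  (powR 2 (4 + 1 / r)) (powR 2 (j%:R * mu3)) (powR 2 mu3) (powR c mu2) (powR (1 + (S * 2 ^- j.+2)^-1) mu2)
  (powR (2 * kap) mu3) (sqr_ge0 (kap ^+ j * alpha0)) (sqr_ge0 c).
move: ((kap ^+ j * alpha0) ^+ 2) (c ^+ 2) => y cc x1 x2 x3 x4 x5 x6 x7 x8 x9 x10 x11 y0 cc0.
move=> e1 e2 e3 e4 e6 q1 q2 q3 q4 q5 q6 q7 q8 q9 q10.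
apply: (@le_trans _ _ ((4 * x1 * x2) * cc * (x4 * x5) * x3)).
  rewrite (_ : 4 * (x1 * x9) * y * x10 = (4 * x1) * (x9 * (y * x10))); last by ring.
  rewrite (_ : 4 * x1 * x2 * cc * (x4 * x5) * x3 = (4 * x1) * (cc * ((x4 * x5) * (x2 * x3)))); last by ring.
  apply: ler_wpM2l; first by rewrite mulr_ge0.
  by apply: ler_pM => //; [exact: mulr_ge0 | exact: ler_pM].
apply: (@le_trans _ _ ((x11 * x6 * x7) * cc * (x4 * x5) * x3)); last by apply: eqr_le; ring.
do 3 (apply: ler_wpM2r; first by rewrite ?mulr_ge0).
apply: (le_trans e4); do 2 (apply: ler_wpM2r => //).
Qed.
End IterationConstants.

Lemma c16_ge1 (R : realType) (N : nat) (al aa : 'I_N.+1 -> R) :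
  (forall i, 0 < aa i) -> 1 <= c16 al aa.
Proof.
move=> aa0; have c40 := ltW (c4_gt0 al aa0); have P := @powR_ge0 R; rewrite /c16.
have h3 := P (aa ord_max) (aexp al - 1); have h2 := P 2 (- aexp al).
have h4 := P 4 (1 - aexp al).
have hk := P (32 * powR (aa ord_max) (aexp al - 1) / c4 al aa) (1 - aexp al).
have hc : 0 <= (chi0 aa ^+ 2)^-1 by rewrite invr_ge0 sqr_ge0.
move: c40 h2 h3 h4 hk hc.
move: (powR 2 _) (powR 4 _) (powR (32 * _ / _) _) (chi0 aa ^+ 2)^-1 => x y z w.
move: (powR (aa ord_max) _) (c4 al aa) => c3 c c40 h2 h3 h4 hk hc.
have p1 : 0 <= y * (x * c) by rewrite !mulr_ge0.
have p2 : 0 <= x * c * w by rewrite !mulr_ge0.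
have p3 : 0 <= 2 * c3 * z by rewrite !mulr_ge0.
have p4 : 0 <= 2 * y * c3 * (1 + z) by rewrite !mulr_ge0// addr_ge0.
have p5 : 0 <= c / 4 by rewrite divr_ge0.
move: p1 p2 p3 p4 p5; move: (y * (x * c)) (x * c * w) (2 * c3 * z) (2 * y * c3 * (1 + z)) (c / 4) => *; lra.
Qed.

Lemma Mfun_ge1 (R : realType) (a chis : R) U Psi (T' T : R) q : 1 <= Mfun a chis U Psi T' T q.
Proof.
have H (x1 x2 x3 x4 : R) : 0 <= x1 -> 0 <= x2 -> 0 <= x3 -> 0 <= x4 -> 1 <= 1 + x1 + x2 + x3 + x4.
  by move=> h1 h2 h3 h4; have [] := le_sum_parts h1 h2 h3 h4.
apply: H; last exact: powR_ge0.
- exact: (mulr_ge0 (powR_ge0 _ _) (powR_ge0 _ _)).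
- exact: (mulr_ge0 (powR_ge0 _ _) (powR_ge0 _ _)).
- exact: (mulr_ge0 (powR_ge0 _ _) (powR_ge0 _ _)).
Qed.

(** * Assembly of the bound *)

Lemma assemble_factors (R : realType) (P two cb c2 al ch S1 q m e b2 d cm Pn x Y Y' : R) :
  0 <= cb -> 0 <= q -> 0 <= m -> 0 <= e -> 0 <= ch -> 0 <= x -> 0 <= Y' ->
  0 <= cm -> 0 <= b2 -> 0 <= d ->
  4 * cm * b2 * d <= P * two * c2 * al * S1 * Pn -> Y' <= Y ->
  4 * cb * cm * (e * ch) * b2 * d * q * m * x * Y' <=
  P * (two * cb * c2) * al * ch * S1 * q * m * e * Pn * x * Y.
Proof.
move=> h1 h2 h3 h4 h5 h6 h7 h8 h9 h10 C YY.
have z0 : 0 <= cb * e * ch * q * m * x by rewrite !mulr_ge0.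
have c0 : 0 <= 4 * cm * b2 * d by rewrite !mulr_ge0.
have -> : 4 * cb * cm * (e * ch) * b2 * d * q * m * x * Y' = 4 * cm * b2 * d * (cb * e * ch * q * m * x) * Y' by ring.
have -> : P * (two * cb * c2) * al * ch * S1 * q * m * e * Pn * x * Y =
  P * two * c2 * al * S1 * Pn * (cb * e * ch * q * m * x) * Y by ring.
by apply: ler_pM => //; [exact: mulr_ge0 | exact: ler_wpM2r].
Qed.

Lemma split_constant (R : realType) (P two cb c2 al ch S1 q m e : R) :
  P * (two * cb * c2) * al * ch * S1 * q * m * e = P * ch * (two * cb * c2 * al * S1 * q * m * e).
Proof. by ring. Qed.

Lemma three_sub_ge0 (R : realType) (a : R) : a < 1 -> 0 <= 3 - 2 * a.
Proof. by move=> h; lra. Qed.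

Unset Implicit Arguments.
Set Strict Implicit.

Theorem theorem4p5 (R : realType)
  (N : nat) (al aa : 'I_N.+1 -> R) (Rs : R) (k : 'rV[R]_3)
  (X : R -> 'rV[R]_3 -> 'rV[R]_3) (G Om : R) (e0 : R -> 'rV[R]_3)
  (U : set 'rV[R]_3) (rs cbar kap alpha0 : R) (p q : 'I_4 -> R)
  (u0 : 'rV[R]_3 -> R) (psi Psi u : 'rV[R]_3 -> R -> R) (T sigma : R) :
  (* structural assumptions *)
  (1 <= N)%N ->
  al 0 = 0 -> (forall i j : 'I_N.+1, (i < j)%N -> al i < al j) ->
  (forall i, 0 < aa i) ->
  vnorm k = 1 ->
  0 <= Rs ->
  (forall z y, Fmap al aa k (Rs * z) (X z y) = y) ->
  0 < G -> 0 <= Om -> smooth_curve e0 -> (forall t, vnorm (e0 t) = 1) ->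
  open U -> bounded_set U -> C1_boundary U ->
  let a := aexp al in
  let chis := chistar aa Rs G Om U in
  (* parameters *)
  3 / (5 - a) < rs -> rs < 1 -> 1 / (2 - a) <= rs ->
  sobolev_const U (rs * (2 - a)) cbar ->
  let lam0 := (rs * (5 - a) - 3) / (3 * rs) in
  1 < kap -> kap < Num.sqrt (1 + lam0) ->
  (forall i, 1 < p i /\ p i < kap) ->
  (forall i, 1 / p i + 1 / q i = 1) ->
  Num.max (2 * p 2 * (1 - a) / (kap - p 2))
    (Num.max (4 * (1 - a) / (kap - 1)) (a / (1 + lam0 - kap ^+ 2))) <= alpha0 ->
  Num.max 2 (a / lam0) < alpha0 ->
  (* the solution *)
  regular_solution X (Zfield k G Om e0) U u0 psi u ->
  (forall x t, U x -> 0 < t -> 0 <= u x t) ->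
  (forall x t, bdry U x -> 0 < t -> Psi x t = psi x t) ->
  (exists W, C1_on W Psi /\ (closure U `*` `[0, +oo[%classic) `<=` W) ->
  0 < T -> 0 < sigma -> sigma < 1 ->
  let ub := fun x t => u x t - Psi x t in
  let beta := fun j : nat => kap ^+ j * alpha0 in
  let rt := fun j => beta j - 2 in
  let st := fun j => (beta j + 4 * (1 - a)) * (1 + a / (beta j - a)) in
  let mut := infprod (fun j => rt j / beta j) in
  let nut := infprod (fun j => st j / beta j) in
  let omega := nut * beta 0%N / st 0%N * (kap ^+ 2 / (alpha0 * (kap - 1) ^+ 2)) in
  let mu2 := 1 + a / (1 + lam0) in
  let mu3 := 2 + a / (1 + lam0) in
  let khat := 1 + lam0 - a / 2 in
  let cbar1 := Num.max 1 ((4 / c4 al aa) * powR (cbar / (2 - a)) (2 - a)) in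
  let Abar := powR 2 (4 + 1 / rs) * cbar1 * c16 al aa ^+ 2 in
  let cbar2 := powR (2 * kap) mu3 * Abar in
  let M1 := Mfun a chis U Psi 0 T q in
  let ex := 2 * rs / (1 - rs) in
  let Estar := Num.max 1
     (esssupT (sigma * T / 2) T (fun t => LpU ex U (fun x => 1 + `|Psi x t|) ^+ 2)
      + esssupT (sigma * T / 2) T (fun t => LpU ex U (fun x => ub x t) ^+ 2)) in
  let nrm := LpST (kap * alpha0) (U `*` `]0, T[%classic) ub in
  LinfST (U `*` `]sigma * T, T[%classic) ub <=
    powR (cbar2 * powR alpha0 mu3 * powR chis (1 / khat)
          * powR (1 + 1 / (sigma * T)) mu2 * powR (1 + T * volU U) mu3
          * powR M1 mu2 * powR Estar (1 / khat)) omega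
    * Num.max (powR nrm mut) (powR nrm nut).
Proof.
move=> N1 al0 al_mono aa_gt0 k1 Rs0 XE G0 _ _ e01 oU bU _ a chis rs_lo rs1 _ sob lam0 kap1 kapS pk pq
  al_ge al_gt solu u_ge0 bdPsi regPsi T0 sg0 sg1.
pose ub := fun x t => u x t - Psi x t; pose beta := fun j : nat => kap ^+ j * alpha0.
pose rt := fun j => beta j - 2; pose st := fun j => (beta j + 4 * (1 - a)) * (1 + a / (beta j - a)).
pose mut := infprod (fun j => rt j / beta j); pose nut := infprod (fun j => st j / beta j).
pose omega := nut * beta 0%N / st 0%N * (kap ^+ 2 / (alpha0 * (kap - 1) ^+ 2)).
pose mu2 := 1 + a / (1 + lam0); pose mu3 := 2 + a / (1 + lam0); pose khat := 1 + lam0 - a / 2.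
pose cbar1 := Num.max 1 ((4 / c4 al aa) * powR (cbar / (2 - a)) (2 - a)).
pose Abar := powR 2 (4 + 1 / rs) * cbar1 * c16 al aa ^+ 2.
pose cbar2 := powR (2 * kap) mu3 * Abar; pose M1 := Mfun a chis U Psi 0 T q.
pose ex := 2 * rs / (1 - rs).
pose Estar := Num.max 1
  (esssupT (sigma * T / 2) T (fun t => LpU ex U (fun x => 1 + `|Psi x t|) ^+ 2)
   + esssupT (sigma * T / 2) T (fun t => LpU ex U (fun x => ub x t) ^+ 2)).
pose nrm := LpST (kap * alpha0) (U `*` `]0, T[%classic) ub.
pose A := cbar2 * powR alpha0 mu3 * powR chis (1 / khat)
          * powR (1 + 1 / (sigma * T)) mu2 * powR (1 + T * volU U) mu3
          * powR M1 mu2 * powR Estar (1 / khat).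
suff goal : LinfST (U `*` `]sigma * T, T[%classic) ub <=
    powR A omega * Num.max (powR nrm mut) (powR nrm nut) by exact: goal.
have a0 : 0 < a := aexp_gt0 N1 al0 al_mono.
have a1 : a < 1 := aexp_lt1 N1 al0 al_mono.
have r0 : 0 < rs := r_gt0 a1 rs_lo.
have r3 : 1 / 3 <= rs := r_ge13 a0 a1 rs_lo.
have l0 : 0 < lam0 := lam0_pos a0 a1 rs_lo.
have kk : kap ^+ 2 < 1 + lam0 := kap_sqr_lt a0 a1 rs_lo kap1 kapS.
have al2 : 2 < alpha0 by move: al_gt; rewrite gt_max => /andP[].
have [_ al4 al_a] : [/\ True, 4 * (1 - a) / (kap - 1) <= alpha0 & a / (1 + lam0 - kap ^+ 2) <= alpha0].
  by move: al_ge; rewrite !ge_max => /and3P[].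
have k0 : 0 < kap := lt_trans ltr01 kap1.
have km0 : 0 < kap - 1 by rewrite subr_gt0.
have alpha_gt0 : 0 < alpha0 by exact: lt_trans al2.
have alpha1 : 1 <= alpha0 by apply: ltW; apply: lt_trans al2; rewrite ltr1n.
have S0 : 0 < sigma * T by exact: mulr_gt0.
have ST : sigma * T < T by rewrite gtr_pMl.
have T0' := ltW T0.
pose x := kap^-1.
have x0 : 0 < x by rewrite invr_gt0.
have x1 : x <= 1 by rewrite invf_le1// ltW.
have kap1' := ltW kap1.
have kj1 j : 1 <= kap ^+ j by rewrite exprn_ege1.
have beta_ge j : alpha0 <= beta j by rewrite /beta ler_peMl// ltW.
have beta2 j : 2 < beta j by exact: lt_le_trans (beta_ge j).
have beta0 j : 0 < beta j by exact: lt_trans (beta2 j).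
have xj0 j : 0 <= x ^+ j by rewrite exprn_ge0// ltW.
have xj1 j : x ^+ j <= 1 by rewrite exprn_ile1// ltW.
(* From a/(1+lam0-kap^2) <= alpha0 <= beta_j: the gained exponent covers two factors kap. *)
have kmj j : kap ^+ 2 <= 1 + lam0 - a / beta j.
  rewrite lerBrDr addrC -lerBrDr ler_pdivrMr// mulrC -ler_pdivrMr ?subr_gt0//.
  exact: le_trans al_a (beta_ge j).
(* From 4(1-a)/(kap-1) <= alpha0: the largest power on the right is controlled by the norm of order
   kap beta_j. *)
have sLj j : beta j + 4 * (1 - a) <= kap * beta j.
  rewrite -subr_ge0 (_ : _ - _ = beta j * (kap - 1) - 4 * (1 - a)); last by ring.
  rewrite subr_ge0 -ler_pdivrMr//.
  exact: le_trans al4 (beta_ge j).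
(* The difference of the two sides is x^(j+1)/alpha0 times (kap-1) alpha0 - 4(1-a). This permits the
   fraction x^j in sharing the power of chi, which makes its exponents summable. *)
have dEj j : (1 - x) * (1 - x ^+ j) <= 1 - (beta j + 4 * (1 - a)) / (kap * beta j).
  rewrite -subr_ge0.
  have -> : 1 - (beta j + 4 * (1 - a)) / (kap * beta j) - (1 - x) * (1 - x ^+ j) =
     x * x ^+ j / alpha0 * ((kap - 1) * alpha0 - 4 * (1 - a)).
    rewrite /x /beta exprVn; move: (kap ^+ j) (kj1 j) => y y1; field.
    by rewrite !gt_eqF// (lt_le_trans ltr01).
  rewrite mulr_ge0//; first by rewrite divr_ge0 ?(ltW alpha_gt0)// mulr_ge0// ltW.
  by rewrite subr_ge0 (mulrC (kap - 1)) -ler_pdivrMr.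
(* Starting times from sigma T/2, where [Estar] begins, increasing to sigma T; consecutive ones
   differ by sigma T 2^(-(j+2)). *)
pose Tj (j : nat) := sigma * T * (1 - 2 ^- j.+1).
have p2 j : 0 < (2 : R) ^- j by rewrite invr_gt0 exprn_gt0.
have half j : (2 : R) ^- j.+1 = 2 ^- j / 2 by rewrite exprS invfM mulrC.
have Tj_lt j : Tj j < sigma * T by rewrite gtr_pMr// gtrBl.
have TjD j : Tj j.+1 - Tj j = sigma * T * 2 ^- j.+2.
  by rewrite /Tj -mulrBr (half j.+1); congr (_ * _); lra.
have Tj_ge j : sigma * T / 2 <= Tj j.
  rewrite ler_pM2l//; have : (2 : R) ^- j.+1 <= 2^-1.
    by rewrite lef_pV2 ?posrE ?exprn_gt0// exprS ler_peMr// exprn_ege1// ler1n.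
  by move: (2 ^- j.+1) => z; lra.
have t10 : 0 < sigma * T / 2 by rewrite divr_gt0.
have Tj0 j : 0 < Tj j by exact: lt_le_trans (Tj_ge j).
have TjT j : Tj j < T by exact: lt_trans (Tj_lt j) ST.
have Tjj j : Tj j < Tj j.+1 by rewrite -subr_gt0 TjD mulr_gt0.
pose Z (j : nat) := powR (\int[sleb4 R]_(z in QT U (Tj j) T)
  powR `|ubar Psi u (mk3 z.1) z.2| (kap * beta j)) (kap * beta j)^-1.
have kb0 j : 0 < kap * beta j by exact: mulr_gt0.
have bpw s c : 0 <= s -> 0 <= c -> bmeas (QT U c T) (fun z => powR `|ubar Psi u (mk3 z.1) z.2| s).
  by move=> s0 c0; exact: (bmeas_powR s0 (bmeas_norm (bmeas_ubar oU bU solu regPsi T c0))).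
have norm_mono s c d : 0 < s -> 0 <= c -> c <= d ->
    powR (\int[sleb4 R]_(z in QT U d T) powR `|ubar Psi u (mk3 z.1) z.2| s) s^-1 <=
    powR (\int[sleb4 R]_(z in QT U c T) powR `|ubar Psi u (mk3 z.1) z.2| s) s^-1.
  move=> s0 c0 cd; have is0 : 0 <= s^-1 by rewrite invr_ge0 ltW.
  have I0 : 0 <= \int[sleb4 R]_(z in QT U d T) powR `|ubar Psi u (mk3 z.1) z.2| s.
    by apply: Rintegral_ge0 => z _; exact: powR_ge0.
  exact: (ler_powR2l is0 I0 (le_int_QT_sub oU bU cd (lexx T) (bpw _ _ (ltW s0) c0) (fun z _ => powR_ge0 _ _))).
have nrmE : nrm = powR (\int[sleb4 R]_(z in QT U 0 T) powR `|ubar Psi u (mk3 z.1) z.2| (kap * alpha0)) (kap * alpha0)^-1.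
  by [].
have Z0 : Z 0%N <= nrm.
  rewrite nrmE /Z /beta expr0 mul1r.
  exact: (norm_mono _ _ _ (mulr_gt0 k0 alpha_gt0) (lexx 0) (ltW (Tj0 0%N))).
(* The first norm is taken over the whole (0,T), as in the statement, instead of over (T_0,T); it is
   larger, and only enters the right-hand side of the step. *)
pose Y (j : nat) := if j is 0%N then nrm else Z j.
have Y_ge0 j : 0 <= Y j by case: j => [|j]; exact: powR_ge0.
have ZY j : Z j <= Y j by case: j => [|j]; [exact: Z0 | exact: lexx].
have khat0 : 0 < khat := khat_gt0 a1 l0.
have ikhat : 0 <= khat^-1 by rewrite invr_ge0 ltW.
have chi1 : 1 <= chis := chi_ge1 aa Rs G Om U.
have Es1 : 1 <= Estar by rewrite /Estar le_max lexx.
have cb1 : 1 <= cbar1 by rewrite /cbar1 le_max lexx.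
have M_ge1 : 1 <= M1 by exact: Mfun_ge1.
have c1 : 1 <= c16 al aa := c16_ge1 al aa_gt0.
have [m1 m2 m3] := mu2_bounds a0 a1 rs_lo.
have mu20 : 0 <= mu2 := le_trans ler01 m1.
have mu30 : 0 <= mu3 by rewrite /mu3 m3 addr_ge0.
have Q0 : 0 <= T * volU U by rewrite mulr_ge0// fine_ge0.
have Q1 : 1 <= 1 + T * volU U by rewrite lerDl.
have iS1 : 1 <= 1 + 1 / (sigma * T) by rewrite lerDl divr_ge0// ltW.
have lt12 : 1 < (2 : R) by rewrite ltr1n.
have le12 := ltW lt12.
have k21 : 1 <= 2 * kap := mulr_ege1 le12 kap1'.
(* P is the growth of the constants from one step to the next, Xc the power of chi whose exponent
   decays. *)
pose P := powR (2 * kap) mu3.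
pose Xc := powR chis (1 / khat).
have XcE : Xc = powR chis khat^-1 by rewrite /Xc div1r.
have P1 : 1 <= P by exact: powR_ge1.
have X1 : 1 <= Xc by rewrite XcE; exact: powR_ge1.
pose K := (3 - 2 * a) * (1 + lam0).
have two1 : 1 <= powR (2 : R) (4 + 1 / rs).
  exact: (powR_ge1 (addr_ge0 (ler0n _ 4) (divr_ge0 ler01 (ltW r0))) le12).
have ge1M (y z : R) : 1 <= y -> 1 <= z -> 1 <= y * z by exact: mulr_ege1.
have c21 : 1 <= c16 al aa ^+ 2 by rewrite exprn_ege1.
have rest1 := ge1M _ _ (ge1M _ _ (ge1M _ _ (ge1M _ _ (ge1M _ _ (ge1M _ _ (ge1M _ _ two1 cb1) c21)
  (powR_ge1 mu30 alpha1)) (powR_ge1 mu20 iS1)) (powR_ge1 mu30 Q1)) (powR_ge1 mu20 M_ge1)) (powR_ge1 ikhat Es1).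
have AE := split_constant P (powR 2 (4 + 1 / rs)) cbar1 (c16 al aa ^+ 2) (powR alpha0 mu3) Xc
  (powR (1 + 1 / (sigma * T)) mu2) (powR (1 + T * volU U) mu3) (powR M1 mu2) (powR Estar khat^-1).
have AE' : A = P * Xc * (powR 2 (4 + 1 / rs) * cbar1 * c16 al aa ^+ 2 * powR alpha0 mu3 *
    powR (1 + 1 / (sigma * T)) mu2 * powR (1 + T * volU U) mu3 * powR M1 mu2 * powR Estar khat^-1).
  by rewrite -AE XcE /A (div1r khat).
have PX0 : 0 <= P * Xc := mulr_ge0 (le_trans ler01 P1) (le_trans ler01 X1).
(* A is P Xc times a product of factors that are all at least 1; the iteration requires this
   comparison to sum the logarithms. *)
have PXA : P * Xc <= A by rewrite AE'; exact: (ler_peMr PX0 rest1).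
have A1 : 1 <= A by apply: le_trans PXA; rewrite mulr_ege1.
have K0 : 0 <= K.
  exact: (mulr_ge0 (three_sub_ge0 a1) (addr_ge0 ler01 (ltW l0))).
have Kbound : K * (1 - x) <= x * (1 + x) := chi_exponent_bound a0 a1 rs_lo rs1 kap1 kapS.
(* [one_step] with m = beta_n between the times T_n and T_(n+1), its constants rewritten by
   [step_constant]; kap beta_(n+1) = kap^2 beta_n links consecutive norms. *)
have step n : powR (Y n.+1) (beta n) <= A * P ^+ n * powR Xc (K * x ^+ n) *
    Num.max (powR (Y n) (rt n)) (powR (Y n) (st n)).
  have H := one_step N1 al0 al_mono aa_gt0 k1 Rs0 XE G0 e01 oU bU solu u_ge0 bdPsi regPsi r0 rs1 r3 l0 sob
    kap1 (kmj n) (beta2 n) pk pq (Tj0 n) (Tjj n) (TjT n.+1) (ltW t10) (Tj_ge n.+1) (xj0 n) (xj1 n) (sLj n) (dEj n).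
  have E : kap * beta n.+1 = kap ^+ 2 * beta n by rewrite /beta exprS expr2; ring.
  rewrite /Y {1}/Z E; apply: (le_trans H).
  have C := step_constant a0 a1 rs_lo rs1 kap1 n c1 alpha1 S0.
  have rt0 : 0 <= rt n by rewrite subr_ge0 ltW.
  have b1 : 0 <= beta n - a by rewrite subr_ge0; exact: ltW (lt_trans a1 (lt_trans lt12 (beta2 n))).
  have a1' : 0 <= 1 - a by rewrite subr_ge0; exact: ltW.
  have st0 : 0 <= st n := mulr_ge0 (addr_ge0 (ltW (beta0 n)) (mulr_ge0 (ler0n _ 4) a1'))
    (addr_ge0 ler01 (divr_ge0 (ltW a0) b1)).
  have Zn0 : 0 <= Z n by exact: powR_ge0.
  have mono : Num.max (powR (Z n) (beta n - 2)) (powR (Z n) ((beta n + 4 * (1 - a)) * (1 + a / (beta n - a)))) <=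
      Num.max (powR (Y n) (rt n)) (powR (Y n) (st n)).
    rewrite ge_max !le_max (ler_powR2l rt0 Zn0 (ZY n)) /= (ler_powR2l st0 Zn0 (ZY n)) orbT //.
  have em : 1 + mu2 = mu3 by rewrite /mu3 m3 addrC.
  have eE : powR (Estar * chis) khat^-1 = powR Estar khat^-1 * powR chis khat^-1.
    exact: (powRM _ (le_trans ler01 Es1) (le_trans ler01 chi1)).
  have Ymax0 : 0 <= Num.max (powR (Z n) (beta n - 2)) (powR (Z n) ((beta n + 4 * (1 - a)) * (1 + a / (beta n - a)))).
    by rewrite le_max powR_ge0.
  have F := assemble_factors (le_trans ler01 cb1) (powR_ge0 (1 + T * volU U) mu3) (powR_ge0 M1 mu2)
    (powR_ge0 Estar khat^-1) (powR_ge0 chis khat^-1) (powR_ge0 (powR chis khat^-1) (K * x ^+ n)) Ymax0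
    (powR_ge0 (2 * c16 al aa) mu2) (sqr_ge0 (beta n)) (powR_ge0 _ mu2) C mono.
  have LE : forall d, d = sigma * T * 2 ^- n.+2 -> forall e, e = mu3 ->
    4 * cbar1 * powR (2 * c16 al aa) mu2 * powR (Estar * chis) khat^-1 * beta n ^+ 2 * powR (1 + d^-1) mu2 *
    powR (1 + T * volU U) e * powR M1 mu2 * powR (powR chis khat^-1) (K * x ^+ n) *
    Num.max (powR (Z n) (beta n - 2)) (powR (Z n) ((beta n + 4 * (1 - a)) * (1 + a / (beta n - a)))) <=
    A * P ^+ n * powR Xc (K * x ^+ n) * Num.max (powR (Y n) (rt n)) (powR (Y n) (st n)).
    by move=> _ -> _ ->; rewrite eE XcE /A (div1r khat); exact: F.
  exact: (LE _ (TjD n) _ em).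
pose B := powR A omega * Num.max (powR nrm mut) (powR nrm nut).
have YB j : Y j <= B := moser_iteration a0 a1 kap1 al2 Y_ge0 A1 P1 X1 K0 PXA Kbound step j.
have B0 : 0 <= B := le_trans (Y_ge0 0%N) (YB 0%N).
have unb C : exists n, C < kap * beta n.
  have [n hn] := expr_unbounded kap1 alpha_gt0 C; exists n.
  by rewrite /beta mulrA -exprS.
(* Every norm of order kap beta_n over (sigma T, T) is at most the norm over the larger cylinder
   starting at T_n, which the iteration bounds by the same B. *)
apply: (LinfST_le oU bU (bmeas_ubar oU bU solu regPsi T (ltW S0)) B0 kb0 unb) => n.
apply: le_trans (norm_mono _ _ _ (kb0 n) (ltW (Tj0 n)) (ltW (Tj_lt n))) _.
exact: le_trans (ZY n) (YB n).
Qed.
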